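(* For every closed orientable hyperbolic surface $X$, the systole $\operatorname{sys}(X)$ and the diameter $\operatorname{diam}(X)$ satisfy $$4\cosh\left(\frac{\operatorname{sys}(X)}{2}\right)\le 3\cosh(\operatorname{diam}(X))-1.$$
   Context: A closed orientable hyperbolic surface is a compact connected orientable surface without boundary, of genus $g\ge 2$, endowed with a Riemannian metric of constant curvature $-1$. The systole $\operatorname{sys}(X)$ is the length of a shortest non-contractible closed curve of $X$. The diameter $\operatorname{diam}(X)$ is the maximum over all pairs of points $x,y\in X$ of the Riemannian distance between $x$ and $y$. *)

(* Defs.v *)
From HB Require Import structures.
From mathcomp Require Import all_boot all_order all_algebra.
From mathcomp Require Import all_classical all_reals all_analysis.

Set Implicit Arguments.
Unset Strict Implicit.
Unset Printing Implicit Defensive.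

Import Order.TTheory GRing.Theory Num.Theory.
Import numFieldNormedType.Exports.

Local Open Scope classical_set_scope.
Local Open Scope ring_scope.

Definition cosh (R : realType) (x : R) : R := (expR x + expR (- x)) / 2.

(* Points and tangent vectors of the coordinate plane are row vectors. *)

Definition partial (R : realType) (i : 'I_2) (f : 'rV[R]_2 -> R) :
    'rV[R]_2 -> R :=
  fun x => 'D_(delta_mx 0 i) f x.

(* [Ck n V f] and [smooth V f] are meant for an open set [V]; they only depend
   on the restriction of [f] to [V]. *)
Fixpoint Ck (R : realType) (n : nat) (V : set 'rV[R]_2) (f : 'rV[R]_2 -> R) :
    Prop :=
  (forall x, V x -> {for x, continuous f}) /\
  match n with
  | 0 => True
  | m.+1 => forall i : 'I_2,
      (forall x, V x -> derivable f x (delta_mx 0 i)) /\ Ck m V (partial i f)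
  end.

Definition smooth (R : realType) (V : set 'rV[R]_2) (f : 'rV[R]_2 -> R) : Prop :=
  forall n, Ck n V f.

(** * Smooth surfaces *)

(* A homeomorphism from an open set of X onto an open set of the plane. The
   values of [cmap] off [cdom] and of [cinv] off [cimg] are irrelevant. *)
Record chart (R : realType) (X : topologicalType) : Type := Chart {
  cdom : set X;
  cmap : X -> 'rV[R]_2;
  cinv : 'rV[R]_2 -> X;
  cdom_open : open cdom;
  cimg_open : open (cmap @` cdom);
  cmapK : forall x, cdom x -> cinv (cmap x) = x;
  cmap_continuous : forall x, cdom x -> {for x, continuous cmap};
  cinv_continuous : forall v, (cmap @` cdom) v -> {for v, continuous cinv}
}.

Definition cimg (R : realType) (X : topologicalType) (k : chart R X) :
    set 'rV[R]_2 :=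
  cmap k @` cdom k.

Definition overlap (R : realType) (X : topologicalType) (k l : chart R X) :
    set 'rV[R]_2 :=
  cmap k @` (cdom k `&` cdom l).

Definition transition (R : realType) (X : topologicalType) (k l : chart R X) :
    'rV[R]_2 -> 'rV[R]_2 :=
  cmap l \o cinv k.

Definition smooth_atlas (R : realType) (X : topologicalType)
    (A : set (chart R X)) : Prop :=
  (forall x, exists2 k, A k & cdom k x) /\
  (forall k l, A k -> A l -> forall j : 'I_2,
     smooth (overlap k l) (fun v => transition k l v 0 j)).

Definition oriented_atlas (R : realType) (X : topologicalType)
    (B : set (chart R X)) : Prop :=
  smooth_atlas B /\
  (forall k l, B k -> B l -> forall v, overlap k l v ->
     0 < \det (jacobian (transition k l) v)).

(* Some oriented atlas defines the same smooth structure as [A]. *)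
Definition orientable (R : realType) (X : topologicalType)
    (A : set (chart R X)) : Prop :=
  exists B : set (chart R X), oriented_atlas B /\ smooth_atlas (A `|` B).

Definition simple_closed_curve (R : realType) (X : topologicalType)
    (c : R -> X) : Prop :=
  [/\ {within `[0, 1], continuous c}, c 0 = c 1 &
      forall s t, 0 <= s < 1 -> 0 <= t < 1 -> c s = c t -> s = t].

(* The genus of a closed orientable surface is the largest number of pairwise
   disjoint simple closed curves that together do not separate it. *)
Definition genus_at_least (R : realType) (X : topologicalType) (n : nat) :
    Prop :=
  exists c : 'I_n -> R -> X,
    [/\ forall i, simple_closed_curve (c i),
        forall i j, i != j -> c i @` `[0, 1] `&` c j @` `[0, 1] = set0 &
        connected (~` (\bigcup_(i in [set: 'I_n]) (c i @` `[0, 1])))].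

(** * Riemannian metrics *)

(* [g k v] is the Gram matrix of the metric at the point of coordinates [v] in
   the chart [k]; [qform G w] is the squared length of the vector [w]. *)

Definition qform (R : realType) (G : 'M[R]_2) (w : 'rV[R]_2) : R :=
  (w *m G *m w^T) 0 0.

(* As vectors are rows, the differential of [f] at [v] sends [w] to
   [w *m jacobian f v]. *)
Definition riemannian_metric (R : realType) (X : topologicalType)
    (A : set (chart R X)) (g : chart R X -> 'rV[R]_2 -> 'M[R]_2) : Prop :=
  [/\ forall k, A k -> forall i j, smooth (cimg k) (fun v => g k v i j),
      forall k, A k -> forall v, cimg k v -> (g k v)^T = g k v,
      forall k, A k -> forall v, cimg k v ->
        forall w, w != 0 -> 0 < qform (g k v) w &
      forall k l, A k -> A l -> forall v, overlap k l v ->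
        let J := jacobian (transition k l) v in
        g k v = J *m g l (transition k l v) *m J^T].

(* Christoffel symbol $\Gamma^k_{ij}$ of [G]. *)
Definition christoffel (R : realType) (G : 'rV[R]_2 -> 'M[R]_2)
    (k i j : 'I_2) (v : 'rV[R]_2) : R :=
  2^-1 * \sum_(l < 2) invmx (G v) k l *
    (partial i (fun x => G x j l) v + partial j (fun x => G x i l) v
     - partial l (fun x => G x i j) v).

(* The coordinate of index [l] of the vector field
   $\nabla_0 \nabla_1 \partial_1 - \nabla_1 \nabla_0 \partial_1$. *)
Definition curvature_vector (R : realType) (G : 'rV[R]_2 -> 'M[R]_2)
    (l : 'I_2) (v : 'rV[R]_2) : R :=
  let C := christoffel G in
  partial 0 (C l 1 1) v - partial 1 (C l 0 1) v
  + \sum_(m < 2) (C m 1 1 v * C l 0 m v - C m 0 1 v * C l 1 m v).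

Definition gauss_curvature (R : realType) (G : 'rV[R]_2 -> 'M[R]_2)
    (v : 'rV[R]_2) : R :=
  (\sum_(l < 2) G v 0 l * curvature_vector G l v) / \det (G v).

Definition has_constant_curvature (R : realType) (X : topologicalType)
    (A : set (chart R X)) (g : chart R X -> 'rV[R]_2 -> 'M[R]_2) (K : R) :
    Prop :=
  forall k, A k -> forall v, cimg k v -> gauss_curvature (g k) v = K.

Definition closed_orientable_hyperbolic_surface (R : realType)
    (X : topologicalType) (A : set (chart R X))
    (g : chart R X -> 'rV[R]_2 -> 'M[R]_2) : Prop :=
  [/\ [/\ hausdorff_space X, compact [set: X] & connected [set: X]],
      smooth_atlas A, orientable A, genus_at_least R X 2 &
      riemannian_metric A g /\ has_constant_curvature A g (-1)].

(** * Length, distance, diameter and systole *)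

(* On `[a, b] the curve [c] stays in the domain of [k], where it is given by the
   restriction of the C^1 curve [u]. *)
Definition C1_arc (R : realType) (X : topologicalType) (c : R -> X) (a b : R)
    (k : chart R X) (u : R -> 'rV[R]_2) : Prop :=
  [/\ forall t, derivable u t 1, continuous (derive1 u) &
      forall t, a <= t <= b -> cdom k (c t) /\ cmap k (c t) = u t].

Definition arc_length (R : realType) (G : 'rV[R]_2 -> 'M[R]_2)
    (u : R -> 'rV[R]_2) (a b : R) : R :=
  \int[lebesgue_measure]_(t in `[a, b]) Num.sqrt (qform (G (u t)) (derive1 u t)).

(* [c] is piecewise C^1 on `[0, 1], of length [L]. By Lebesgue's number lemma,
   any subdivision into C^1 pieces has a refinement each piece of which lies in
   one chart; [L] does not depend on the choices. *)
Definition has_length (R : realType) (X : topologicalType)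
    (A : set (chart R X)) (g : chart R X -> 'rV[R]_2 -> 'M[R]_2)
    (c : R -> X) (L : R) : Prop :=
  exists (n : nat) (t : nat -> R) (k : nat -> chart R X)
         (u : nat -> R -> 'rV[R]_2),
    [/\ t 0%N = 0, t n = 1,
        forall i, (i < n)%N ->
          [/\ t i < t i.+1, A (k i) & C1_arc c (t i) (t i.+1) (k i) (u i)] &
        L = \sum_(i < n) arc_length (g (k i)) (u i) (t i) (t i.+1)].

Definition riemannian_distance (R : realType) (X : topologicalType)
    (A : set (chart R X)) (g : chart R X -> 'rV[R]_2 -> 'M[R]_2)
    (x y : X) : R :=
  inf [set L | exists c : R -> X, [/\ c 0 = x, c 1 = y & has_length A g c L]].

Definition diameter (R : realType) (X : topologicalType)
    (A : set (chart R X)) (g : chart R X -> 'rV[R]_2 -> 'M[R]_2) : R :=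
  sup [set d | exists x y : X, d = riemannian_distance A g x y].

(* [H (s, t)] is a homotopy of closed curves, from [c] to a constant one. *)
Definition contractible (R : realType) (X : topologicalType) (c : R -> X) :
    Prop :=
  exists (H : R * R -> X) (p : X),
    {within `[0, 1] `*` `[0, 1], continuous H} /\
    (forall t, 0 <= t <= 1 ->
       [/\ H (0, t) = c t, H (1, t) = p & H (t, 0) = H (t, 1)]).

Definition systole (R : realType) (X : topologicalType)
    (A : set (chart R X)) (g : chart R X -> 'rV[R]_2 -> 'M[R]_2) : R :=
  inf [set L | exists c : R -> X,
    [/\ c 0 = c 1, ~ contractible c & has_length A g c L]].

(* Main.v *)
Require Import Defs.
From HB Require Import structures.
From mathcomp Require Import all_boot all_order all_algebra.
From mathcomp Require Import all_classical all_reals all_analysis.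
From mathcomp Require Import ring lra.
Set Implicit Arguments.
Unset Strict Implicit.
Unset Printing Implicit Defensive.
Import Order.TTheory GRing.Theory Num.Theory.
Import numFieldNormedType.Exports.
Local Open Scope classical_set_scope.
Local Open Scope ring_scope.

(** The surface is a quotient of the hyperbolic plane by a discrete group, and the
    inequality says that this group contains a nontrivial element of small trace.

    The hyperbolic plane is the hyperboloid [hyp], on which the form [lor] is the
    hyperbolic cosine of the distance. For a metric of curvature -1 the equations
    for the frame of an isometric map into the hyperboloid are integrable
    ([flatness], [frobenius]), so every point has a chart in the hyperbolic plane;
    by compactness these charts contain balls of a common radius
    ([uniform_sheets]), and they can be continued along larger and larger balls to
    a covering [E] of the surface ([developing_map], [covering_exists]). Curves
    lift to the hyperboloid, with ends no farther apart than their length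
    ([curve_lift]), and geodesics project to curves of the same length
    ([geodesic_pieces]). Hence every ball of radius [diameter + e] meets every
    orbit of the deck group ([orbit_dense]); and a deck transformation other than
    the identity moves all points at least by the systole ([systole_le]), because
    lifting a contraction of the projected geodesic would close up its lift. If
    [A] in SL2 represents such a transformation, the least displacement is
    governed by its trace, and [2 cosh (systole / 2) <= |tr A|]
    ([systole_trace]). So it is enough to find [A] with
    [|tr A| <= (3 C - 1) / 2] for [C = cosh (diameter + e)], and to let [e] tend
    to 0.

    Suppose that all these traces are larger ([large_traces_absurd]). Let
    [p1, p2, p3] be points of the orbit of the origin, images of it under [A1, A2,
    A3], in a disc of radius [diameter + e]. A quadratic inequality
    ([trace_bound]) shows that the product of the traces of [A1 A2^-1],
    [A2 A3^-1], [A3 A1^-1] cannot be negative. Let [angle A B] be half of the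
    rotation angle of [A B^-1], taken between -pi/2 and pi/2: it is invariant
    under the group, antisymmetric, and independent of the choice of signs of the
    matrices. As the product of the traces is positive, the sum of the three
    angles has the sign of the orientation of the triangle ([triangle_sign]). In
    the language of topology, the angle would be an invariant primitive of a
    positive 2-cocycle, which a closed oriented surface cannot have. To see this
    contradiction concretely, consider the Voronoi cells of the orbit. The orbit
    points nearest to a vertex of this tessellation form an inscribed polygon,
    whose angles have a positive sum when it is run in the positive direction
    ([polygon_angle]). Added over all vertices up to the group, these sums are a
    sum over the corners of the cell of the origin ([mass_transport]); but the two
    ends of an edge of the cell give the same pair of orbit points in opposite
    directions ([edge_sum]), so that running all polygons in the negative
    direction gives the same total instead of the opposite one. *)

(** * Matrix-valued functions of one variable *)

Section MatrixNorm.
Context {R : realType}.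

Lemma mxnorm_le m n (A : 'M[R]_(m, n)) (K : R) :
  0 <= K -> (forall i j, `|A i j| <= K) -> `|A| <= K.
Proof.
move=> K0 h; rewrite /Num.Def.normr/= mx_normrE.
by rewrite (bigmax_le _ K0) // => -[i j] _; exact: h.
Qed.

Lemma mxnorm_ge m n (A : 'M[R]_(m, n)) i j : `|A i j| <= `|A|.
Proof.
rewrite [leRHS]/Num.Def.normr/= mx_normrE.
exact: (le_bigmax _ (fun x => `|A x.1 x.2|) (i, j)).
Qed.

Lemma mulmx_norm m p n (A : 'M[R]_(m, p)) (B : 'M[R]_(p, n)) :
  `|A *m B| <= p%:R * `|A| * `|B|.
Proof.
apply: mxnorm_le => [|i j]; first by rewrite !mulr_ge0.
rewrite mxE (le_trans (ler_norm_sum _ _ _))//.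
apply: (@le_trans _ _ (\sum_(k < p) (`|A| * `|B|))); last first.
  by rewrite sumr_const card_ord -mulrA mulr_natl.
by apply: ler_sum => k _; rewrite normrM ler_pM// mxnorm_ge.
Qed.

Lemma cvg_mx T (F : set_system T) (FF : Filter F) m n (f : T -> 'M[R]_(m, n))
    (L : 'M[R]_(m, n)) :
  (forall i j, f x i j @[x --> F] --> L i j) -> f @ F --> L.
Proof.
move=> h; apply/cvgrPdist_le => e e0; near=> x.
apply: mxnorm_le => [|i j]; first exact: ltW.
rewrite !mxE.
move: i j; near: x; apply: filter_forall => i; apply: filter_forall => j.
by have /cvgrPdist_le := h i j; apply.
Unshelve. all: by end_near. Qed.

Lemma continuous_entry m n i j : continuous (fun A : 'M[R]_(m, n) => A i j).
Proof. exact: coord_continuous. Qed.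

Lemma cvg_entry T (F : set_system T) (FF : Filter F) m n (f : T -> 'M[R]_(m, n))
    (L : 'M[R]_(m, n)) i j :
  f @ F --> L -> f x i j @[x --> F] --> L i j.
Proof.
move=> h; apply: (@cvg_comp _ _ _ f (fun A : 'M[R]_(m, n) => A i j) F (nbhs L)).
  exact: h.
exact: continuous_entry.
Qed.

Lemma cvg_mulmx T (F : set_system T) (FF : Filter F) m p n
    (f : T -> 'M[R]_(m, p)) (g : T -> 'M[R]_(p, n)) (A : 'M[R]_(m, p))
    (B : 'M[R]_(p, n)) :
  f @ F --> A -> g @ F --> B -> f x *m g x @[x --> F] --> A *m B.
Proof.
move=> fA gB; apply: cvg_mx => i j; rewrite mxE.
under eq_cvg do rewrite mxE.
apply: cvg_big => [|k _]; last by apply: cvgM; exact: cvg_entry.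
exact: add_continuous.
Qed.

Lemma is_derive_mx m n (f : R -> 'M[R]_(m, n)) (t : R) df :
  is_derive t 1 f df <-> forall i j, is_derive t 1 (fun s => f s i j) (df i j).
Proof.
split=> [[dv <-] i j|h].
  split; first by move/derivable_mxP : dv.
  by rewrite derive_mx// mxE.
have dv : derivable f t 1 by apply/derivable_mxP => i j; have [] := h i j.
split=> //; rewrite derive_mx//; apply/matrixP => i j; rewrite mxE.
by have [_ ->] := h i j.
Qed.

Lemma mvt_ineq m n (f df : R -> 'M[R]_(m, n)) (a b K : R) : a <= b -> 0 <= K ->
  (forall x : R, a < x < b -> is_derive x 1 f (df x)) ->
  {within `[a, b], continuous f} ->
  (forall x : R, a < x < b -> `|df x| <= K) ->
  `|f b - f a| <= K * (b - a).
Proof.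
move=> ab K0 fd fc dK; move: ab; rewrite le_eqVlt => /predU1P[<-|ab].
  by rewrite !subrr normr0 mulr0.
apply: mxnorm_le => [|i j]; first by rewrite mulr_ge0// subr_ge0 ltW.
have [|/=|c] := @MVT R (fun x => f x i j) (fun x => df x i j) a b ab.
- move=> x; rewrite in_itv/= => xab.
  by have /is_derive_mx := fd _ xab.
- by move=> x; apply: cvg_entry; exact: fc.
rewrite in_itv/= !mxE => cab ->.
rewrite normrM (@gtr0_norm _ (b - a)) ?subr_gt0// ler_pM2r ?subr_gt0//.
by rewrite (le_trans (mxnorm_ge _ _ _))// dK.
Qed.

(** Extending the integral by 0 to the left of the base point makes it
    continuous on the whole line. *)
Lemma primitive_exists (f : R -> R) (x0 : R) : continuous f ->
  exists F : R -> R, [/\ continuous F, F x0 = 0 &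
    forall x, x0 < x -> is_derive x 1 F (f x)].
Proof.
move=> cf.
pose mu := @lebesgue_measure R.
have itg u : mu.-integrable `[x0, u] (EFin \o f).
  apply: continuous_compact_integrable; first exact: segment_compact.
  exact: continuous_subspaceT.
pose G x := (\int[mu]_(t in [set` `[x0, x]]) (f t))%R.
have dG x : x0 < x -> is_derive x 1 G (f x).
  move=> x0x; have xx1 : x < x + 1 by rewrite ltrDl.
  have [d e] := @continuous_FTC1_closed R f x0 x (x + 1) xx1 (itg _) x0x (cf x).
  by split; [exact: d|rewrite -derive1E; exact: e].
have G0 x : x <= x0 -> G x = 0.
  move=> xx0; rewrite /G; move: xx0; rewrite le_eqVlt => /predU1P[->|xx0].
    by rewrite set_itv1 Rintegral_set1.
  by rewrite set_itv_ge ?Rintegral_set0// bnd_simp -ltNge.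
exists G; split => //; last exact: G0.
move=> x; have [xx0|xx0|->] := ltgtP x x0.
- rewrite /continuous_at (G0 x (ltW xx0)); apply: cvg_near_cst.
  by have := lt_nbhsl xx0; apply: filterS => y yx0; rewrite (G0 _ (ltW yx0)).
- have [d _] := dG _ xx0.
  exact/differentiable_continuous/derivable1_diffP.
- have hh : {within `[x0, x0 + 1], continuous G}.
    by apply: parameterized_integral_continuous; [rewrite lerDl|exact: itg].
  rewrite /continuous_at; apply/left_right_continuousP; split.
    apply: cvg_near_cst; near=> y; apply/eqP; rewrite !G0//.
  by have [|_ +] := (continuous_within_itvP G _).1 hh; rewrite ?ltrDl.
Unshelve. all: by end_near. Qed.

Lemma geometric_small (C e : R) : 0 < e -> exists N, C * 2^-1 ^+ N < e.
Proof.
move=> e0; have : C * 2^-1 ^+ N @[N --> \oo] --> (0 : R).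
  rewrite -(mulr0 C); apply: cvgMr; apply: cvg_expr.
  by rewrite gtr0_norm ?invr_gt0// invf_lt1// ltr1n.
move=> /cvgrPdist_lt /(_ _ e0) [N _ /(_ N (leqnn _))]; rewrite sub0r normrN => h.
by exists N; exact: le_lt_trans (ler_norm _) h.
Qed.

Lemma geometric_cvg m n (u : nat -> 'M[R]_(m, n)) (C : R) :
  (forall N k, `|u (N + k)%N - u N| <= C * 2^-1 ^+ N) ->
  exists L : 'M[R]_(m, n), forall N, `|L - u N| <= C * 2^-1 ^+ N.
Proof.
move=> h.
have cv i j : cvgn (fun k => u k i j).
  apply/cauchy_cvgP/cauchy_exP => e e0; have [N hN] := geometric_small C e0.
  exists (u N i j); exists N => // k /= Nk; rewrite /ball/= distrC.
  apply: le_lt_trans hN; rewrite -(subnKC Nk).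
  apply: le_trans (h N (k - N)%N).
  by have := mxnorm_ge (u (N + (k - N))%N - u N) i j; rewrite !mxE.
pose L := \matrix_(i, j) limn (fun k => u k i j).
have uL : u @ \oo --> L by apply: cvg_mx => i j; rewrite mxE; exact: cv.
exists L => N; apply/ler_addgt0Pr => e e0.
move/cvgrPdist_lt : uL => /(_ _ e0) [K _ /(_ (N + K)%N)] /= /(_ (leq_addl _ _)) hK.
rewrite -(subrK (u (N + K)%N) L) -addrA (le_trans (ler_normD _ _))//.
by rewrite [leRHS]addrC lerD// ltW.
Qed.

Lemma primitive_mx m n (f : R -> 'M[R]_(m, n)) (x0 : R) : continuous f ->
  exists F : R -> 'M[R]_(m, n), [/\ continuous F, F x0 = 0 &
    forall x, x0 < x -> is_derive x 1 F (f x)].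
Proof.
move=> cf.
have /choice[F hF] : forall ij : 'I_m * 'I_n, exists F : R -> R,
  [/\ continuous F, F x0 = 0 &
    forall x, x0 < x -> is_derive x 1 F (f x ij.1 ij.2)].
  by move=> [i j]; apply: primitive_exists => x; apply: cvg_entry; exact: cf.
exists (fun x => \matrix_(i, j) F (i, j) x); split.
- move=> x; apply: cvg_mx => i j; rewrite mxE; under eq_cvg do rewrite mxE.
  by have [+ _ _] := hF (i, j); exact.
- by apply/matrixP => i j; rewrite !mxE; have [_ + _] := hF (i, j).
- move=> x x0x; apply/is_derive_mx => i j; have [_ _ /(_ x x0x)] := hF (i, j).
  by under [X in _ -> is_derive _ _ X _]eq_fun do rewrite mxE.
Qed.

Definition clamp (a b t : R) := Num.max a (Num.min t b).

Lemma clamp_in a b t : a <= b -> a <= clamp a b t <= b.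
Proof.
move=> ab; rewrite /clamp le_max lexx/= ge_max ab/=.
by rewrite ge_min lexx orbT.
Qed.

Lemma clamp_id a b t : a <= t <= b -> clamp a b t = t.
Proof. by move=> /andP[ta tb]; rewrite /clamp (min_idPl tb) (max_idPr ta). Qed.

Lemma clamp_continuous a b : continuous (clamp a b).
Proof.
move=> t; apply: (@continuous_max _ _ (cst a) (fun t => Num.min t b)).
  exact: cvg_cst.
apply: (@continuous_min _ _ id (cst b)); [exact: cvg_id|exact: cvg_cst].
Qed.

(** Existence for linear differential equations on an interval short enough for
    Picard's operator to halve distances. *)
Lemma linear_ode n m (a : R -> 'M[R]_n) (x0 l K : R) (Z0 : 'M[R]_(n, m)) :
  continuous a -> 0 <= K -> 0 <= l -> (forall t, `|a t| <= K) ->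
  n%:R * K * l <= 2^-1 ->
  exists Z : R -> 'M[R]_(n, m), [/\ continuous Z, Z x0 = Z0 &
    forall t, x0 < t < x0 + l -> is_derive t 1 Z (a t *m Z t)].
Proof.
move=> ca K0 l0 aK nKl.
have x0l : x0 <= x0 + l by rewrite lerDl.
have cc (v : 'M[R]_(n, m)) : continuous (cst v : R -> 'M[R]_(n, m)).
  by move=> ?; exact: cvg_cst.
have /choice[P hP] : forall f : R -> 'M[R]_(n, m), exists F : R -> 'M[R]_(n, m),
  continuous f -> [/\ continuous F, F x0 = 0 &
    forall x, x0 < x -> is_derive x 1 F (a x *m f x)].
  move=> f.
  have [cf|ncf] := pselect (continuous f); last by exists f.
  have [F hF] := @primitive_mx _ _ (fun x => a x *m f x) x0
    (fun x => cvg_mulmx _ (ca x) (cf x)).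
  by exists F.
pose c := clamp x0 (x0 + l).
pose T f t := Z0 + P f (c t).
have cT (f : R -> 'M[R]_(n, m)) : continuous f -> continuous (T f).
  move=> cf t; apply: cvgD; first exact: cvg_cst.
  have [cP _ _] := hP f cf.
  by apply: (@continuous_comp _ _ _ c (P f)); [exact: clamp_continuous|exact: cP].
have T2 (f g : R -> 'M[R]_(n, m)) (B : R) : continuous f -> continuous g -> 0 <= B ->
    (forall t, `|f t - g t| <= B) -> forall t, `|T f t - T g t| <= B * 2^-1.
  move=> cf cg B0 fgB t; have [cPf Pf0 dPf] := hP f cf; have [cPg Pg0 dPg] := hP g cg.
  have /andP[c1 c2] := clamp_in t x0l; rewrite -/c in c1 c2.
  have := @mvt_ineq n m (fun t => P f t - P g t) (fun t => a t *m (f t - g t))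
    x0 (c t) (n%:R * K * B) c1.
  rewrite Pf0 Pg0 subrr subr0 => H.
  rewrite /T opprD addrACA subrr add0r (le_trans (H _ _ _ _))//.
  - by rewrite !mulr_ge0.
  - move=> x /andP[x0x _]; rewrite mulmxBr; apply: is_deriveB; [exact: dPf|exact: dPg].
  - by apply: continuous_subspaceT => x; apply: cvgB; [exact: cPf|exact: cPg].
  - move=> x _; rewrite (le_trans (mulmx_norm _ _))// ler_pM ?mulr_ge0//.
    by rewrite ler_pM.
  - rewrite mulrAC [X in _ <= X]mulrC ler_wpM2r// (le_trans _ nKl)//.
    by rewrite ler_wpM2l ?mulr_ge0// lerBlDl.
pose Y k := iter k T (cst Z0).
have cY k : continuous (Y k).
  by elim: k => [|k ih] /=; [exact: cc|exact: cT].
pose B := `|Z0|; have B0 : 0 <= B by exact: normr_ge0.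
have YB k : forall t, `|Y k.+1 t - Y k t| <= B * 2^-1 ^+ k.+1.
  elim: k => [|k ih] t.
    have [_ P0 _] := hP _ (cY 0%N).
    have := @T2 (cst Z0) (cst 0) B (cc _) (cc _) (normr_ge0 _).
    rewrite expr1 /= => H.
    suff E : Y 0%N t = T (cst 0) t.
      have := H _ t; rewrite -E; apply=> s; by rewrite subr0.
    rewrite /T/= -[LHS]addr0; congr (_ + _).
    have [cP P00 dP] := hP (cst 0) (cc _).
    have /andP[c1 c2] := clamp_in t x0l; rewrite -/c in c1 c2.
    have : `|P (cst 0) (c t) - P (cst 0) x0| <= 0.
      rewrite -(mul0r (c t - x0)); apply: (mvt_ineq (df := cst 0)) => //.
      - by move=> x /andP[x0x _]; have := dP x x0x; rewrite mulmx0.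
      - exact: continuous_subspaceT.
      - by move=> x _; rewrite normr0.
    by rewrite P00 subr0 normr_le0 => /eqP.
  rewrite exprSr mulrA; apply: (T2 _ _ _ (cY _) (cY _) _ ih).
  by rewrite mulr_ge0 ?exprn_ge0 ?invr_ge0.
have YN N k : forall t, `|Y (N + k)%N t - Y N t| <= B * 2^-1 ^+ N * (1 - 2^-1 ^+ k).
  elim: k => [|k ih] t; first by rewrite addn0 subrr normr0 subrr mulr0.
  rewrite addnS -(subrK (Y (N + k)%N t) (Y _ t)) -addrA (le_trans (ler_normD _ _))//.
  have := YB (N + k)%N t; have := ih t.
  rewrite -addnS exprD (exprS _ k); set x := _ ^+ N; set y := _ ^+ k.
  lra.
have /choice[Z hZ] : forall t, exists L : 'M[R]_(n, m), forall N,
    `|L - Y N t| <= B * 2^-1 ^+ N.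
  move=> t; apply: geometric_cvg => N k; rewrite (le_trans (YN _ _ _))//.
  by rewrite ler_piMr ?mulr_ge0 ?exprn_ge0 ?invr_ge0// lerBlDr lerDl exprn_ge0 ?invr_ge0.
have cZ : continuous Z.
  move=> t; apply/cvgrPdist_le => e e0; have e3 : 0 < e / 3 by rewrite divr_gt0.
  have [N hN] := geometric_small B e3.
  have /cvgrPdist_le /(_ _ e3) := cY N t.
  apply: filterS => s hs.
  have h1 := hZ t N; have h2 := hZ s N; rewrite distrC in h2.
  have -> : Z t - Z s = (Z t - Y N t) + (Y N t - Y N s) + (Y N s - Z s).
    by rewrite !subrKA.
  rewrite (le_trans (ler_normD _ _))// -(@mulfK _ 3%:R _ e)//.
  rewrite (le_trans (lerD (ler_normD _ _) (lexx _)))//.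
  lra.
have ZT t : Z t = T Z t.
  apply/eqP; rewrite -subr_eq0 -normr_le0; apply/ler_addgt0Pr => e e0; rewrite add0r.
  have e3 : 0 < e / 2 by rewrite divr_gt0.
  have [N hN] := geometric_small B e3.
  have h1 := hZ t N.+1; rewrite exprSr in h1.
  have h2 := @T2 (Y N) Z (B * 2^-1 ^+ N) (cY N) cZ _ _ t.
  rewrite -(subrK (Y N.+1 t) (Z t)) -addrA (le_trans (ler_normD _ _))//.
  have B2 : 0 <= B * 2^-1 ^+ N by rewrite mulr_ge0 ?exprn_ge0 ?invr_ge0.
  have : `|Y N.+1 t - T Z t| <= B * 2^-1 ^+ N * 2^-1.
    by apply: h2 => // s; rewrite distrC.
  lra.
have [cP P0 dP] := hP Z cZ.
exists Z; split => //.
  rewrite ZT /T; have -> : c x0 = x0 by apply: clamp_id; rewrite lexx x0l.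
  by rewrite P0 addr0.
move=> t /andP[t1 t2].
apply: (@near_eq_is_derive _ _ _ (fun s => Z0 + P Z s)).
- have : \forall s \near t, x0 < s < x0 + l.
    by near=> s; apply/andP; split; near: s; [exact: lt_nbhsr|exact: lt_nbhsl].
  apply: filterS => s /andP[s1 s2]; rewrite [RHS]ZT /T /c clamp_id//.
  by rewrite !ltW.
- rewrite -[X in is_derive _ _ _ X]add0r; apply: is_deriveD; exact: dP.
Unshelve. all: by end_near. Qed.

End MatrixNorm.

(** * Integrable linear systems in two variables *)

Section Frobenius.
Context {R : realType}.

Lemma is_derive_scale m n (v : 'M[R]_(m, n)) (x : R) :
  is_derive x 1 (fun t : R => t *: v) v.
Proof.
have d := @is_diff_scalel R _ x v.
split; first by apply: diff_derivable; have [] := d.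
rewrite deriveE; last by have [] := d.
by have [_ ->] := d; rewrite scale1r.
Qed.

Lemma mvt_abs m n (f df : R -> 'M[R]_(m, n)) (c d K u v : R) : 0 <= K ->
  (forall x : R, c < x < d -> is_derive x 1 f (df x)) ->
  {within `[c, d], continuous f} ->
  (forall x : R, c < x < d -> `|df x| <= K) ->
  c <= u <= d -> c <= v <= d -> `|f v - f u| <= K * `|v - u|.
Proof.
move=> K0; wlog uv : u v / u <= v => [H|] fd fc dK uI vI.
  by have [|/ltW] := leP u v => uv; [|rewrite distrC (distrC v)]; apply: H.
case/andP: uI => cu ud; case/andP: vI => cv vd.
rewrite (@ger0_norm _ (v - u)) ?subr_ge0//.
apply: (mvt_ineq (df := df)) => //.
- by move=> x /andP[ux xv]; apply: fd; rewrite (le_lt_trans cu)// (lt_le_trans xv).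
- apply: continuous_subspaceW fc; apply: subset_itv; rewrite bnd_simp//.
- by move=> x /andP[ux xv]; apply: dK; rewrite (le_lt_trans cu)// (lt_le_trans xv).
Qed.

Lemma derive_within m n (f df : R -> 'M[R]_(m, n)) (c d : R) :
  (forall x : R, c <= x <= d -> is_derive x 1 f (df x)) ->
  {within `[c, d], continuous f}.
Proof.
move=> fd; apply: derivable_within_continuous => x.
by rewrite in_itv/= => /fd [].
Qed.

(** Gronwall's inequality on an interval short enough to need no exponential. *)
Lemma gronwall m n (f df : R -> 'M[R]_(m, n)) (a b k e e0 x : R) :
  0 <= k -> 0 <= e -> k * (b - a) <= 2^-1 -> a <= x <= b ->
  (forall x : R, a < x < b -> is_derive x 1 f (df x)) ->
  {within `[a, b], continuous f} ->
  (forall x : R, a < x < b -> `|df x| <= k * `|f x| + e) ->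
  `|f a| <= e0 -> `|f x| <= 2 * (e0 + e * (b - a)).
Proof.
move=> k0 e1 kab /andP[ax xb] fd fc dk fa; have ab := le_trans ax xb.
have [|c] := @EVT_max R (fun t => `|f t|) a b ab.
  by move=> t; apply: cvg_norm; exact: fc.
rewrite in_itv/= => /andP[ac cb] cmax.
suff : `|f c| <= 2 * (e0 + e * (b - a)).
  by apply: le_trans; apply: cmax; rewrite in_itv/= ax.
have : `|f c - f a| <= (k * `|f c| + e) * (c - a).
  apply: (mvt_ineq (df := df)) => //.
  - by rewrite addr_ge0// mulr_ge0.
  - by move=> t /andP[t1 t2]; apply: fd; rewrite t1 (lt_le_trans t2).
  - by apply: continuous_subspaceW fc; apply: subset_itv; rewrite bnd_simp.
  - move=> t /andP[t1 t2]; rewrite (le_trans (dk _ _)) ?t1 ?(lt_le_trans t2)//.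
    rewrite lerD2r ler_wpM2l// cmax// in_itv/= (ltW t1) (ltW (lt_le_trans t2 _))//.
have : (k * `|f c| + e) * (c - a) <= (k * `|f c| + e) * (b - a).
  by rewrite ler_wpM2l ?addr_ge0 ?mulr_ge0// lerD2r.
have : `|f c| * (k * (b - a)) <= `|f c| * 2^-1 by rewrite ler_wpM2l.
have : `|f c| <= `|f c - f a| + `|f a|.
  by rewrite -{1}(subrK (f a) (f c)) ler_normD.
set N := `|f c|; set D := `|f c - f a|; set F := `|f a| in fa *.
nra.
Qed.

Lemma quadratic_is_derive m n (f : R -> 'M[R]_(m, n)) (s C r : R) d : 0 < r ->
  (forall h, `|h| < r -> `|f (s + h) - f s - h *: d| <= C * h ^+ 2) ->
  is_derive s 1 f d.
Proof.
move=> r0 H; have C0 : 0 <= `|C| + 1 by rewrite addr_ge0.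
have cv : h^-1 *: (f (h *: 1 + s) - f s) @[h --> 0^'] --> d.
  apply/cvgrPdist_le => e e0; near=> h.
  have h0 : h != 0 by near: h; exact: nbhs_dnbhs_neq.
  have hr : `|h| < r by near: h; exact: dnbhs0_lt.
  have he : `|h| <= e / (`|C| + 1).
    by near: h; apply: dnbhs0_le; rewrite divr_gt0// ltr_pwDr.
  have -> : d - h^-1 *: (f (h *: 1 + s) - f s)
      = - (h^-1 *: (f (s + h) - f s - h *: d)).
    rewrite [h *: 1]mulr1 (addrC h) (scalerBr h^-1 (_ - _)) scalerA mulVf// scale1r opprB.
    by [].
  rewrite normrN normrZ normfV ler_pdivrMl ?normr_gt0//.
  rewrite (le_trans (H _ hr))// -real_normK ?num_real// expr2 mulrCA ler_wpM2l//.
  rewrite (le_trans _ (_ : (`|C| + 1) * `|h| <= _))//.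
    by rewrite ler_wpM2r// ler_wpDr// ler_norm.
  by rewrite mulrC -ler_pdivlMr// ltr_pwDr.
split; first by apply/cvg_ex; exists d.
exact: cvg_lim.
Unshelve. all: by end_near. Qed.

Lemma taylor2 m n (f df : R -> 'M[R]_(m, n)) (c d K s h : R) : 0 <= K ->
  (forall x : R, c < x < d -> is_derive x 1 f (df x)) ->
  {within `[c, d], continuous f} ->
  c < s < d -> c <= s + h <= d ->
  (forall x : R, c < x < d -> `|df x - df s| <= K * `|x - s|) ->
  `|f (s + h) - f s - h *: df s| <= K * h ^+ 2.
Proof.
move=> K0 fd fc sI shI dK.
pose c' := Num.min s (s + h); pose d' := Num.max s (s + h).
have [cc' dd'] : c <= c' /\ d' <= d.
  move: sI shI => /andP[s1 s2] /andP[s3 s4].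
  by rewrite /c' /d' le_min ge_max s3 s4 !ltW.
have h' x : c' < x < d' -> `|x - s| <= `|h|.
  rewrite /c' /d'; have [h0|h0] := leP 0 h.
    rewrite (min_idPl _) ?lerDl// (max_idPr _) ?lerDl// (ger0_norm h0).
    move=> /andP[x1 x2]; rewrite ler_norml; apply/andP; split; lra.
  have hh : s + h <= s by rewrite gerDl ltW.
  rewrite (min_idPr hh) (max_idPl hh).
  move=> /andP[x1 x2]; rewrite (@ltr0_norm _ h)// ler_norml; apply/andP; split; lra.
have xI x : c' < x < d' -> c < x < d.
  by move=> /andP[x1 x2]; rewrite (le_lt_trans cc')// (lt_le_trans x2).
have := @mvt_abs m n (fun x => f x - x *: df s) (fun x => df x - df s) c' d'
  (K * `|h|) s (s + h).
have -> : f (s + h) - (s + h) *: df s - (f s - s *: df s) = f (s + h) - f s - h *: df s.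
  by apply/matrixP => i j; rewrite !mxE; ring.
rewrite -[s + h - s]addrAC subrr add0r -mulrA -expr2 real_normK ?num_real//.
apply.
- by rewrite mulr_ge0.
- move=> x /xI /fd dx; apply: is_deriveB.
  exact: is_derive_scale.
- move=> x; apply: cvgB.
    by apply: (@continuous_subspaceW _ _ _ `[c, d]) => //; apply: subset_itv; rewrite bnd_simp.
  have : {within `[c', d'], continuous (fun x : R => x *: df s)}.
    by apply: continuous_subspaceT => y; apply: cvgZr_tmp; exact: cvg_id.
  exact.
- move=> x xI'; rewrite (le_trans (dK _ (xI _ xI')))// ler_wpM2l//; exact: h'.
- by rewrite /c' /d' ge_min le_max lexx.
- by rewrite /c' /d' ge_min le_max lexx !orbT.
Qed.

Lemma is_derive_mulmx m p n (f : R -> 'M[R]_(m, p)) (g : R -> 'M[R]_(p, n))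
    (t : R) df dg : is_derive t 1 f df -> is_derive t 1 g dg ->
  is_derive t 1 (fun s => f s *m g s) (df *m g t + f t *m dg).
Proof.
move=> /is_derive_mx hf /is_derive_mx hg; apply/is_derive_mx => i j.
under eq_fun do rewrite mxE.
rewrite !mxE -big_split/=.
have -> : (fun s => \sum_k f s i k * g s k j) =
    \sum_k (fun s => f s i k * g s k j) by apply/funext => s; rewrite fct_sumE.
apply: is_derive_sum => k.
apply: (is_derive_eq (is_deriveM (hf i k) (hg k j))).
by rewrite /GRing.scale/=; ring.
Qed.

(** The integrability condition says that [A Z] and the derivative of [Z] along
    the first variable satisfy the same differential equation along the second
    one; the difference quotients of [Z] are therefore controlled by their
    values on the bottom edge. *)
Lemma frobenius n m (A B A1 B0 : R -> R -> 'M[R]_n) (x0 y0 l K : R)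
    (Z0 : 'M[R]_(n, m)) : 0 < l -> 0 <= K -> n%:R * K * l <= 2^-1 ->
  let Q s t := x0 <= s <= x0 + l /\ y0 <= t <= y0 + l in
  (forall s t, Q s t -> [/\ `|A s t| <= K, `|B s t| <= K & `|B0 s t| <= K]) ->
  (forall s t, Q s t -> is_derive s 1 (B^~ t) (B0 s t)) ->
  (forall s t, Q s t -> is_derive t 1 (A s) (A1 s t)) ->
  (forall s t, Q s t -> {for t, continuous (B s)}) ->
  (forall s s' t, Q s t -> Q s' t -> `|B0 s' t - B0 s t| <= K * `|s' - s|) ->
  (forall s s', Q s y0 -> Q s' y0 -> `|A s' y0 - A s y0| <= K * `|s' - s|) ->
  (forall s t, Q s t -> A1 s t + A s t *m B s t = B0 s t + B s t *m A s t) ->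
  exists (Z : R -> R -> 'M[R]_(n, m)) (L : R), [/\ Z x0 y0 = Z0,
    forall s t, x0 < s < x0 + l -> y0 < t < y0 + l ->
      is_derive s 1 (Z^~ t) (A s t *m Z s t) /\
      is_derive t 1 (Z s) (B s t *m Z s t) ,
    forall s, continuous (Z s),
    forall s t, Q s t -> `|Z s t - Z0| <= 8 * n%:R * K * l * `|Z0| &
    forall s s' t, Q s t -> Q s' t -> `|Z s' t - Z s t| <= L * `|s' - s|].
Proof.
move=> l0 K0 nKl Q bd dB dA cB lB lA flat.
have n0 : 0 <= n%:R :> R by [].
have l0' := ltW l0.
have [x0l y0l] : x0 <= x0 + l /\ y0 <= y0 + l by rewrite !lerDl ltW.
pose cx := clamp x0 (x0 + l); pose cy := clamp y0 (y0 + l).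
have Qc s t : Q (cx s) (cy t) by split; exact: clamp_in.
have cxE s t : Q s t -> cx s = s by move=> [h _]; exact: clamp_id.
have cyE s t : Q s t -> cy t = t by move=> [_ h]; exact: clamp_id.
have Qy0 s : x0 <= s <= x0 + l -> Q s y0 by split => //; rewrite lexx.
have ltI (a b x : R) : a < x < b -> a <= x <= b.
  by move=> /andP[/ltW -> /ltW ->].
have cA : continuous (fun s => A (cx s) y0).
  move=> s; apply/cvgrPdist_le => e e0; have K1 : 0 < K + 1 by rewrite ltr_wpDl.
  have /cvgrPdist_le /(_ (e / (K + 1))) := @clamp_continuous R x0 (x0 + l) s.
  rewrite divr_gt0// => /(_ isT); apply: filterS => t; rewrite ler_pdivlMr// => h.
  have := lA _ _ (Qy0 _ (clamp_in t x0l)) (Qy0 _ (clamp_in s x0l)).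
  have := normr_ge0 (cx s - cx t); rewrite -/(cx s) -/(cx t) in h *; nra.
have [E [cE E0 dE]] := linear_ode x0 Z0 cA K0 l0' (fun s => let: And3 h _ _ :=
  bd _ _ (Qy0 _ (clamp_in s x0l)) in h) nKl.
have {}dE s : x0 < s < x0 + l -> is_derive s 1 E (A s y0 *m E s).
  by move=> sI; have := dE s sI; rewrite /cx clamp_id ?ltI.
pose M := 4 * `|Z0|; have M0 : 0 <= M by rewrite mulr_ge0.
have nK0 : 0 <= n%:R * K by rewrite mulr_ge0.
have ltQ s t : x0 < s < x0 + l -> y0 < t < y0 + l -> Q s t.
  by move=> /ltI h1 /ltI h2.
have mulK (X : 'M[R]_n) (Y : 'M[R]_(n, m)) a b : `|X| <= a -> `|Y| <= b ->
    `|X *m Y| <= n%:R * a * b.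
  by move=> Xa Yb; rewrite (le_trans (mulmx_norm _ _))// ler_pM ?mulr_ge0// ler_pM.
have Ebd s : x0 <= s <= x0 + l -> `|E s| <= 2 * `|Z0|.
  move=> sI; rewrite -[X in 2 * X]addr0 -[X in _ + X](mul0r (x0 + l - x0)).
  apply: (@gronwall _ _ E (fun s => A s y0 *m E s) x0 (x0 + l) (n%:R * K)) => //.
  - by rewrite addrC addKr.
  - exact: continuous_subspaceT.
  - move=> u uI; rewrite addr0; apply: mulK => //.
    by have [] := bd u y0 (Qy0 _ (ltI _ _ _ uI)).
  - by rewrite E0.
have /choice[Z hZ] : forall s, exists Z : R -> 'M[R]_(n, m),
    [/\ continuous Z, Z y0 = E (cx s) & forall t, y0 < t < y0 + l ->
      is_derive t 1 Z (B (cx s) (cy t) *m Z t)].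
  move=> s; apply: (@linear_ode _ _ _ (fun t => B (cx s) (cy t)) _ l K) => //.
  - move=> t; apply: (@continuous_comp _ _ _ cy (B (cx s))).
      exact: clamp_continuous.
    exact: cB.
  - by move=> t; have [] := bd _ _ (Qc s t).
have cZ s : continuous (Z s) by have [] := hZ s.
have Zy0 s : x0 <= s <= x0 + l -> Z s y0 = E s.
  by move=> sI; have [_ -> _] := hZ s; rewrite /cx clamp_id.
have dZ s t : x0 <= s <= x0 + l -> y0 < t < y0 + l ->
    is_derive t 1 (Z s) (B s t *m Z s t).
  move=> sI tI; have [_ _ /(_ t tI)] := hZ s.
  by rewrite /cx /cy !clamp_id// ltI.
have Zbd s t : Q s t -> `|Z s t| <= M.
  move=> [sI tI]; rewrite /M (_ : 4 = 2 * 2); last by rewrite -natrM.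
  rewrite -mulrA -[X in 2 * X]addr0 -[X in _ + X](mul0r (y0 + l - y0)).
  apply: (@gronwall _ _ (Z s) (fun t => B s t *m Z s t) y0 (y0 + l) (n%:R * K)) => //.
  - by rewrite addrC addKr.
  - by move=> u uI; apply: dZ.
  - exact: continuous_subspaceT.
  - move=> u uI; rewrite addr0; apply: mulK => //.
    by have [] := bd s u (conj sI (ltI _ _ _ uI)).
  - by rewrite Zy0// Ebd.
have EM s : x0 <= s <= x0 + l -> `|E s| <= M.
  by move=> /Ebd; have := normr_ge0 Z0; rewrite /M; lra.
have Elip s s' : x0 <= s <= x0 + l -> x0 <= s' <= x0 + l ->
    `|E s' - E s| <= n%:R * K * M * `|s' - s|.
  move=> sI sI'; apply: (@mvt_abs _ _ E (fun s => A s y0 *m E s) x0 (x0 + l)) => //.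
  - by rewrite !mulr_ge0.
  - exact: continuous_subspaceT.
  - move=> u uI; apply: mulK; last by apply: EM; exact: ltI.
    by have [] := bd u y0 (Qy0 _ (ltI _ _ _ uI)).
have Blip s s' t : Q s t -> Q s' t -> `|B s' t - B s t| <= K * `|s' - s|.
  move=> [sI tI] [sI' _].
  apply: (@mvt_abs _ _ (B^~ t) (B0^~ t) x0 (x0 + l)) => //.
  - by move=> x /ltI xI; apply: dB.
  - by apply: (@derive_within _ _ _ (B0^~ t)) => x xI; apply: dB.
  - by move=> x /ltI xI; have [] := bd x t (conj xI tI).
pose L := 2 * (n%:R * K * M + n%:R * K * M * l).
have L0 : 0 <= L by rewrite mulr_ge0// addr_ge0// !mulr_ge0.
have Zlip s s' t : Q s t -> Q s' t -> `|Z s' t - Z s t| <= L * `|s' - s|.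
  move=> [sI tI] [sI' _].
  have -> : L * `|s' - s| = 2 * (n%:R * K * M * `|s' - s| +
      n%:R * (K * `|s' - s|) * M * (y0 + l - y0)) by rewrite /L; ring.
  apply: (@gronwall _ _ (fun t => Z s' t - Z s t)
    (fun t => B s' t *m Z s' t - B s t *m Z s t) _ _ (n%:R * K)) => //.
  - by rewrite !mulr_ge0.
  - by rewrite addrC addKr.
  - by move=> u uI; apply: is_deriveB; exact: dZ.
  - by apply: continuous_subspaceT => u; apply: cvgB; exact: cZ.
  - move=> u /ltI uI.
    have -> : B s' u *m Z s' u - B s u *m Z s u =
        B s' u *m (Z s' u - Z s u) + (B s' u - B s u) *m Z s u.
      by rewrite mulmxBr mulmxBl subrKA.
    rewrite (le_trans (ler_normD _ _))// lerD//.
      by apply: mulK => //; have [] := bd s' u (conj sI' uI).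
    by apply: mulK; [exact: Blip|exact: Zbd].
  - by rewrite !Zy0//; exact: Elip.
have Zdist s t : Q s t -> `|Z s t - Z0| <= 8 * n%:R * K * l * `|Z0|.
  move=> [sI tI]; have y0I : y0 <= y0 <= y0 + l by rewrite lexx.
  have x0I : x0 <= x0 <= x0 + l by rewrite lexx.
  have h1 : `|Z s t - Z s y0| <= n%:R * K * M * `|t - y0|.
    apply: (@mvt_abs _ _ (Z s) (fun t => B s t *m Z s t) y0 (y0 + l)) => //.
    - by rewrite !mulr_ge0.
    - by move=> u uI; apply: dZ.
    - exact: continuous_subspaceT.
    - move=> u /ltI uI; apply: mulK; last exact: Zbd.
      by have [] := bd s u (conj sI uI).
  have h2 := Elip _ _ x0I sI; rewrite E0 -Zy0// in h2.
  have nl (u v : R) : v <= u <= v + l -> `|u - v| <= l.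
    by move=> /andP[? ?]; rewrite ger0_norm ?subr_ge0// lerBlDl.
  have M1 : 0 <= n%:R * K * M by rewrite !mulr_ge0.
  have h1' := le_trans h1 (ler_wpM2l M1 (nl _ _ tI)).
  have h2' := le_trans h2 (ler_wpM2l M1 (nl _ _ sI)).
  rewrite -(subrKA (Z s y0)) (le_trans (ler_normD _ _))// (le_trans (lerD h1' h2'))//.
  by rewrite /M; lra.
exists Z, L; split => //; first by rewrite Zy0// lexx.
move=> s t sI tI; split; last by apply: dZ => //; exact: ltI.
pose r := Num.min (s - x0) (x0 + l - s).
have r0 : 0 < r by case/andP: sI => *; rewrite lt_min !subr_gt0; apply/andP.
pose C0 := n%:R * K * (n%:R * K * M) + n%:R * K * M.
have C00 : 0 <= C0 by rewrite addr_ge0// !mulr_ge0.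
apply: (@quadratic_is_derive _ _ _ _ (2 * (C0 + (n%:R * K * L + n%:R * K * M) * l)) r) => //.
move=> h hr.
have hI : x0 <= s + h <= x0 + l.
  move: hr; rewrite lt_min !ltr_norml => /andP[/andP[? ?] /andP[? ?]].
  by apply/andP; split; lra.
have sI' := ltI _ _ _ sI.
have hh : `|h| * `|h| = h ^+ 2 by rewrite -expr2 real_normK ?num_real.
have hs : `|s + h - s| = `|h| by rewrite addrAC subrr add0r.
have -> : 2 * (C0 + (n%:R * K * L + n%:R * K * M) * l) * h ^+ 2 =
  2 * (C0 * h ^+ 2 + (n%:R * (K * `|h|) * (L * `|h|) + n%:R * (K * h ^+ 2) * M) * (y0 + l - y0)).
  by rewrite -hh; ring.
apply: (@gronwall _ _ (fun t => Z (s + h) t - Z s t - h *: (A s t *m Z s t))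
    (fun t => B (s + h) t *m Z (s + h) t - B s t *m Z s t -
      h *: (A1 s t *m Z s t + A s t *m (B s t *m Z s t))) _ _ (n%:R * K)) => //.
- by rewrite -hh; apply: addr_ge0; repeat apply: mulr_ge0 => //; exact: normr_ge0.
- by rewrite addrC addKr.
- exact: ltI.
- move=> u uI; apply: is_deriveB; first by apply: is_deriveB; exact: dZ.
  apply: is_deriveZ; apply: is_derive_mulmx; last exact: dZ.
  by apply: dA; split => //; exact: ltI.
- have cAs : {within `[y0, y0 + l], continuous (A s)}.
    by apply: (@derive_within _ _ _ (A1 s)) => x xI; apply: dA.
  have cZw v : {within `[y0, y0 + l], continuous (Z v)} by exact: continuous_subspaceT.
  move=> u; apply: cvgB; first by apply: cvgB; exact: cZw.
  by apply: cvgZl_tmp; apply: cvg_mulmx; [exact: cAs|exact: cZw].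
- move=> u /ltI uI; have qu : Q s u by []; have qu' : Q (s + h) u by [].
  have -> : B (s + h) u *m Z (s + h) u - B s u *m Z s u -
      h *: (A1 s u *m Z s u + A s u *m (B s u *m Z s u)) =
    B s u *m (Z (s + h) u - Z s u - h *: (A s u *m Z s u)) +
    ((B (s + h) u - B s u) *m (Z (s + h) u - Z s u) +
    (B (s + h) u - B s u - h *: B0 s u) *m Z s u).
    rewrite mulmxA -mulmxDl flat// !mulmxBr !mulmxBl -scalemxAr -scalemxAl mulmxDl.
    rewrite mulmxA.
    move: (B (s + h) u *m _) (B s u *m Z (s + h) u) (B s u *m Z s u)
      (B s u *m A s u *m Z s u) (B (s + h) u *m Z s u) (B0 s u *m Z s u).
    by move=> X1 X2 X3 X4 X5 X6; apply/matrixP => i j; rewrite !mxE; ring.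
  rewrite (le_trans (ler_normD _ _))// lerD//.
    by apply: mulK => //; have [] := bd s u qu.
  rewrite (le_trans (ler_normD _ _))// lerD//.
    apply: mulK; first by rewrite -hs; exact: Blip.
    by rewrite -hs; exact: Zlip.
  apply: mulK; last exact: Zbd.
  apply: (@taylor2 _ _ (B^~ u) (B0^~ u) x0 (x0 + l)) => //.
  + by move=> x /ltI xI; apply: dB.
  + by apply: (@derive_within _ _ _ (B0^~ u)) => x xI; apply: dB.
  + by move=> x /ltI xI; apply: lB.
- rewrite !Zy0//.
  apply: (@taylor2 _ _ E (fun s => A s y0 *m E s) x0 (x0 + l)) => //.
  + exact: continuous_subspaceT.
  + move=> x /ltI xI.
    have -> : A x y0 *m E x - A s y0 *m E s =
        A x y0 *m (E x - E s) + (A x y0 - A s y0) *m E s.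
      by rewrite mulmxBr mulmxBl subrKA.
    rewrite mulrDl (le_trans (ler_normD _ _))// lerD//.
      rewrite -[leRHS]mulrA; apply: mulK; last exact: Elip.
      by have [] := bd x y0 (Qy0 _ xI).
    have -> : n%:R * K * M * `|x - s| = n%:R * (K * `|x - s|) * M by ring.
    by apply: mulK; [apply: lA; exact: Qy0|exact: EM].
Qed.

End Frobenius.

(** * Differential calculus in the plane *)

Section Plane.
Context {R : realType}.
Local Notation plane := 'rV[R]_2.
Implicit Types (V : set plane) (f g : plane -> R) (v w : plane) (i j : 'I_2).

Lemma norm_split (a b z e : R) :
  `|a - z| <= e / 2 -> `|b - z| <= e / 2 -> `|a - b| <= e.
Proof.
move=> ha hb; rewrite -(subrKA z) (le_trans (ler_normD _ _))// [e]splitr lerD//.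
by rewrite distrC.
Qed.

Definition ebase (i : 'I_2) : plane := delta_mx 0 i.

Lemma row2P (v w : plane) : v 0 0 = w 0 0 -> v 0 1 = w 0 1 -> v = w.
Proof.
move=> h0 h1; apply/rowP => j; case: j => [[|[|//]] p].
  by rewrite (_ : Ordinal p = 0) //; apply/val_inj.
by rewrite (_ : Ordinal p = 1) //; apply/val_inj.
Qed.

Lemma ebaseE i j : ebase i 0 j = (j == i)%:R.
Proof. by rewrite mxE eqxx. Qed.

Lemma sum2 (T : nmodType) (F : 'I_2 -> T) : \sum_(i < 2) F i = F 0 + F 1.
Proof.
rewrite big_ord_recl big_ord_recl big_ord0 addr0; congr (_ + F _).
exact/val_inj.
Qed.

Lemma plane_decomp w : w = w 0 0 *: ebase 0 + w 0 1 *: ebase 1.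
Proof. by apply: row2P; rewrite !mxE /= ?mulr1 ?mulr0 ?addr0 ?add0r. Qed.

Lemma norm_plane w (r : R) : 0 <= r -> `|w 0 0| <= r -> `|w 0 1| <= r -> `|w| <= r.
Proof.
move=> r0 h0 h1; apply: mxnorm_le => // i j; rewrite ord1.
case: j => [[|[|//]] p].
  by rewrite (_ : Ordinal p = 0) //; apply/val_inj.
by rewrite (_ : Ordinal p = 1) //; apply/val_inj.
Qed.

Lemma line_derive f w i (x : R) : derivable f (w + x *: ebase i) (ebase i) ->
  is_derive x 1 (fun y : R => f (w + y *: ebase i)) (partial i f (w + x *: ebase i)).
Proof.
move=> d.
have E : (fun h : R => h^-1 *: (((fun y : R => f (w + y *: ebase i)) \o shift x)
    (h *: (1 : R)) - f (w + x *: ebase i))) =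
    (fun h : R => h^-1 *: ((f \o shift (w + x *: ebase i)) (h *: ebase i) -
      f (w + x *: ebase i))).
  apply/funext => h /=; congr (_ *: (f _ - _)).
  by rewrite [h *: 1]mulr1 scalerDl addrCA addrA.
by split; [rewrite /derivable E|rewrite /derive E].
Qed.

(** The mean value theorem along a coordinate direction. *)
Lemma mvt_coord V f w i (h : R) :
  (forall x : R, `|x| <= `|h| -> V (w + x *: ebase i)) ->
  (forall v, V v -> derivable f v (ebase i)) ->
  exists2 x : R, `|x| <= `|h| &
    f (w + h *: ebase i) - f w = h * partial i f (w + x *: ebase i).
Proof.
move=> hV df.
pose phi := fun y : R => f (w + y *: ebase i).
pose dphi := fun y : R => partial i f (w + y *: ebase i).
have dp (x : R) : `|x| <= `|h| -> is_derive x 1 phi (dphi x).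
  by move=> xh; apply: line_derive; apply: df; exact: hV.
have phi0 : f w = phi 0 by rewrite /phi scale0r addr0.
rewrite phi0 -/(phi h).
have [h0|h0] := leP 0 h.
- have nI (x : R) : 0 <= x <= h -> `|x| <= `|h|.
    by move=> /andP[x0 xh]; rewrite !ger0_norm.
  have [||c] := @MVT_segment R phi dphi 0 h h0.
  + by move=> x; rewrite in_itv/= => /andP[/ltW x1 /ltW x2]; apply: dp; apply: nI; rewrite x1.
  + apply: derivable_within_continuous => x; rewrite in_itv/= => xI.
    by have [] := dp x (nI _ xI).
  rewrite in_itv/= => cI ->; exists c; first exact: nI.
  by rewrite subr0 mulrC.
- have nI (x : R) : h <= x <= 0 -> `|x| <= `|h|.
    by move=> /andP[x0 xh]; rewrite ler0_norm// ltr0_norm// lerN2.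
  have [||c] := @MVT_segment R phi dphi h 0 (ltW h0).
  + by move=> x; rewrite in_itv/= => /andP[/ltW x1 /ltW x2]; apply: dp; apply: nI; rewrite x1.
  + apply: derivable_within_continuous => x; rewrite in_itv/= => xI.
    by have [] := dp x (nI _ xI).
  rewrite in_itv/= => cI E; exists c; first exact: nI.
  by rewrite -opprB E sub0r mulrN opprK mulrC.
Qed.

Lemma near_ball_plane V v : (\forall w \near v, V w) ->
  exists2 r : R, 0 < r & forall w, `|w - v| < r -> V w.
Proof.
move=> /nbhs_normP [r r0 h]; exists r => // w wv; apply: h.
by rewrite /= distrC.
Qed.

Lemma entry_le w (i : 'I_2) : `|w 0 i| <= `|w|.
Proof. exact: mxnorm_ge. Qed.

Lemma norm_coord (x : R) i : `|x *: ebase i| = `|x|.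
Proof.
rewrite normrZ (_ : `|ebase i| = 1) ?mulr1//; apply/le_anti/andP; split.
  by apply: mxnorm_le => // k l; rewrite ord1 ebaseE; case: eqP; rewrite ?normr1 ?normr0.
by have := entry_le (ebase i) i; rewrite ebaseE eqxx normr1.
Qed.

Lemma diff_of_estimate (W : normedModType R) (f : plane -> W) v (p0 p1 : W) :
  (forall e : R, 0 < e -> exists2 r : R, 0 < r & forall w : plane, `|w| < r ->
    `|f (w + v) - f v - (w 0 0 *: p0 + w 0 1 *: p1)| <= e * `|w|) ->
  differentiable f v /\ forall w, 'd f v w = w 0 0 *: p0 + w 0 1 *: p1.
Proof.
move=> H; pose L := fun w : plane => w 0 0 *: p0 + w 0 1 *: p1.
have linL : linear L.
  move=> a x y; rewrite /L !mxE !scalerDl scalerDr !scalerA.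
  by rewrite addrACA.
pose LL : {linear plane -> W} := HB.pack L (GRing.isLinear.Build _ _ _ _ L linL).
have cL : continuous (L : plane -> W).
  move=> x; have FF : Filter (nbhs (x : plane)) by exact: nbhs_filter.
  have h k := @continuous_entry R 1 2 0 k x.
  have H0 := @cvgZr_tmp R W plane (nbhs x) FF (fun w : plane => w 0 0) _ p0 (h 0).
  have H1 := @cvgZr_tmp R W plane (nbhs x) FF (fun w : plane => w 0 1) _ p1 (h 1).
  exact: (@cvgD R W plane (nbhs x) FF _ _ _ _ H0 H1).
have key : f \o shift v = cst (f v) + LL +o_ (0 : plane) id.
  apply/eqaddoP => e e0; have [r r0 hr] := H e e0.
  have h : \forall w \near (0 : plane), `|w| < r by exact: nbhs0_lt.
  apply: filterS h => w /hr.
  by rewrite -[(_ - _) w]/(f (w + v) - (f v + L w)) (opprD (f v)) (addrA (f (w + v))).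
have E := @diff_unique _ _ _ f LL v cL key.
split; last by move=> w; rewrite E.
by apply/diff_locallyP; rewrite E; split.
Qed.

(** A function with continuous partial derivatives is differentiable: reach the
    point by two coordinate steps and use the mean value theorem on each. *)
Lemma C1_estimate V f v (e : R) : open V -> Ck 1 V f -> V v -> 0 < e ->
  exists2 r : R, 0 < r & forall w : plane, `|w| < r -> `|f (w + v) - f v -
    (w 0 0 * partial 0 f v + w 0 1 * partial 1 f v)| <= e * `|w|.
Proof.
move=> oV [_ h] Vv e0.
have c0 (i : 'I_2) : \forall w \near v, `|partial i f v - partial i f w| <= e / 2.
  have [_ [+ _]] := h i; move=> /(_ v Vv) /cvgrPdist_le; apply.
  by rewrite divr_gt0.
have [r r0 hr] : exists2 r : R, 0 < r & forall w, `|w - v| < r ->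
    V w /\ forall i : 'I_2, `|partial i f v - partial i f w| <= e / 2.
  apply: near_ball_plane; near=> w; split; first by near: w; exact: open_nbhs_nbhs.
  by near: w; exact: filter_forall.
have df i u : V u -> derivable f u (ebase i) by have [+ _] := h i; exact.
exists r => // w wr.
have wi i : `|w 0 i| < r by apply: le_lt_trans wr; exact: entry_le.
pose w' := v + w 0 1 *: ebase 1.
have w'r (x : R) : `|x| <= `|w 0 0| -> `|w' + x *: ebase 0 - v| < r.
  move=> hx; apply: le_lt_trans wr; rewrite /w' addrC !addrA addNr add0r.
  apply: norm_plane => //; rewrite !mxE /= ?mulr1 ?mulr0 ?addr0 ?add0r.
    exact: le_trans hx (entry_le _ _).
  exact: entry_le.
have vr (x : R) : `|x| <= `|w 0 1| -> `|v + x *: ebase 1 - v| < r.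
  by move=> hx; rewrite addrAC subrr add0r norm_coord (le_lt_trans hx).
have [x hx Ex] := @mvt_coord V f w' 0 (w 0 0) (fun x hx => proj1 (hr _ (w'r x hx))) (df 0).
have [y hy Ey] := @mvt_coord V f v 1 (w 0 1) (fun x hx => proj1 (hr _ (vr x hx))) (df 1).
have E : w + v = w' + w 0 0 *: ebase 0.
  by rewrite {1}(plane_decomp w) /w'; apply/rowP => k; rewrite !mxE; ring.
have -> : f (w + v) - f v - (w 0 0 * partial 0 f v + w 0 1 * partial 1 f v) =
    w 0 0 * (partial 0 f (w' + x *: ebase 0) - partial 0 f v) +
    w 0 1 * (partial 1 f (v + y *: ebase 1) - partial 1 f v).
  by rewrite E !mulrBr -Ex -Ey -/w'; ring.
have b0 : `|partial 0 f (w' + x *: ebase 0) - partial 0 f v| <= e / 2.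
  by rewrite distrC; apply: (proj2 (hr _ (w'r _ hx))).
have b1 : `|partial 1 f (v + y *: ebase 1) - partial 1 f v| <= e / 2.
  by rewrite distrC; apply: (proj2 (hr _ (vr _ hy))).
apply: (le_trans (ler_normD _ _)); rewrite !normrM.
have b2 := entry_le w 0; have b3 := entry_le w 1.
have h1 : `|w 0 0| * `|partial 0 f (w' + x *: ebase 0) - partial 0 f v| <= `|w| * (e / 2).
  exact: ler_pM (normr_ge0 _) (normr_ge0 _) b2 b0.
have h2 : `|w 0 1| * `|partial 1 f (v + y *: ebase 1) - partial 1 f v| <= `|w| * (e / 2).
  exact: ler_pM (normr_ge0 _) (normr_ge0 _) b3 b1.
by rewrite [leRHS]mulrC [e]splitr mulrDr; exact: lerD h1 h2.
Unshelve. all: by end_near. Qed.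

Lemma C1_diff V f v : open V -> Ck 1 V f -> V v ->
  differentiable f v /\
  forall w, 'd f v w = w 0 0 * partial 0 f v + w 0 1 * partial 1 f v.
Proof.
move=> oV Cf Vv; apply: diff_of_estimate => e e0.
exact: (C1_estimate oV Cf Vv e0).
Qed.

Lemma C1_diff_mx m n V (f : plane -> 'M[R]_(m, n)) v : open V ->
  (forall k l, Ck 1 V (fun w => f w k l)) -> V v ->
  differentiable f v /\ forall w k l,
    'd f v w k l = w 0 0 * partial 0 (fun w => f w k l) v +
                   w 0 1 * partial 1 (fun w => f w k l) v.
Proof.
move=> oV Cf Vv.
have [|d E] := @diff_of_estimate _ f v
  (\matrix_(k, l) partial 0 (fun w => f w k l) v)
  (\matrix_(k, l) partial 1 (fun w => f w k l) v).
  move=> e e0.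
  have /choice[r hr] : forall kl : 'I_m * 'I_n, exists r : R, 0 < r /\
      forall w : plane, `|w| < r -> `|f (w + v) kl.1 kl.2 - f v kl.1 kl.2 -
        (w 0 0 * partial 0 (fun w => f w kl.1 kl.2) v +
         w 0 1 * partial 1 (fun w => f w kl.1 kl.2) v)| <= e * `|w|.
    by move=> [k l]; have [r r0 hr] := C1_estimate oV (Cf k l) Vv e0; exists r.
  exists (\big[Num.min/1]_kl r kl).
    by apply: lt_bigmin => // kl _; have [] := hr kl.
  move=> w wr; apply: mxnorm_le => [|k l]; first by rewrite mulr_ge0// ltW.
  rewrite !mxE; have [_ h] := hr (k, l); apply: h; apply: (lt_le_trans wr).
  exact: bigmin_le_cond.
by split; [exact: d|move=> w k l; rewrite E !mxE].
Qed.

Lemma chain_curve V f (u : R -> plane) (t : R) (du : plane) : open V -> Ck 1 V f ->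
  V (u t) -> is_derive t 1 u du ->
  is_derive t 1 (f \o u) (du 0 0 * partial 0 f (u t) + du 0 1 * partial 1 f (u t)).
Proof.
move=> oV Cf Vu [d <-]; have [df E] := C1_diff oV Cf Vu.
have d' : differentiable u t by apply/derivable1_diffP.
have d'' : differentiable (f \o u) t by apply: differentiable_comp.
split; first by apply/derivable1_diffP.
have -> : 'D_1 u t = 'd u t 1 by rewrite deriveE.
by rewrite deriveE// diff_comp//= E.
Qed.

(** Symmetry of second derivatives: both are limits of the same second
    difference. *)
Lemma schwarz V f v : open V -> Ck 2 V f -> V v ->
  partial 0 (partial 1 f) v = partial 1 (partial 0 f) v.
Proof.
move=> oV [_ h] Vv.
have df i u : V u -> derivable f u (ebase i) by have [+ _] := h i; exact.
have ddf i j u : V u -> derivable (partial i f) u (ebase j).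
  by move=> Vu; have [_ [_ h2]] := h i; have [+ _] := h2 j; exact.
have cdf i j : {for v, continuous (partial j (partial i f))}.
  by have [_ [_ h2]] := h i; have [_ [+ _]] := h2 j; exact.
apply/eqP; rewrite -subr_eq0 -normr_le0; apply/ler_addgt0Pr => e e0; rewrite add0r.
have [r r0 hr] : exists2 r : R, 0 < r & forall w, `|w - v| < r -> V w /\
  forall i j : 'I_2, `|partial j (partial i f) v - partial j (partial i f) w| <= e / 2.
  apply: near_ball_plane; near=> w; split; first by near: w; exact: open_nbhs_nbhs.
  near: w; apply: filter_forall => i.
  apply: filter_forall => j; have /cvgrPdist_le := cdf i j; apply.
  by rewrite divr_gt0.
pose k := r / 2; have k0 : 0 < k by rewrite divr_gt0.
have kr : k < r by rewrite /k; lra.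
have kk : `|k| = k by rewrite gtr0_norm.
have inr (x y : R) : `|x| <= `|k| -> `|y| <= `|k| ->
    `|v + x *: ebase 0 + y *: ebase 1 - v| < r.
  move=> hx hy; rewrite addrC !addrA addNr add0r (le_lt_trans _ kr)// -kk.
  by apply: norm_plane; rewrite // !mxE /= ?mulr1 ?mulr0 ?addr0 ?add0r.
have inr' (x y : R) : `|x| <= `|k| -> `|y| <= `|k| ->
    `|v + y *: ebase 1 + x *: ebase 0 - v| < r.
  by move=> hx hy; rewrite (addrAC v (y *: _)) inr.
have kle0 : `|0 : R| <= `|k| by rewrite normr0.
have kle : `|k| <= `|k| by [].
have in0 (x : R) : `|x| <= `|k| -> `|v + x *: ebase 0 - v| < r.
  by move=> hx; have := inr x 0 hx kle0; rewrite scale0r addr0.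
have in1 (x : R) : `|x| <= `|k| -> `|v + x *: ebase 1 - v| < r.
  by move=> hx; have := inr' 0 x kle0 hx; rewrite scale0r addr0.
have dpartial (g : plane -> R) (a : plane) i j u :
    derivable g u (ebase i) -> derivable g (u + a) (ebase i) ->
    derivable (fun w => g (w + a) - g w) u (ebase i) /\
    partial i (fun w => g (w + a) - g w) u = partial i g (u + a) - partial i g u.
  move=> d1 d2.
  have dg : is_derive u (ebase i) (fun w => g (w + a)) (partial i g (u + a)).
    have E : (fun h : R => h^-1 *: (((fun w => g (w + a)) \o shift u) (h *: ebase i) -
        g (u + a))) = (fun h : R => h^-1 *: ((g \o shift (u + a)) (h *: ebase i) -
        g (u + a))) by apply/funext => y /=; rewrite addrA.
    by split; [rewrite /derivable E|rewrite /derive E].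
  have := is_deriveB dg (derivableP d1).
  by move=> [? ?].
pose D := f (v + k *: ebase 0 + k *: ebase 1) - f (v + k *: ebase 0) -
  (f (v + k *: ebase 1) - f v).
have D01 : exists2 w, `|w - v| < r & D = k * (k * partial 1 (partial 0 f) w).
  pose g := fun w => f (w + k *: ebase 1) - f w.
  pose S := [set w | exists2 x : R, `|x| <= `|k| & w = v + x *: ebase 0].
  have Sd w : S w -> derivable g w (ebase 0) /\
      partial 0 g w = partial 0 f (w + k *: ebase 1) - partial 0 f w.
    move=> [x hx ->]; apply: dpartial; [exact: 0|apply: df..].
      exact: (hr _ (in0 _ hx)).1.
    exact: (hr _ (inr _ _ hx kle)).1.
  have [|x hx Ex] := @mvt_coord S g v 0 k _ (fun w Sw => (Sd w Sw).1).
    by move=> x hx; exists x.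
  have [|y hy Ey] := @mvt_coord V (partial 0 f) (v + x *: ebase 0) 1 k _ (ddf 0 1).
    by move=> y hy; exact: (hr _ (inr _ _ hx hy)).1.
  exists (v + x *: ebase 0 + y *: ebase 1); first exact: inr.
  by rewrite -Ey -(Sd _ _).2 -?Ex ?/D//; exists x.
have D10 : exists2 w, `|w - v| < r & D = k * (k * partial 0 (partial 1 f) w).
  pose g := fun w => f (w + k *: ebase 0) - f w.
  pose S := [set w | exists2 x : R, `|x| <= `|k| & w = v + x *: ebase 1].
  have Sd w : S w -> derivable g w (ebase 1) /\
      partial 1 g w = partial 1 f (w + k *: ebase 0) - partial 1 f w.
    move=> [x hx ->]; apply: dpartial; [exact: 0|apply: df..].
      exact: (hr _ (in1 _ hx)).1.
    exact: (hr _ (inr' _ _ kle hx)).1.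
  have [|x hx Ex] := @mvt_coord S g v 1 k _ (fun w Sw => (Sd w Sw).1).
    by move=> x hx; exists x.
  have [|y hy Ey] := @mvt_coord V (partial 1 f) (v + x *: ebase 1) 0 k _ (ddf 1 0).
    by move=> y hy; exact: (hr _ (inr' _ _ hy hx)).1.
  exists (v + x *: ebase 1 + y *: ebase 0); first exact: inr'.
  rewrite -Ey -(Sd _ _).2 -?Ex; last by exists x.
  by rewrite /D /g (addrAC v); ring.
have [w wr Ew] := D01; have [w' wr' Ew'] := D10.
have : partial 1 (partial 0 f) w = partial 0 (partial 1 f) w'.
  have k0' : k != 0 by rewrite gt_eqF.
  have E2 : k * (k * partial 1 (partial 0 f) w) = k * (k * partial 0 (partial 1 f) w').
    exact: etrans (esym Ew) Ew'.
  exact: (mulfI k0' (mulfI k0' E2)).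
move=> E; have h2 := (hr _ wr).2 0 1; rewrite E in h2.
exact: (norm_split ((hr _ wr').2 1 0) h2).
Unshelve. all: by end_near. Qed.

End Plane.

(** * Functions of class C^n on an open set *)

Section Smooth.
Context {R : realType}.
Local Notation plane := 'rV[R]_2.
Implicit Types (V : set plane) (f g : plane -> R) (v w : plane) (i j : 'I_2).

Lemma Ck_cts n V f v : Ck n V f -> V v -> {for v, continuous f}.
Proof. by case: n => [|n] [h _] Vv; exact: h. Qed.

Lemma Ck_der n V f v i : Ck n.+1 V f -> V v -> derivable f v (ebase i).
Proof. by move=> [_ /(_ i) [h _]] Vv; exact: h. Qed.

Lemma Ck_partial n V f i : Ck n.+1 V f -> Ck n V (partial i f).
Proof. by move=> [_ /(_ i) [_ h]]. Qed.

Lemma Ck_down n V f : Ck n.+1 V f -> Ck n V f.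
Proof.
elim: n f => [|n ih] f [h1 h2]; first by split.
by split=> // i; have [h3 h4] := h2 i; split => //; exact: ih.
Qed.

Lemma smooth_partial V f i : smooth V f -> smooth V (partial i f).
Proof. by move=> h n; exact: Ck_partial (h n.+1). Qed.

Lemma near_ext V f g v : open V -> (forall w, V w -> f w = g w) -> V v ->
  \near v, f v = g v.
Proof.
move=> oV fg Vv; have : nbhs v V by exact: open_nbhs_nbhs.
exact: filterS.
Qed.

Lemma derive_ext V f g v i : open V -> (forall w, V w -> f w = g w) -> V v ->
  derivable f v (ebase i) ->
  derivable g v (ebase i) /\ partial i g v = partial i f v.
Proof.
move=> oV fg Vv df; have nfg := near_ext oV fg Vv.
have [d e] := near_eq_is_derive nfg (derivableP df).
by split.
Qed.

Lemma near_cts f g v : (\near v, f v = g v) -> {for v, continuous f} ->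
  {for v, continuous g}.
Proof.
move=> nfg cf; have E := nbhs_singleton nfg.
rewrite /prop_for /continuous_at -E; apply: cvg_trans cf.
have FF : Filter (nbhs (v : plane)) by exact: nbhs_filter.
by apply: near_eq_cvg; apply: (@filterS _ _ FF _ _ _ nfg) => w.
Qed.

Lemma Ck_ext n V f g : open V -> (forall w, V w -> f w = g w) -> Ck n V f ->
  Ck n V g.
Proof.
move=> oV; elim: n f g => [|n ih] f g fg [h1 h2].
- by split=> // v Vv; apply: near_cts (near_ext oV fg Vv) (h1 v Vv).
- split=> [v Vv|i]; first exact: near_cts (near_ext oV fg Vv) (h1 v Vv).
  have [h3 h4] := h2 i; split=> [v Vv|].
    by have [] := derive_ext oV fg Vv (h3 v Vv).
  apply: ih h4 => w Vw.
  by have [_ ->] := derive_ext oV fg Vw (h3 w Vw).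
Qed.

Lemma Ck_subset n V W f : W `<=` V -> Ck n V f -> Ck n W f.
Proof.
move=> WV; elim: n f => [|n ih] f [h1 h2]; split=> //.
- by move=> w Ww; exact/h1/WV.
- by move=> w Ww; exact/h1/WV.
- move=> i; have [h3 h4] := h2 i; split; last exact: ih.
  by move=> w Ww; exact/h3/WV.
Qed.

Lemma Ck_cst n V (c : R) : Ck n V (fun=> c).
Proof.
have cc v : {for v, continuous (fun _ : plane => c)} by exact: cst_continuous.
elim: n c cc => [|n ih] c cc; split=> //.
- move=> i; split; first by move=> v _; exact: derivable_cst.
  rewrite (_ : partial i _ = fun=> 0) //.
    by apply: ih => v; exact: cst_continuous.
  by apply/funext => v; rewrite /partial derive_cst.
Qed.

Lemma partialD f g v i : derivable f v (ebase i) -> derivable g v (ebase i) ->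
  derivable (fun w => f w + g w) v (ebase i) /\
  partial i (fun w => f w + g w) v = partial i f v + partial i g v.
Proof.
by move=> df dg; have [d e] := is_deriveD (derivableP df) (derivableP dg).
Qed.

Lemma partialM f g v i : derivable f v (ebase i) -> derivable g v (ebase i) ->
  derivable (fun w => f w * g w) v (ebase i) /\
  partial i (fun w => f w * g w) v = partial i f v * g v + f v * partial i g v.
Proof.
move=> df dg; have [d e] := is_deriveM (derivableP df) (derivableP dg).
by split=> //; rewrite /partial e /GRing.scale/= addrC (mulrC (g v)).
Qed.

Lemma partialV f v i : derivable f v (ebase i) -> f v != 0 ->
  derivable (fun w => (f w)^-1) v (ebase i) /\
  partial i (fun w => (f w)^-1) v = - partial i f v * ((f v)^-1 * (f v)^-1).
Proof.
move=> df f0; split; first exact: derivableV.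
rewrite /partial deriveV// /GRing.scale/= !mulNr mulrC; congr (- (_ * _)).
by rewrite -exprVn expr2.
Qed.

Lemma Ck_add n V f g : open V -> Ck n V f -> Ck n V g ->
  Ck n V (fun w => f w + g w).
Proof.
move=> oV; elim: n f g => [|n ih] f g hf hg.
  by split=> // v Vv; exact: continuousD (Ck_cts hf Vv) (Ck_cts hg Vv).
split=> [v Vv|i].
  exact: continuousD (Ck_cts hf Vv) (Ck_cts hg Vv).
have D v : V v -> _ := fun Vv => partialD (Ck_der (i := i) hf Vv) (Ck_der (i := i) hg Vv).
split=> [v Vv|]; first by have [] := D v Vv.
apply: (Ck_ext oV _ (ih _ _ (Ck_partial i hf) (Ck_partial i hg))) => w Vw.
by have [_ ->] := D w Vw.
Qed.

Lemma Ck_mul n V f g : open V -> Ck n V f -> Ck n V g ->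
  Ck n V (fun w => f w * g w).
Proof.
move=> oV; elim: n f g => [|n ih] f g hf hg.
  by split=> // v Vv; exact: continuousM (Ck_cts hf Vv) (Ck_cts hg Vv).
split=> [v Vv|i].
  exact: continuousM (Ck_cts hf Vv) (Ck_cts hg Vv).
have D v : V v -> _ := fun Vv => partialM (Ck_der (i := i) hf Vv) (Ck_der (i := i) hg Vv).
split=> [v Vv|]; first by have [] := D v Vv.
apply: (Ck_ext oV _ (Ck_add oV (ih _ _ (Ck_partial i hf) (Ck_down hg))
  (ih _ _ (Ck_down hf) (Ck_partial i hg)))) => w Vw.
by have [_ ->] := D w Vw.
Qed.

Lemma Ck_opp n V f : open V -> Ck n V f -> Ck n V (fun w => - f w).
Proof.
move=> oV hf; apply: (Ck_ext oV _ (Ck_mul oV (Ck_cst n V (-1)) hf)) => w _.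
by rewrite mulN1r.
Qed.

Lemma Ck_inv n V f : open V -> (forall v, V v -> f v != 0) -> Ck n V f ->
  Ck n V (fun w => (f w)^-1).
Proof.
move=> oV f0; elim: n f f0 => [|n ih] f f0 hf.
  by split=> // v Vv; exact: continuousV (f0 v Vv) (Ck_cts hf Vv).
split=> [v Vv|i].
  exact: continuousV (f0 v Vv) (Ck_cts hf Vv).
have D v : V v -> _ := fun Vv => partialV (Ck_der (i := i) hf Vv) (f0 v Vv).
split=> [v Vv|]; first by have [] := D v Vv.
have h := ih _ f0 (Ck_down hf).
apply: (Ck_ext oV _ (Ck_mul oV (Ck_opp oV (Ck_partial i hf)) (Ck_mul oV h h))).
by move=> w Vw; have [_ ->] := D w Vw.
Qed.

End Smooth.

(** * The structure equations of a metric of curvature -1 *)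

Section Curvature.
Context {R : realType}.
Local Notation plane := 'rV[R]_2.

Lemma inv2 (M : 'M[R]_2) : let d := M 0 0 * M 1 1 - M 0 1 * M 1 0 in d != 0 ->
  [/\ invmx M 0 0 = M 1 1 * d^-1, invmx M 0 1 = - M 0 1 * d^-1,
      invmx M 1 0 = - M 1 0 * d^-1 & invmx M 1 1 = M 0 0 * d^-1].
Proof.
move=> d d0.
pose N : 'M[R]_2 := \matrix_(i, j) (if i == 0 then if j == 0 then M 1 1 * d^-1
  else - M 0 1 * d^-1 else if j == 0 then - M 1 0 * d^-1 else M 0 0 * d^-1).
have MN : M *m N = 1%:M.
  apply/matrixP => i j; rewrite !mxE sum2 !mxE /=.
  case: i => [[|[|//]] pi]; case: j => [[|[|//]] pj]; rewrite /=.
  - rewrite (_ : Ordinal pi = 0); last exact/val_inj.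
    by rewrite mulrA mulrA -mulrDl mulrN -/d divff.
  - rewrite (_ : Ordinal pi = 0); last exact/val_inj.
    by rewrite !mulrA -mulrDl mulrN mulrC (mulrC (M 0 0)) addNr mulr0.
  - rewrite (_ : Ordinal pi = 1); last exact/val_inj.
    by rewrite !mulrA -mulrDl mulrN (mulrC (M 1 1)) subrr mul0r.
  - rewrite (_ : Ordinal pi = 1); last exact/val_inj.
    by rewrite !mulrA -mulrDl mulrN (mulrC (M 1 1)) (mulrC (M 1 0)) addrC -/d divff.
have [uM _] := mulmx1_unit MN.
have -> : invmx M = N by rewrite -(mulKmx uM N) MN mulmx1.
by rewrite !mxE.
Qed.

(** The Gauss and Codazzi equations by algebra: [a, b, c] are the entries of the
    metric, [u, v, w] the Christoffel symbols; [du], [ev] are derivatives along the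
    second coordinate, [dv], [dw] along the first. Equality of the mixed second
    derivatives [a01], [b01], [c01] makes the curvature vector [(K0, K1)]
    orthogonal to the second basis vector, and its product with the first one is
    prescribed. *)
Lemma gauss_algebra (a b c u0 u1 v0 v1 w0 w1 a0 a1 b0 b1 c0 c1 du0 du1 dv0 dv1
    ev0 ev1 dw0 dw1 a01 a11 b01 c00 c01 : R) :
  let D := a * c - b * b in D != 0 ->
  a0 = 2 * (u0 * a + u1 * b) -> a1 = 2 * (v0 * a + v1 * b) ->
  b0 = u0 * b + u1 * c + (v0 * a + v1 * b) ->
  b1 = v0 * b + v1 * c + (w0 * a + w1 * b) ->
  c0 = 2 * (v0 * b + v1 * c) -> c1 = 2 * (w0 * b + w1 * c) ->
  du0 * a + du1 * b + (u0 * a1 + u1 * b1) = 2^-1 * a01 ->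
  du0 * b + du1 * c + (u0 * b1 + u1 * c1) = b01 - 2^-1 * a11 ->
  dv0 * a + dv1 * b + (v0 * a0 + v1 * b0) = 2^-1 * a01 ->
  dv0 * b + dv1 * c + (v0 * b0 + v1 * c0) = 2^-1 * c00 ->
  ev0 * a + ev1 * b + (v0 * a1 + v1 * b1) = 2^-1 * a11 ->
  ev0 * b + ev1 * c + (v0 * b1 + v1 * c1) = 2^-1 * c01 ->
  dw0 * a + dw1 * b + (w0 * a0 + w1 * b0) = b01 - 2^-1 * c00 ->
  dw0 * b + dw1 * c + (w0 * b0 + w1 * c0) = 2^-1 * c01 ->
  let K0 := dw0 - ev0 + (w0 * u0 + w1 * v0 - (v0 * v0 + v1 * w0)) in
  let K1 := dw1 - ev1 + (w0 * u1 + w1 * v1 - (v0 * v1 + v1 * w1)) in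
  a * K0 + b * K1 = - D ->
  [/\ K0 = - c, K1 = b,
      du0 + (u0 * v0 + u1 * w0) = dv0 + (v0 * u0 + v1 * v0) + b &
      du1 + (u0 * v1 + u1 * w1) + a = dv1 + (v0 * u1 + v1 * v1)].
Proof.
move=> D D0 -> -> -> -> -> -> h1 h2 h3 h4 h5 h6 h7 h8 K0 K1 hK.
have solve x y p q : a * x + b * y = p -> b * x + c * y = q ->
    D * x = c * p - b * q /\ D * y = a * q - b * p.
  by move=> <- <-; rewrite /D; split; ring.
have hK' : b * K0 + c * K1 = 0 by rewrite /K0 /K1; lra.
pose W0 := dv0 - du0 + (v0 * u0 + v1 * v0 - (u0 * v0 + u1 * w0)).
pose W1 := dv1 - du1 + (v0 * u1 + v1 * v1 - (u0 * v1 + u1 * w1)).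
have hW : a * W0 + b * W1 = 0 by rewrite /W0 /W1; lra.
have hW' : b * W0 + c * W1 = D by rewrite -[D]opprK -hK /W0 /W1 /K0 /K1; lra.
have [e1 e2] := solve _ _ _ _ hK hK'.
have [e3 e4] := solve _ _ _ _ hW hW'.
have E1 : K0 = - c by apply: (mulfI D0); rewrite e1; ring.
have E2 : K1 = b by apply: (mulfI D0); rewrite e2; ring.
have E3 : W0 = - b by apply: (mulfI D0); rewrite e3; ring.
have E4 : W1 = a by apply: (mulfI D0); rewrite e4; ring.
by split=> //; [move: E3; rewrite /W0; lra|move: E4; rewrite /W1; lra].
Qed.

End Curvature.

Notation i0 := (@Ordinal 3 0 isT).
Notation i1 := (@Ordinal 3 1 isT).
Notation i2 := (@Ordinal 3 2 isT).

Section Structure.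
Context {R : realType}.
Local Notation plane := 'rV[R]_2.

Definition hyperbolic_metric (V : set plane) (G : plane -> 'M[R]_2) : Prop :=
  [/\ open V, forall i j, smooth V (fun v => G v i j),
      forall v, V v -> (G v)^T = G v,
      forall v, V v -> forall w, w != 0 -> 0 < qform (G v) w &
      forall v, V v -> gauss_curvature G v = -1].

Lemma qformE (M : 'M[R]_2) (w : plane) : qform M w =
  w 0 0 * w 0 0 * M 0 0 + w 0 0 * w 0 1 * (M 0 1 + M 1 0) + w 0 1 * w 0 1 * M 1 1.
Proof. by rewrite /qform mxE sum2 !mxE !sum2; ring. Qed.

Lemma linear_relation_partial (V : set plane) (p q f g F H : plane -> R) (x y : R)
    k v : open V -> smooth V p -> smooth V q -> smooth V f -> smooth V g ->
  smooth V F -> smooth V H ->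
  (forall v, V v -> p v * f v + q v * g v = x * F v + y * H v) -> V v ->
  partial k f v * p v + partial k g v * q v + (f v * partial k p v + g v * partial k q v)
    = x * partial k F v + y * partial k H v.
Proof.
move=> oV sp sq sf sg sF sH E Vv.
have d (h : plane -> R) : smooth V h -> derivable h v (ebase k).
  by move=> sh; exact: Ck_der (sh 1%N) Vv.
have [d1 e1] := partialM (d _ sp) (d _ sf).
have [d2 e2] := partialM (d _ sq) (d _ sg).
have [d3 e3] := partialD d1 d2.
have [d4 e4] := partialM (derivable_cst x v (ebase k)) (d _ sF).
have [d5 e5] := partialM (derivable_cst y v (ebase k)) (d _ sH).
have [d6 e6] := partialD d4 d5.
have [_] := derive_ext oV E Vv d3.
rewrite e3 e6 e1 e2 e4 e5 /partial !derive_cst !mul0r !add0r => ->.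
ring.
Qed.

Lemma det2 (M : 'M[R]_2) : \det M = M 0 0 * M 1 1 - M 0 1 * M 1 0.
Proof.
rewrite (expand_det_row _ 0) sum2 /cofactor !det_mx11 !mxE /=.
rewrite (_ : lift 0 0 = 1); last exact/val_inj.
rewrite (_ : lift 1 0 = 0); last exact/val_inj.
by rewrite expr0 expr1 mul1r mulN1r mulrN.
Qed.

(** The next identities are stated on variables so that normalization does not
    look into the partial derivatives for which they are instantiated. *)
Lemma half_sum1 (x y : R) : 2^-1 * (x + x - x) = 2^-1 * x + 0 * y.
Proof. by ring. Qed.

Lemma half_sum2 (x y : R) : 2^-1 * (x + x - y) = 1 * x + - 2^-1 * y.
Proof. by field. Qed.

Lemma half_sum3 (x y z : R) : 2^-1 * (y + x - y) = 2^-1 * x + 0 * z.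
Proof. by ring. Qed.

Lemma half_sum4 (x y z : R) : 2^-1 * (x + y - y) = 2^-1 * x + 0 * z.
Proof. by ring. Qed.

Lemma drop_zero (A x y z : R) : A = z * x + 0 * y -> A = z * x.
Proof. by move=> ->; ring. Qed.

Lemma drop_one (A x y z : R) : A = 1 * x + - z * y -> A = x - z * y.
Proof. by move=> ->; ring. Qed.

Lemma regroup (X Y a b c d : R) :
  X - Y + (a + c - (b + d)) = X - Y + (a - b + (c - d)).
Proof. by ring. Qed.

Lemma isolate1 (X Y A B c : R) : X - Y + (A - B) = - c -> X + A + c = Y + B.
Proof. by move=> h; lra. Qed.

Lemma isolate2 (X Y A B b : R) : X - Y + (A - B) = b -> X + A = Y + B + b.
Proof. by move=> h; lra. Qed.

Lemma flat_entry1 (X Y P Q a b : R) : X + Y = P + Q + b ->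
  X + (Y + a * 0) = P + (Q + b * 1).
Proof. by rewrite mulr0 mulr1 addr0 addrA. Qed.

Lemma flat_entry2 (X Y P Q a b : R) : X + Y + a = P + Q ->
  X + (Y + a * 1) = P + (Q + b * 0).
Proof. by rewrite mulr0 mulr1 addr0 addrA. Qed.

Lemma flat_entry3 (a b c u0 u1 v0 v1 : R) : 2 * (v0 * a + v1 * b) +
  (u0 * b + u1 * c + a * 0) =
  u0 * b + u1 * c + (v0 * a + v1 * b) + (v0 * a + v1 * b + b * 0).
Proof. by ring. Qed.

Lemma flat_entry4 (a b c w0 w1 v0 v1 : R) : v0 * b + v1 * c + (w0 * a + w1 * b) +
  (v0 * b + v1 * c + b * 0) =
  2 * (v0 * b + v1 * c) + (w0 * a + w1 * b + c * 0).
Proof. by ring. Qed.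

Lemma lower_algebra (a b c u0 u1 v0 v1 w0 w1 a0 a1 b0 b1 c0 c1 : R) :
  a * u0 + b * u1 = 2^-1 * (a0 + a0 - a0) /\ b * u0 + c * u1 = 2^-1 * (b0 + b0 - a1) ->
  a * v0 + b * v1 = 2^-1 * (b0 + a1 - b0) /\ b * v0 + c * v1 = 2^-1 * (c0 + b1 - b1) ->
  a * w0 + b * w1 = 2^-1 * (b1 + b1 - c0) /\ b * w0 + c * w1 = 2^-1 * (c1 + c1 - c1) ->
  [/\ a0 = 2 * (u0 * a + u1 * b), a1 = 2 * (v0 * a + v1 * b),
      b0 = u0 * b + u1 * c + (v0 * a + v1 * b),
      b1 = v0 * b + v1 * c + (w0 * a + w1 * b) &
      c0 = 2 * (v0 * b + v1 * c) /\ c1 = 2 * (w0 * b + w1 * c)].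
Proof.
by move=> [h1 h2] [h3 h4] [h5 h6]; split; [lra|lra|lra|lra|split; lra].
Qed.

Section WithMetric.
Variables (V : set plane) (G : plane -> 'M[R]_2).
Hypothesis hG : hyperbolic_metric V G.

Let oV : open V. Proof. by case: hG. Qed.
Let sG i j : smooth V (fun v => G v i j). Proof. by case: hG. Qed.

Lemma metric_symm v : V v -> G v 1 0 = G v 0 1.
Proof. by case: hG => _ _ h _ _ /h /matrixP /(_ 0 1); rewrite mxE. Qed.

Lemma metric_pos v : V v -> 0 < G v 0 0.
Proof.
case: hG => _ _ _ h _ Vv.
have /(h v Vv) : ebase 0 != 0 :> plane.
  by apply/eqP => /matrixP /(_ 0 0) /eqP; rewrite ebaseE eqxx mxE oner_eq0.
by rewrite qformE !ebaseE /= !mulr0 !mul0r !mul1r !addr0.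
Qed.

Lemma metric_det_pos v : V v -> 0 < G v 0 0 * G v 1 1 - G v 0 1 * G v 0 1.
Proof.
move=> Vv; have a0 := metric_pos Vv; case: hG => _ _ _ h _.
pose w : plane := - G v 0 1 *: ebase 0 + G v 0 0 *: ebase 1.
have w0 : w 0 0 = - G v 0 1 by rewrite !mxE /= mulr1 mulr0 addr0.
have w1 : w 0 1 = G v 0 0 by rewrite !mxE /= mulr1 mulr0 add0r.
have /(h v Vv) : w != 0.
  apply/eqP => /matrixP /(_ 0 1) /eqP; rewrite w1 mxE gt_eqF//.
rewrite qformE w0 w1 metric_symm// => h'.
rewrite -(pmulr_rgt0 _ a0); move: h'; congr (0 < _); ring.
Qed.

Lemma metric_det_neq0 v : V v -> G v 0 0 * G v 1 1 - G v 0 1 * G v 1 0 != 0.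
Proof. by move=> Vv; rewrite metric_symm// gt_eqF// metric_det_pos. Qed.

Lemma smooth_inverse k l : smooth V (fun v => invmx (G v) k l).
Proof.
move=> n; have id : Ck n V (fun v => (G v 0 0 * G v 1 1 - G v 0 1 * G v 1 0)^-1).
  apply: Ck_inv => //; first exact: metric_det_neq0.
  apply: Ck_add => //; first by apply: Ck_mul => //; exact: sG.
  by apply: Ck_opp => //; apply: Ck_mul => //; exact: sG.
have C (M : plane -> R) : Ck n V M ->
    (forall v, V v -> M v * (G v 0 0 * G v 1 1 - G v 0 1 * G v 1 0)^-1 = invmx (G v) k l) ->
    Ck n V (fun v => invmx (G v) k l).
  by move=> sM E; apply: (Ck_ext oV E); exact: Ck_mul.
have I2 v : V v -> _ := fun Vv => inv2 (metric_det_neq0 Vv).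
have [k0|k1] : k = 0 \/ k = 1.
  by case: k {C} => [[|[|//]] p]; [left|right]; exact/val_inj.
- have [l0|l1] : l = 0 \/ l = 1.
    by case: l {C} => [[|[|//]] p]; [left|right]; exact/val_inj.
  + apply: (C (fun v => G v 1 1)); first exact: sG.
    by move=> v /I2 [<- _ _ _]; rewrite k0 l0.
  + apply: (C (fun v => - G v 0 1)); first by apply: Ck_opp => //; exact: sG.
    by move=> v /I2 [_ <- _ _]; rewrite k0 l1.
- have [l0|l1] : l = 0 \/ l = 1.
    by case: l {C} => [[|[|//]] p]; [left|right]; exact/val_inj.
  + apply: (C (fun v => - G v 1 0)); first by apply: Ck_opp => //; exact: sG.
    by move=> v /I2 [_ _ <- _]; rewrite k1 l0.
  + apply: (C (fun v => G v 0 0)); first exact: sG.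
    by move=> v /I2 [_ _ _ <-]; rewrite k1 l1.
Qed.

Definition koszul (n i j : 'I_2) (v : plane) : R :=
  partial i (fun x => G x j n) v + partial j (fun x => G x i n) v
  - partial n (fun x => G x i j) v.

Lemma christoffelE k i j v : christoffel G k i j v =
  2^-1 * (invmx (G v) k 0 * koszul 0 i j v + invmx (G v) k 1 * koszul 1 i j v).
Proof. by rewrite /christoffel sum2. Qed.

Lemma smooth_koszul n i j : smooth V (koszul n i j).
Proof.
move=> m; apply: Ck_add => //; last first.
  by apply: Ck_opp => //; apply: smooth_partial; exact: sG.
by apply: Ck_add => //; apply: smooth_partial; exact: sG.
Qed.

Lemma smooth_christoffel k i j : smooth V (christoffel G k i j).
Proof.
move=> n; apply: (Ck_ext oV (fun v _ => esym (christoffelE k i j v))).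
apply: Ck_mul => //; first exact: Ck_cst.
apply: Ck_add => //; apply: Ck_mul => //;
  by [exact: smooth_inverse|exact: smooth_koszul].
Qed.

Lemma partial_sym i v : V v ->
  partial i (fun x => G x 1 0) v = partial i (fun x => G x 0 1) v.
Proof.
move=> Vv; have E w : V w -> G w 0 1 = G w 1 0 by move=> Vw; rewrite metric_symm.
by have [] := derive_ext oV E Vv (Ck_der (i := i) (sG 0 1 1%N) Vv).
Qed.

Lemma koszul_sym n v : V v -> koszul n 1 0 v = koszul n 0 1 v.
Proof. by move=> Vv; rewrite /koszul partial_sym// (addrC (partial 1 _ v)). Qed.

Lemma christoffel_sym k v : V v -> christoffel G k 1 0 v = christoffel G k 0 1 v.
Proof. by move=> Vv; rewrite !christoffelE !koszul_sym. Qed.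

Lemma christoffel_lower i j v : V v ->
  G v 0 0 * christoffel G 0 i j v + G v 0 1 * christoffel G 1 i j v =
    2^-1 * koszul 0 i j v /\
  G v 0 1 * christoffel G 0 i j v + G v 1 1 * christoffel G 1 i j v =
    2^-1 * koszul 1 i j v.
Proof.
move=> Vv; rewrite !christoffelE.
have D0 := metric_det_neq0 Vv; have [-> -> -> ->] := inv2 D0.
rewrite metric_symm// in D0 *; move: D0.
move: (koszul 0 i j v) (koszul 1 i j v) (G v 0 0) (G v 0 1) (G v 1 1) => x y a b c D0.
by split; field.
Qed.

Lemma christoffel_first v : V v ->
  let a := G v 0 0 in let b := G v 0 1 in let c := G v 1 1 in
  let C := fun k i j => christoffel G k i j v in
  [/\ partial 0 (fun x => G x 0 0) v = 2 * (C 0 0 0 * a + C 1 0 0 * b),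
      partial 1 (fun x => G x 0 0) v = 2 * (C 0 0 1 * a + C 1 0 1 * b),
      partial 0 (fun x => G x 0 1) v =
        C 0 0 0 * b + C 1 0 0 * c + (C 0 0 1 * a + C 1 0 1 * b),
      partial 1 (fun x => G x 0 1) v =
        C 0 0 1 * b + C 1 0 1 * c + (C 0 1 1 * a + C 1 1 1 * b) &
      partial 0 (fun x => G x 1 1) v = 2 * (C 0 0 1 * b + C 1 0 1 * c) /\
      partial 1 (fun x => G x 1 1) v = 2 * (C 0 1 1 * b + C 1 1 1 * c)].
Proof.
move=> Vv a b c C.
have := christoffel_lower 0 0 Vv; have := christoffel_lower 0 1 Vv.
have := christoffel_lower 1 1 Vv; rewrite /koszul !partial_sym// => h3 h2 h1.
exact: (lower_algebra h1 h2 h3).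
Qed.

Lemma structure_identities v : V v ->
  let a := G v 0 0 in let b := G v 0 1 in let c := G v 1 1 in
  let C := fun k i j => christoffel G k i j v in
  let dC := fun l k i j => partial l (christoffel G k i j) v in
  [/\ dC 0 0 1 1 + (C 0 1 1 * C 0 0 0 + C 1 1 1 * C 0 0 1) + c =
        dC 1 0 0 1 + (C 0 0 1 * C 0 0 1 + C 1 0 1 * C 0 1 1),
      dC 0 1 1 1 + (C 0 1 1 * C 1 0 0 + C 1 1 1 * C 1 0 1) =
        dC 1 1 0 1 + (C 0 0 1 * C 1 0 1 + C 1 0 1 * C 1 1 1) + b,
      dC 1 0 0 0 + (C 0 0 0 * C 0 0 1 + C 1 0 0 * C 0 1 1) =
        dC 0 0 0 1 + (C 0 0 1 * C 0 0 0 + C 1 0 1 * C 0 0 1) + b &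
      dC 1 1 0 0 + (C 0 0 0 * C 1 0 1 + C 1 0 0 * C 1 1 1) + a =
        dC 0 1 0 1 + (C 0 0 1 * C 1 0 0 + C 1 0 1 * C 1 0 1)].
Proof.
move=> Vv a b c C dC.
have [p1 p2 p3 p4 [p5 p6]] := christoffel_first Vv.
have sC k i j := smooth_christoffel k i j.
have sP i j k : smooth V (partial k (fun x => G x i j)).
  by apply: smooth_partial; exact: sG.
have lin := fun (p q f g F H : plane -> R) x y k sp sq sf sg sF sH E =>
  @linear_relation_partial V p q f g F H x y k v oV sp sq sf sg sF sH E Vv.
have D0 : a * c - b * b != 0 by rewrite gt_eqF// metric_det_pos.
have low i j w (Vw : V w) := christoffel_lower i j Vw.
have h1 := lin _ _ _ _ _ _ 2^-1 0 1 (sG 0 0) (sG 0 1) (sC 0 0 0) (sC 1 0 0)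
  (sP 0 0 0) (sP 0 0 0).
have {}h1 := h1 (fun w Vw => etrans (low 0 0 w Vw).1 (half_sum1 _ _)).
have h2 := lin _ _ _ _ _ _ 1 (- 2^-1) 1 (sG 0 1) (sG 1 1) (sC 0 0 0) (sC 1 0 0)
  (sP 0 1 0) (sP 0 0 1).
have {}h2 := h2 (fun w Vw => etrans (low 0 0 w Vw).2 (half_sum2 _ _)).
have k001 w (Vw : V w) : 2^-1 * koszul 0 0 1 w =
    2^-1 * partial 1 (fun x => G x 0 0) w + 0 * partial 1 (fun x => G x 0 0) w.
  by rewrite /koszul !partial_sym//; exact: half_sum3.
have k101 w (Vw : V w) : 2^-1 * koszul 1 0 1 w =
    2^-1 * partial 0 (fun x => G x 1 1) w + 0 * partial 0 (fun x => G x 1 1) w.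
  by rewrite /koszul; exact: half_sum4.
have k011 w (Vw : V w) : 2^-1 * koszul 0 1 1 w =
    1 * partial 1 (fun x => G x 0 1) w + - 2^-1 * partial 0 (fun x => G x 1 1) w.
  by rewrite /koszul !partial_sym// half_sum2.
have h3 := lin _ _ _ _ _ _ 2^-1 0 0 (sG 0 0) (sG 0 1) (sC 0 0 1) (sC 1 0 1)
  (sP 0 0 1) (sP 0 0 1).
have {}h3 := h3 (fun w Vw => etrans (low 0 1 w Vw).1 (k001 w Vw)).
have h4 := lin _ _ _ _ _ _ 2^-1 0 0 (sG 0 1) (sG 1 1) (sC 0 0 1) (sC 1 0 1)
  (sP 1 1 0) (sP 1 1 0).
have {}h4 := h4 (fun w Vw => etrans (low 0 1 w Vw).2 (k101 w Vw)).
have h5 := lin _ _ _ _ _ _ 2^-1 0 1 (sG 0 0) (sG 0 1) (sC 0 0 1) (sC 1 0 1)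
  (sP 0 0 1) (sP 0 0 1).
have {}h5 := h5 (fun w Vw => etrans (low 0 1 w Vw).1 (k001 w Vw)).
have h6 := lin _ _ _ _ _ _ 2^-1 0 1 (sG 0 1) (sG 1 1) (sC 0 0 1) (sC 1 0 1)
  (sP 1 1 0) (sP 1 1 0).
have {}h6 := h6 (fun w Vw => etrans (low 0 1 w Vw).2 (k101 w Vw)).
have h7 := lin _ _ _ _ _ _ 1 (- 2^-1) 0 (sG 0 0) (sG 0 1) (sC 0 1 1) (sC 1 1 1)
  (sP 0 1 1) (sP 1 1 0).
have {}h7 := h7 (fun w Vw => etrans (low 1 1 w Vw).1 (k011 w Vw)).
have h8 := lin _ _ _ _ _ _ 2^-1 0 0 (sG 0 1) (sG 1 1) (sC 0 1 1) (sC 1 1 1)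
  (sP 1 1 1) (sP 1 1 1).
have {}h8 := h8 (fun w Vw => etrans (low 1 1 w Vw).2 (half_sum1 _ _)).
have sch (f : plane -> R) (sf : smooth V f) := schwarz oV (sf 2%N) Vv.
rewrite sch// in h3; rewrite sch// in h7; rewrite sch// in h8.
have := gauss_algebra D0 p1 p2 p3 p4 p5 p6 (drop_zero h1) (drop_one h2)
  (drop_zero h3) (drop_zero h4) (drop_zero h5) (drop_zero h6) (drop_one h7)
  (drop_zero h8).
have cK : a * (dC 0 0 1 1 - dC 1 0 0 1 +
      (C 0 1 1 * C 0 0 0 + C 1 1 1 * C 0 0 1 - (C 0 0 1 * C 0 0 1 + C 1 0 1 * C 0 1 1))) +
    b * (dC 0 1 1 1 - dC 1 1 0 1 +
      (C 0 1 1 * C 1 0 0 + C 1 1 1 * C 1 0 1 - (C 0 0 1 * C 1 0 1 + C 1 0 1 * C 1 1 1)))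
    = - (a * c - b * b).
  case: hG => _ _ _ _ /(_ v Vv); rewrite /gauss_curvature det2 metric_symm//.
  rewrite -/a -/b -/c => /(canRL (divfK D0)); rewrite mulN1r => <-.
  rewrite sum2 /curvature_vector !sum2 -/a -/b !christoffel_sym//.
  by congr (a * _ + b * _); exact: regroup.
move=> /(_ cK) [e1 e2 e3 e4]; split.
- exact: (isolate1 e1).
- exact: (isolate2 e2).
- exact: e3.
- exact: e4.
Qed.

Definition o2 (k : 'I_3) : 'I_2 := if k == 0 :> nat then 0 else 1.

(** The system satisfied by the rows [dF/dx, dF/dy, F] of an isometric map [F]
    into the hyperboloid, by the Gauss formula. *)
Definition gauss_form (i : 'I_2) (v : plane) : 'M[R]_3 :=
  \matrix_(j, m) if (j < 2)%N
    then if (m < 2)%N then christoffel G (o2 m) i (o2 j) v else G v i (o2 j)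
    else if (m < 2)%N then (o2 m == i)%:R else 0.

(** The Minkowski products of the rows [dF/dx, dF/dy, F]. *)
Definition gram (v : plane) : 'M[R]_3 :=
  \matrix_(j, m) if (j < 2)%N then if (m < 2)%N then G v (o2 j) (o2 m) else 0
    else if (m < 2)%N then 0 else -1.

Lemma sum3 (T : nmodType) (F : 'I_3 -> T) : \sum_(i < 3) F i = F i0 + F i1 + F i2.
Proof.
rewrite !big_ord_recl big_ord0 addr0 addrA.
by congr (F _ + F _ + F _); exact/val_inj.
Qed.

Lemma ord3P (P : 'I_3 -> Prop) : P i0 -> P i1 -> P i2 -> forall i, P i.
Proof.
by move=> h0 h1 h2 [[|[|[|//]]] p];
  [rewrite (_ : Ordinal p = i0)|rewrite (_ : Ordinal p = i1)|
   rewrite (_ : Ordinal p = i2)] => //; exact/val_inj.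
Qed.

Lemma smooth_gauss_form i j m : smooth V (fun v => gauss_form i v j m).
Proof.
move=> n.
pose F v := if (j < 2)%N
    then if (m < 2)%N then christoffel G (o2 m) i (o2 j) v else G v i (o2 j)
    else if (m < 2)%N then (o2 m == i)%:R else 0 : R.
have : Ck n V F.
  rewrite /F; case: (j < 2)%N; case: (m < 2)%N.
  - exact: smooth_christoffel.
  - exact: sG.
  - exact: Ck_cst.
  - exact: Ck_cst.
by apply: Ck_ext => // v _; rewrite mxE.
Qed.

Lemma gauss_formE i v :
  ((gauss_form i v i0 i0 = christoffel G 0 i 0 v) *
   (gauss_form i v i0 i1 = christoffel G 1 i 0 v) *
   (gauss_form i v i0 i2 = G v i 0) *
   (gauss_form i v i1 i0 = christoffel G 0 i 1 v) *
   (gauss_form i v i1 i1 = christoffel G 1 i 1 v) *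
   (gauss_form i v i1 i2 = G v i 1) *
   (gauss_form i v i2 i0 = (0 == i)%:R) *
   (gauss_form i v i2 i1 = (1 == i)%:R) *
   (gauss_form i v i2 i2 = 0))%type.
Proof. by do !split; rewrite mxE. Qed.

Lemma mulmx33 m n (A : 'M[R]_(m, 3)) (B : 'M[R]_(3, n)) j k : (A *m B) j k =
  A j i0 * B i0 k + A j i1 * B i1 k + A j i2 * B i2 k.
Proof. by rewrite mxE sum3. Qed.

(** The integrability condition of the system, which is where the curvature
    enters. *)
Lemma flatness v : V v ->
  (\matrix_(j, m) partial 1 (fun w => gauss_form 0 w j m) v) +
    gauss_form 0 v *m gauss_form 1 v =
  (\matrix_(j, m) partial 0 (fun w => gauss_form 1 w j m) v) +
    gauss_form 1 v *m gauss_form 0 v.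
Proof.
move=> Vv; have [e1 e2 e3 e4] := structure_identities Vv.
have [p1 p2 p3 p4 [p5 p6]] := christoffel_first Vv.
have pE i k j m : partial i (fun w => gauss_form k w j m) v =
    if (j < 2)%N
    then if (m < 2)%N then partial i (christoffel G (o2 m) k (o2 j)) v
      else partial i (fun w => G w k (o2 j)) v
    else 0.
  transitivity (partial i (fun w => if (j < 2)%N
    then if (m < 2)%N then christoffel G (o2 m) k (o2 j) w else G w k (o2 j)
    else if (m < 2)%N then (o2 m == k)%:R else 0 : R) v).
    by congr (partial i _ v); apply/funext => w; rewrite mxE.
  case: ifP => _; case: ifP => _ //; exact: derive_cst.
have cs k l w : V w -> _ := fun Vw => christoffel_sym k Vw.
have dcs i k : partial i (christoffel G k 1 0) v = partial i (christoffel G k 0 1) v.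
  have E w (Vw : V w) : christoffel G k 0 1 w = christoffel G k 1 0 w.
    by rewrite christoffel_sym.
  by have [] := derive_ext oV E Vv (Ck_der (i := i) (smooth_christoffel k 0 1 1%N) Vv).
apply/matrixP => j m; rewrite [LHS]mxE [RHS]mxE !mulmx33.
rewrite [X in X + _ = _]mxE [X in _ = X + _]mxE !pE {pE}.
move: j m; elim/ord3P; elim/ord3P; rewrite !gauss_formE /o2 /=.
- by rewrite metric_symm// dcs !christoffel_sym//; apply: flat_entry1; exact: e3.
- by rewrite dcs !christoffel_sym//; apply: flat_entry2; exact: e4.
- by rewrite metric_symm// partial_sym// p2 p3 !christoffel_sym//; exact: flat_entry3.
- by rewrite !christoffel_sym//; apply/esym/flat_entry2; exact: e1.
- by rewrite !christoffel_sym//; apply/esym/flat_entry1; exact: e2.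
- by rewrite metric_symm// p4 p5; exact: flat_entry4.
- by rewrite !(mul1r, mul0r, add0r, addr0) christoffel_sym.
- by rewrite !(mul1r, mul0r, add0r, addr0) christoffel_sym.
- by rewrite !(mul1r, mul0r, add0r, addr0) metric_symm.
Qed.

(** The metric is parallel. *)
Lemma gram_partial k v : V v ->
  (forall j m, derivable (fun w => gram w j m) v (ebase k)) /\
  \matrix_(j, m) partial k (fun w => gram w j m) v =
    gauss_form k v *m gram v + gram v *m (gauss_form k v)^T.
Proof.
move=> Vv.
have gE w : ((gram w i0 i0 = G w 0 0) * (gram w i0 i1 = G w 0 1) *
  (gram w i0 i2 = 0) * (gram w i1 i0 = G w 1 0) * (gram w i1 i1 = G w 1 1) *
  (gram w i1 i2 = 0) * (gram w i2 i0 = 0) * (gram w i2 i1 = 0) *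
  (gram w i2 i2 = -1))%type by do !split; rewrite mxE.
have d : forall j m, derivable (fun w => gram w j m) v (ebase k).
  have d2 i j : derivable (fun w => G w i j) v (ebase k) by exact: Ck_der (sG i j 1%N) Vv.
  have d0 (c : R) : derivable (fun _ : plane => c) v (ebase k) by exact: derivable_cst.
  have rw (F H : plane -> R) : F = H -> derivable H v (ebase k) -> derivable F v (ebase k).
    by move=> ->.
  by elim/ord3P; elim/ord3P; (apply: rw; first by apply/funext => w; rewrite gE).
split=> //; have [p1 p2 p3 p4 [p5 p6]] := christoffel_first Vv.
have pc (c : R) : partial k (fun _ : plane => c) v = 0 by exact: derive_cst.
have P (j m : 'I_3) : partial k (fun w => gram w j m) v =
    if (j < 2)%N then if (m < 2)%N then partial k (fun w => G w (o2 j) (o2 m)) v else 0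
    else 0.
  transitivity (partial k (fun w => if (j < 2)%N then if (m < 2)%N
    then G w (o2 j) (o2 m) else 0 else if (m < 2)%N then 0 else -1) v).
    by congr (partial k _ v); apply/funext => w; rewrite mxE.
  by case: ifP => _; case: ifP => _ //; exact: pc.
have tr (j m : 'I_3) : (gauss_form k v)^T j m = gauss_form k v m j by rewrite mxE.
have [k0|k1] : k = 0 \/ k = 1.
  by case: (k) => [[|[|//]] p]; [left|right]; exact/val_inj.
- rewrite k0 in P tr *.
  apply/matrixP => j m; rewrite [LHS]mxE [RHS]mxE !mulmx33 !tr.
  move: j m; elim/ord3P; elim/ord3P; rewrite P !gE
    !gauss_formE /o2 /= ?partial_sym// ?metric_symm// ?christoffel_sym// ?p1 ?p3 ?p5; ring.
- rewrite k1 in P tr *.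
  apply/matrixP => j m; rewrite [LHS]mxE [RHS]mxE !mulmx33 !tr.
  move: j m; elim/ord3P; elim/ord3P; rewrite P !gE
    !gauss_formE /o2 /= ?partial_sym// ?metric_symm// ?christoffel_sym// ?p2 ?p4 ?p6; ring.
Qed.

End WithMetric.
End Structure.

(** * Local isometries into the hyperboloid *)

Section LocalIsometry.
Context {R : realType}.
Local Notation plane := 'rV[R]_2.

(** At the maximum of the norm, the mean value inequality bounds it by half of
    itself. *)
Lemma ode_unique m n (f df : R -> 'M[R]_(m, n)) (c d k x0 x : R) :
  0 <= k -> k * (d - c) <= 2^-1 -> c <= x0 <= d ->
  (forall x : R, c < x < d -> is_derive x 1 f (df x)) ->
  {within `[c, d], continuous f} ->
  (forall x : R, c < x < d -> `|df x| <= k * `|f x|) ->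
  f x0 = 0 -> c <= x <= d -> f x = 0.
Proof.
move=> k0 kcd x0I fd fc dk f0 xI; have cd : c <= d by case/andP: xI => /le_trans; apply.
have [|p pI pmax] := @EVT_max R (fun t => `|f t|) c d cd.
  by move=> t; apply: cvg_norm; exact: fc.
rewrite in_itv/= in pI.
have M0 : 0 <= k * `|f p| by rewrite mulr_ge0.
have h1 : `|f p - f x0| <= k * `|f p| * `|p - x0|.
  apply: (@mvt_abs _ _ _ f df c d) => // y yI; rewrite (le_trans (dk _ yI))//.
  rewrite ler_wpM2l// pmax// in_itv/=; case/andP: yI => y1 y2.
  by rewrite (ltW y1) (ltW y2).
have h2 : `|p - x0| <= d - c.
  by case/andP: pI => ? ?; case/andP: x0I => ? ?; rewrite ler_norml; apply/andP; split; lra.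
rewrite f0 subr0 in h1.
have h3 := le_trans h1 (ler_wpM2l M0 h2).
have h4 : k * `|f p| * (d - c) <= `|f p| * 2^-1.
  by rewrite -mulrA mulrCA ler_wpM2l.
have fp : `|f p| <= 0 by have := normr_ge0 (f p); lra.
by apply/eqP; rewrite -normr_le0 (le_trans (pmax _ _))// in_itv.
Qed.

Lemma bounded_near (I : finType) (f : I -> plane -> R) (v : plane) :
  (forall a, {for v, continuous (f a)}) ->
  exists2 K : R, 0 <= K & exists2 r : R, 0 < r &
    forall w, `|w - v| < r -> forall a, `|f a w| <= K.
Proof.
move=> cf; pose K := 1 + \sum_a `|f a v|.
have K0 : 0 <= K by rewrite addr_ge0// sumr_ge0.
exists K => //; apply: near_ball_plane.
have h a : \forall w \near v, `|f a w| <= K.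
  have /cvgrPdist_le /(_ 1 ltr01) := cf a; apply: filterS => w hw.
  have h1 : `|f a w| <= `|f a v| + 1.
    by rewrite -(subKr (f a v) (f a w)) (le_trans (ler_normB _ _))// lerD2l.
  rewrite (le_trans h1)// addrC lerD2l (bigD1 a)//= lerDl.
  by rewrite sumr_ge0.
near=> w; near: w; exact: filter_forall.
Unshelve. all: by end_near. Qed.

Lemma cts_plane (f : plane -> R) (v : plane) :
  (forall e : R, 0 < e -> exists2 r : R, 0 < r &
    forall w, `|w - v| < r -> `|f v - f w| <= e) -> {for v, continuous f}.
Proof.
move=> h; have FF : Filter (nbhs (v : plane)) by exact: nbhs_filter.
apply: (proj2 (@cvgrPdist_le _ _ _ (nbhs (v : plane)) FF f (f v))) => e e0.
have [r r0 hr] := h e e0.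
have := nbhsx_ballx v r r0; apply: filterS => w; rewrite -ball_normE /ball_/= distrC.
exact: hr.
Qed.

Definition pt (s t : R) : plane := t *: ebase 1 + s *: ebase 0.

Lemma pt0 s t : pt s t 0 0 = s.
Proof. by rewrite !mxE /= mulr0 mulr1 add0r. Qed.

Lemma pt1 s t : pt s t 0 1 = t.
Proof. by rewrite !mxE /= mulr0 mulr1 addr0. Qed.

Lemma ptE (v : plane) : pt (v 0 0) (v 0 1) = v.
Proof. by apply: row2P; rewrite ?pt0 ?pt1. Qed.

Lemma pt_derive0 (f : plane -> R) s t : derivable f (pt s t) (ebase 0) ->
  is_derive s 1 (fun x => f (pt x t)) (partial 0 f (pt s t)).
Proof. exact: line_derive. Qed.

Lemma pt_derive1 (f : plane -> R) s t : derivable f (pt s t) (ebase 1) ->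
  is_derive t 1 (fun x => f (pt s x)) (partial 1 f (pt s t)).
Proof.
rewrite /pt addrC => /line_derive.
by under eq_fun do rewrite addrC.
Qed.

Lemma line_derive_rev (f : plane -> R) (v w : plane) i (x d : R) : v = w + x *: ebase i ->
  is_derive x 1 (fun y : R => f (w + y *: ebase i)) d -> is_derive v (ebase i) f d.
Proof.
move=> -> [dv <-].
have E : (fun h : R => h^-1 *: (((fun y : R => f (w + y *: ebase i)) \o shift x)
    (h *: (1 : R)) - f (w + x *: ebase i))) =
    (fun h : R => h^-1 *: ((f \o shift (w + x *: ebase i)) (h *: ebase i) -
      f (w + x *: ebase i))).
  apply/funext => h /=; congr (_ *: (f _ - _)).
  by rewrite [h *: 1]mulr1 scalerDl addrCA addrA.
by split; [move: dv; rewrite /derivable E|rewrite /derive E].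
Qed.

Lemma pt_derive0_rev (f : plane -> R) (v : plane) (d : R) :
  is_derive (v 0 0) 1 (fun x => f (pt x (v 0 1))) d -> is_derive v (ebase 0) f d.
Proof. by apply: line_derive_rev; rewrite -[LHS]ptE. Qed.

Lemma pt_derive1_rev (f : plane -> R) (v : plane) (d : R) :
  is_derive (v 0 1) 1 (fun x => f (pt (v 0 0) x)) d -> is_derive v (ebase 1) f d.
Proof.
under eq_fun do rewrite /pt addrC.
by apply: line_derive_rev; rewrite addrC -[LHS]ptE.
Qed.

Definition jac m n (f : plane -> 'M[R]_(m, n)) (i : 'I_2) (v : plane) : 'M[R]_(m, n) :=
  \matrix_(j, k) partial i (fun w => f w j k) v.

Lemma line_derive_mx m n (f : plane -> 'M[R]_(m, n)) w i (x : R) :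
  (forall j k, derivable (fun u => f u j k) (w + x *: ebase i) (ebase i)) ->
  is_derive x 1 (fun y : R => f (w + y *: ebase i)) (jac f i (w + x *: ebase i)).
Proof.
move=> h; apply/is_derive_mx => j k; rewrite mxE.
exact: (@line_derive _ (fun u => f u j k)).
Qed.

(** Uniqueness for total differential systems, along the two sides of a
    coordinate rectangle. *)
Lemma total_unique m n (N : plane -> 'M[R]_(m, n)) (v0 : plane) (r k : R) :
  0 <= k -> k * (2 * r) <= 2^-1 ->
  (forall v, `|v - v0| < r -> forall i j l,
    derivable (fun u => N u j l) v (ebase i)) ->
  (forall v i, `|v - v0| < r -> `|jac N i v| <= k * `|N v|) ->
  N v0 = 0 -> forall v, `|v - v0| < r -> N v = 0.
Proof.
move=> k0 kr dN bN N0.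
have step (w : plane) i (h : R) : N w = 0 ->
    (forall x : R, `|x| <= `|h| -> `|w + x *: ebase i - v0| < r) -> N (w + h *: ebase i) = 0.
  move=> Nw wr.
  have nle (x : R) : - `|h| <= x <= `|h| -> `|x| <= `|h| by rewrite ler_norml.
  have nlt (x : R) : - `|h| < x < `|h| -> `|x| <= `|h|.
    by move=> /andP[/ltW x1 /ltW x2]; apply: nle; rewrite x1.
  have hr : `|h| <= r.
    have h2 : 0 <= `|h| by [].
    have e1 := wr h (lexx _); have e2 := wr (- h).
    rewrite normrN in e2; have {}e2 := e2 (lexx _).
    have : `|(2 * h) *: ebase i| < 2 * r.
      have -> : (2 * h) *: ebase i = (w + h *: ebase i - v0) - (w - h *: ebase i - v0).
        by apply/rowP => l; rewrite !mxE; ring.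
      rewrite scaleNr in e2; rewrite (le_lt_trans (ler_normB _ _))//.
      by rewrite mulr_natl mulr2n ltrD.
    by rewrite norm_coord normrM ger0_norm// ltr_pM2l// => /ltW.
  have D x : `|x| <= `|h| -> is_derive (x : R) 1 (fun y : R => N (w + y *: ebase i))
      (jac N i (w + x *: ebase i)).
    by move=> xh; apply: line_derive_mx => j l; apply: dN; exact: wr.
  apply: (@ode_unique _ _ (fun y : R => N (w + y *: ebase i))
    (fun y => jac N i (w + y *: ebase i)) (- `|h|) `|h| k 0 h) => //.
  - rewrite (le_trans _ kr)// ler_wpM2l// opprK mulr_natl mulr2n.
    by rewrite lerD.
  - by rewrite oppr_le0 normr_ge0.
  - by move=> x /nlt /D.
  - by apply: derive_within => x /nle; exact: D.
  - by move=> x /nlt /wr xr; apply: bN.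
  - by rewrite scale0r addr0.
  - by rewrite -ler_norml.
move=> v vr.
have vri i : `|(v - v0) 0 i| < r by apply: le_lt_trans vr; exact: entry_le.
have vE : v = v0 + (v - v0) 0 0 *: ebase 0 + (v - v0) 0 1 *: ebase 1.
  by rewrite -addrA -plane_decomp addrC subrK.
rewrite vE; apply: (step).
  apply: (step) => // x xh; rewrite addrAC subrr add0r norm_coord.
  exact: le_lt_trans xh _.
move=> x xh; rewrite addrC !addrA addNr add0r.
apply: le_lt_trans vr; apply: norm_plane => //.
  by rewrite !mxE /= mulr1 mulr0 addr0; have := entry_le (v - v0) 0; rewrite !mxE.
rewrite !mxE /= mulr1 mulr0 add0r; apply: le_trans xh _.
exact: entry_le.
Qed.

Definition mink_mx : 'M[R]_3 :=
  \matrix_(j, m) if j == m then if (j < 2)%N then 1 else -1 else 0.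

(** [Y] stacks the partial derivatives of a map into the hyperboloid and the map
    itself, which pulls the Minkowski form back to [G]. *)
Definition frame_field (G : plane -> 'M[R]_2) (U : set plane) (Y : plane -> 'M[R]_3) :=
  [/\ open U, forall j m, Ck 1 U (fun v => Y v j m),
      forall i v, U v -> jac Y i v = gauss_form G i v *m Y v,
      forall v, U v -> Y v *m mink_mx *m (Y v)^T = gram G v &
      forall v, U v -> 0 < Y v i2 i2].

Section Frames.
Variables (V : set plane) (G : plane -> 'M[R]_2).
Hypothesis hG : hyperbolic_metric V G.

Let oV : open V. Proof. by case: hG. Qed.

Lemma gauss_form_bounds (v0 : plane) : V v0 ->
  exists2 K : R, 0 <= K & exists2 r : R, 0 < r & forall w, `|w - v0| < r ->
    [/\ V w, forall i, `|gauss_form G i w| <= K,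
        forall i k, `|jac (gauss_form G i) k w| <= K &
        forall i k l, `|jac (jac (gauss_form G i) k) l w| <= K].
Proof.
move=> Vv0; have sm i j m := @smooth_gauss_form R V G hG i j m.
have b0 := @bounded_near ('I_2 * ('I_3 * 'I_3))%type
  (fun a v => gauss_form G a.1 v a.2.1 a.2.2) v0
  (fun a => Ck_cts (sm _ _ _ 0%N) Vv0).
have b1 := @bounded_near ('I_2 * 'I_2 * ('I_3 * 'I_3))%type
  (fun a => partial a.1.2 (fun v => gauss_form G a.1.1 v a.2.1 a.2.2)) v0
  (fun a => Ck_cts (smooth_partial _ (sm _ _ _) 0%N) Vv0).
have b2 := @bounded_near ('I_2 * 'I_2 * 'I_2 * ('I_3 * 'I_3))%type
  (fun a => partial a.1.2 (partial a.1.1.2 (fun v => gauss_form G a.1.1.1 v a.2.1 a.2.2)))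
  v0 (fun a => Ck_cts (smooth_partial _ (smooth_partial _ (sm _ _ _)) 0%N) Vv0).
have [r3 r30 h3] : exists2 r : R, 0 < r & forall w, `|w - v0| < r -> V w.
  by apply: near_ball_plane; exact: open_nbhs_nbhs.
have [K0 K00 [r0 r00 h0]] := b0; have [K1 K10 [r1 r10 h1]] := b1.
have [K2 K20 [r2 r20 h2]] := b2.
exists (K0 + K1 + K2); first by rewrite !addr_ge0.
exists (Num.min (Num.min r0 r1) (Num.min r2 r3)); first by rewrite !lt_min r00 r10 r20.
move=> w; rewrite !lt_min => /andP[/andP[w0 w1] /andP[w2 w3]].
have le0 : K0 <= K0 + K1 + K2 by lra.
have le1 : K1 <= K0 + K1 + K2 by lra.
have le2 : K2 <= K0 + K1 + K2 by lra.
have ge0 := le_trans K00 le0.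
split; first exact: h3.
- move=> i; apply: mxnorm_le => // j m; apply: le_trans le0.
  exact: (h0 w w0 (i, (j, m))).
- move=> i k; apply: mxnorm_le => // j m; apply: le_trans le1; rewrite mxE.
  exact: (h1 w w1 (i, k, (j, m))).
- move=> i k l; apply: mxnorm_le => // j m; apply: le_trans le2; rewrite mxE.
  rewrite (_ : (fun w0 => jac (gauss_form G i) k w0 j m) =
    partial k (fun v => gauss_form G i v j m)).
    exact: (h2 w w2 (i, k, l, (j, m))).
  by apply/funext => u; rewrite mxE.
Qed.

(** The kernel is reproduced by [1 - Z], which halves norms. *)
Lemma near_identity_unit n (Z : 'M[R]_n) : n%:R * `|Z - 1%:M| <= 2^-1 -> Z \in unitmx.
Proof.
move=> h; rewrite -row_free_unit -kermx_eq0 -normr_le0.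
have := mulmx_ker Z; set K := kermx Z => KZ.
have E : K = - (K *m (Z - 1%:M)).
  by rewrite mulmxBr KZ mulmx1 sub0r opprK.
have h1 : `|K| <= n%:R * `|K| * `|Z - 1%:M| by rewrite {1}E normrN mulmx_norm.
have h2 : `|K| * (n%:R * `|Z - 1%:M|) <= `|K| * 2^-1 by rewrite ler_wpM2l.
have h3 : n%:R * `|K| * `|Z - 1%:M| = `|K| * (n%:R * `|Z - 1%:M|) by rewrite mulrAC mulrC.
by rewrite h3 in h1; lra.
Qed.

(** The coefficients are bounded on a small square, where [frobenius] applies on
    account of [flatness]; continuity of the partial derivatives then comes from
    the equations themselves. *)
Lemma structure_solution (v0 : plane) : V v0 -> exists2 r : R, 0 < r &
  exists Z : plane -> 'M[R]_3, let U := [set v : plane | `|v - v0| < r] in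
  [/\ U `<=` V, Z v0 \in unitmx, forall j m, Ck 1 U (fun v => Z v j m) &
      forall i v, U v -> jac Z i v = gauss_form G i v *m Z v].
Proof.
move=> Vv0; have [K K0 [r0 r00 hr]] := gauss_form_bounds Vv0.
pose l : R := Num.min r0 (200 * (K + 1))^-1.
have K1 : 0 < 200 * (K + 1) by rewrite mulr_gt0// ltr_wpDl.
have l0 : 0 < l by rewrite lt_min r00 invr_gt0.
have Kl : K * l <= 200^-1.
  have : l <= (200 * (K + 1))^-1 by rewrite ge_min lexx orbT.
  by rewrite -(ler_pM2r K1) mulVf ?(lt0r_neq0 K1)//; lra.
pose x0 := v0 0 0 - l / 2; pose y0 := v0 0 1 - l / 2.
pose Q s t := x0 <= s <= x0 + l /\ y0 <= t <= y0 + l.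
have Qr s t : Q s t -> `|pt s t - v0| < r0.
  move=> [/andP[h1 h2] /andP[h3 h4]]; rewrite /x0 /y0 in h1 h2 h3 h4.
  apply: (@le_lt_trans _ _ (l / 2)).
    apply: norm_plane; first by rewrite divr_ge0// ltW.
      by rewrite mxE pt0 mxE ler_norml; apply/andP; split; lra.
    by rewrite mxE pt1 mxE ler_norml; apply/andP; split; lra.
  have : l <= r0 by rewrite ge_min lexx.
  by lra.
have sm i j m := @smooth_gauss_form R V G hG i j m.
have dg s t k i j m : Q s t -> derivable (fun v => gauss_form G i v j m) (pt s t) (ebase k).
  by move=> /Qr /hr [Vp _ _ _]; exact: Ck_der (sm i j m 1%N) Vp.
have ddg s t k i l' j m : Q s t ->
    derivable (fun v => jac (gauss_form G i) k v j m) (pt s t) (ebase l').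
  move=> /Qr /hr [Vp _ _ _].
  rewrite (_ : (fun w0 => jac (gauss_form G i) k w0 j m) =
    partial k (fun v => gauss_form G i v j m)).
    exact: Ck_der (Ck_partial k (sm i j m 2%N)) Vp.
  by apply/funext => u; rewrite mxE.
have dB s t : Q s t -> is_derive s 1 (fun x => gauss_form G 1 (pt x t))
    (jac (gauss_form G 1) 0 (pt s t)).
  move=> q; apply/is_derive_mx => j m; rewrite mxE.
  apply: (@pt_derive0 (fun v => gauss_form G 1 v j m)).
  exact: dg.
have dA s t : Q s t -> is_derive t 1 (fun x => gauss_form G 0 (pt s x))
    (jac (gauss_form G 0) 1 (pt s t)).
  move=> q; apply/is_derive_mx => j m; rewrite mxE.
  apply: (@pt_derive1 (fun v => gauss_form G 0 v j m)).
  exact: dg.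
have dA0 s t : Q s t -> is_derive s 1 (fun x => gauss_form G 0 (pt x t))
    (jac (gauss_form G 0) 0 (pt s t)).
  move=> q; apply/is_derive_mx => j m; rewrite mxE.
  apply: (@pt_derive0 (fun v => gauss_form G 0 v j m)).
  exact: dg.
have dB1 s t : Q s t -> is_derive t 1 (fun x => gauss_form G 1 (pt s x))
    (jac (gauss_form G 1) 1 (pt s t)).
  move=> q; apply/is_derive_mx => j m; rewrite mxE.
  apply: (@pt_derive1 (fun v => gauss_form G 1 v j m)).
  exact: dg.
have ddB s t : Q s t -> is_derive s 1 (fun x => jac (gauss_form G 1) 0 (pt x t))
    (jac (jac (gauss_form G 1) 0) 0 (pt s t)).
  move=> q; apply/is_derive_mx => j m; rewrite mxE.
  apply: (@pt_derive0 (fun v => jac (gauss_form G 1) 0 v j m)).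
  exact: ddg.
have ltI (a b x : R) : a < x < b -> a <= x <= b by move=> /andP[/ltW -> /ltW ->].
have nKl : 3%:R * K * l <= 2^-1 by rewrite -mulrA; lra.
have bd s t : Q s t -> [/\ `|gauss_form G 0 (pt s t)| <= K,
    `|gauss_form G 1 (pt s t)| <= K & `|jac (gauss_form G 1) 0 (pt s t)| <= K].
  by move=> /Qr /hr [_ h1 h2 _]; split.
have cB s t : Q s t -> {for t, continuous (fun x => gauss_form G 1 (pt s x))}.
  by move=> /dB1 [d _]; apply: differentiable_continuous; apply/derivable1_diffP.
have lB s s' t : Q s t -> Q s' t -> `|jac (gauss_form G 1) 0 (pt s' t) -
    jac (gauss_form G 1) 0 (pt s t)| <= K * `|s' - s|.
  move=> [sI tI] [sI' _].
  have qx x : x0 <= x <= x0 + l -> Q x t by [].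
  apply: (@mvt_abs _ _ _ (fun x => jac (gauss_form G 1) 0 (pt x t))
    (fun x => jac (jac (gauss_form G 1) 0) 0 (pt x t)) x0 (x0 + l)) => //.
  - by move=> x /ltI /qx; exact: ddB.
  - by apply: derive_within => x /qx; exact: ddB.
  - by move=> x /ltI /qx /Qr /hr [].
have lA s s' : Q s y0 -> Q s' y0 -> `|gauss_form G 0 (pt s' y0) -
    gauss_form G 0 (pt s y0)| <= K * `|s' - s|.
  move=> [sI tI] [sI' _].
  have qx x : x0 <= x <= x0 + l -> Q x y0 by [].
  pose f := fun x : R => gauss_form G 0 (pt x y0).
  pose df := fun x : R => jac (gauss_form G 0) 0 (pt x y0).
  have h0 (x : R) : x0 <= x <= x0 + l -> is_derive x 1 f (df x).
    by move=> xI; exact: (dA0 _ _ (qx x xI)).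
  have h1 (x : R) : x0 < x < x0 + l -> is_derive x 1 f (df x).
    by move=> /ltI; exact: h0.
  have h2 := derive_within h0.
  have h3 (x : R) : x0 < x < x0 + l -> `|df x| <= K.
    by move=> /ltI /qx /Qr /hr [_ _ h _]; exact: h.
  exact: (mvt_abs K0 h1 h2 h3 sI sI').
have fl s t : Q s t -> _ := fun q => let: And4 Vp _ _ _ := hr _ (Qr s t q) in
  flatness hG Vp.
have [Z [L [Z00 dZ cZ Zd Zl]]] := @frobenius R 3 3 (fun s t => gauss_form G 0 (pt s t))
  (fun s t => gauss_form G 1 (pt s t)) (fun s t => jac (gauss_form G 0) 1 (pt s t))
  (fun s t => jac (gauss_form G 1) 0 (pt s t)) x0 y0 l K 1%:M l0 K0 nKl
  bd dB dA cB lB lA fl.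
have l2 : 0 < l / 2 by rewrite divr_gt0.
exists (l / 2) => //.
pose U := [set v : plane | `|v - v0| < l / 2].
pose ZZ (v : plane) := Z (v 0 0) (v 0 1).
have Uin v : U v -> x0 < v 0 0 < x0 + l /\ y0 < v 0 1 < y0 + l.
  move=> /= Uv; have := le_lt_trans (entry_le _ 0) Uv; have := le_lt_trans (entry_le _ 1) Uv.
  clear Kl nKl K1; rewrite !mxE !ltr_norml /x0 /y0 => /andP[? ?] /andP[? ?].
  by split; apply/andP; split; lra.
have UQ v : U v -> Q (v 0 0) (v 0 1).
  by move=> /Uin [h1 h2]; split; exact: ltI.
have UV : U `<=` V.
  by move=> v /UQ /Qr; rewrite ptE => /hr [].
have oU : open U.
  rewrite (_ : U = ball v0 (l / 2)); first exact: ball_open.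
  by apply/seteqP; split=> v; rewrite /U /= -ball_normE /ball_/= distrC.
have dZZ i v : U v -> forall j m, is_derive v (ebase i) (fun w => ZZ w j m)
    ((gauss_form G i v *m ZZ v) j m).
  move=> Uv j m; have [h1 h2] := Uin v Uv; have [d0 d1] := dZ _ _ h1 h2.
  have [i0' |i1'] : i = 0 \/ i = 1.
    by case: (i) => [[|[|//]] p]; [left|right]; exact/val_inj.
  - rewrite i0'; apply: pt_derive0_rev.
    under eq_fun do rewrite /ZZ pt0 pt1.
    by have /is_derive_mx := d0; rewrite ptE; exact.
  - rewrite i1'; apply: pt_derive1_rev.
    under eq_fun do rewrite /ZZ pt0 pt1.
    by have /is_derive_mx := d1; rewrite ptE; exact.
have jZZ i v : U v -> jac ZZ i v = gauss_form G i v *m ZZ v.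
  move=> Uv; apply/matrixP => j m; rewrite mxE.
  by have [_] := dZZ i v Uv j m.
have cZZ v : U v -> forall j m, {for v, continuous (fun w => ZZ w j m)}.
  move=> Uv j m; apply: cts_plane => e e0.
  have L1 : 0 < `|L| + 1 by rewrite ltr_wpDl.
  have e2 : 0 < e / 2 by rewrite divr_gt0.
  have eL : 0 < e / 2 / (`|L| + 1) by rewrite divr_gt0.
  have h3 : \forall t \near v 0 1, `|Z (v 0 0) (v 0 1) - Z (v 0 0) t| <= e / 2.
    by have /cvgrPdist_le := cZ (v 0 0) (v 0 1); exact.
  have [r r1 hr3] : exists2 r : R, 0 < r & forall t, `|t - v 0 1| < r ->
      `|Z (v 0 0) (v 0 1) - Z (v 0 0) t| <= e / 2.
    by move/nbhs_normP : h3 => [r r1 h]; exists r => // t tr; apply: h; rewrite /= distrC.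
  exists (Num.min (Num.min r (e / 2 / (`|L| + 1))) (l / 2 - `|v - v0|)).
    by rewrite !lt_min r1 eL subr_gt0.
  move=> w; rewrite !lt_min => /andP[/andP[w1 w2] w3].
  have Uw : U w.
    rewrite /U /= -(subrKA v) (le_lt_trans (ler_normD _ _))//.
    by rewrite ltrBrDr in w3.
  have hw2 : `|w 0 0 - v 0 0| <= e / 2 / (`|L| + 1).
    by have := entry_le (w - v) 0; rewrite !mxE => /le_trans; apply; exact: ltW.
  have hw3 : `|Z (v 0 0) (v 0 1) - Z (v 0 0) (w 0 1)| <= e / 2.
    apply: hr3; have := entry_le (w - v) 1; rewrite !mxE => /le_lt_trans; exact.
  have q : Q (w 0 0) (w 0 1) by exact: UQ.
  have q' : Q (v 0 0) (w 0 1) by split; [case: (UQ v Uv)|case: (UQ w Uw)].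
  have := Zl _ _ _ q' q; rewrite ler_pdivlMr// in hw2 => hl.
  have hl' : `|Z (w 0 0) (w 0 1) - Z (v 0 0) (w 0 1)| <= e / 2.
    rewrite (le_trans hl)// (le_trans _ hw2)// mulrC ler_wpM2l//.
    by rewrite (le_trans (ler_norm _))// lerDl.
  have := mxnorm_ge (ZZ v - ZZ w) j m; rewrite !mxE => /le_trans; apply.
  rewrite -(subrKA (Z (v 0 0) (w 0 1))) (le_trans (ler_normD _ _))//.
  by rewrite [e]splitr lerD// distrC.
exists ZZ; split => //.
- apply: near_identity_unit.
  have v0U : U v0 by rewrite /U /= subrr normr0.
  have n1 : `|1%:M : 'M[R]_3| <= 1.
    by apply: mxnorm_le => // a b; rewrite mxE; case: eqP; rewrite ?normr1 ?normr0.
  have h := Zd _ _ (UQ _ v0U).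
  have h' : 8 * 3 * K * l * `|1%:M : 'M[R]_3| <= 8 * 3 * K * l.
    by rewrite ler_piMr// !mulr_ge0// ltW.
  have := le_trans h h'; rewrite /ZZ; lra.
- move=> j m; have C0 : Ck 0 U (fun v => ZZ v j m).
    by split=> // v Uv; exact: cZZ.
  split; first by move=> v Uv; exact: cZZ.
  move=> i; split; first by move=> v Uv; have [] := dZZ i v Uv j m.
  apply: (@Ck_ext _ _ _ (fun v => gauss_form G i v j i0 * ZZ v i0 m +
    gauss_form G i v j i1 * ZZ v i1 m + gauss_form G i v j i2 * ZZ v i2 m)) => //.
    move=> v Uv; have [_ E] := dZZ i v Uv j m.
    exact: (etrans (esym (mulmx33 _ _ _ _)) (esym E)).
  have sm' k : Ck 0 U (fun v => gauss_form G i v j k).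
    exact: Ck_subset UV (sm i j k 0%N).
  have cz k : Ck 0 U (fun v => ZZ v k m) by split=> // v Uv; exact: cZZ.
  by apply: Ck_add => //; [apply: Ck_add => //|]; exact: Ck_mul.
Unshelve. all: by end_near. Qed.

End Frames.

End LocalIsometry.

Section FrameFields.
Context {R : realType}.
Local Notation plane := 'rV[R]_2.
Variables (V : set plane) (G : plane -> 'M[R]_2).
Hypothesis hG : hyperbolic_metric V G.
Local Notation mink_mx := (@mink_mx R).

Let oV : open V. Proof. by case: hG. Qed.

Definition smooth_entries (v : plane) i m n (f : plane -> 'M[R]_(m, n)) :=
  forall j k, derivable (fun w => f w j k) v (ebase i).

Lemma jac_mulmx m p n (f : plane -> 'M[R]_(m, p)) (g : plane -> 'M[R]_(p, n)) i v :
  smooth_entries v i f -> smooth_entries v i g ->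
  smooth_entries v i (fun w => f w *m g w) /\
  jac (fun w => f w *m g w) i v = jac f i v *m g v + f v *m jac g i v.
Proof.
move=> df dg.
have H j k : is_derive v (ebase i) (fun w => (f w *m g w) j k)
    ((jac f i v *m g v + f v *m jac g i v) j k).
  under eq_fun do rewrite mxE.
  rewrite !mxE -big_split/=.
  have -> : (fun w => \sum_l f w j l * g w l k) =
      \sum_l (fun w => f w j l * g w l k) by apply/funext => w; rewrite fct_sumE.
  apply: is_derive_sum => l; rewrite !mxE.
  have [d e] := partialM (df j l) (dg l k).
  by split.
split=> [j k|]; first by have [] := H j k.
by apply/matrixP => j k; rewrite mxE; have [_] := H j k.
Qed.

Lemma jac_cst m n (C : 'M[R]_(m, n)) i v :
  smooth_entries v i (fun=> C) /\ jac (fun=> C) i v = 0.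
Proof.
split=> [j k|]; first exact: derivable_cst.
by apply/matrixP => j k; rewrite !mxE; exact: derive_cst.
Qed.

Lemma jac_tr m n (f : plane -> 'M[R]_(m, n)) i v : smooth_entries v i f ->
  smooth_entries v i (fun w => (f w)^T) /\ jac (fun w => (f w)^T) i v = (jac f i v)^T.
Proof.
move=> df; split=> [j k|]; first by under eq_fun do rewrite mxE; exact: df.
apply/matrixP => j k; rewrite !mxE; congr (partial i _ v).
by apply/funext => w; rewrite mxE.
Qed.

Lemma jac_sub m n (f g : plane -> 'M[R]_(m, n)) i v :
  smooth_entries v i f -> smooth_entries v i g ->
  smooth_entries v i (fun w => f w - g w) /\
  jac (fun w => f w - g w) i v = jac f i v - jac g i v.
Proof.
move=> df dg.
have H j k : is_derive v (ebase i) (fun w => (f w - g w) j k)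
    ((jac f i v - jac g i v) j k).
  under eq_fun do rewrite !mxE.
  by rewrite !mxE; apply: is_deriveB; exact: derivableP.
split=> [j k|]; first by have [] := H j k.
by apply/matrixP => j k; rewrite mxE; have [_] := H j k.
Qed.

Lemma mxnorm_tr m n (A : 'M[R]_(m, n)) : `|A^T| = `|A|.
Proof.
by apply/le_anti/andP; split; apply: mxnorm_le => // i j;
  rewrite ?mxE ?mxnorm_ge//; have := mxnorm_ge (A^T) j i; rewrite mxE.
Qed.

Lemma mink_mxE : ((mink_mx i0 i0 = 1) * (mink_mx i0 i1 = 0) * (mink_mx i0 i2 = 0) *
  (mink_mx i1 i0 = 0) * (mink_mx i1 i1 = 1) * (mink_mx i1 i2 = 0) *
  (mink_mx i2 i0 = 0) * (mink_mx i2 i1 = 0) * (mink_mx i2 i2 = -1 :> R))%type.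
Proof. by do !split; rewrite mxE. Qed.

Lemma gramE w : ((gram G w i0 i0 = G w 0 0) * (gram G w i0 i1 = G w 0 1) *
  (gram G w i0 i2 = 0) * (gram G w i1 i0 = G w 1 0) * (gram G w i1 i1 = G w 1 1) *
  (gram G w i1 i2 = 0) * (gram G w i2 i0 = 0) * (gram G w i2 i1 = 0) *
  (gram G w i2 i2 = -1))%type.
Proof. by do !split; rewrite mxE. Qed.

Lemma gram_unit v : V v -> gram G v \in unitmx.
Proof.
move=> Vv; have D0 : G v 0 0 * G v 1 1 - G v 0 1 * G v 0 1 != 0.
  by rewrite gt_eqF// (metric_det_pos hG).
pose D := G v 0 0 * G v 1 1 - G v 0 1 * G v 0 1.
pose W : 'M[R]_3 := \matrix_(j, m) if (j == 0 :> nat) then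
    if (m == 0 :> nat) then G v 1 1 / D else if (m == 1 :> nat) then - G v 0 1 / D else 0
  else if (j == 1 :> nat) then
    if (m == 0 :> nat) then - G v 0 1 / D else if (m == 1 :> nat) then G v 0 0 / D else 0
  else if (m == 2 :> nat) then -1 else 0.
have WE : ((W i0 i0 = G v 1 1 / D) * (W i0 i1 = - G v 0 1 / D) * (W i0 i2 = 0) *
  (W i1 i0 = - G v 0 1 / D) * (W i1 i1 = G v 0 0 / D) * (W i1 i2 = 0) *
  (W i2 i0 = 0) * (W i2 i1 = 0) * (W i2 i2 = -1))%type by do !split; rewrite mxE.
suff /mulmx1_unit [] : gram G v *m W = 1%:M by [].
have E := metric_symm hG Vv.
apply/matrixP => j m; rewrite mulmx33 [RHS]mxE.
move: j m; elim/ord3P; elim/ord3P; rewrite !gramE !WE ?E /D /=; field; first [exact: D0|by []|idtac].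
Qed.

(** The initial value of the frame. *)
Lemma cholesky v : V v -> exists S : 'M[R]_3,
  [/\ S *m mink_mx *m S^T = gram G v, S i2 i0 = 0, S i2 i1 = 0 & S i2 i2 = 1].
Proof.
move=> Vv; have a0 := metric_pos hG Vv; have D0 := metric_det_pos hG Vv.
pose a := G v 0 0; pose b := G v 0 1; pose c := G v 1 1.
pose s := Num.sqrt a; have s0 : s != 0 by rewrite gt_eqF// sqrtr_gt0.
have ss : s * s = a by rewrite -expr2 sqr_sqrtr// ltW.
pose t := Num.sqrt ((a * c - b * b) / a).
have tt : t * t = (a * c - b * b) / a by rewrite -expr2 sqr_sqrtr// divr_ge0// ltW.
pose S : 'M[R]_3 := \matrix_(j, m) if (j == 0 :> nat) then
    if (m == 0 :> nat) then s else 0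
  else if (j == 1 :> nat) then
    if (m == 0 :> nat) then b / s else if (m == 1 :> nat) then t else 0
  else if (m == 2 :> nat) then 1 else 0.
exists S; split; try by rewrite mxE.
have tr j m : S^T j m = S m j by rewrite mxE.
have SE : ((S i0 i0 = s) * (S i0 i1 = 0) * (S i0 i2 = 0) * (S i1 i0 = b / s) *
  (S i1 i1 = t) * (S i1 i2 = 0) * (S i2 i0 = 0) * (S i2 i1 = 0) * (S i2 i2 = 1))%type.
  by do !split; rewrite mxE.
have bs : b / s * (b / s) = b * b / a by rewrite mulf_div ss.
have sb : s * (b / s) = b by rewrite mulrC divfK.
have bst : b / s * (b / s) + t * t = c.
  by rewrite bs tt -mulrDl addrC subrK mulrC mulKf// gt_eqF.
apply/matrixP => j m; rewrite !mulmx33 !tr; move: j m.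
have E := metric_symm hG Vv.
elim/ord3P; elim/ord3P; rewrite !SE !mink_mxE !gramE ?E -/a -/b -/c.
- by rewrite !(mulr0, mulr1, mul0r, addr0, add0r).
- by rewrite !(mulr0, mulr1, mul0r, addr0, add0r).
- by rewrite !(mulr0, mulr1, mul0r, addr0, add0r).
- by rewrite !(mulr0, mulr1, mul0r, addr0, add0r) divfK.
- by rewrite !(mulr0, mulr1, mul0r, addr0, add0r).
- by rewrite !(mulr0, mulr1, mul0r, addr0, add0r).
- by rewrite !(mulr0, mulr1, mul0r, addr0, add0r).
- by rewrite !(mulr0, mulr1, mul0r, addr0, add0r).
- by rewrite !(mulr0, mulr1, mul0r, addr0, add0r) mul1r.
Qed.

Lemma gram_defect (O Y J g : 'M[R]_3) :
  O *m Y *m J *m Y^T + Y *m J *m (O *m Y)^T - (O *m g + g *m O^T) =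
  O *m (Y *m J *m Y^T - g) + (Y *m J *m Y^T - g) *m O^T.
Proof. by rewrite trmx_mul mulmxBr mulmxBl !mulmxA opprD addrACA. Qed.

(** The defect of the solution from being isometric vanishes at the base point
    and satisfies a homogeneous linear system by [gram_partial] and
    [gram_defect]. *)
Lemma frame_exists (v0 : plane) : V v0 -> exists2 r : R, 0 < r &
  exists Y : plane -> 'M[R]_3, let U := [set v : plane | `|v - v0| < r] in
  [/\ U `<=` V, frame_field G U Y, Y v0 i2 i0 = 0, Y v0 i2 i1 = 0 & Y v0 i2 i2 = 1].
Proof.
move=> Vv0; have [r1 r10 [Z [UV1 Zu CZ jZ]]] := structure_solution hG Vv0.
have [K K0 [r2 r20 hr2]] := gauss_form_bounds hG Vv0.
have [S [SS S0 S1 S2]] := cholesky Vv0.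
pose C := invmx (Z v0) *m S.
pose Y v := Z v *m C.
have Yv0 : Y v0 = S by rewrite /Y /C mulmxA mulmxV// mul1mx.
have CY : forall j m, Ck 1 [set v : plane | `|v - v0| < r1] (fun v => Y v j m).
  have o1 : open [set v : plane | `|v - v0| < r1].
    rewrite (_ : mkset _ = ball v0 r1); first exact: ball_open.
    by apply/seteqP; split=> v; rewrite /= -ball_normE /ball_/= distrC.
  move=> j m; apply: (@Ck_ext _ _ _ (fun v => Z v j i0 * C i0 m + Z v j i1 * C i1 m +
    Z v j i2 * C i2 m)) => //; first by move=> v _; rewrite /Y mulmx33.
  by apply: Ck_add => //; [apply: Ck_add => //|]; apply: Ck_mul => //; exact: Ck_cst.
have [r3 r30 h3] : exists2 r : R, 0 < r & forall v, `|v - v0| < r -> 0 < Y v i2 i2.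
  apply: near_ball_plane.
  have v01 : `|v0 - v0| < r1 by rewrite subrr normr0.
  have h := Ck_cts (CY i2 i2) v01.
  have : 0 < Y v0 i2 i2 by rewrite Yv0 S2.
  by move=> h'; apply: (cvgr_gt _ h).
have K1 : 0 < 24 * (K + 1) by rewrite mulr_gt0// ltr_wpDl.
pose r := Num.min (Num.min r1 r2) (Num.min r3 (24 * (K + 1))^-1).
have r0 : 0 < r by rewrite !lt_min r10 r20 r30 invr_gt0.
have rr1 v : `|v - v0| < r -> `|v - v0| < r1.
  by move=> h; rewrite (lt_le_trans h)// !ge_min lexx.
have rr2 v : `|v - v0| < r -> `|v - v0| < r2.
  by move=> h; rewrite (lt_le_trans h)// !ge_min lexx orbT.
have rr3 v : `|v - v0| < r -> `|v - v0| < r3.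
  by move=> h; rewrite (lt_le_trans h)// !ge_min lexx !orbT.
have Kr : 6 * K * (2 * r) <= 2^-1.
  have : r <= (24 * (K + 1))^-1 by rewrite !ge_min lexx !orbT.
  rewrite -[X in _ <= X]mul1r ler_pdivlMr// => h.
  rewrite -[_^-1]mul1r ler_pdivlMr//; nra.
exists r => //; exists Y.
have o : open [set v : plane | `|v - v0| < r].
  rewrite (_ : mkset _ = ball v0 r); first exact: ball_open.
  by apply/seteqP; split=> v; rewrite /= -ball_normE /ball_/= distrC.
have sZ i v : `|v - v0| < r1 -> smooth_entries v i Z.
  by move=> h j k; apply: Ck_der (CZ j k) h.
have sY i v : `|v - v0| < r1 -> smooth_entries v i Y.
  by move=> h j k; apply: Ck_der (CY j k) h.
have jY i v : `|v - v0| < r1 -> jac Y i v = gauss_form G i v *m Y v.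
  move=> h; have [_ ->] := jac_mulmx (sZ i v h) (proj1 (jac_cst C i v)).
  rewrite (proj2 (jac_cst C i v)) mulmx0 addr0 jZ//.
  by rewrite /Y (mulmxA (gauss_form G i v) (Z v) C).
have gramY v : `|v - v0| < r -> Y v *m mink_mx *m (Y v)^T = gram G v.
  move=> h; apply/eqP; rewrite -subr_eq0; apply/eqP.
  have JN i w : `|w - v0| < r ->
      smooth_entries w i (fun v => Y v *m mink_mx *m (Y v)^T - gram G v) /\
      jac (fun v => Y v *m mink_mx *m (Y v)^T - gram G v) i w =
      gauss_form G i w *m (Y w *m mink_mx *m (Y w)^T - gram G w) +
      (Y w *m mink_mx *m (Y w)^T - gram G w) *m (gauss_form G i w)^T.
    move=> hw; have Vw : V w by apply: UV1; exact: rr1.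
    have [a1 a2] := jac_mulmx (sY i w (rr1 _ hw)) (proj1 (jac_cst mink_mx i w)).
    have [b1 b2] := jac_tr (sY i w (rr1 _ hw)).
    have [c1 c2] := jac_mulmx a1 b1.
    have [d1 d2] := gram_partial hG i Vw.
    have [e1 e2] := jac_sub c1 d1.
    split=> //; rewrite e2 c2 a2 b2 (proj2 (jac_cst mink_mx i w)) mulmx0 addr0.
    rewrite [jac (gram G) i w]d2 !jY//; [|exact: rr1..].
    exact: gram_defect.
  apply: (@total_unique R _ _ (fun v => Y v *m mink_mx *m (Y v)^T - gram G v) v0 r
    (6 * K)) => //.
  - by rewrite mulr_ge0.
  - by move=> w hw i; exact: (proj1 (JN i w hw)).
  - move=> w i hw; rewrite (proj2 (JN i w hw)).
    have [_ gK _ _] := hr2 w (rr2 w hw).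
    set N := _ - gram G w.
    have h1 : `|gauss_form G i w *m N| <= 3 * K * `|N|.
      rewrite (le_trans (mulmx_norm _ _))// ler_wpM2r// ler_wpM2l//; exact: gK.
    have h2 : `|N *m (gauss_form G i w)^T| <= 3 * `|N| * K.
      rewrite (le_trans (mulmx_norm _ _))// mxnorm_tr ler_wpM2l ?mulr_ge0//; exact: gK.
    rewrite (le_trans (ler_normD _ _))// (le_trans (lerD h1 h2))//.
    by lra.
  - by rewrite Yv0 SS subrr.
split=> //; rewrite ?Yv0//; first by move=> v /rr1; exact: UV1.
split=> //.
- move=> j m; apply: Ck_subset (CY j m) => v; exact: rr1.
- by move=> i v /rr1; exact: jY.
- by move=> v /rr3; exact: h3.
Qed.

Lemma frame_unit U (Y : plane -> 'M[R]_3) v : frame_field G U Y -> U v -> V v ->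
  Y v \in unitmx.
Proof.
move=> [_ _ _ h _] Uv Vv.
have /mulmx1_unit [] : Y v *m (mink_mx *m (Y v)^T *m invmx (gram G v)) = 1%:M.
  by rewrite !mulmxA h// mulmxV// gram_unit.
by [].
Qed.

(** The frames are matched at the base point; their difference then vanishes by
    uniqueness for the linear system that both solve. *)
Lemma frame_unique U U' (Y Y' : plane -> 'M[R]_3) v0 :
  frame_field G U Y -> frame_field G U' Y' -> U v0 -> U' v0 -> V v0 ->
  exists M : 'M[R]_3, M *m mink_mx *m M^T = mink_mx /\
  exists2 r : R, 0 < r & forall v, `|v - v0| < r -> [/\ U v, U' v & Y' v = Y v *m M].
Proof.
move=> fY fY' Uv0 Uv0' Vv0; have Yu := frame_unit fY Uv0 Vv0.
have [oU CY jY gY _] := fY; have [oU' CY' jY' gY' _] := fY'.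
pose M := invmx (Y v0) *m Y' v0.
have YM : Y v0 *m M = Y' v0 by rewrite /M mulmxA mulmxV// mul1mx.
exists M; split.
  have := gY' _ Uv0'; rewrite -(gY _ Uv0) -YM trmx_mul !mulmxA => E.
  have YTu : (Y v0)^T \in unitmx by rewrite unitmx_tr.
  have {}E := congr1 (fun X => X *m invmx (Y v0)^T) E.
  rewrite -!mulmxA !mulmxV// !mulmx1 !mulmxA in E.
  have {}E := congr1 (fun X => invmx (Y v0) *m X) E.
  by rewrite !mulmxA !mulVmx// !mul1mx in E.
have [K K0 [r2 r20 hr2]] := gauss_form_bounds hG Vv0.
have [r1 r10 h1] : exists2 r : R, 0 < r & forall w, `|w - v0| < r -> U w.
  by apply: near_ball_plane; exact: open_nbhs_nbhs.
have [r3 r30 h3] : exists2 r : R, 0 < r & forall w, `|w - v0| < r -> U' w.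
  by apply: near_ball_plane; exact: open_nbhs_nbhs.
have K1 : 0 < 12 * (K + 1) by rewrite mulr_gt0// ltr_wpDl.
pose r := Num.min (Num.min r1 r2) (Num.min r3 (12 * (K + 1))^-1).
have r0 : 0 < r by rewrite !lt_min r10 r20 r30 invr_gt0.
have rr1 v : `|v - v0| < r -> U v.
  by move=> h; apply: h1; rewrite (lt_le_trans h)// !ge_min lexx.
have rr2 v : `|v - v0| < r -> `|v - v0| < r2.
  by move=> h; rewrite (lt_le_trans h)// !ge_min lexx orbT.
have rr3 v : `|v - v0| < r -> U' v.
  by move=> h; apply: h3; rewrite (lt_le_trans h)// !ge_min lexx !orbT.
have Kr : 3 * K * (2 * r) <= 2^-1.
  have : r <= (12 * (K + 1))^-1 by rewrite !ge_min lexx !orbT.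
  rewrite -[X in _ <= X]mul1r ler_pdivlMr// => h.
  rewrite -[_^-1]mul1r ler_pdivlMr//; nra.
exists r => // v hv; split; [exact: rr1|exact: rr3|].
apply/eqP; rewrite -subr_eq0; apply/eqP.
have JN i w : `|w - v0| < r -> smooth_entries w i (fun v => Y' v - Y v *m M) /\
    jac (fun v => Y' v - Y v *m M) i w = gauss_form G i w *m (Y' w - Y w *m M).
  move=> hw.
  have a0 : smooth_entries w i Y by move=> j k; exact: Ck_der (CY j k) (rr1 w hw).
  have a0' : smooth_entries w i Y' by move=> j k; exact: Ck_der (CY' j k) (rr3 w hw).
  have [a1 a2] := jac_mulmx a0 (proj1 (jac_cst M i w)).
  have [b1 b2] := jac_sub a0' a1.
  split=> //; rewrite b2 a2 (proj2 (jac_cst M i w)) mulmx0 addr0.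
  rewrite (jY i w (rr1 w hw)) (jY' i w (rr3 w hw)). 
  by rewrite mulmxBr (mulmxA _ (Y w) M).
apply: (@total_unique R _ _ (fun v => Y' v - Y v *m M) v0 r (3 * K)) => //.
- by rewrite mulr_ge0.
- by move=> w hw i; exact: (proj1 (JN i w hw)).
- move=> w i hw; rewrite (proj2 (JN i w hw)).
  have [_ gK _ _] := hr2 w (rr2 w hw).
  rewrite (le_trans (mulmx_norm _ _))// ler_wpM2r// ler_wpM2l//; exact: gK.
- by rewrite YM subrr.
Qed.

End FrameFields.

(** * Change of coordinates and the inverse function theorem *)

Section Coordinates.
Context {R : realType}.
Local Notation plane := 'rV[R]_2.
Local Notation mink_mx := (@mink_mx R).

Lemma cts_row (t : plane -> plane) v : (forall m, {for v, continuous (fun w => t w 0 m)}) ->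
  {for v, continuous t}.
Proof.
move=> h; have FF : Filter (nbhs (v : plane)) by exact: nbhs_filter.
by apply: cvg_mx => i j; rewrite (ord1 i); exact: h.
Qed.

Lemma cts_comp (T : topologicalType) (f : plane -> T) (t : plane -> plane) v :
  {for v, continuous t} -> {for t v, continuous f} ->
  {for v, continuous (fun w => f (t w))}.
Proof. by move=> h1 h2; exact: (@continuous_comp _ _ _ t f v h1 h2). Qed.

Lemma partial_comp (V W : set plane) (f : plane -> R) (t : plane -> plane) v i :
  open V -> open W -> Ck 1 W f -> (forall m, Ck 1 V (fun w => t w 0 m)) ->
  V v -> W (t v) ->
  derivable (fun w => f (t w)) v (ebase i) /\
  partial i (fun w => f (t w)) v =
    partial i (fun w => t w 0 0) v * partial 0 f (t v) +
    partial i (fun w => t w 0 1) v * partial 1 f (t v).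
Proof.
move=> oV oW Cf Ct Vv Wv.
pose u := fun x : R => t (v + x *: ebase i).
have v0 : v = v + (0 : R) *: ebase i by rewrite scale0r addr0.
pose du : plane := \row_m partial i (fun w => t w 0 m) v.
have hu : is_derive (0 : R) 1 u du.
  apply/is_derive_mx => a m; rewrite (ord1 a) mxE.
  have := @line_derive _ (fun w => t w 0 m) v i 0; rewrite -v0; apply.
  exact: Ck_der (Ct m) Vv.
have u0 : u 0 = t v by rewrite /u -v0.
have Wu : W (u 0) by rewrite u0.
have := chain_curve oW Cf Wu hu; rewrite u0 => h.
have [d e] := @line_derive_rev _ (fun w => f (t w)) v v i 0 _ v0 h.
by split=> //; rewrite /partial e !mxE.
Qed.

Lemma Ck1_comp (V W : set plane) (f : plane -> R) (t : plane -> plane) :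
  open V -> open W -> Ck 1 W f -> (forall m, Ck 1 V (fun w => t w 0 m)) ->
  (forall v, V v -> W (t v)) -> Ck 1 V (fun w => f (t w)).
Proof.
move=> oV oW Cf Ct VW.
have ct v : V v -> {for v, continuous t}.
  by move=> Vv; apply: cts_row => m; exact: Ck_cts (Ct m) Vv.
split=> [v Vv|i]; first by apply: cts_comp (ct v Vv) _; exact: Ck_cts Cf (VW v Vv).
split=> [v Vv|]; first by have [] := @partial_comp V W f t v i oV oW Cf Ct Vv (VW v Vv).
have C0 m : Ck 0 V (fun w => partial m f (t w)).
  split=> // v Vv; apply: cts_comp (ct v Vv) _.
  exact: Ck_cts (Ck_partial m Cf) (VW v Vv).
apply: (@Ck_ext _ _ _ (fun v => partial i (fun w => t w 0 0) v * partial 0 f (t v) +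
    partial i (fun w => t w 0 1) v * partial 1 f (t v))) => //.
  by move=> v Vv; have [_ ->] := @partial_comp V W f t v i oV oW Cf Ct Vv (VW v Vv).
by apply: Ck_add => //; apply: Ck_mul => //; exact: Ck_partial (Ct _).
Qed.

Definition tjac (t : plane -> plane) (v : plane) : 'M[R]_2 :=
  \matrix_(i, m) partial i (fun w => t w 0 m) v.

Lemma jacobianE (V : set plane) (t : plane -> plane) v : open V ->
  (forall m, Ck 1 V (fun w => t w 0 m)) -> V v ->
  differentiable t v /\ jacobian t v = tjac t v.
Proof.
move=> oV Ct Vv; have [|d E] := @C1_diff_mx R 1 2 V t v oV _ Vv.
  by move=> k l; rewrite (ord1 k); exact: Ct.
split=> //; apply/matrixP => i m; rewrite !mxE E.
have -> : (delta_mx 0 i : plane) = ebase i by [].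
rewrite !ebaseE; have [-> | ->] : i = 0 \/ i = 1.
    by case: i => [[|[|//]] p]; [left|right]; exact/val_inj.
  by rewrite /= mul1r mul0r addr0.
by rewrite /= mul1r mul0r add0r.
Qed.

Definition pad (J : 'M[R]_2) : 'M[R]_3 :=
  \matrix_(j, m) if (j < 2)%N then if (m < 2)%N then J (o2 j) (o2 m) else 0
    else if (m < 2)%N then 0 else 1.

Lemma padE J : ((pad J i0 i0 = J 0 0) * (pad J i0 i1 = J 0 1) * (pad J i0 i2 = 0) *
  (pad J i1 i0 = J 1 0) * (pad J i1 i1 = J 1 1) * (pad J i1 i2 = 0) *
  (pad J i2 i0 = 0) * (pad J i2 i1 = 0) * (pad J i2 i2 = 1))%type.
Proof. by do !split; rewrite mxE. Qed.

Lemma det_pad J : \det (pad J) = \det J.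
Proof.
rewrite (expand_det_row _ i2) sum3 !padE !mul0r !add0r mul1r /cofactor /=.
rewrite -signr_odd /= expr0 mul1r !det2 !mxE /=.
have e0 : lift i2 (0 : 'I_2) = i0 by exact/val_inj.
have e1 : lift i2 (1 : 'I_2) = i1 by exact/val_inj.
by rewrite !e0 !e1.
Qed.

Lemma mulmx22 m n (A : 'M[R]_(m, 2)) (B : 'M[R]_(2, n)) j k : (A *m B) j k =
  A j 0 * B 0 k + A j 1 * B 1 k.
Proof. by rewrite mxE sum2. Qed.

Lemma gram_pad (G G' : plane -> 'M[R]_2) v v' J : G v = J *m G' v' *m J^T ->
  gram G v = pad J *m gram G' v' *m (pad J)^T.
Proof.
move=> E; have tr j m : (pad J)^T j m = pad J m j by rewrite mxE.
have tr2 j m : J^T j m = J m j by rewrite mxE.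
apply/matrixP => j m; rewrite !mulmx33 !tr; move: j m.
elim/ord3P; elim/ord3P; rewrite !gramE !padE ?E ?mulmx22 ?tr2; ring.
Qed.

Lemma prod_entry (B Y : 'M[R]_3) j m : (B *m mink_mx *m Y^T) j m =
  B j i0 * Y m i0 + B j i1 * Y m i1 - B j i2 * Y m i2.
Proof.
have tr p q : Y^T p q = Y q p by rewrite mxE.
by rewrite !mulmx33 !mink_mxE !tr; ring.
Qed.

Lemma sub_entry (A B : 'M[R]_3) j m : (A - B) j m = A j m - B j m.
Proof. by rewrite !mxE. Qed.

Lemma frame_cancel (B O Y J g : 'M[R]_3) : Y *m J *m Y^T = g -> g \in unitmx ->
  B *m J *m Y^T = O *m g -> B = O *m Y.
Proof.
move=> YJ gu h; have JYu : J *m Y^T \in unitmx.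
  have /mulmx1_unit [] // : invmx g *m Y *m (J *m Y^T) = 1%:M.
  by rewrite -(mulmxA (invmx g)) (mulmxA Y) YJ mulVmx.
have E : B *m (J *m Y^T) = O *m Y *m (J *m Y^T) by rewrite mulmxA h -YJ !mulmxA.
by rewrite -[B](mulmxK JYu) E mulmxK.
Qed.

Lemma tr_sandwich (B J Y : 'M[R]_3) : J^T = J -> (B *m J *m Y^T)^T = Y *m J *m B^T.
Proof. by move=> JT; rewrite !trmx_mul trmxK JT mulmxA. Qed.

(** A C^2 isometric map into the hyperboloid satisfies the Gauss formula: its
    second derivatives are determined by their products with the frame, which are
    given by the derivatives of the metric (Koszul). Hence frame fields can be
    transported along changes of coordinates. *)
Lemma frame_pullback (V V' : set plane) (G G' : plane -> 'M[R]_2) (O U' : set plane)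
    (t : plane -> plane) (Y' : plane -> 'M[R]_3) :
  hyperbolic_metric V G -> hyperbolic_metric V' G' -> open O -> O `<=` V ->
  U' `<=` V' -> frame_field G' U' Y' ->
  (forall m, smooth O (fun v => t v 0 m)) -> (forall v, O v -> U' (t v)) ->
  (forall v, O v -> G v = tjac t v *m G' (t v) *m (tjac t v)^T) ->
  frame_field G O (fun v => pad (tjac t v) *m Y' (t v)).
Proof.
move=> hG hG' oO OV UV' fY' st tU GE.
have [oU' CY' jY' gY' pY'] := fY'.
pose Y v := pad (tjac t v) *m Y' (t v).
have Ct m : Ck 1 O (fun v => t v 0 m) by exact: st.
have CYt j c : Ck 1 O (fun v => Y' (t v) j c).
  exact: (@Ck1_comp O U' (fun w => Y' w j c) t oO oU' (CY' j c) Ct tU).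
have rowE (j : 'I_3) (i : 'I_2) c v : j = (if i == 0 then i0 else i1) ->
    Y v j c = partial i (fun w => t w 0 0) v * Y' (t v) i0 c +
      partial i (fun w => t w 0 1) v * Y' (t v) i1 c.
  have [-> | ->] : i = 0 \/ i = 1.
    by case: (i) => [[|[|//]] p]; [left|right]; exact/val_inj.
  - by move=> -> /=; rewrite /Y mulmx33 !padE /tjac !mxE mul0r addr0.
  - by move=> -> /=; rewrite /Y mulmx33 !padE /tjac !mxE mul0r addr0.
have row2E c v : Y v i2 c = Y' (t v) i2 c.
  by rewrite /Y mulmx33 !padE !mul0r !add0r mul1r.
have CY j c : Ck 1 O (fun v => Y v j c).
  have P i m : Ck 1 O (partial i (fun w => t w 0 m)) by exact: smooth_partial (st m) 1%N.
  move: j; elim/ord3P.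
  - apply: (Ck_ext oO (fun v _ => esym (rowE i0 0 c v erefl))).
    by apply: Ck_add => //; apply: Ck_mul.
  - apply: (Ck_ext oO (fun v _ => esym (rowE i1 1 c v erefl))).
    by apply: Ck_add => //; apply: Ck_mul.
  - by apply: (Ck_ext oO (fun v _ => esym (row2E c v))).
have gY v : O v -> Y v *m mink_mx *m (Y v)^T = gram G v.
  move=> Ov; rewrite (gram_pad (GE v Ov)) -(gY' _ (tU v Ov)) /Y.
  by rewrite trmx_mul !mulmxA.
have dF i c v : O v -> partial i (fun w => Y w i2 c) v = Y v (if i == 0 then i0 else i1) c.
  move=> Ov; rewrite (rowE _ i c v erefl).
  have [_ E] := derive_ext oO (fun w _ => esym (row2E c w)) Ov
    (Ck_der (i := i) (CYt i2 c) Ov).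
  rewrite E; have [_ ->] := @partial_comp O U' (fun w => Y' w i2 c) t v i oO oU' (CY' i2 c)
    Ct Ov (tU v Ov).
  have jE k : partial k (fun w => Y' w i2 c) (t v) = Y' (t v) (if k == 0 then i0 else i1) c.
    have /matrixP /(_ i2 c) := jY' k _ (tU v Ov); rewrite mxE => ->.
    rewrite mulmx33 !gauss_formE; have [-> | ->] : k = 0 \/ k = 1.
        by case: (k) => [[|[|//]] p]; [left|right]; exact/val_inj.
      by rewrite /= mul1r !mul0r !addr0.
    by rewrite /= mul1r !mul0r add0r addr0.
  by rewrite !jE.
have CF c : Ck 2 O (fun w => Y w i2 c).
  split=> [v Ov|i]; first exact: Ck_cts (CY i2 c) Ov.
  split=> [v Ov|]; first exact: Ck_der (CY i2 c) Ov.
  by apply: (Ck_ext oO (fun v Ov => esym (dF i c v Ov))); exact: CY.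
have symY c v : O v -> partial 0 (fun w => Y w i1 c) v = partial 1 (fun w => Y w i0 c) v.
  move=> Ov; have := schwarz oO (CF c) Ov.
  have [_ ->] := derive_ext oO (dF 1 c) Ov (Ck_der (i := 0) (Ck_partial 1 (CF c)) Ov).
  by have [_ ->] := derive_ext oO (dF 0 c) Ov (Ck_der (i := 1) (Ck_partial 0 (CF c)) Ov).
split=> //; last first.
  by move=> v Ov; rewrite -/(Y v) row2E; apply: pY'; exact: tU.
move=> i v Ov; rewrite -/Y; have Vv := OV _ Ov.
pose E i := jac Y i v *m mink_mx *m (Y v)^T - gauss_form G i v *m gram G v.
have sY k : smooth_entries v k Y by move=> j c; exact: Ck_der (CY j c) Ov.
have Eanti k : E k + (E k)^T = 0.
  have [a1 a2] := jac_mulmx (sY k) (proj1 (jac_cst mink_mx k v)).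
  have [b1 b2] := jac_tr (sY k).
  have [c1 c2] := jac_mulmx a1 b1.
  have [d1 d2] := gram_partial hG k Vv.
  have eq1 : jac (fun w => Y w *m mink_mx *m (Y w)^T) k v = jac (gram G) k v.
    apply/matrixP => p q; rewrite !mxE.
    have E0 w (Ow : O w) : gram G w p q = (Y w *m mink_mx *m (Y w)^T) p q.
      by rewrite gY.
    by have [_ e] := derive_ext oO E0 Ov (d1 p q); exact: e.
  rewrite c2 a2 b2 (proj2 (jac_cst mink_mx k v)) mulmx0 addr0 [jac (gram G) k v]d2 in eq1.
  have mT : mink_mx^T = mink_mx.
    by apply/matrixP => p q; rewrite !mxE eq_sym; case: eqP => // ->.
  have gT : (gram G v)^T = gram G v.
    by rewrite -(gY v Ov) tr_sandwich.
  rewrite /E linearB /= tr_sandwich// (trmx_mul _ (gram G v)) gT addrACA -opprD.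
  by rewrite eq1 subrr.
have Eent k j m : E k j m = - E k m j.
  have /matrixP /(_ j m) := Eanti k; rewrite !mxE => /eqP.
  by rewrite addr_eq0 => /eqP.
have jE k j m : (jac Y k v *m mink_mx *m (Y v)^T) j m =
    partial k (fun w => Y w j i0) v * Y v m i0 + partial k (fun w => Y w j i1) v * Y v m i1
    - partial k (fun w => Y w j i2) v * Y v m i2.
  by rewrite prod_entry [jac Y k v j i0]mxE [jac Y k v j i1]mxE [jac Y k v j i2]mxE.
have gE j m : (Y v *m mink_mx *m (Y v)^T) j m =
    Y v j i0 * Y v m i0 + Y v j i1 * Y v m i1 - Y v j i2 * Y v m i2.
  exact: prod_entry.
have E2 k m : E k i2 m = 0.
  rewrite /E sub_entry jE !dF// -gE gY// mulmx33 !gauss_formE.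
  have [-> | ->] : k = 0 \/ k = 1.
      by case: (k) => [[|[|//]] p]; [left|right]; exact/val_inj.
    by rewrite /= mul1r !mul0r !addr0 subrr.
  by rewrite /= mul1r !mul0r add0r addr0 subrr.
have Ediag k j : E k j j = 0.
  by have := Eent k j j => h; lra.
have Esym m : E 0 i1 m = E 1 i0 m.
  have gg : (gauss_form G 0 v *m gram G v) i1 m = (gauss_form G 1 v *m gram G v) i0 m.
    by rewrite !mulmx33 !gauss_formE !(christoffel_sym hG _ Vv) (metric_symm hG Vv).
  apply: etrans (sub_entry _ _ _ _) _; apply: etrans _ (esym (sub_entry _ _ _ _)).
  congr (_ - _); last exact: gg.
  apply: etrans (jE 0 i1 m) _; apply: etrans _ (esym (jE 1 i0 m)).
  by rewrite (symY i0 v Ov) (symY i1 v Ov) (symY i2 v Ov).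
have E010 : E 0 i1 i0 = 0 by rewrite Esym Ediag.
have E101 : E 1 i0 i1 = 0 by rewrite -Esym Ediag.
have E0 : E i = 0.
  apply/matrixP => j m; rewrite [RHS]mxE; move: j m.
  have [-> | ->] : i = 0 \/ i = 1.
    by case: (i) => [[|[|//]] p]; [left|right]; exact/val_inj.
  - elim/ord3P; elim/ord3P; rewrite ?E2 ?Ediag ?E010//.
    + by rewrite Eent E010 oppr0.
    + by rewrite Eent E2 oppr0.
    + by rewrite Eent E2 oppr0.
  - elim/ord3P; elim/ord3P; rewrite ?E2 ?Ediag ?E101//.
    + by rewrite Eent E2 oppr0.
    + by rewrite Eent E101 oppr0.
    + by rewrite Eent E2 oppr0.
have gu := gram_unit hG Vv.
exact: (frame_cancel (gY v Ov) gu (subr0_eq E0)).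
Qed.

End Coordinates.

Section Inverse.
Context {R : realType}.
Local Notation plane := 'rV[R]_2.

Lemma near_ball_R (P : R -> Prop) (t : R) : (\forall s \near t, P s) ->
  exists2 r : R, 0 < r & forall s, `|s - t| < r -> P s.
Proof.
move=> /nbhs_ballP[r /= r0 h]; exists r => // s sr; apply: h.
by rewrite /ball/= distrC.
Qed.

Lemma is_deriveP m n (f : R -> 'M[R]_(m, n)) (s : R) d :
  is_derive s 1 f d <-> forall e : R, 0 < e -> exists2 r : R, 0 < r &
    forall h, `|h| < r -> `|f (s + h) - f s - h *: d| <= e * `|h|.
Proof.
have E h : h != 0 -> d - h^-1 *: (f (h *: 1 + s) - f s)
      = - (h^-1 *: (f (s + h) - f s - h *: d)).
  move=> h0; rewrite [h *: 1]mulr1 (addrC h) (scalerBr h^-1 (_ - _)) scalerA mulVf//.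
  by rewrite scale1r opprB.
split=> [[df dE] e e0|H].
  have cv : h^-1 *: (f (h *: 1 + s) - f s) @[h --> 0^'] --> d by rewrite -dE.
  move: cv => /cvgrPdist_le /(_ _ e0); rewrite near_withinE near_simpl => hn.
  have /near_ball_R[r r0 hr] : \forall h \near (0 : R), h != 0 ->
     `|d - h^-1 *: (f (h *: 1 + s) - f s)| <= e by exact: hn.
  exists r => // h hh; have [->|h0] := eqVneq h 0.
    by rewrite addr0 subrr scale0r subr0 !normr0 mulr0.
  have : `|h - 0| < r by rewrite subr0.
  move=> /hr /(_ h0); rewrite E// normrN normrZ normfV ler_pdivrMl ?normr_gt0//.
  by rewrite mulrC.
have cv : h^-1 *: (f (h *: 1 + s) - f s) @[h --> 0^'] --> d.
  apply/cvgrPdist_le => e e0; have [r r0 hr] := H _ e0; near=> h.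
  have h0 : h != 0 by near: h; exact: nbhs_dnbhs_neq.
  have hhr : `|h| < r by near: h; exact: dnbhs0_lt.
  rewrite E// normrN normrZ normfV ler_pdivrMl ?normr_gt0// mulrC.
  exact: hr.
split; first by apply/cvg_ex; exists d.
exact: cvg_lim.
Unshelve. all: by end_near. Qed.

Definition invertible_near (f : plane -> plane) (v0 : plane) (r d L : R)
    (h : plane -> plane) : Prop :=
  [/\ h (f v0) = v0,
      forall y, `|y - f v0| < d -> `|h y - v0| < r /\ f (h y) = y,
      forall u, `|u - v0| < r -> h (f u) = u &
      forall u u', `|u - v0| < r -> `|u' - v0| < r -> `|u - u'| <= L * `|f u - f u'|].

Lemma linear_approx (V : set plane) (f : plane -> plane) v0 (e : R) :
  open V -> (forall m, Ck 1 V (fun w => f w 0 m)) -> V v0 -> 0 < e ->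
  exists2 r : R, 0 < r & forall u u', `|u - v0| < r -> `|u' - v0| < r ->
    `|f u - f u' - (u - u') *m tjac f v0| <= e * `|u - u'|.
Proof.
move=> oV Cf Vv0 e0; have e2 : 0 < e / 2 by rewrite divr_gt0.
have [r r0 hr] : exists2 r : R, 0 < r & forall w, `|w - v0| < r ->
    V w /\ forall im : 'I_2 * 'I_2, `|partial im.1 (fun w => f w 0 im.2) v0 -
      partial im.1 (fun w => f w 0 im.2) w| <= e / 2.
  have c0 (im : 'I_2 * 'I_2) : \forall w \near v0,
      `|partial im.1 (fun w => f w 0 im.2) v0 - partial im.1 (fun w => f w 0 im.2) w| <= e / 2.
    have := Ck_cts (Ck_partial im.1 (Cf im.2)) Vv0.
    by move=> /cvgrPdist_le; apply.
  apply: near_ball_plane; near=> w; split; first by near: w; exact: open_nbhs_nbhs.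
  by near: w; exact: filter_forall.
exists r => // u u' ur ur'.
pose D := u - u'.
pose c (x : R) := u' + x *: D.
have cr (x : R) : 0 <= x <= 1 -> `|c x - v0| < r.
  move=> /andP[x0 x1].
  have -> : c x - v0 = (1 - x) *: (u' - v0) + x *: (u - v0).
    by apply/rowP => k; rewrite /c /D !mxE; ring.
  have h1 : `|(1 - x) *: (u' - v0)| = (1 - x) * `|u' - v0|.
    by rewrite normrZ ger0_norm// subr_ge0.
  have h2 : `|x *: (u - v0)| = x * `|u - v0| by rewrite normrZ ger0_norm.
  rewrite (le_lt_trans (ler_normD _ _))// h1 h2.
  have [x00|x00] := eqVneq x 0; first by rewrite x00 subr0 mul1r mul0r addr0.
  have a1 : x * `|u - v0| < x * r by rewrite ltr_pM2l// lt_neqAle eq_sym x00.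
  have a2 : (1 - x) * `|u' - v0| <= (1 - x) * r by rewrite ler_wpM2l ?subr_ge0// ltW.
  move: a1 a2; clear; move: (x * _) ((1 - x) * `|_|) => p q.
  by rewrite mulrBl mul1r; lra.
have dc (x : R) : is_derive x 1 c D.
  have d := is_derive_scale D x.
  by have := is_deriveD (is_derive_cst u' x 1) d; rewrite add0r.
pose phi (x : R) := f (c x) - x *: (D *m tjac f v0).
pose dphi (x : R) : plane := \row_m (D 0 0 * (partial 0 (fun w => f w 0 m) (c x) -
    partial 0 (fun w => f w 0 m) v0) +
  D 0 1 * (partial 1 (fun w => f w 0 m) (c x) - partial 1 (fun w => f w 0 m) v0)).
have dp (x : R) : 0 <= x <= 1 -> is_derive x 1 phi (dphi x).
  move=> xI; apply/is_derive_mx => a m; rewrite (ord1 a).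
  have Vc : V (c x) by have [] := hr _ (cr x xI).
  have h1 := chain_curve oV (Cf m) Vc (dc x).
  have h2 := (is_derive_mx _ _ _).1 (is_derive_scale (D *m tjac f v0) x) 0 m.
  have := is_deriveB h1 h2; rewrite mulmx22 /tjac ![(\matrix_(_, _) _) _ _]mxE => h3.
  rewrite !mulrBr addrACA -opprD.
  have -> : (fun x => phi x 0 m) = (fun x => (f (c x)) 0 m) \- (fun x => (x *: (D *m tjac f v0)) 0 m).
    by apply/funext => y; rewrite /phi [LHS]mxE [X in _ + X]mxE.
  exact: h3.
have e0' := ltW e0.
have : `|phi 1 - phi 0| <= e * `|D| * (1 - 0).
  apply: (mvt_ineq (df := dphi)) => //.
  - by rewrite mulr_ge0.
  - by move=> x /andP[/ltW x0 /ltW x1]; apply: dp; rewrite x0.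
  - by apply: (derive_within (df := dphi)) => x; exact: dp.
  - move=> x /andP[/ltW x0 /ltW x1]; have xI : 0 <= x <= 1 by rewrite x0.
    have [_ hp] := hr _ (cr x xI).
    apply: mxnorm_le => [|a m]; first by rewrite mulr_ge0.
    rewrite mxE; apply: (le_trans (ler_normD _ _)); rewrite !normrM.
    have p0 := hp (0, m); have p1 := hp (1, m); rewrite distrC in p0; rewrite distrC in p1.
    have b0 := entry_le D 0; have b1 := entry_le D 1.
    have q0 := ler_pM (normr_ge0 _) (normr_ge0 _) b0 p0.
    have q1 := ler_pM (normr_ge0 _) (normr_ge0 _) b1 p1.
    apply: (le_trans (lerD q0 q1)).
    by rewrite -mulrDr -splitr mulrC.
rewrite subr0 mulr1; congr (`|_| <= _).
rewrite /phi /c !scale1r !scale0r subr0 addr0 (_ : u' + D = u); last by rewrite /D addrC subrK.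
by rewrite addrAC.
Unshelve. all: by end_near. Qed.

(** The inverse function theorem, by Newton's iteration with the derivative
    frozen at the base point. *)
Lemma local_inverse (V : set plane) (f : plane -> plane) v0 :
  open V -> (forall m, Ck 1 V (fun w => f w 0 m)) -> V v0 -> tjac f v0 \in unitmx ->
  forall r1 : R, 0 < r1 -> exists r d L h, [/\ 0 < r <= r1, 0 < d, 0 <= L &
    invertible_near f v0 r d L h].
Proof.
move=> oV Cf Vv0 Ju r1 r10; set J := tjac f v0 in Ju.
pose K := 2 * `|invmx J|; have K0 : 0 <= K by rewrite mulr_ge0.
pose e := (2 * (K + 1))^-1; have e0 : 0 < e by rewrite invr_gt0; lra.
have Ke : K * e <= 2^-1.
  by rewrite /e invfM mulrCA ler_piMr// ler_pdivrMr; lra.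
have [r2 r20 approx] := linear_approx oV Cf Vv0 e0.
pose r := Num.min r1 r2; have r0 : 0 < r by rewrite lt_min r10.
have mK (w : plane) : `|w *m invmx J| <= K * `|w|.
  by have := mulmx_norm w (invmx J); rewrite mulrAC.
have contr u u' : `|u - v0| < r -> `|u' - v0| < r ->
    `|(u - u') - (f u - f u') *m invmx J| <= `|u - u'| / 2.
  rewrite /r !lt_min => /andP[_ h1] /andP[_ h2].
  have -> : (u - u') - (f u - f u') *m invmx J =
      - ((f u - f u' - (u - u') *m J) *m invmx J).
    by rewrite [in RHS]mulmxBl mulmxK// opprB.
  rewrite normrN (le_trans (mK _))//.
  have /(ler_wpM2l K0) h := approx _ _ h1 h2.
  apply: (le_trans h); rewrite mulrA [leRHS]mulrC ler_wpM2r//.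
have lip u u' : `|u - v0| < r -> `|u' - v0| < r -> `|u - u'| <= 2 * K * `|f u - f u'|.
  move=> h1 h2; have c := contr _ _ h1 h2; have m := mK (f u - f u').
  have := ler_normB (u - u' - (f u - f u') *m invmx J) (- ((f u - f u') *m invmx J)).
  by rewrite opprK subrK normrN; lra.
pose d := r / (8 * (K + 1)); have d0 : 0 < d by rewrite divr_gt0//; lra.
have Kd (y : plane) : `|y - f v0| < d -> `|(y - f v0) *m invmx J| <= r / 8.
  move=> yd; apply: le_trans (mK _) _; apply: (le_trans (ler_wpM2l K0 (ltW yd))).
  rewrite /d invfM mulrCA ler_wpM2l// ?(ltW r0)//.
  by rewrite mulrCA ler_piMr// ler_pdivrMr; lra.
have sol (y : plane) : `|y - f v0| < d -> exists u, `|u - v0| < r /\ f u = y.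
  move=> yd; have k8 := Kd _ yd.
  pose T u := u + (y - f u) *m invmx J.
  pose U n := iter n T v0.
  have TE u u' : T u - T u' = (u - u') - (f u - f u') *m invmx J.
    by rewrite /T !mulmxBl; apply/rowP => k; rewrite !mxE; ring.
  have p2 n : 0 < (2^-1 ^+ n : R) by rewrite exprn_gt0// invr_gt0.
  have stepU n : `|U n - v0| <= r / 4 * (1 - 2^-1 ^+ n) /\ `|U n.+1 - U n| <= r / 8 * 2^-1 ^+ n.
    elim: n => [|n [I1 I2]].
      rewrite /U /= subrr normr0 expr0 subrr mulr0; split=> //.
      by rewrite mulr1 /T addrC addKr.
    have h1 : `|U n.+1 - v0| <= r / 4 * (1 - 2^-1 ^+ n.+1).
      have := ler_normD (U n.+1 - U n) (U n - v0); rewrite addrA subrK.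
      rewrite exprS => h; apply: le_trans h _; move: I1 I2; clear.
      move: (`|_|) (`|_|) (2^-1 ^+ n) => a b c; lra.
    split=> //.
    have lt m : r / 4 * (1 - 2^-1 ^+ m) < r.
      have rc : 0 < r * 2^-1 ^+ m by rewrite mulr_gt0.
      by move: rc; move: (2^-1 ^+ m) => c; rewrite mulrBr mulr1 (mulrAC r); lra.
    have := contr _ _ (le_lt_trans h1 (lt _)) (le_lt_trans I1 (lt _)).
    rewrite -TE -[T (U n.+1)]/(U n.+2) -[T (U n)]/(U n.+1) => h; apply: le_trans h _.
    by rewrite exprS; move: I2; clear; move: (`|_|) (2^-1 ^+ n) => a c; lra.
  have geo N k : `|U (N + k)%N - U N| <= r / 4 * 2^-1 ^+ N * (1 - 2^-1 ^+ k).
    elim: k => [|k IH]; first by rewrite addn0 subrr normr0 expr0 subrr mulr0.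
    rewrite addnS; have [_ h] := stepU (N + k)%N.
    have := ler_normD (U (N + k).+1 - U (N + k)%N) (U (N + k)%N - U N); rewrite addrA subrK.
    move=> h'; apply: le_trans h' _; apply: (le_trans (lerD h IH)).
    rewrite exprD exprS; move: (2^-1 ^+ N) (2^-1 ^+ k) => a c.
    by rewrite le_eqVlt; apply/orP; left; apply/eqP; field.
  have [l hl] : exists l : plane, forall N, `|l - U N| <= r / 4 * 2^-1 ^+ N.
    have [|l hl] := @geometric_cvg R _ _ U (r / 4); last by exists l.
    move=> N k; apply: le_trans (geo N k) _; rewrite ler_piMr//.
    by rewrite mulr_ge0 ?(ltW (p2 _))//; lra.
  have lr : `|l - v0| < r by have := hl 0%N; rewrite /U /= expr0; lra.
  exists l; split=> //.
  have Tl : `|T l - l| <= 0.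
    apply/ler_addgt0Pr => eps eps0; rewrite add0r.
    have [N hN] := @geometric_small R (r / 4 * 2) eps eps0.
    have [h1 h2] := stepU N.
    have Ur : `|U N - v0| < r.
      apply: le_lt_trans h1 _; have rc : 0 < r * 2^-1 ^+ N by rewrite mulr_gt0.
      by move: rc; move: (2^-1 ^+ N) => c; rewrite mulrBr mulr1 (mulrAC r); lra.
    have c := contr _ _ lr Ur; rewrite -TE -[T (U N)]/(U N.+1) in c.
    have := ler_normD (T l - U N.+1) (U N.+1 - l); rewrite addrA subrK.
    have := hl N; have := hl N.+1; rewrite (distrC l (U N.+1)) exprS.
    move: hN c (normr_ge0 (l - U N)); clear; lra.
  have : (y - f l) *m invmx J = 0.
    by move: Tl; rewrite normr_le0 /T addrC addKr => /eqP.
  move=> /(congr1 (mulmx^~ J)); rewrite mul0mx mulmxKV// => /subr0_eq -> //.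
pose h y := if pselect (exists u, `|u - v0| < r /\ f u = y) is left H then projT1 (cid H) else v0.
have hP y u : `|u - v0| < r -> f u = y -> `|h y - v0| < r /\ f (h y) = y.
  move=> ur fu; rewrite /h; case: pselect => [H|[]]; last by exists u.
  exact: projT2 (cid H).
have hK u : `|u - v0| < r -> h (f u) = u.
  move=> ur; have [a b] := hP _ _ ur erefl.
  apply/eqP; rewrite -subr_eq0 -normr_le0; have := lip _ _ a ur.
  by rewrite b subrr normr0 mulr0.
exists r, d, (2 * K), h; split=> //.
- by rewrite r0 /r ge_min lexx.
- lra.
split=> //; first by apply: hK; rewrite subrr normr0.
by move=> y /sol[u [ur fu]]; exact: hP ur fu.
Qed.

(** The inverse is Lipschitz, so the first order expansion of [f] along the curve
    can be solved for the increment of the lifted curve. *)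
Lemma inverse_curve (V : set plane) (f : plane -> plane) v0 r d L h (y : R -> plane)
    (t : R) dy :
  open V -> (forall m, Ck 1 V (fun w => f w 0 m)) ->
  invertible_near f v0 r d L h -> 0 <= L -> `|y t - f v0| < d -> V (h (y t)) ->
  tjac f (h (y t)) \in unitmx -> is_derive t 1 y dy ->
  is_derive t 1 (fun s => h (y s)) (dy *m invmx (tjac f (h (y t)))).
Proof.
move=> oV Cf [hv0 hf hK lip] L0 yd Vh Ju dyt.
set v1 := h (y t); set J := tjac f v1 in Ju *.
have [hv1 fv1] := hf _ yd; rewrite -/v1 in hv1 fv1.
apply/is_deriveP => e e0.
pose K := 2 * `|invmx J|; have K0 : 0 <= K by rewrite mulr_ge0.
pose D := `|dy| + 1; have D0 : 0 < D by rewrite ltr_wpDl.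
pose e1 := e / (2 * (K + 1) * (L + 1) * D).
have e10 : 0 < e1 by rewrite divr_gt0// !mulr_gt0//; lra.
pose e2 := Num.min 1 (e / (2 * (K + 1))).
have e20 : 0 < e2 by rewrite lt_min ltr01 divr_gt0//; lra.
have [r1 r10 ap] := linear_approx oV Cf Vh e10.
have [r2 r20 hy] := (is_deriveP _ _ _).1 dyt _ e20.
pose m := Num.min (d - `|y t - f v0|) (r1 / (L + 1)).
have m0 : 0 < m by rewrite lt_min subr_gt0 yd divr_gt0//; lra.
exists (Num.min r2 (m / D)) => [|s]; first by rewrite lt_min r20 divr_gt0.
rewrite lt_min => /andP[s2 sm]; have hs := hy _ s2.
have yD : `|y (t + s) - y t| <= D * `|s|.
  have := ler_normD (y (t + s) - y t - s *: dy) (s *: dy); rewrite subrK normrZ => h1.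
  apply: le_trans h1 _; rewrite /D mulrDl mul1r addrC (mulrC `|s|) lerD2l.
  by apply: le_trans hs _; rewrite ler_piMl// ge_min lexx.
have ym : `|y (t + s) - y t| < m.
  by apply: le_lt_trans yD _; rewrite mulrC -ltr_pdivlMr.
have [yd' yr1] : `|y (t + s) - y t| < d - `|y t - f v0| /\ `|y (t + s) - y t| < r1 / (L + 1).
  by move: ym; rewrite lt_min => /andP.
have yds : `|y (t + s) - f v0| < d.
  by have := ler_normD (y (t + s) - y t) (y t - f v0); rewrite addrA subrK; lra.
have [hu fu] := hf _ yds; set u := h (y (t + s)) in hu fu *.
have uL : `|u - v1| <= L * `|y (t + s) - y t|.
  by have := lip _ _ hu hv1; rewrite fu fv1.
have ur1 : `|u - v1| < r1.
  apply: le_lt_trans uL _; have : `|y (t + s) - y t| * (L + 1) < r1.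
    by rewrite -ltr_pdivlMr//; lra.
  have := normr_ge0 (y (t + s) - y t); clear -L0; move: `|_| => a; nra.
have v11 : `|v1 - v1| < r1 by rewrite subrr normr0.
have := ap _ _ ur1 v11; rewrite fu fv1 -/J => ap1.
have -> : u - v1 - s *: (dy *m invmx J) =
    ((y (t + s) - y t - s *: dy) - (y (t + s) - y t - (u - v1) *m J)) *m invmx J.
  have -> : (y (t + s) - y t - s *: dy) - (y (t + s) - y t - (u - v1) *m J) =
     (u - v1) *m J - s *: dy by rewrite opprB addrC addrA subrK.
  by rewrite mulmxBl mulmxK// scalemxAl.
have mK (w : plane) : `|w *m invmx J| <= K * `|w|.
  by have := mulmx_norm w (invmx J); rewrite mulrAC.
apply: le_trans (mK _) _; apply: (le_trans (ler_wpM2l K0 (ler_normB _ _))).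
have b1 : K * `|y (t + s) - y t - s *: dy| <= e / 2 * `|s|.
  apply: (@le_trans _ _ (K * (e / (2 * (K + 1)) * `|s|))).
    rewrite ler_wpM2l//; apply: le_trans hs _; rewrite ler_wpM2r//.
    by rewrite ge_min lexx orbT.
  rewrite mulrA ler_wpM2r// mulrA ler_pdivrMr; last by lra.
  by clear -K0 e0; nra.
have b2 : K * `|y (t + s) - y t - (u - v1) *m J| <= e / 2 * `|s|.
  apply: (@le_trans _ _ (K * (e1 * ((L + 1) * (D * `|s|))))).
    rewrite ler_wpM2l//; apply: le_trans ap1 _; rewrite ler_wpM2l ?(ltW e10)//.
    apply: le_trans uL _; apply: ler_pM => //; lra.
  have -> : K * (e1 * ((L + 1) * (D * `|s|))) = (K / (K + 1)) * (e / 2 * `|s|).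
    by rewrite /e1; field; rewrite !gt_eqF//; lra.
  by rewrite ler_piMl ?mulr_ge0// ?(ltW e0)// ?ler_pdivrMr; lra.
by rewrite mulrDr; lra.
Qed.

End Inverse.

(** * The hyperboloid model of the hyperbolic plane *)

Section Hyperboloid.
Context {R : realType}.
Local Notation space := 'rV[R]_3.
Local Notation mink_mx := (@mink_mx R).
Local Notation x0 v := (v 0 i0).
Local Notation x1 v := (v 0 i1).
Local Notation x2 v := (v 0 i2).

(** Minus the Minkowski form: between points of the hyperboloid it is the
    hyperbolic cosine of the distance. *)
Definition lor (v w : space) : R := x2 v * x2 w - x0 v * x0 w - x1 v * x1 w.

Definition hyp : set space := [set v | lor v v = 1 /\ 0 < x2 v].

Definition row3 (a b c : R) : space :=
  \row_j if j == i0 then a else if j == i1 then b else c.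

Definition orig : space := row3 0 0 1.

Lemma row3E a b c : ((x0 (row3 a b c) = a) * (x1 (row3 a b c) = b) *
  (x2 (row3 a b c) = c))%type.
Proof. by do !split; rewrite mxE. Qed.

Lemma row3P (v w : space) : x0 v = x0 w -> x1 v = x1 w -> x2 v = x2 w -> v = w.
Proof. by move=> h0 h1 h2; apply/rowP; apply: ord3P. Qed.

Lemma rowDE (v w : space) i : (v + w) 0 i = v 0 i + w 0 i. Proof. by rewrite mxE. Qed.
Lemma rowZE a (v : space) i : (a *: v) 0 i = a * v 0 i. Proof. by rewrite mxE. Qed.
Lemma rowNE (v : space) i : (- v) 0 i = - v 0 i. Proof. by rewrite mxE. Qed.
Definition vecE := (rowDE, rowZE, rowNE).

Lemma lorC v w : lor v w = lor w v.
Proof. by rewrite /lor; ring. Qed.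

Lemma lorDl u v w : lor (u + v) w = lor u w + lor v w.
Proof. by rewrite /lor !vecE; ring. Qed.

Lemma lorZl a v w : lor (a *: v) w = a * lor v w.
Proof. by rewrite /lor !vecE; ring. Qed.

Lemma lorDr u v w : lor w (u + v) = lor w u + lor w v.
Proof. by rewrite lorC lorDl !(lorC w). Qed.

Lemma lorZr a v w : lor w (a *: v) = a * lor w v.
Proof. by rewrite lorC lorZl lorC. Qed.

Lemma lorNl v w : lor (- v) w = - lor v w.
Proof. by rewrite /lor !vecE; ring. Qed.

Lemma lor_orig v : lor orig v = x2 v.
Proof. by rewrite /lor !row3E; ring. Qed.

Lemma hyp_orig : hyp orig.
Proof. by rewrite /hyp /= lor_orig row3E. Qed.

Lemma det33 (M : 'M[R]_3) : \det M =
  M i0 i0 * (M i1 i1 * M i2 i2 - M i1 i2 * M i2 i1)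
  - M i0 i1 * (M i1 i0 * M i2 i2 - M i1 i2 * M i2 i0)
  + M i0 i2 * (M i1 i0 * M i2 i1 - M i1 i1 * M i2 i0).
Proof.
rewrite (expand_det_row _ i0) sum3 /cofactor !det2 !mxE /=.
rewrite (_ : lift i0 0 = i1); last exact/val_inj.
rewrite (_ : lift i0 1 = i2); last exact/val_inj.
rewrite (_ : lift i1 0 = i0); last exact/val_inj.
rewrite (_ : lift i1 1 = i2); last exact/val_inj.
rewrite (_ : lift i2 0 = i0); last exact/val_inj.
rewrite (_ : lift i2 1 = i1); last exact/val_inj.
have -> : (-1 : R) ^+ (i0 + i0) = 1 by [].
have -> : (-1 : R) ^+ (i0 + i1) = -1 by [].
have -> : (-1 : R) ^+ (i0 + i2) = 1 by rewrite -signr_odd.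
move: (M i0 i0) (M i0 i1) (M i0 i2) (M i1 i0) (M i1 i1) (M i1 i2) (M i2 i0) (M i2 i1)
  (M i2 i2) => *; ring.
Qed.

Lemma lorE (v w : space) : lor v w = - (v *m mink_mx *m w^T) 0 0.
Proof.
have tr p q : w^T p q = w q p by rewrite mxE.
by rewrite !mulmx33 !tr !mink_mxE /lor; ring.
Qed.

(** ** Orientation-preserving isometries *)

Definition isom (M : 'M[R]_3) : Prop :=
  [/\ M *m mink_mx *m M^T = mink_mx, 0 < \det M & 0 < M i2 i2].

Lemma mink_preserve (M : 'M[R]_3) (v w : space) : M *m mink_mx *m M^T = mink_mx ->
  lor (v *m M) (w *m M) = lor v w.
Proof.
by move=> h; rewrite !lorE trmx_mul -!mulmxA (mulmxA mink_mx) (mulmxA M) mulmxA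
  (mulmxA M) h !mulmxA.
Qed.

Lemma isom_lor M v w : isom M -> lor (v *m M) (w *m M) = lor v w.
Proof. by case=> h _ _; exact: mink_preserve. Qed.

Lemma hyp_pos v : hyp v -> 1 <= x2 v.
Proof. by rewrite /hyp /lor /= => -[h1 h2]; nra. Qed.

(** The Gram determinant is the square of the determinant. *)
Lemma gram_det (u v w : space) : 
  lor u u * lor v v * lor w w + 2 * lor u v * lor v w * lor u w
  - lor u u * lor v w ^+ 2 - lor v v * lor u w ^+ 2 - lor w w * lor u v ^+ 2 =
  (x0 u * (x1 v * x2 w - x2 v * x1 w) - x1 u * (x0 v * x2 w - x2 v * x0 w)
   + x2 u * (x0 v * x1 w - x1 v * x0 w)) ^+ 2.
Proof. by rewrite /lor; ring. Qed.

Lemma cauchy (a b c d e f : R) : 0 < e -> 0 < f -> e ^+ 2 = 1 + a ^+ 2 + b ^+ 2 ->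
  f ^+ 2 = 1 + c ^+ 2 + d ^+ 2 -> 1 <= e * f - a * c - b * d.
Proof.
move=> e0 f0 h1 h2.
have h : (1 + (a * c + b * d)) ^+ 2 <= (e * f) ^+ 2.
  rewrite exprMn h1 h2 -subr_ge0.
  rewrite (_ : _ - _ = (a - c) ^+ 2 + (b - d) ^+ 2 + (a * d - b * c) ^+ 2); last by ring.
  by rewrite !addr_ge0 ?sqr_ge0.
have : 1 + (a * c + b * d) <= e * f.
  have ef : 0 < e * f by rewrite mulr_gt0.
  by nra.
lra.
Qed.

Lemma hyp_sq v : hyp v -> x2 v ^+ 2 = 1 + x0 v ^+ 2 + x1 v ^+ 2.
Proof. by rewrite /hyp /lor /= => -[h1 h2]; rewrite !expr2; lra. Qed.

Lemma lor_ge1 v w : hyp v -> hyp w -> 1 <= lor v w.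
Proof.
move=> hv hw; apply: cauchy (hyp_sq hv) (hyp_sq hw); first by case: hv.
by case: hw.
Qed.

Lemma lor_eq1 v w : hyp v -> hyp w -> lor v w <= 1 -> v = w.
Proof.
move=> hv hw h; have e : lor v w = 1 by apply/le_anti; rewrite h lor_ge1.
have p : 0 < x2 v by case: hv. have q : 0 < x2 w by case: hw.
have sv := hyp_sq hv; have sw := hyp_sq hw.
have E : (x0 v - x0 w) ^+ 2 + (x1 v - x1 w) ^+ 2 + (x0 v * x1 w - x1 v * x0 w) ^+ 2 = 0.
  have : (x2 v * x2 w) ^+ 2 = (1 + x0 v * x0 w + x1 v * x1 w) ^+ 2.
    by congr (_ ^+ 2); move: e; rewrite /lor; lra.
  by rewrite exprMn sv sw => E; move: E; rewrite !expr2; lra.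
move: E => /eqP; rewrite paddr_eq0 ?addr_ge0 ?sqr_ge0// => /andP[].
rewrite paddr_eq0 ?sqr_ge0// !sqrf_eq0 !subr_eq0 => /andP[/eqP a /eqP b] _.
apply: row3P => //; have : x2 v ^+ 2 = x2 w ^+ 2 by rewrite sv sw a b.
by move=> /eqP; rewrite eqrXn2 ?ltW// => /eqP.
Qed.

Lemma hyp_mink (M : 'M[R]_3) (v : space) : M *m mink_mx *m M^T = mink_mx ->
  0 < M i2 i2 -> hyp v -> hyp (v *m M).
Proof.
move=> h p hv; split; first by rewrite mink_preserve//; case: hv.
have oM : lor (orig *m M) (orig *m M) = 1 by rewrite mink_preserve//; case: hyp_orig.
have oMi j : (orig *m M) 0 j = M i2 j.
  by rewrite mulmx33 !row3E; ring.
have ho : hyp (orig *m M) by split=> //; rewrite oMi.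
have e : lor (v *m M) (orig *m M) = x2 v by rewrite mink_preserve// lorC lor_orig.
have v1 := hyp_pos hv.
rewrite ltNge; apply/negP => neg.
have [n0|n0] : x2 (v *m M) = 0 \/ x2 (v *m M) < 0.
    by move: neg; rewrite le_eqVlt => /orP[/eqP|]; [left|right].
  have := mink_preserve v v h; case: (hv) => -> _; rewrite /lor n0.
  by have := sqr_ge0 (x0 (v *m M)); have := sqr_ge0 (x1 (v *m M)); rewrite !expr2; lra.
have hn : hyp (- (v *m M)).
  split; last by rewrite vecE; lra.
  by rewrite lorNl lorC lorNl opprK mink_preserve//; case: hv.
have := lor_ge1 hn ho; rewrite lorNl e; lra.
Qed.

Lemma isom_hyp M v : isom M -> hyp v -> hyp (v *m M).
Proof. by case=> h _ p; exact: hyp_mink. Qed.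

Lemma orig_mul (M : 'M[R]_3) : orig *m M = row i2 M.
Proof. by apply/rowP => j; rewrite mulmx33 !row3E mxE; ring. Qed.

Lemma isom_of_point (M : 'M[R]_3) p : M *m mink_mx *m M^T = mink_mx -> 0 < \det M ->
  hyp p -> hyp (p *m M) -> isom M.
Proof.
move=> h d hp hpM; split=> //.
have e : lor (p *m M) (orig *m M) = x2 p by rewrite mink_preserve// lorC lor_orig.
have oMi j : (orig *m M) 0 j = M i2 j by rewrite orig_mul mxE.
have oM : lor (orig *m M) (orig *m M) = 1 by rewrite mink_preserve//; case: hyp_orig.
have p1 := hyp_pos hp.
rewrite ltNge; apply/negP => neg.
have [n0|n0] : M i2 i2 = 0 \/ M i2 i2 < 0.
    by move: neg; rewrite le_eqVlt => /orP[/eqP|]; [left|right].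
  move: oM; rewrite /lor !oMi n0.
  by have := sqr_ge0 (M i2 i0); have := sqr_ge0 (M i2 i1); rewrite !expr2; lra.
have hn : hyp (- (orig *m M)).
  split; last by rewrite vecE oMi; lra.
  by rewrite lorNl lorC lorNl opprK.
have := lor_ge1 hpM hn; rewrite lorC lorNl lorC e; lra.
Qed.

Lemma isom1 : isom 1%:M.
Proof. by split; rewrite ?mul1mx ?trmx1 ?mulmx1 ?det1// mxE. Qed.

Lemma isomM M N : isom M -> isom N -> isom (M *m N).
Proof.
move=> iM iN; apply: (@isom_of_point _ orig).
- case: iM => h _ _; case: iN => h' _ _.
  by rewrite trmx_mul mulmxA -(mulmxA _ N) -(mulmxA M) h' h.
- by rewrite det_mulmx mulr_gt0//; [case: iM|case: iN].
- exact: hyp_orig.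
- by rewrite mulmxA; apply: isom_hyp iN _; apply: isom_hyp iM hyp_orig.
Qed.

Lemma isom_unit M : isom M -> M \in unitmx.
Proof. by case=> _ d _; rewrite unitmxE unitfE gt_eqF. Qed.

Lemma isomV M : isom M -> isom (invmx M).
Proof.
move=> iM; have Mu := isom_unit iM.
have iMo : invmx M *m mink_mx *m (invmx M)^T = mink_mx.
  case: (iM) => h _ _; rewrite -[in LHS]h !mulmxA mulVmx// mul1mx -mulmxA -trmx_mul.
  by rewrite mulVmx// trmx1 mulmx1.
apply: (@isom_of_point _ (orig *m M)) => //.
- by rewrite det_inv invr_gt0; case: iM.
- exact: isom_hyp iM hyp_orig.
- by rewrite -mulmxA mulmxV// mulmx1; exact: hyp_orig.
Qed.

Lemma lor_invmx M v w : isom M -> lor (v *m invmx M) w = lor v (w *m M).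
Proof.
by move=> iM; rewrite -(isom_lor _ _ iM) mulmxKV//; exact: isom_unit.
Qed.

(** A certificate for deducing an equation from two others, to be checked by
    [ring]. *)
Lemma lc (k l x y p q p' q' : R) : x - y = k * (p - q) + l * (p' - q') ->
  p = q -> p' = q' -> x = y.
Proof. by move=> h e e'; apply: subr0_eq; rewrite h e e' !subrr !mulr0 addr0. Qed.

(** The boost along the segment from the origin to [v]. *)
Lemma hyp_transitive v : hyp v -> exists2 M, isom M & orig *m M = v.
Proof.
move=> hv; have v0 : 1 + x2 v != 0 by case: (hv) => _ p; rewrite gt_eqF// ltr_wpDl.
have sv := hyp_sq hv.
pose a : R := x0 v; pose b : R := x1 v; pose c : R := x2 v; pose d := (1 + c)^-1.
pose M : 'M[R]_3 := \matrix_(i, j)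
  if i == i0 then row3 (1 + a * a * d) (a * b * d) a 0 j
  else if i == i1 then row3 (a * b * d) (1 + b * b * d) b 0 j else v 0 j.
have ME : ((M i0 i0 = (1 + a * a * d)%R) * (M i0 i1 = (a * b * d)%R) * (M i0 i2 = a) *
  (M i1 i0 = (a * b * d)%R) * (M i1 i1 = (1 + b * b * d)%R) * (M i1 i2 = b) *
  (M i2 i0 = a) * (M i2 i1 = b) * (M i2 i2 = c))%type.
  by do !split; rewrite mxE /= ?row3E.
have tr p q : M^T p q = M q p by rewrite mxE.
have h2 : c * d = 1 - d by rewrite -(mulVf v0) -/d /c; ring.
have sv' : b * b = c * c - 1 - a * a by move: sv; rewrite !expr2 -/a -/b -/c; lra.
have h1 : b * b * d = c - 1 - a * a * d.
  by rewrite sv'; transitivity (c * (c * d) - d - a * a * d); [ring|rewrite h2; ring: h2].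
have cp : 0 < c by case: hv.
clearbody a b c d.
exists M; last by apply/rowP => j; rewrite orig_mul mxE mxE.
split.
- apply/matrixP; elim/ord3P; elim/ord3P; rewrite !mulmx33 !tr !mink_mxE !ME.
  + by apply: (lc (k := (a * a * d)) (l := (a * a)) _ h1 h2); ring.
  + by apply: (lc (k := (a * b * d)) (l := (a * b)) _ h1 h2); ring.
  + by apply: (lc (k := a) (l := 0) _ h1 h2); ring.
  + by apply: (lc (k := (a * b * d)) (l := (a * b)) _ h1 h2); ring.
  + by apply: (lc (k := (b * b * d)) (l := (b * b)) _ h1 h2); ring.
  + by apply: (lc (k := b) (l := 0) _ h1 h2); ring.
  + by apply: (lc (k := a) (l := 0) _ h1 h2); ring.
  + by apply: (lc (k := b) (l := 0) _ h1 h2); ring.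
  + by apply: (lc (k := 1) (l := 0) _ sv' h2); ring.
- by rewrite det33 !ME (_ : _ + _ = 1) //; apply: (lc (k := c) (l := (-1)) _ h1 sv'); ring.
- by rewrite ME.
Qed.

End Hyperboloid.

Section Neighbourhoods.
Context {R : realType}.
Local Notation space := 'rV[R]_3.
Local Notation mink_mx := (@mink_mx R).
Local Notation hyp := (@hyp R).

(** The triangle inequality in terms of hyperbolic cosines: the Gram determinant
    is nonnegative. *)
Lemma gram_le (u v w : space) : hyp u -> hyp v -> hyp w ->
  (lor u v * lor v w - lor u w) ^+ 2 <= (lor u v ^+ 2 - 1) * (lor v w ^+ 2 - 1).
Proof.
move=> [hu _] [hv _] [hw _]; have := gram_det u v w; rewrite hu hv hw.
set q := (X in _ = X ^+ 2); have := sqr_ge0 q; move: (q ^+ 2) => q2 q20.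
move: (lor u v) (lor v w) (lor u w) => a b c; rewrite !expr2; lra.
Qed.

Lemma lor_double (u v w : space) k : hyp u -> hyp v -> hyp w -> lor u v <= k -> lor v w <= k ->
  lor u w <= 2 * k ^+ 2 - 1.
Proof.
move=> hu hv hw; have := gram_le hu hv hw; have := lor_ge1 hu hv; have := lor_ge1 hv hw.
move: (lor u v) (lor v w) (lor u w) => a b c b1 a1 h ak bk.
rewrite leNgt; apply/negP => lt.
have ab : a * b <= k ^+ 2 by rewrite expr2; nra.
have h1 : k ^+ 2 - 1 < c - a * b by lra.
have k1 : 0 <= k ^+ 2 - 1 by rewrite expr2; nra.
have h2 : (a ^+ 2 - 1) * (b ^+ 2 - 1) <= (k ^+ 2 - 1) ^+ 2.
  rewrite [leRHS]expr2; apply: ler_pM; rewrite ?expr2; nra.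
have : (k ^+ 2 - 1) ^+ 2 < (c - a * b) ^+ 2 by rewrite ltrXn2r// nnegrE; lra.
by move: h; rewrite -(sqrrN (a * b - c)) opprB; lra.
Qed.

Lemma hyp_scale (x : space) : 0 < lor x x -> 0 < x 0 i2 -> hyp ((Num.sqrt (lor x x))^-1 *: x).
Proof.
move=> n0 p0; have s0 : 0 < Num.sqrt (lor x x) by rewrite sqrtr_gt0.
split; last by rewrite rowZE mulr_gt0// invr_gt0.
rewrite lorZl lorZr -{3}(sqr_sqrtr (ltW n0)) expr2; field; exact: lt0r_neq0.
Qed.

(** Three points close to the origin span the space. *)
Lemma rigidity (M M' : 'M[R]_3) p eta : hyp p -> 1 < eta ->
  (forall w, hyp w -> lor p w < eta -> w *m M = w *m M') -> M = M'.
Proof.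
move=> hp e1 H; have [T iT oT] := hyp_transitive hp.
suff : T *m M = T *m M' by move=> /(congr1 (mulmx (invmx T))); rewrite !mulKmx//; exact: isom_unit.
have e0 : 0 <= eta by lra.
pose s := Num.sqrt (eta ^+ 2 - 1) / 2.
have q0 : 0 < eta ^+ 2 - 1 by rewrite expr2; nra.
have s0 : 0 < s by rewrite divr_gt0 ?sqrtr_gt0.
have sE : s ^+ 2 = (eta ^+ 2 - 1) / 4.
  by rewrite expr_div_n sqr_sqrtr ?ltW//; congr (_ / _); rewrite expr2; lra.
pose c := Num.sqrt (1 + s ^+ 2).
have c0 : 0 < c by rewrite sqrtr_gt0 ltr_pwDl// sqr_ge0.
have cE : c ^+ 2 = 1 + s ^+ 2 by rewrite sqr_sqrtr// addr_ge0// sqr_ge0.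
have ce : c < eta by rewrite -(@ltr_pXn2r _ 2) ?nnegrE ?(ltW c0)// cE sE; lra.
have key (a b : R) : a ^+ 2 + b ^+ 2 = s ^+ 2 -> row3 a b c *m T *m M = row3 a b c *m T *m M'.
  move=> ab; have ho : hyp (row3 a b c).
    by split; rewrite /lor !row3E//; move: ab cE; rewrite !expr2; lra.
  apply: H; first exact: isom_hyp iT ho.
  by rewrite -oT isom_lor// lor_orig row3E.
have k1 := key s 0; have k2 := key (- s) 0; have k3 := key 0 s.
have {}k1 := k1 _; have {}k2 := k2 _; have {}k3 := k3 _.
rewrite -!mulmxA in k1 k2 k3.
have {k1} k1 : row3 s 0 c *m (T *m M) = row3 s 0 c *m (T *m M') by apply: k1; rewrite expr0n addr0.
have {k2} k2 : row3 (- s) 0 c *m (T *m M) = row3 (- s) 0 c *m (T *m M').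
  by apply: k2; rewrite expr0n addr0 sqrrN.
have {k3} k3 : row3 0 s c *m (T *m M) = row3 0 s c *m (T *m M') by apply: k3; rewrite expr0n add0r.
move: (T *m M) (T *m M') k1 k2 k3 => N N' k1 k2 k3.
apply/matrixP => i j.
move: k1 k2 k3 => /rowP /(_ j) + /rowP /(_ j) + /rowP /(_ j); rewrite !mulmx33 !row3E => k1 k2 k3.
have e2 : N i2 j = N' i2 j by apply: (mulfI (lt0r_neq0 c0)); lra.
have e0' : N i0 j = N' i0 j by apply: (mulfI (lt0r_neq0 s0)); rewrite e2 in k1; lra.
have e1' : N i1 j = N' i1 j by apply: (mulfI (lt0r_neq0 s0)); rewrite e2 in k3; lra.
by move: i; apply: ord3P.
Qed.

Lemma norm_row3 (v : space) r : 0 <= r -> `|v 0 i0| <= r -> `|v 0 i1| <= r -> `|v 0 i2| <= r ->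
  `|v| <= r.
Proof. by move=> r0 h0 h1 h2; apply: mxnorm_le => // i j; rewrite (ord1 i); move: j; apply: ord3P. Qed.

Lemma hyp_near_orig (e : R) : 0 < e -> exists2 eta : R, 1 < eta &
  forall w, hyp w -> w 0 i2 < eta -> `|w - orig| < e.
Proof.
move=> e0; pose m := Num.min 1 (e / 2); have m0 : 0 < m by rewrite lt_min ltr01 divr_gt0.
have m1 : m <= 1 by rewrite ge_min lexx.
have me : m <= e / 2 by rewrite ge_min lexx orbT.
exists (1 + m ^+ 2 / 4) => [|w hw w2]; first by rewrite ltrDl divr_gt0// exprn_gt0.
have sw := hyp_sq hw; have w1 := hyp_pos hw.
apply: (@le_lt_trans _ _ m); last by lra.
have mm : m ^+ 2 <= m by rewrite expr2; nra.
have b : w 0 i0 ^+ 2 + w 0 i1 ^+ 2 <= m ^+ 2.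
  have : w 0 i2 ^+ 2 <= (1 + m ^+ 2 / 4) ^+ 2 by rewrite lerXn2r ?nnegrE; lra.
  rewrite sw; move: mm m1 m0; rewrite !expr2; clear; nra.
have key (x : R) : x ^+ 2 <= m ^+ 2 -> `|x| <= m.
  by rewrite -(real_normK (num_real x)) ler_pXn2r ?nnegrE// ltW.
apply: norm_row3 (ltW m0) _ _ _; rewrite rowDE rowNE row3E ?subr0.
- by apply: key; have := sqr_ge0 (w 0 i1); lra.
- by apply: key; have := sqr_ge0 (w 0 i0); lra.
- by rewrite ger0_norm; lra.
Qed.

(** The topology of the hyperboloid is the one defined by the distance. *)
Lemma hyp_near p (e : R) : hyp p -> 0 < e -> exists2 eta : R, 1 < eta &
  forall w, hyp w -> lor p w < eta -> `|w - p| < e.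
Proof.
move=> hp e0; have [T iT oT] := hyp_transitive hp.
pose K := 3 * `|T| + 1; have K0 : 0 < K by rewrite ltr_wpDl// mulr_ge0.
have [eta e1 H] := hyp_near_orig (divr_gt0 e0 K0).
exists eta => // w hw; rewrite -oT lorC -(mulmxKV (isom_unit iT) w) isom_lor// lorC lor_orig => h.
have iV := isomV iT.
have := H _ (isom_hyp iV hw) h => h2.
rewrite -mulmxBl; apply: (le_lt_trans (mulmx_norm _ _)).
move: h2; rewrite ltr_pdivlMr// /K; move: (`|_|) (`|T|) (normr_ge0 (w *m invmx T - orig)) (normr_ge0 T).
by move=> a b a0 b0; nra.
Qed.

Lemma lor_continuous p : continuous (lor p : space -> R).
Proof.
move=> v; have FF : Filter (nbhs (v : space)) by exact: nbhs_filter.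
have h k := @continuous_entry R 1 3 0 k v.
by apply: cvgB; [apply: cvgB|]; apply: cvgM; (exact: cvg_cst || exact: h).
Qed.

Lemma lor_ball_open p (eta : R) : open [set w | lor p w < eta].
Proof.
exact: (open_comp (fun v _ => @lor_continuous p v) (@open_lt _ eta)).
Qed.

(** ** Segments *)

Definition mixture (a b : space) (t : R) : space := (1 - t) *: a + t *: b.

(** The geodesic segment, with the parametrization of the chord. *)
Definition seg (a b : space) (t : R) : space :=
  (Num.sqrt (lor (mixture a b t) (mixture a b t)))^-1 *: mixture a b t.

Lemma lor_mixture a b p t : lor p (mixture a b t) = (1 - t) * lor p a + t * lor p b.
Proof. by rewrite lorDr !lorZr. Qed.

Lemma mixture_norm a b t : hyp a -> hyp b -> 0 <= t <= 1 ->
  1 <= lor (mixture a b t) (mixture a b t).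
Proof.
move=> ha hb /andP[t0 t1]; rewrite lor_mixture !(lorC (mixture _ _ _)) !lor_mixture (lorC b a).
have := lor_ge1 ha hb; case: ha => -> _; case: hb => -> _; move: (lor a b) => L L1.
have : 0 <= t * (1 - t) * (L - 1) by rewrite !mulr_ge0; lra.
lra.
Qed.

Lemma seg_hyp a b t : hyp a -> hyp b -> 0 <= t <= 1 -> hyp (seg a b t).
Proof.
move=> ha hb tI; have := mixture_norm ha hb tI => n1.
apply: hyp_scale; first by lra.
case: ha => _ a0; case: hb => _ b0; rewrite !vecE; move: tI => /andP[t0 t1].
by have [->|tn] := eqVneq t 0; [lra|have : 0 < t * b 0 i2 by rewrite mulr_gt0// lt_neqAle eq_sym tn];
  have : 0 <= (1 - t) * a 0 i2 by [rewrite mulr_ge0; lra]; lra.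
Qed.

Lemma seg0 a b : hyp a -> seg a b 0 = a.
Proof. by move=> [h _]; rewrite /seg /mixture subr0 scale1r scale0r addr0 h sqrtr1 invr1 scale1r. Qed.

Lemma seg1 a b : hyp b -> seg a b 1 = b.
Proof. by move=> [h _]; rewrite /seg /mixture subrr scale1r scale0r add0r h sqrtr1 invr1 scale1r. Qed.

Lemma seg_ball a b p (eta t : R) : hyp a -> hyp b -> 0 <= t <= 1 -> 0 < eta ->
  lor p a < eta -> lor p b < eta -> lor p (seg a b t) < eta.
Proof.
move=> ha hb tI e0 pa pb; have n1 := mixture_norm ha hb tI.
have s1 : 1 <= Num.sqrt (lor (mixture a b t) (mixture a b t)) by rewrite -sqrtr1 ler_sqrt//; lra.
rewrite lorZr ltr_pdivrMl; last by lra.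
apply: (@lt_le_trans _ _ eta); last by rewrite ler_peMl// ltW.
rewrite lor_mixture; move: tI => /andP[t0 t1].
have [->|tn] := eqVneq t 0; first lra.
have h1 : t * lor p b < t * eta by rewrite ltr_pM2l// lt_neqAle eq_sym tn.
have h2 : (1 - t) * lor p a <= (1 - t) * eta by apply: ler_wpM2l; lra.
lra.
Qed.

Lemma seg_near a b t0 (eta : R) : hyp a -> hyp b -> 0 <= t0 <= 1 -> 1 < eta ->
  exists2 r : R, 0 < r & forall t, 0 <= t <= 1 -> `|t - t0| < r ->
    lor (seg a b t0) (seg a b t) < eta.
Proof.
move=> ha hb tI e1; have L1 := lor_ge1 ha hb; set L := lor a b in L1.
have q0 : 0 < eta ^+ 2 - 1 by rewrite expr2; nra.
exists (Num.min 1 ((eta ^+ 2 - 1) / L ^+ 2)) => [|t tI'].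
  by rewrite lt_min ltr01 divr_gt0// exprn_gt0//; lra.
rewrite lt_min => /andP[d1 d2].
have n := mixture_norm ha hb tI; have n' := mixture_norm ha hb tI'.
have sh := seg_hyp ha hb tI; have sh' := seg_hyp ha hb tI'.
rewrite -(@ltr_pXn2r _ 2) ?nnegrE//; [|by have := lor_ge1 sh sh'; lra|by lra].
rewrite lorZl lorZr mulrA exprMn -invfM.
rewrite exprVn exprMn !sqr_sqrtr; [|lra|lra].
set N := lor (mixture a b t0) _ in n *; set N' := lor (mixture a b t) _ in n' *.
have E : lor (mixture a b t0) (mixture a b t) ^+ 2 - N * N' = (t - t0) ^+ 2 * (L ^+ 2 - 1).
  rewrite /N /N' !lor_mixture !(lorC (mixture _ _ _)) !lor_mixture (lorC b a) -/L.
  by case: ha => -> _; case: hb => -> _; ring.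
rewrite ltr_pdivrMl; last by rewrite mulr_gt0; lra.
have h : (t - t0) ^+ 2 * (L ^+ 2 - 1) < eta ^+ 2 - 1.
  apply: (@le_lt_trans _ _ (`|t - t0| * L ^+ 2)); last by rewrite -ltr_pdivlMr// exprn_gt0//; lra.
  rewrite -real_normK ?num_real//; apply: ler_pM; rewrite ?sqr_ge0//.
  - by rewrite expr2; nra.
  - by rewrite expr2 ler_piMr// ltW.
  - lra.
have nn : 1 <= N * N' by rewrite -[1]mul1r ler_pM.
have : eta ^+ 2 - 1 <= N * N' * (eta ^+ 2 - 1) by rewrite ler_peMl// ltW.
lra.
Qed.

(** A point just outside a large ball is close to a point inside, at a scale that
    does not depend on the ball: move it towards the origin. *)
Lemma lor_pull (eta C0 : R) : 1 < eta -> 1 < C0 -> exists2 c : R, 1 < c &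
  forall C w, C0 <= C -> hyp w -> w 0 i2 < c * C ->
    exists p, [/\ hyp p, p 0 i2 < C & lor p w < eta].
Proof.
move=> e1 C1; pose s := eta - 1; have s0 : 0 < s by rewrite /s; lra.
pose d := 2 * s * (1 - C0 ^- 2).
have C2 : 0 < C0 ^- 2 < 1.
  by rewrite invr_gt0 exprn_gt0 ?invf_lt1 ?exprn_gt0 ?exprn_egt1//; lra.
have d0 : 0 < d by rewrite /d !mulr_gt0//; lra.
pose k := 1 + d / (2 * (1 + s) ^+ 2).
have k1 : 1 < k by rewrite ltrDl divr_gt0// mulr_gt0// exprn_gt0//; lra.
exists (Num.sqrt k) => [|C w CC hw wC]; first by rewrite -[ltLHS]sqrtr1 ltr_sqrt//; lra.
have w1 := hyp_pos hw.
have [wlt|wge] := ltP (w 0 i2) C.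
  by exists w; split=> //; case: (hw) => -> _.
set W := w 0 i2 in w1 wC wge *.
pose x := w + (s / W) *: orig.
have xE : lor x x = 1 + 2 * s + s ^+ 2 / W ^+ 2.
  rewrite /x lorDl !lorDr lorZl !lorZr lorZl (lorC w orig) !lor_orig row3E -/W.
  by case: (hw) => -> _; field; rewrite gt_eqF//; lra.
have x2 : x 0 i2 = W + s / W by rewrite !vecE row3E mulr1.
have sW : 0 < s / W by rewrite divr_gt0//; lra.
have lxx : 1 < lor x x by rewrite xE; have : 0 < s ^+ 2 / W ^+ 2 by [rewrite -expr_div_n exprn_gt0]; lra.
have hx := @hyp_scale x _ _.
have {}hx : hyp ((Num.sqrt (lor x x))^-1 *: x) by apply: hx; [lra|rewrite x2; lra].
exists ((Num.sqrt (lor x x))^-1 *: x); split=> //.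
- rewrite -(@ltr_pXn2r _ 2) ?nnegrE//; [|by have := hyp_pos hx; lra|by lra].
  rewrite rowZE exprMn exprVn sqr_sqrtr; last by lra.
  rewrite ltr_pdivrMl; last by lra.
  have kC : W ^+ 2 < k * C ^+ 2.
    have : W ^+ 2 < (Num.sqrt k * C) ^+ 2 by rewrite ltrXn2r ?nnegrE ?mulr_ge0 ?sqrtr_ge0//; lra.
    by rewrite exprMn sqr_sqrtr//; lra.
  have y1 : 0 < W ^- 2 <= C0 ^- 2.
    rewrite invr_gt0 exprn_gt0 ?lef_pV2 ?posrE ?exprn_gt0 ?lerXn2r ?nnegrE //; lra.
  have key : k * (1 + s * W ^- 2) ^+ 2 < lor x x.
    rewrite xE; move: (W ^- 2) y1 => y /andP[y0 yC].
    have h1 : (1 + s * y) ^+ 2 <= (1 + s) ^+ 2.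
      rewrite lerXn2r ?nnegrE; [|nra|lra|nra].
      done.
    have h2 : (k - 1) * (1 + s * y) ^+ 2 <= d / 2.
      have -> : d / 2 = (k - 1) * (1 + s) ^+ 2 by rewrite /k; field; rewrite gt_eqF//; lra.
      by rewrite ler_wpM2l//; lra.
    have h3 : d <= 2 * s * (1 - y) by rewrite /d ler_wpM2l//; lra.
    have h4 : 0 <= s ^+ 2 * y * (1 - y) by rewrite !mulr_ge0 ?sqr_ge0//; lra.
    rewrite expr2 in h2; rewrite expr2 in h4; rewrite !expr2; nra.
  have -> : x 0 i2 ^+ 2 = W ^+ 2 * (1 + s * W ^- 2) ^+ 2.
    by rewrite x2; field; rewrite gt_eqF//; lra.
  have q : 0 < (1 + s * W ^- 2) ^+ 2 by rewrite exprn_gt0// addr_gt0// mulr_gt0//; lra.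
  apply: (lt_trans (y := k * C ^+ 2 * (1 + s * W ^- 2) ^+ 2)); first by rewrite ltr_pM2r.
  by rewrite mulrAC ltr_pM2r// exprn_gt0//; lra.
- rewrite -(@ltr_pXn2r _ 2) ?nnegrE//; [|by have := lor_ge1 hx hw; lra|by lra].
  rewrite lorZl exprMn exprVn sqr_sqrtr; last by lra.
  rewrite ltr_pdivrMl; last by lra.
  have -> : lor x w = 1 + s.
    rewrite /x lorDl lorZl lor_orig -/W; case: (hw) => -> _.
    by rewrite divfK// gt_eqF//; lra.
  have -> : eta = 1 + s by rewrite /s; lra.
  by rewrite -[ltLHS]mul1r ltr_pM2r// exprn_gt0//; lra.
Qed.

End Neighbourhoods.

(** * Charts into the hyperbolic plane *)

Section LocalDevelopment.
Context {R : realType}.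
Local Notation plane := 'rV[R]_2.
Local Notation space := 'rV[R]_3.
Local Notation mink_mx := (@mink_mx R).
Local Notation hyp := (@hyp R).
Local Notation orig := (@orig R).

Lemma near_open (T : topologicalType) (U : set T) :
  (forall z, U z -> nbhs z U) -> open U.
Proof. by rewrite openE => h z Uz; exact: h. Qed.

Lemma frame_hyp G U (Y : plane -> 'M[R]_3) v : frame_field G U Y -> U v ->
  hyp (row i2 (Y v)).
Proof.
move=> [_ _ _ gY pY] Uv; split; last by rewrite mxE; exact: pY.
have e j : row i2 (Y v) 0 j = Y v i2 j by rewrite mxE.
have /matrixP /(_ i2 i2) := gY v Uv; rewrite prod_entry gramE /lor !e => h; lra.
Qed.

Lemma frame_restrict G U U' (Y : plane -> 'M[R]_3) : frame_field G U Y -> open U' ->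
  U' `<=` U -> frame_field G U' Y.
Proof.
move=> [_ CY jY gY pY] oU' UU'; split=> //.
- by move=> j m; exact: Ck_subset UU' (CY j m).
- by move=> i v /UU'; exact: jY.
- by move=> v /UU'; exact: gY.
- by move=> v /UU'; exact: pY.
Qed.

Lemma frame_mulr G U (Y : plane -> 'M[R]_3) (M : 'M[R]_3) : frame_field G U Y ->
  M *m mink_mx *m M^T = mink_mx -> 0 < M i2 i2 -> frame_field G U (fun v => Y v *m M).
Proof.
move=> fY MM M2; have [oU CY jY gY pY] := fY.
have sY v i : U v -> smooth_entries v i Y by move=> Uv j k; exact: Ck_der (CY j k) Uv.
split=> //.
- move=> j m; apply: (Ck_ext (f := fun v => Y v j i0 * M i0 m + Y v j i1 * M i1 m +
    Y v j i2 * M i2 m) oU); first by move=> v _; rewrite mulmx33.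
  by apply: Ck_add => //; [apply: Ck_add => //|]; apply: Ck_mul => //; exact: Ck_cst.
- move=> i v Uv.
  have [_ ->] := jac_mulmx (sY v i Uv) (proj1 (jac_cst M i v)).
  by rewrite (proj2 (jac_cst M i v)) mulmx0 addr0 jY// mulmxA.
- move=> v Uv; rewrite -(gY v Uv) trmx_mul !mulmxA -(mulmxA (Y v)) -(mulmxA (Y v)).
  by rewrite MM.
- move=> v Uv; have [_] := hyp_mink MM M2 (frame_hyp fY Uv).
  by rewrite -row_mul mxE.
Qed.

(** The smooth structure is given by [A], where the metric lives, and the
    orientation by [B]. *)
Definition oriented_hyperbolic (X : topologicalType) (A B : set (chart R X))
    (g : chart R X -> plane -> 'M[R]_2) : Prop :=
  [/\ smooth_atlas (A `|` B), forall x, exists2 k, A k & cdom k x, oriented_atlas B,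
      riemannian_metric A g & has_constant_curvature A g (-1)].

Context {X : topologicalType}.
Variables (A B : set (chart R X)) (g : chart R X -> plane -> 'M[R]_2).
Hypothesis hS : oriented_hyperbolic A B g.

Let AB_smooth : smooth_atlas (A `|` B). Proof. by case: hS. Qed.
Let A_cover x : exists2 k, A k & cdom k x. Proof. by case: hS. Qed.
Let B_oriented : oriented_atlas B. Proof. by case: hS. Qed.
Let A_metric : riemannian_metric A g. Proof. by case: hS. Qed.
Let A_curvature : has_constant_curvature A g (-1). Proof. by case: hS. Qed.

Lemma chart_metric k : A k -> hyperbolic_metric (cimg k) (g k).
Proof.
case: A_metric => h1 h2 h3 _ Ak; split.
- exact: cimg_open.
- by move=> i j; exact: h1.
- exact: h2.
- exact: h3.
- by move=> v kv; exact: A_curvature.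
Qed.

Lemma cimg_mem (k : chart R X) z : cdom k z -> cimg k (cmap k z).
Proof. by exists z. Qed.

Lemma cinvK (k : chart R X) v : cimg k v -> cdom k (cinv k v) /\ cmap k (cinv k v) = v.
Proof. by case=> z kz <-; rewrite cmapK. Qed.

Lemma cinv_near (k : chart R X) v (W : set X) : cimg k v -> nbhs (cinv k v) W ->
  \forall w \near v, W (cinv k w).
Proof. by move=> kv; exact: cinv_continuous. Qed.

Lemma cmap_near (k : chart R X) z (W : set plane) : cdom k z -> nbhs (cmap k z) W ->
  \forall y \near z, W (cmap k y).
Proof. by move=> kz; exact: cmap_continuous. Qed.

Lemma cdom_nbhs (k : chart R X) z : cdom k z -> nbhs z (cdom k).
Proof. by move=> kz; apply: open_nbhs_nbhs; split=> //; exact: cdom_open. Qed.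

Lemma cimg_nbhs (k : chart R X) v : cimg k v -> nbhs v (cimg k).
Proof. by move=> kv; apply: open_nbhs_nbhs; split=> //; exact: cimg_open. Qed.

Lemma overlapP (k l : chart R X) v : overlap k l v <-> cimg k v /\ cdom l (cinv k v).
Proof.
split=> [[z [kz lz] <-]|[[z kz <-]]]; first by rewrite cmapK//; split=> //; exists z.
by rewrite cmapK// => lz; exists z.
Qed.

Lemma overlap_mem (k l : chart R X) z : cdom k z -> cdom l z -> overlap k l (cmap k z).
Proof. by move=> kz lz; exists z. Qed.

Lemma overlap_open (k l : chart R X) : open (overlap k l).
Proof.
apply: near_open => v /overlapP[kv lv].
have h1 := cimg_nbhs kv; have h2 := cinv_near kv (cdom_nbhs lv).
have FF : Filter (nbhs (v : plane)) by exact: nbhs_filter.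
by apply: filterS2 h1 h2 => w ? ?; exact/overlapP.
Qed.

(** The derivative of the change of charts, indexed by points of [X]. *)
Definition tmap (k l : chart R X) (z : X) : 'M[R]_2 := tjac (transition k l) (cmap k z).

Lemma transition_smooth k l : (A `|` B) k -> (A `|` B) l -> forall j,
  smooth (overlap k l) (fun v => transition k l v 0 j).
Proof. by case: AB_smooth => _; apply. Qed.

Lemma tmap_mul k l m z : (A `|` B) k -> (A `|` B) l -> (A `|` B) m ->
  cdom k z -> cdom l z -> cdom m z -> tmap k m z = tmap k l z *m tmap l m z.
Proof.
move=> Ck Cl Cm kz lz mz; set v := cmap k z.
have okl := overlap_mem kz lz; have okm := overlap_mem kz mz.
have tl : transition k l v = cmap l z by rewrite /transition /= cmapK.
have olm : overlap l m (transition k l v) by rewrite tl; exact: overlap_mem.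
have o3 : open (overlap k l `&` overlap k m) by apply: openI; exact: overlap_open.
have E w (j : 'I_2) : (overlap k l `&` overlap k m) w ->
    transition l m (transition k l w) 0 j = transition k m w 0 j.
  by move=> [/overlapP[kw lw] _]; rewrite /transition /= cmapK.
apply/matrixP => i j; rewrite [LHS]mxE mulmx22 /tmap [tjac _ _ i 0]mxE [tjac _ _ i 1]mxE.
have [d e] := @partial_comp R _ _ (fun w => transition l m w 0 j) (transition k l) v i
  (@overlap_open k l) (@overlap_open l m) (transition_smooth Cl Cm j 1%N)
  (fun q => transition_smooth Ck Cl q 1%N) okl olm.
have [_ e'] := derive_ext o3 (fun w h => E w j h) (conj okl okm) d.
rewrite e' e tl; congr (_ * _ + _ * _); rewrite mxE //.
Qed.

Lemma tmap_id k z : cdom k z -> tmap k k z = 1%:M.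
Proof.
move=> kz; have kv := cimg_mem kz.
apply/matrixP => i j; rewrite mxE.
have E w : cimg k w -> w 0 j = transition k k w 0 j.
  by move=> kw; rewrite /transition /=; have [_ ->] := cinvK kw.
have dj : is_derive (cmap k z) (ebase i) (fun w : plane => w 0 j) ((i == j)%:R).
  have h := @is_derive_mx R 1 2 (fun x : R => cmap k z + x *: ebase i) 0 (ebase i).
  have : is_derive (0 : R) 1 (fun x : R => cmap k z + x *: ebase i) (ebase i).
    have := is_deriveD (is_derive_cst (cmap k z) (0 : R) 1) (is_derive_scale (ebase i) (0 : R)).
    by rewrite add0r.
  move=> /h.1 /(_ 0 j); rewrite ebaseE (eq_sym j) => d.
  by apply: (@line_derive_rev _ _ (cmap k z) (cmap k z) i 0 _ _ d); rewrite scale0r addr0.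
case: dj => dj1 dj2; have [d e] := derive_ext (@cimg_open _ _ k) E kv dj1.
by rewrite e mxE; exact: dj2.
Qed.

Lemma tmap_det k l z : (A `|` B) k -> (A `|` B) l -> cdom k z -> cdom l z ->
  \det (tmap k l z) != 0.
Proof.
move=> Ck Cl kz lz; have := tmap_mul Ck Cl Ck kz lz kz; rewrite tmap_id// => /(congr1 determinant).
rewrite det1 det_mulmx => h; apply: contra_eq_neq h => ->; rewrite mul0r; exact: oner_neq0.
Qed.

Lemma tmap_oriented k l z : B k -> B l -> cdom k z -> cdom l z -> 0 < \det (tmap k l z).
Proof.
move=> Bk Bl kz lz; have okl := overlap_mem kz lz.
case: B_oriented => _ /(_ _ _ Bk Bl _ okl).
by have [_ ->] := jacobianE (@overlap_open k l)
  (fun q => transition_smooth (or_intror Bk) (or_intror Bl) q 1%N) okl.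
Qed.

(** [phi] is near [z] an isometric immersion into the hyperboloid, compatible
    with the orientation. *)
Definition dev_at (phi : X -> space) (z : X) : Prop :=
  forall k, A k -> cdom k z -> exists U Y,
    [/\ frame_field (g k) U Y, U `<=` cimg k, U (cmap k z),
        forall v, U v -> row i2 (Y v) = phi (cinv k v) &
        forall l, B l -> cdom l z -> 0 < \det (Y (cmap k z)) * \det (tmap k l z)].

Lemma dev_at_one (phi : X -> space) (z : X) k l U Y : A k -> B l -> cdom k z -> cdom l z ->
  frame_field (g k) U Y -> U `<=` cimg k -> U (cmap k z) ->
  (forall v, U v -> row i2 (Y v) = phi (cinv k v)) ->
  0 < \det (Y (cmap k z)) * \det (tmap k l z) -> dev_at phi z.
Proof.
move=> Ak Bl kz lz fY Uk Uz UF pos k' Ak' kz'.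
have [oU _ _ _ _] := fY.
pose t := transition k' k; pose O := overlap k' k `&` t @^-1` U.
have tz : t (cmap k' z) = cmap k z by rewrite /t /transition /= cmapK.
have Ct m : smooth (overlap k' k) (fun v => t v 0 m).
  by apply: transition_smooth; left.
have oO : open O.
  apply: near_open => v [ov tv].
  have h1 : nbhs v (overlap k' k) by apply: open_nbhs_nbhs; split=> //; exact: overlap_open.
  have h2 : {for v, continuous t} by apply: cts_row => m; exact: Ck_cts (Ct m 1%N) ov.
  have h3 : nbhs (t v) U by exact: open_nbhs_nbhs.
  have FF : Filter (nbhs (v : plane)) by exact: nbhs_filter.
  by apply: filterS2 h1 (h2 _ h3) => w ? ?.
have Oz : O (cmap k' z) by split; [exact: overlap_mem|rewrite /= tz].
have Ok' : O `<=` cimg k' by move=> v [/overlapP[]].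
have CtO m : smooth O (fun v => t v 0 m).
  by move=> n; apply: Ck_subset (Ct m n); exact: subIsetl.
exists O, (fun v => pad (tjac t v) *m Y (t v)); split=> //.
- apply: (frame_pullback (chart_metric Ak') (chart_metric Ak) oO Ok' Uk fY CtO).
    by move=> v [].
  move=> v [ov _]; case: A_metric => _ _ _ /(_ _ _ Ak' Ak _ ov) /= ->.
  by have [_ ->] := jacobianE (@overlap_open k' k) (fun q => Ct q 1%N) ov.
- move=> v [/overlapP[kv lv] tv]; have := UF _ tv; rewrite /t /transition /= cmapK// => <-.
  apply/rowP => j; rewrite !mxE sum3 !padE; ring.
- move=> l' Bl' lz'; rewrite det_mulmx det_pad tz.
  have Ck : (A `|` B) k by left. have Ck' : (A `|` B) k' by left.
  have Cl : (A `|` B) l by right. have Cl' : (A `|` B) l' by right.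
  rewrite (tmap_mul Ck' Ck Cl')// (tmap_mul Ck Cl Cl')// !det_mulmx.
  have a0 := tmap_det Ck' Ck kz' kz; have b0 := tmap_oriented Bl Bl' lz lz'.
  rewrite -[tjac t (cmap k' z)]/(tmap k' k z).
  have -> (a y c b : R) : a * y * (a * (c * b)) = a ^+ 2 * (y * c) * b by ring.
  by apply: mulr_gt0 => //; apply: mulr_gt0 => //; rewrite exprn_even_gt0.
Qed.

Lemma dev_at_mulr phi z M : isom M -> dev_at phi z -> dev_at (fun y => phi y *m M) z.
Proof.
move=> [MM dM M2] h k Ak kz; have [U [Y [fY Uk Uz UF pos]]] := h k Ak kz.
exists U, (fun v => Y v *m M); split=> //.
- exact: frame_mulr.
- by move=> v Uv; rewrite row_mul UF.
- by move=> l Bl lz; rewrite det_mulmx mulrAC; rewrite mulr_gt0//; exact: pos.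
Qed.

Lemma B_cover x : exists2 l, B l & cdom l x.
Proof. by case: B_oriented => -[h _] _; exact: h. Qed.

Lemma dev_at_hyp phi z : dev_at phi z -> hyp (phi z).
Proof.
move=> h; have [k Ak kz] := A_cover z; have [U [Y [fY Uk Uz UF _]]] := h k Ak kz.
by have := frame_hyp fY Uz; rewrite UF// cmapK.
Qed.

Lemma dev_at_continuous phi z : dev_at phi z -> {for z, continuous phi}.
Proof.
move=> h; have [k Ak kz] := A_cover z; have [U [Y [[oU CY _ _ _] Uk Uz UF _]]] := h k Ak kz.
have FF : Filter (nbhs (cmap k z : plane)) by exact: nbhs_filter.
have h1 : row i2 (Y v) @[v --> cmap k z] --> row i2 (Y (cmap k z)).
  apply: cvg_mx => i j; rewrite mxE; under eq_fun do rewrite mxE.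
  exact: Ck_cts (CY i2 j) Uz.
have h2 : row i2 (Y (cmap k y)) @[y --> z] --> phi z.
  have -> : phi z = row i2 (Y (cmap k z)) by rewrite UF// cmapK.
  exact: (@cvg_comp _ _ _ (cmap k) (fun v => row i2 (Y v)) _ _ _ (cmap_continuous kz) h1).
have E : \forall y \near z, row i2 (Y (cmap k y)) = phi y.
  have hU : nbhs (cmap k z) U by exact: open_nbhs_nbhs.
  apply: filterS2 (cdom_nbhs kz) (cmap_near kz hU) => y ky Uy.
  by rewrite UF// cmapK.
by apply: cvg_trans h2; apply: near_eq_cvg.
Qed.

(** By [frame_unique]; the Lorentz transformation is an isometry of the right sheet
    and orientation because both immersions take values in [hyp] and agree with the
    oriented atlas. *)
Lemma dev_compat phi phi' z : dev_at phi z -> dev_at phi' z ->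
  exists2 M, isom M & \forall y \near z, phi' y = phi y *m M.
Proof.
move=> h h'; have [k Ak kz] := A_cover z; have [l Bl lz] := B_cover z.
have [U [Y [fY Uk Uz UF /(_ l Bl lz) pos]]] := h k Ak kz.
have [U' [Y' [fY' Uk' Uz' UF' /(_ l Bl lz) pos']]] := h' k Ak kz.
have [M [MM [r r0 hr]]] := frame_unique (chart_metric Ak) fY fY' Uz Uz' (cimg_mem kz).
have vv : `|cmap k z - cmap k z| < r by rewrite subrr normr0.
have [_ _ E] := hr _ vv.
exists M.
  apply: (@isom_of_point _ _ (phi z)) => //.
  - move: pos pos'; rewrite E det_mulmx mulrAC => pos.
    by rewrite pmulr_rgt0.
  - exact: dev_at_hyp.
  - have := dev_at_hyp h'; have e := UF _ Uz; have e' := UF' _ Uz'.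
    by rewrite cmapK// in e e'; rewrite -e' E row_mul e.
have hn : nbhs (cmap k z) [set v | `|v - cmap k z| < r].
  rewrite (_ : mkset _ = ball (cmap k z) r); first exact: nbhsx_ballx.
  by apply/seteqP; split=> v; rewrite /= -ball_normE /ball_/= distrC.
apply: filterS2 (cdom_nbhs kz) (cmap_near kz hn) => y ky /= /hr[Uy Uy' Ey].
by have := UF' _ Uy'; have := UF _ Uy; rewrite cmapK// => <- <-; rewrite Ey row_mul.
Qed.

(** A sheet is the inverse of an isometric chart onto the ball about the origin. *)
Definition sheet (psi : space -> X) (eta : R) : Prop :=
  exists phi U, [/\ open U,
    forall z, U z -> [/\ dev_at phi z, (phi z) 0 i2 < eta & psi (phi z) = z],
    forall w, hyp w -> w 0 i2 < eta -> U (psi w) /\ phi (psi w) = w &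
    forall w, hyp w -> w 0 i2 < eta -> {for w, continuous psi}].

End LocalDevelopment.

Section Sheets.
Context {R : realType}.
Local Notation plane := 'rV[R]_2.
Local Notation space := 'rV[R]_3.
Local Notation mink_mx := (@mink_mx R).
Local Notation hyp := (@hyp R).
Local Notation orig := (@orig R).
Context {X : topologicalType}.
Variables (A B : set (chart R X)) (g : chart R X -> plane -> 'M[R]_2).
Hypothesis hS : oriented_hyperbolic A B g.
Local Notation dev_at := (dev_at A B g).
Local Notation sheet := (sheet A B g).

Lemma ball_plane_open (v0 : plane) (r : R) : open [set v : plane | `|v - v0| < r].
Proof.
rewrite (_ : mkset _ = ball v0 r); first exact: ball_open.
by apply/seteqP; split=> v; rewrite /= -ball_normE /ball_/= distrC.
Qed.

Lemma det_continuous k l V (Y : plane -> 'M[R]_3) (t : plane -> plane) v :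
  open V -> (forall j m, Ck 1 V (fun v => Y v j m)) ->
  (forall m, smooth V (fun v => t v 0 m)) -> V v -> k = \det (Y v) -> l = \det (tjac t v) ->
  0 < k * l -> \forall w \near v, 0 < \det (Y w) * \det (tjac t w).
Proof.
move=> oV CY Ct Vv -> -> p.
have h : Ck 0 V (fun w => \det (Y w) * \det (tjac t w)).
  have e w : \det (tjac t w) = partial 0 (fun w => t w 0 0) w * partial 1 (fun w => t w 0 1) w
      + - (partial 0 (fun w => t w 0 1) w * partial 1 (fun w => t w 0 0) w).
    by rewrite det2 !mxE.
  have P i m : Ck 0 V (partial i (fun w => t w 0 m)) by exact: smooth_partial (Ct m) 0%N.
  have Q j m : Ck 0 V (fun w => Y w j m) by exact: Ck_down.
  have N f : Ck 0 V f -> Ck 0 V (fun w => - f w) by exact: Ck_opp.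
  have M f f' : Ck 0 V f -> Ck 0 V f' -> Ck 0 V (fun w => f w * f' w) by exact: Ck_mul.
  have D f f' : Ck 0 V f -> Ck 0 V f' -> Ck 0 V (fun w => f w + f' w) by exact: Ck_add.
  apply (M).
    under eq_fun do rewrite det33.
    pose T a b c d a' b' c' d' := D _ _ (M _ _ (Q a b) (Q c d)) (N _ (M _ _ (Q a' b') (Q c' d'))).
    exact: (D _ _ (D _ _ (M _ _ (Q i0 i0) (T i1 i1 i2 i2 i1 i2 i2 i1))
      (N _ (M _ _ (Q i0 i1) (T i1 i0 i2 i2 i1 i2 i2 i0))))
      (M _ _ (Q i0 i2) (T i1 i0 i2 i1 i1 i1 i2 i0))).
  under eq_fun do rewrite e.
  exact: (D _ _ (M _ _ (P 0 0) (P 1 1)) (N _ (M _ _ (P 0 1) (P 1 0)))).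
by apply: (cvgr_gt _ (Ck_cts h Vv)).
Qed.

(** A reflection of the hyperboloid, to correct the orientation of a frame. *)
Definition flip : 'M[R]_3 := \matrix_(i, j)
  if i == j then if i == i1 then -1 else 1 else 0.

Lemma flipE : ((flip i0 i0 = 1) * (flip i0 i1 = 0) * (flip i0 i2 = 0) *
  (flip i1 i0 = 0) * (flip i1 i1 = -1) * (flip i1 i2 = 0) *
  (flip i2 i0 = 0) * (flip i2 i1 = 0) * (flip i2 i2 = 1 :> R))%type.
Proof. by do !split; rewrite mxE. Qed.

Lemma flip_mink : flip *m mink_mx *m flip^T = mink_mx.
Proof.
have tr p q : flip^T p q = flip q p by rewrite mxE.
by apply/matrixP; elim/ord3P; elim/ord3P; rewrite !mulmx33 !tr !flipE !mink_mxE; ring.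
Qed.

(** The hyperboloid is a graph over the plane of the first two coordinates. *)
Definition shadow (w : space) : plane := pt (w 0 i0) (w 0 i1).

Lemma shadow_inj v w : hyp v -> hyp w -> shadow v = shadow w -> v = w.
Proof.
move=> hv hw E; have e0 : v 0 i0 = w 0 i0 by have := congr1 (fun u : plane => u 0 0) E; rewrite !pt0.
have e1 : v 0 i1 = w 0 i1 by have := congr1 (fun u : plane => u 0 1) E; rewrite !pt1.
apply: row3P => //; have := hyp_sq hv; rewrite e0 e1 -(hyp_sq hw) => /eqP.
case: hv => _ v0; case: hw => _ w0.
by rewrite eqrXn2 ?ltW// => /eqP.
Qed.

Lemma shadow_continuous : continuous (shadow : space -> plane).
Proof.
move=> w; have FF : Filter (nbhs (w : space)) by exact: nbhs_filter.
apply: cvg_mx => i j; rewrite (ord1 i).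
have [-> | ->] : j = 0 \/ j = 1.
    by case: (j) => [[|[|//]] p]; [left|right]; exact/val_inj.
  rewrite pt0; under eq_fun do rewrite pt0; exact: continuous_entry.
rewrite pt1; under eq_fun do rewrite pt1; exact: continuous_entry.
Qed.

Lemma invertible_continuous f (v0 : plane) (r d L : R) h y : 0 <= L -> invertible_near f v0 r d L h ->
  `|y - f v0| < d -> {for y, continuous h}.
Proof.
move=> L0 [hv0 hf hK lip] yd; have FF : Filter (nbhs (y : plane)) by exact: nbhs_filter.
apply/cvgrPdist_lt => e e0.
have L1 : 0 < L + 1 by lra.
have m0 : 0 < Num.min (d - `|y - f v0|) (e / (L + 1)) by rewrite lt_min subr_gt0 yd divr_gt0.
have : nbhs y [set w | `|w - y| < Num.min (d - `|y - f v0|) (e / (L + 1))].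
  by apply: open_nbhs_nbhs; split; [exact: ball_plane_open|rewrite /= subrr normr0].
apply: filterS => w /=; rewrite lt_min => /andP[w1 w2].
have wd : `|w - f v0| < d.
  by have := ler_normD (w - y) (y - f v0); rewrite addrA subrK; lra.
have [a1 a2] := hf _ yd; have [b1 b2] := hf _ wd.
have := lip _ _ a1 b1; rewrite a2 b2 (distrC y w) => h1; apply: le_lt_trans h1 _.
move: w2; rewrite ltr_pdivlMr// (mulrC L); apply: le_lt_trans.
by rewrite ler_wpM2l//; lra.
Qed.

(** Near every point, the frame of the structure equations gives an isometric map
    into the hyperboloid; the inverse function theorem makes it a chart. *)
Lemma sheet_exists x : exists psi eta, [/\ 1 < eta, sheet psi eta & psi orig = x].
Proof.
have [AB_smooth A_cover B_oriented _ _] := hS.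
have [k Ak kx] := A_cover x; have [l Bl lx] := B_cover hS x.
have hG := chart_metric hS Ak.
pose v0 := cmap k x; have kv0 : cimg k v0 := cimg_mem kx.
have [r0 r00 [Y [UV fY y20 y21 y22]]] : exists2 r : R, 0 < r &
  exists Y : plane -> 'M[R]_3, let U := [set v : plane | `|v - v0| < r] in
    [/\ U `<=` cimg k, frame_field (g k) U Y, row i2 (Y v0) = orig,
      Y v0 i2 i2 = 1 & 0 < \det (Y v0) * \det (tmap k l x)].
  have [r0 r00 [Y [UV fY y0 y1 y2]]] := frame_exists hG kv0.
  have Uv0 : `|v0 - v0| < r0 by rewrite subrr normr0.
  have yo : row i2 (Y v0) = orig by apply: row3P; rewrite ?row3E mxE.
  have := frame_unit hG fY Uv0 kv0; rewrite unitmxE unitfE => Yn.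
  have Jn := tmap_det hS (or_introl Ak) (or_intror Bl) kx lx.
  have : \det (Y v0) * \det (tmap k l x) != 0 by rewrite mulf_neq0.
  rewrite neq_lt => /orP[neg|pos]; exists r0 => //; last by exists Y.
  exists (fun v => Y v *m flip); split=> //.
  - by apply: frame_mulr => //; [exact: flip_mink|rewrite flipE].
  - by rewrite row_mul yo; apply/rowP => j; move: j; apply: ord3P; rewrite mulmx33 !row3E !flipE; ring.
  - by rewrite mulmx33 !flipE y2; ring.
  - rewrite det_mulmx (_ : \det flip = -1); last by rewrite det33 !flipE; ring.
    by rewrite mulrN1 mulNr oppr_gt0.
have [_ CY jY gY pY] := fY.
have Uv0 : `|v0 - v0| < r0 by rewrite subrr normr0.
have [r1 r10 hr1] : exists2 r : R, 0 < r & forall v, `|v - v0| < r ->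
    [/\ `|v - v0| < r0, overlap k l v & 0 < \det (Y v) * \det (tjac (transition k l) v)].
  apply: near_ball_plane; have FF : Filter (nbhs (v0 : plane)) by exact: nbhs_filter.
  have h1 : \forall v \near v0, `|v - v0| < r0.
    by apply: open_nbhs_nbhs; split=> //; exact: ball_plane_open.
  have h2 : nbhs v0 (overlap k l).
    by apply: open_nbhs_nbhs; split; [exact: overlap_open|exact: overlap_mem].
  have h3 : \forall v \near v0, 0 < \det (Y v) * \det (tjac (transition k l) v).
    have oO : open ([set v : plane | `|v - v0| < r0] `&` overlap k l).
      by apply: openI; [exact: ball_plane_open|exact: overlap_open].
    apply: (det_continuous (V := [set v : plane | `|v - v0| < r0] `&` overlap k l)
      oO _ _ _ erefl erefl y22).
    - by move=> j m; apply: Ck_subset (CY j m) => v [].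
    - move=> m n; apply: Ck_subset (transition_smooth hS _ _ m n); [by move=> v []|by left|by right].
    - by split=> //; exact: overlap_mem.
  by apply: filterS3 h1 h2 h3 => v ? ? ?.
pose f (v : plane) : plane := pt (Y v i2 i0) (Y v i2 i1).
pose U1 := [set v : plane | `|v - v0| < r1].
have oU1 : open U1 by exact: ball_plane_open.
have U1v0 : U1 v0 by rewrite /U1 /= subrr normr0.
have f0 v : f v 0 0 = Y v i2 i0 by rewrite pt0.
have f1 v : f v 0 1 = Y v i2 i1 by rewrite pt1.
have ord2 (m : 'I_2) : m = 0 \/ m = 1.
  by case: m => [[|[|//]] p]; [left|right]; exact/val_inj.
have CY1 j m : Ck 1 U1 (fun v => Y v j m).
  by apply: Ck_subset (CY j m) => v /hr1[].
have Cf m : Ck 1 U1 (fun v => f v 0 m).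
  have [-> | ->] := ord2 m; first by under eq_fun do rewrite f0; exact: CY1.
  by under eq_fun do rewrite f1; exact: CY1.
have dY i c : partial i (fun v => Y v i2 c) v0 = Y v0 (if i == 0 then i0 else i1) c.
  have /matrixP /(_ i2 c) := jY i v0 Uv0; rewrite mxE mulmx33 !gauss_formE => ->.
  by have [-> | ->] := ord2 i; rewrite /=; ring.
have T0 i : partial i (fun v => f v 0 0) v0 = partial i (fun v => Y v i2 i0) v0.
  by congr (partial i _ v0); apply/funext => v; rewrite f0.
have T1 i : partial i (fun v => f v 0 1) v0 = partial i (fun v => Y v i2 i1) v0.
  by congr (partial i _ v0); apply/funext => v; rewrite f1.
have Ju : tjac f v0 \in unitmx.
  rewrite unitmxE unitfE det2 ![tjac _ _ _ _]mxE.
  rewrite !T0 !T1.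
  rewrite !dY /=.
  have := frame_unit hG fY Uv0 kv0; rewrite unitmxE unitfE det33.
  have yo c : Y v0 i2 c = orig 0 c by rewrite -y20 mxE.
  rewrite !yo !row3E; apply: contra_neq => e0; rewrite -[RHS]e0; ring.
have [r [d [L [h [/andP[r2 rr] d0 L0 inv]]]]] := local_inverse oU1 Cf U1v0 Ju r10.
have fv0 : f v0 = 0.
  have yo c : Y v0 i2 c = orig 0 c by rewrite -y20 mxE.
  by apply: row2P; rewrite ?f0 ?f1 yo row3E mxE.
have [hv0 hf hK lip] := inv.
have [eta e1 He] := hyp_near_orig d0.
have sd w : hyp w -> w 0 i2 < eta -> `|shadow w - f v0| < d.
  move=> hw w2; have := He _ hw w2 => h1; rewrite fv0 subr0; apply: le_lt_trans h1.
  have e c : `|(w - orig) 0 c| <= `|w - orig| by exact: mxnorm_ge.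
  have := e i0; have := e i1; rewrite !vecE !row3E !subr0 => a b.
  by apply: norm_plane => //; rewrite ?pt0 ?pt1.
pose F v := row i2 (Y v).
have Fs v : shadow (F v) = f v by apply: row2P; rewrite !(pt0, pt1) mxE.
pose psi w := cinv k (h (shadow w)).
pose phi z := F (cmap k z).
have inU1 v : `|v - v0| < r -> `|v - v0| < r1 by move=> /lt_le_trans; apply.
have FhypE v : `|v - v0| < r -> hyp (F v).
  by move=> /inU1 /hr1[vr0 _ _]; exact: frame_hyp fY vr0.
have psiP w : hyp w -> w 0 i2 < eta ->
    [/\ `|h (shadow w) - v0| < r, cimg k (h (shadow w)) & F (h (shadow w)) = w].
  move=> hw w2; have [a b] := hf _ (sd w hw w2).
  split=> //; first by have [_ /overlapP[]] := hr1 _ (inU1 _ a).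
  by apply: shadow_inj => //; [exact: FhypE|rewrite Fs].
have oFc : forall v, `|v - v0| < r -> {for v, continuous F}.
  move=> v vr; have FF : Filter (nbhs (v : plane)) by exact: nbhs_filter.
  apply: cvg_mx => i j; rewrite mxE; under eq_fun do rewrite mxE.
  by apply: Ck_cts (CY1 i2 j) _; exact: inU1.
have pF (v : plane) : `|v - v0| < r -> F v 0 i2 < eta -> nbhs v [set w | F w 0 i2 < eta].
  move=> vr ve; have FF : Filter (nbhs (v : plane)) by exact: nbhs_filter.
  have c1 : F w @[w --> v] --> F v by exact: oFc.
  have hc := @cvg_entry _ _ _ FF _ _ _ _ 0 i2 c1.
  exact: (cvgr_lt _ hc).
pose U := [set z | [/\ cdom k z, `|cmap k z - v0| < r & F (cmap k z) 0 i2 < eta]].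
exists psi, eta; split=> //; last first.
  rewrite /psi (_ : shadow orig = f v0) ?hv0 ?cmapK//.
  by rewrite fv0; apply: row2P; rewrite !(pt0, pt1) row3E mxE.
exists phi, U; split.
- apply: near_open => z [kz zr ze].
  have hb : nbhs (cmap k z) [set v | `|v - v0| < r].
    by apply: open_nbhs_nbhs; split=> //; exact: ball_plane_open.
  by apply: filterS3 (cdom_nbhs kz) (cmap_near kz hb) (cmap_near kz (pF _ zr ze)) => y.
- move=> z [kz zr ze]; split=> //; last by rewrite /psi /phi Fs hK// cmapK.
  have [_ /overlapP[_ lz] pos] := hr1 _ (inU1 _ zr); rewrite cmapK// in lz.
  have fYr : frame_field (g k) [set v : plane | `|v - v0| < r] Y.
    by apply: (frame_restrict fY); [exact: ball_plane_open|move=> v /inU1 /hr1[]].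
  apply: (dev_at_one hS Ak Bl kz lz fYr) => //.
  + by move=> v /inU1 /hr1[_ /overlapP[]].
  + by move=> v /inU1 /hr1[_ /overlapP[kv _] _]; rewrite /phi; have [_ ->] := cinvK kv.
- move=> w hw w2; have [a b c] := psiP w hw w2.
  have [kd kc] := cinvK b.
  by rewrite /U /phi /psi /= kc c.
- move=> w hw w2; have [a b c] := psiP w hw w2.
  have h1 : {for shadow w, continuous h} by exact: invertible_continuous L0 inv (sd w hw w2).
  have h2 : {for h (shadow w), continuous (cinv k)} by exact: cinv_continuous.
  have h3 := @continuous_comp _ _ _ shadow h w (@shadow_continuous w) h1.
  exact: (@continuous_comp _ _ _ _ (cinv k) w h3 h2).
Qed.

(** Any point of a sheet can be moved to the origin, at the price of a smaller
    radius that is uniform nearby. *)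
Lemma sheet_recenter psi (eta k : R) phi U z :
  open U -> (forall z, U z -> [/\ dev_at phi z, (phi z) 0 i2 < eta & psi (phi z) = z]) ->
  (forall w, hyp w -> w 0 i2 < eta -> U (psi w) /\ phi (psi w) = w) ->
  (forall w, hyp w -> w 0 i2 < eta -> {for w, continuous psi}) ->
  2 * k ^+ 2 - 1 < eta -> U z -> (phi z) 0 i2 < k ->
  forall e, e <= k -> exists2 psi', sheet psi' e & psi' orig = z.
Proof.
move=> oU UP psiP psic ke Uz zk e ek.
have [dz zeta pz] := UP _ Uz; have ha := dev_at_hyp hS dz.
have [M iM oM] := hyp_transitive ha; have iV := isomV iM.
have Mc (w : space) : {for w, continuous (fun w : space => w *m M)}.
  have FF : Filter (nbhs (w : space)) by exact: nbhs_filter.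
  by apply: cvg_mulmx => //; exact: cvg_cst.
have pc z' : U z' -> {for z', continuous phi}.
  move=> /UP[d _ _]. exact: (dev_at_continuous hS d).
have wE w : hyp w -> w 0 i2 < e -> hyp (w *m M) /\ (w *m M) 0 i2 < eta.
  move=> hw we; have hwM := isom_hyp iM hw; split=> //.
  have h1 : lor orig (phi z) <= k by rewrite lor_orig ltW.
  have h2 : lor (phi z) (w *m M) <= k by rewrite -oM isom_lor// lor_orig; lra.
  by have := lor_double hyp_orig ha hwM h1 h2; rewrite lor_orig; lra.
exists (fun w => psi (w *m M)); last by rewrite oM.
exists (fun z' => phi z' *m invmx M), [set z' | U z' /\ lor (phi z) (phi z') < e]; split.
- apply: near_open => z' [Uz' le].
  have h1 : nbhs z' U by exact: open_nbhs_nbhs.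
  have h2 : nbhs (phi z') [set w | lor (phi z) w < e].
    by apply: open_nbhs_nbhs; split=> //; exact: lor_ball_open.
  by apply: filterS2 h1 (pc _ Uz' _ h2) => y.
- move=> z' [Uz' le]; have [d _ p] := UP _ Uz'; split.
  + exact: dev_at_mulr.
  + by rewrite -lor_orig lorC lor_invmx// oM lorC.
  + by rewrite mulmxKV//; exact: isom_unit.
- move=> w hw we; have [h1 h2] := wE w hw we; have [h3 h4] := psiP _ h1 h2.
  split; last by rewrite h4 mulmxK//; exact: isom_unit.
  by split=> //; rewrite h4 -oM isom_lor// lor_orig.
- move=> w hw we; have [h1 h2] := wE w hw we.
  exact: (@continuous_comp _ _ _ (fun w : space => w *m M) psi w (Mc w) (psic _ h1 h2)).
Qed.

(** The radius is positive and locally bounded below by [sheet_recenter]. *)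
Lemma uniform_sheets : compact [set: X] -> exists2 eta, 1 < eta &
  forall x, exists2 psi, sheet psi eta & psi orig = x.
Proof.
move=> /compact_near_coveringP cX.
pose P (e : R) x := exists2 psi, sheet psi e & psi orig = x.
have H : \forall e \near (1 : R)^'+, [set: X] `<=` P e.
  apply: cX => x _; have [psi [eta [e1 [phi [U [oU UP psiP psic]]] px]]] := sheet_exists x.
  have oe : orig 0 i2 < eta by rewrite row3E.
  have [Ux pxo] := psiP _ hyp_orig oe; rewrite px in Ux pxo.
  pose k := Num.sqrt ((eta + 3) / 4); have k1 : 1 < k by rewrite -sqrtr1 ltr_sqrt; lra.
  have ke : 2 * k ^+ 2 - 1 < eta by rewrite sqr_sqrtr; lra.
  have [do_ _ _] := UP _ Ux.
  have xk : nbhs x [set y | phi y 0 i2 < k].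
    have FF : Filter (nbhs x) by exact: nbhs_filter.
    have c1 : phi y @[y --> x] --> phi x by exact: (dev_at_continuous hS do_).
    have hc := @cvg_entry _ _ _ FF _ _ _ _ 0 i2 c1.
    by apply: (cvgr_lt _ hc); rewrite pxo row3E.
  have Ux' : nbhs x U by exact: open_nbhs_nbhs.
  exists ([set y | U y /\ phi y 0 i2 < k], [set e : R | e <= k]).
    split=> /=; first exact: filterI.
    by near=> e; near: e; exact: nbhs_right_le.
  move=> [y e] /= [[Uy yk] ek].
  exact: (sheet_recenter oU UP psiP psic ke Uy yk ek).
near (1 : R)^'+ => e; exists e; first by near: e; exact: nbhs_right_gt.
move=> x; have : [set: X] `<=` P e by near: e.
exact.
Unshelve. all: by end_near. Qed.

End Sheets.

(** * The developing covering *)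

(** Compactness of the interval, for relations between parameters. *)
Lemma interval_chain (R : realType) (a b : R) (Rel : R -> R -> Prop) : a <= b ->
  (forall s t u, Rel s t -> Rel t u -> Rel s u) ->
  (forall t, a <= t <= b -> exists2 r : R, 0 < r & forall s u, a <= s -> s <= u -> u <= b ->
     `|s - t| < r -> `|u - t| < r -> Rel s u) ->
  Rel a b.
Proof.
move=> ab tr loc; pose S := [set t | a <= t <= b /\ Rel a t].
have Sa : S a.
  split; first by rewrite lexx ab.
  have [|r r0 h] := loc a; first by rewrite lexx ab.
  by apply: h => //; rewrite subrr normr0.
have ubS : has_ubound S by exists b => t [/andP[]].
have supS : has_sup S by split; [exists a|].
pose c := sup S; have ac : a <= c by exact: ub_le_sup.
have cb : c <= b by apply: ge_sup; [exists a|move=> t [/andP[]]].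
have [|r r0 h] := loc c; first by rewrite ac cb.
have [t [/andP[at_ tb] Rt] ct] := sup_adherent r0 supS.
have tc : t <= c by apply: ub_le_sup => //; split=> //; rewrite at_ tb.
pose u := Num.min b (c + r / 2).
have ub : u <= b by rewrite ge_min lexx.
have uc : u <= c + r / 2 by rewrite ge_min lexx orbT.
have cu : c <= u by rewrite le_min cb; lra.
have Rau : Rel a u.
  apply: tr Rt _; apply: h => //; first exact: le_trans tc cu.
    by rewrite ler0_norm -/c in ct *; lra.
  by rewrite ger0_norm; lra.
have Su : S u by split=> //; rewrite ub (le_trans ac cu).
have : u <= c by exact: ub_le_sup.
rewrite /u ge_min => /orP[bc|]; last by lra.
by have -> : b = u by apply/le_anti; rewrite ub (le_trans bc cu).
Qed.

Section Developing.
Context {R : realType}.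
Local Notation plane := 'rV[R]_2.
Local Notation space := 'rV[R]_3.
Local Notation mink_mx := (@mink_mx R).
Local Notation hyp := (@hyp R).
Local Notation orig := (@orig R).

Definition hnear (p : space) (P : space -> Prop) : Prop :=
  exists2 d : R, 1 < d & forall w, hyp w -> lor p w < d -> P w.

Lemma hnear_and p P Q : hnear p P -> hnear p Q -> hnear p (fun w => P w /\ Q w).
Proof.
move=> [d d1 h] [e e1 h']; exists (Num.min d e) => [|w hw]; first by rewrite lt_min d1.
by rewrite lt_min => /andP[? ?]; split; [exact: h|exact: h'].
Qed.

Lemma hnear_sub p (P Q : space -> Prop) : (forall w, hyp w -> P w -> Q w) -> hnear p P -> hnear p Q.
Proof. by move=> PQ [d d1 h]; exists d => // w hw wd; apply: PQ => //; exact: h. Qed.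

Lemma hnear_point p P : hyp p -> hnear p P -> P p.
Proof. by move=> hp [d d1 h]; apply: h => //; case: hp => ->. Qed.

Lemma hnear_nbhs p (V : set space) : hyp p -> nbhs p V -> hnear p V.
Proof.
move=> hp /nbhs_ballP[e /= e0 h]; have [d d1 hd] := hyp_near hp e0.
by exists d => // w hw wd; apply: h; rewrite -ball_normE /ball_/= distrC; exact: hd.
Qed.

Lemma hnear_ball p q d : hyp q -> lor p q < d -> hnear q (fun w => lor p w < d).
Proof.
move=> hq pq; apply: (@hnear_nbhs q [set w | lor p w < d]) => //.
by apply: open_nbhs_nbhs; split=> //; exact: lor_ball_open.
Qed.

Lemma hnear_hnear p P : hnear p P -> hnear p (fun q => hnear q P).
Proof.
move=> [d d1 h]; exists d => // q hq pq.
by apply: hnear_sub (hnear_ball hq pq) => w; exact: h.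
Qed.

Context {X : topologicalType}.
Variables (A B : set (chart R X)) (g : chart R X -> plane -> 'M[R]_2).
Hypothesis hS : oriented_hyperbolic A B g.
Local Notation dev_at := (dev_at A B g).
Local Notation sheet := (sheet A B g).

Lemma sheet_inj psi e v w : sheet psi e -> hyp v -> hyp w -> v 0 i2 < e -> w 0 i2 < e ->
  psi v = psi w -> v = w.
Proof.
move=> [phi [U [_ _ h _]]] hv hw ve we E.
by have [_ <-] := h _ hv ve; have [_ <-] := h _ hw we; rewrite E.
Qed.

(** Two isometric charts of [X] differ by an isometry near a common point. *)
Lemma sheet_compat psi1 psi2 e1 e2 a b : sheet psi1 e1 -> sheet psi2 e2 ->
  hyp a -> hyp b -> a 0 i2 < e1 -> b 0 i2 < e2 -> psi1 a = psi2 b ->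
  exists M, [/\ isom M, a *m M = b & hnear a (fun w => psi1 w = psi2 (w *m M))].
Proof.
move=> [f1 [U1 [oU1 UP1 h1 c1]]] [f2 [U2 [oU2 UP2 h2 c2]]] ha hb ae be E.
have [Ua fa] := h1 _ ha ae; have [Ub fb] := h2 _ hb be.
have [d1 _ _] := UP1 _ Ua; have [d2 _ _] := UP2 _ Ub; rewrite -E in Ub fb d2.
have [M iM nM] := dev_compat hS d1 d2; exists M; split=> //.
  by have := nbhs_singleton nM; rewrite fa fb.
have n2 : nbhs (psi1 a) U2 by exact: open_nbhs_nbhs.
have n23 := @filterI _ _ (nbhs_filter (psi1 a)) _ _ nM n2.
have n3 := c1 a ha ae _ n23.
have n4 : hnear a (fun w => lor orig w < e1) by apply: hnear_ball; rewrite ?lor_orig.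
have n5 := hnear_nbhs ha n3.
apply: (hnear_sub _ (hnear_and n5 n4)) => w hw [[/= Ew Uw]].
rewrite lor_orig => we; have [_ fw] := h1 _ hw we.
by have [_ _ <-] := UP2 _ Uw; rewrite Ew fw.
Qed.

Lemma sheet_near psi e w (V : set X) : sheet psi e -> hyp w -> w 0 i2 < e -> nbhs (psi w) V ->
  hnear w (fun v => V (psi v)).
Proof. by move=> [f [U [_ _ _ c]]] hw we n; exact: hnear_nbhs hw (c w hw we _ n). Qed.

Lemma sheet_open psi e w (P : space -> Prop) : sheet psi e -> hyp w -> w 0 i2 < e -> hnear w P ->
  nbhs (psi w) [set z | exists v, [/\ hyp v, v 0 i2 < e, P v & psi v = z]].
Proof.
move=> [f [U [oU UP h _]]] hw we [d d1 hd].
have [Uw fw] := h _ hw we; have [dw _ _] := UP _ Uw.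
have n1 : nbhs (psi w) U by exact: open_nbhs_nbhs.
have n2 : nbhs (psi w) [set z | lor w (f z) < d].
  have c1 : f z @[z --> psi w] --> f (psi w) by exact: (dev_at_continuous hS dw).
  apply: (c1 [set v | lor w v < d]).
  apply: open_nbhs_nbhs; split; first exact: lor_ball_open.
  by rewrite /= fw; case: hw => ->.
apply: filterS2 n1 n2 => z Uz zd; have [dz ze pz] := UP _ Uz.
have hz := dev_at_hyp hS dz.
by exists (f z); split=> //; exact: hd.
Qed.

Variables (eta : R) (psi : X -> space -> X).
Hypothesis eta1 : 1 < eta.
Hypothesis psi_sheet : forall x, sheet (psi x) eta.
Hypothesis psi_orig : forall x, psi x orig = x.
Hypothesis X_hausdorff : hausdorff_space X.

Let orig_eta : orig 0 i2 < eta. Proof. by rewrite row3E. Qed.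

Definition local_iso (f : space -> X) (p : space) : Prop :=
  exists M, [/\ isom M, p *m M = orig & hnear p (fun w => f w = psi (f p) (w *m M))].

Lemma local_iso_sheet x p M : isom M -> hyp p -> (p *m M) 0 i2 < eta ->
  local_iso (fun w => psi x (w *m M)) p.
Proof.
move=> iM hp pe; have hpM := isom_hyp iM hp.
have [N [iN pN [d d1 hd]]] := sheet_compat (psi_sheet x) (psi_sheet (psi x (p *m M))) hpM
  hyp_orig pe orig_eta (esym (psi_orig _)).
exists (M *m N); split; [exact: isomM|by rewrite mulmxA|].
exists d => // w hw wd; rewrite mulmxA; apply: hd; first exact: isom_hyp iM hw.
by rewrite isom_lor.
Qed.

Lemma local_iso_ext f f' p : hyp p -> hnear p (fun w => f w = f' w) -> local_iso f p ->
  local_iso f' p.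
Proof.
move=> hp n [M [iM pM h]]; exists M; split=> //; rewrite -(hnear_point hp n).
by apply: hnear_sub (hnear_and n h) => w hw [<-].
Qed.

Lemma local_iso_near f p (V : set X) : hyp p -> local_iso f p -> nbhs (f p) V ->
  hnear p (fun w => V (f w)).
Proof.
move=> hp [M [iM pM h]] n.
have := sheet_near (psi_sheet (f p)) hyp_orig orig_eta; rewrite psi_orig => /(_ _ n) [d d1 hd].
have h2 : hnear p (fun w => V (psi (f p) (w *m M))).
  exists d => // w hw wd; apply: hd; first exact: isom_hyp iM hw.
  by rewrite -pM isom_lor.
by apply: hnear_sub (hnear_and h h2) => w hw [->].
Qed.

Definition convex (C : set space) : Prop :=
  C `<=` hyp /\ forall a b t, C a -> C b -> 0 <= t <= 1 -> C (seg a b t).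

(** Along the segment from [a] to [b], agreement near a point propagates to near
    parameters: the values of [f] and [f'] agree there because [X] is Hausdorff,
    and the isometries that express them in a sheet are equal by rigidity. *)
Lemma agreement (C : set space) f f' a b : convex C ->
  (forall p, C p -> local_iso f p) -> (forall p, C p -> local_iso f' p) ->
  C a -> C b -> hnear a (fun w => f w = f' w) -> hnear b (fun w => f w = f' w).
Proof.
move=> [Ch cv] lf lf' Ca Cb.
have ha := Ch _ Ca; have hb := Ch _ Cb.
pose Rel (s t : R) := hnear (seg a b s) (fun w => f w = f' w) ->
  hnear (seg a b t) (fun w => f w = f' w).
suff : Rel 0 1 by rewrite /Rel seg0// seg1.
apply: interval_chain => // [s t u h1 h2 /h1 /h2 //|t0 tI].
set p := seg a b t0; have Cp : C p by exact: cv.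
have hp := Ch _ Cp; have [M [iM pM nM]] := lf _ Cp; have [M' [iM' pM' nM']] := lf' _ Cp.
have toR P : hnear p P -> exists2 r : R, 0 < r & forall t, 0 <= t -> t <= 1 -> `|t - t0| < r ->
    P (seg a b t).
  move=> [d d1 hd]; have [r r0 hr] := seg_near ha hb tI d1.
  exists r => // t t1 t2 tr; have tI' : 0 <= t <= 1 by rewrite t1.
  by apply: hd; [exact: seg_hyp|exact: hr].
have [fp|fp] := eqVneq (f p) (f' p); last first.
  move: X_hausdorff; rewrite open_hausdorff => /(_ _ _ fp) [OO m1 m2].
  case: OO m1 m2 => O O' /= [m1 m1'] [oO oO' /eqP dis].
  have Op := set_mem m1; have Op' := set_mem m1'.
  have n1 := local_iso_near hp (lf _ Cp) (open_nbhs_nbhs (conj oO Op)).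
  have n2 := local_iso_near hp (lf' _ Cp) (open_nbhs_nbhs (conj oO' Op')).
  have [r r0 hr] := toR _ (hnear_and n1 n2).
  exists r => // s u s0 su u1 sr ur nfs; exfalso.
  have s1 : s <= 1 by exact: le_trans su u1.
  have hs : hyp (seg a b s) by apply: seg_hyp => //; rewrite s0.
  have [h1 h2] := hr _ s0 s1 sr; have e := hnear_point hs nfs.
  have : (O `&` O') (f (seg a b s)) by split=> //; rewrite e.
  by rewrite dis.
rewrite -fp in nM'.
have ne : hnear p (fun w => lor p w < eta) by exists eta.
have N := hnear_and (hnear_and nM nM') ne.
have [r r0 hr] := toR _ (hnear_hnear N).
exists r => // s u s0 su u1 sr ur nfs.
have s1 : s <= 1 by exact: le_trans su u1.
have u0 : 0 <= u by exact: le_trans s0 su.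
have hs : hyp (seg a b s) by apply: seg_hyp => //; rewrite s0.
have Ns := hr _ s0 s1 sr; have Nu := hr _ u0 u1 ur.
have MM : M = M'.
  have [d d1 hd] := hnear_and Ns nfs.
  apply: (rigidity hs d1) => w hw wd; have [[[e1 e2] e3] e4] := hd _ hw wd.
  apply: (sheet_inj (psi_sheet (f p))); [exact: isom_hyp iM hw|exact: isom_hyp iM' hw| | |].
  - by rewrite -lor_orig -pM isom_lor.
  - by rewrite -lor_orig -pM' isom_lor.
  - by rewrite -e1 e4 e2.
apply: hnear_sub Nu => w hw [[-> ->] _]; by rewrite MM.
Qed.

Lemma convex_balls p q c d : 0 < c -> 0 < d -> 
  convex [set w | [/\ hyp w, lor p w < c & lor q w < d]].
Proof.
move=> c0 d0; split=> [w []//|a b t [ha pa qa] [hb pb qb] tI].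
by split; [exact: seg_hyp|exact: seg_ball|exact: seg_ball].
Qed.

Lemma convex_hyp : convex hyp.
Proof. by split=> // a b t ha hb tI; exact: seg_hyp. Qed.

Definition extends (x : X) (C : R) (f : space -> X) : Prop :=
  (forall p, hyp p -> p 0 i2 < C -> local_iso f p) /\ hnear orig (fun w => f w = psi x w).

Lemma sheet_extends x : extends x eta (psi x).
Proof.
split=> [p hp pe|]; last by exists eta.
have := @local_iso_sheet x p 1%:M isom1 hp; rewrite mulmx1 => /(_ pe).
by apply: local_iso_ext => //; exists eta => // w _ _; rewrite mulmx1.
Qed.

(** The map is continued to a larger ball by the sheets centred at points of the
    smaller one; two of them agree where they overlap because they both agree
    with the given map on a part of the overlap. *)
Lemma extend_step : exists2 c : R, 1 < c & forall x C f, eta <= C -> extends x C f ->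
  exists f', extends x (c * C) f'.
Proof.
have e1 := eta1; pose k := Num.sqrt ((eta + 3) / 4).
have k1 : 1 < k by rewrite -sqrtr1 ltr_sqrt; lra.
have ke : 2 * k ^+ 2 - 1 < eta by rewrite sqr_sqrtr; lra.
have ke' : k <= eta by have : k <= k ^+ 2 by [rewrite expr2; nra]; nra.
have [c c1 hc] := lor_pull k1 eta1; exists c => // x C f eC [lf nf].
have C0 : 0 < C by lra.
have /choice[p hp] : forall w, exists p, hyp w -> w 0 i2 < c * C ->
    [/\ hyp p, p 0 i2 < C & lor p w < k].
  move=> w; have [[hw wC]|n] := pselect (hyp w /\ w 0 i2 < c * C).
    by have [q hq] := hc C w eC hw wC; exists q.
  by exists orig => hw wC; case: n.
have /choice[M hM] : forall q, exists M, hyp q -> q 0 i2 < C ->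
    [/\ isom M, q *m M = orig & hnear q (fun w => f w = psi (f q) (w *m M))].
  move=> q; have [[hq qC]|n] := pselect (hyp q /\ q 0 i2 < C).
    by have [M hM] := lf q hq qC; exists M.
  by exists 1%:M => hq qC; case: n.
pose F q w := psi (f q) (w *m M q).
have lF q w : hyp q -> q 0 i2 < C -> hyp w -> lor q w < eta -> local_iso (F q) w.
  move=> hq qC hw qw; have [iM qM _] := hM q hq qC.
  by apply: local_iso_sheet => //; rewrite -lor_orig -qM isom_lor.
have Ff q w : hyp q -> q 0 i2 < C -> hyp w -> lor q w < eta -> w 0 i2 < C ->
    hnear w (fun v => f v = F q v).
  move=> hq qC hw qw wC; have [iM qM nq] := hM q hq qC.
  have e0 : 0 < eta by lra.
  apply: (agreement (convex_balls q orig e0 C0) (a := q)) => //.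
  - by move=> v [hv _]; rewrite lor_orig; exact: lf.
  - by move=> v [hv qv _]; exact: lF.
  - by split=> //; rewrite ?lor_orig//; case: hq => ->.
  - by split=> //; rewrite lor_orig.
have FF q q' w : hyp q -> q 0 i2 < C -> hyp q' -> q' 0 i2 < C -> hyp w ->
    lor q w < k -> lor q' w < k -> F q w = F q' w.
  move=> hq qC hq' qC' hw qw qw'; have e0 : 0 < eta by lra.
  apply: (hnear_point (P := fun v => F q v = F q' v)) => //.
  have qq : lor q q' < eta.
    have h1 := ltW qw; have h2 : lor w q' <= k by rewrite lorC ltW.
    exact: le_lt_trans (lor_double hq hw hq' h1 h2) ke.
  apply: (agreement (convex_balls q q' e0 e0) (a := q)) => //.
  - by move=> v [hv qv _]; exact: lF.
  - by move=> v [hv _ qv]; exact: lF.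
  - by split=> //; [case: hq => ->|rewrite lorC].
  - by split=> //; lra.
  - have n1 := Ff q q hq qC hq; have n2 := Ff q' q hq' qC' hq.
    have qq1 : lor q q < eta by case: hq => ->.
    have qq2 : lor q' q < eta by rewrite lorC.
    by apply: hnear_sub (hnear_and (n1 qq1 qC) (n2 qq2 qC)) => v hv [<-].
have near_F w : hyp w -> w 0 i2 < c * C -> hnear w (fun v => F (p w) v = F (p v) v).
  move=> hw wC; have [hpw pwC pww] := hp w hw wC.
  have n1 := hnear_ball hw pww.
  have n2 : hnear w (fun v => lor orig v < c * C) by apply: hnear_ball; rewrite ?lor_orig.
  apply: hnear_sub (hnear_and n1 n2) => v hv []; rewrite lor_orig => pv vC.
  by have [hpv pvC pvv] := hp v hv vC; exact: FF.
exists (fun w => F (p w) w); split=> [w hw wC|].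
  have [hpw pwC pww] := hp w hw wC.
  by apply: (local_iso_ext hw (near_F w hw wC)); apply: lF => //; lra.
have oC : orig 0 i2 < C by rewrite row3E; lra.
have ocC : orig 0 i2 < c * C by apply: lt_trans oC _; rewrite ltr_pMl.
have [hpo poC poo] := hp orig hyp_orig ocC.
have n1 := Ff (p orig) orig hpo poC hyp_orig _ oC.
have n2 := near_F orig hyp_orig ocC.
have pe : lor (p orig) orig < eta by lra.
by apply: hnear_sub (hnear_and (hnear_and (n1 pe) n2) nf) => w hw [[<- <-]].
Qed.

Lemma extends_unique x C C' f f' w : extends x C f -> extends x C' f' -> hyp w ->
  w 0 i2 < C -> w 0 i2 < C' -> hnear w (fun v => f v = f' v).
Proof.
move=> [lf nf] [lf' nf'] hw wC wC'; have w1 := hyp_pos hw.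
have [C0 C0'] : 0 < C /\ 0 < C' by split; lra.
apply: (agreement (convex_balls orig orig C0 C0') (a := orig)).
- by move=> p [hp]; rewrite lor_orig => pC _; exact: lf.
- by move=> p [hp _]; rewrite lor_orig => pC; exact: lf'.
- by split; rewrite ?lor_orig ?row3E; [exact: hyp_orig|lra|lra].
- by split; rewrite ?lor_orig.
- by apply: hnear_sub (hnear_and nf nf') => v hv [-> ->].
Qed.

(** The extensions to balls of growing radii are compatible. *)
Lemma developing_map x : exists2 E : space -> X, forall p, hyp p -> local_iso E p & E orig = x.
Proof.
have e1 := eta1; have [c c1 step] := extend_step.
have ext n : exists f, extends x (c ^+ n * eta) f.
  elim: n => [|n [f hf]]; first by exists (psi x); rewrite expr0 mul1r; exact: sheet_extends.
  have [|f' hf'] := step x _ f _ hf; last by exists f'; rewrite exprS -mulrA.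
  by rewrite ler_peMl ?exprn_ege1//; lra.
have ext' C : exists f, extends x C f.
  have [n hn] : exists n, C <= c ^+ n * eta.
    have bern n : n%:R * (c - 1) <= c ^+ n.
      elim: n => [|n IH]; first by rewrite mul0r expr0.
      have : 1 <= c ^+ n by rewrite exprn_ege1// ltW.
      by rewrite exprS -natr1; move: IH; move: (c ^+ n) (n%:R) => u y; nra.
    have x0 : 0 <= `|C| / (c - 1) by rewrite divr_ge0//; lra.
    have := archi_boundP x0; set n := Num.bound _; rewrite ltr_pdivrMr; last by lra.
    move=> h; exists n; have := bern n; have := ler_norm C; move: (c ^+ n) h => y h hC hy.
    have y0 : 0 <= y by have := normr_ge0 C; lra.
    by nra.
  have [f [lf nf]] := ext n; exists f; split=> // p hp pC; apply: lf => //.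
  exact: lt_le_trans hn.
have {}ext' := choice ext'; case: ext' => f hf.
exists (fun w : space => f (w 0 i2 + 1) w); last first.
  have [_ n] := hf (orig 0 i2 + 1); by rewrite (hnear_point hyp_orig n) psi_orig.
move=> p hp; have p1 : p 0 i2 < p 0 i2 + 1 by lra.
have p2 : p 0 i2 < p 0 i2 + 2 by lra.
have [lf _] := hf (p 0 i2 + 2).
apply: (local_iso_ext hp _ (lf p hp p2)).
have n : hnear p (fun v => lor orig v < p 0 i2 + 2) by apply: hnear_ball; rewrite ?lor_orig.
apply: hnear_sub n => v hv; rewrite lor_orig => vp.
have v1 : v 0 i2 < v 0 i2 + 1 by lra.
exact: hnear_point hv (extends_unique (hf _) (hf _) hv vp v1).
Qed.

End Developing.

Section Deck.
Context {R : realType}.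
Local Notation plane := 'rV[R]_2.
Local Notation space := 'rV[R]_3.
Local Notation mink_mx := (@mink_mx R).
Local Notation hyp := (@hyp R).
Local Notation orig := (@orig R).
Context {X : topologicalType}.
Variables (A B : set (chart R X)) (g : chart R X -> plane -> 'M[R]_2).
Hypothesis hS : oriented_hyperbolic A B g.
Local Notation dev_at := (dev_at A B g).
Local Notation sheet := (sheet A B g).
Variables (eta : R) (psi : X -> space -> X).
Hypothesis eta1 : 1 < eta.
Hypothesis psi_sheet : forall x, sheet (psi x) eta.
Hypothesis psi_orig : forall x, psi x orig = x.
Hypothesis X_hausdorff : hausdorff_space X.
Variable E : space -> X.
Hypothesis E_iso : forall p, hyp p -> local_iso psi E p.

Let orig_eta : orig 0 i2 < eta. Proof. by rewrite row3E. Qed.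

(** Sheets are evenly covered: [E] precomposed with an isometry and the sheet are
    local isometries that agree near one point. *)
Lemma sheet_lift x a y : hyp a -> a 0 i2 < eta -> hyp y -> psi x a = E y ->
  exists M, [/\ isom M, a *m M = y & forall w, hyp w -> w 0 i2 < eta -> E (w *m M) = psi x w].
Proof.
move=> ha ae hy e; have [N [iN yN nN]] := E_iso hy.
have e' : psi x a = psi (E y) orig by rewrite e psi_orig.
have [M1 [iM1 aM1 nM1]] := sheet_compat hS (psi_sheet x) (psi_sheet (E y)) ha hyp_orig ae
  orig_eta e'.
have iV := isomV iN; pose M := M1 *m invmx N.
have iM : isom M by exact: isomM.
have aM : a *m M = y by rewrite /M mulmxA aM1 -yN mulmxK//; exact: isom_unit.
have liftM P w : hyp w -> hnear (w *m M) P -> hnear w (fun v => P (v *m M)).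
  move=> hw [d d1 hd]; exists d => // v hv vd; apply: hd; first exact: isom_hyp iM hv.
  by rewrite isom_lor.
exists M; split=> // w hw we; apply/esym.
have e0 : 0 < eta by have := eta1; lra.
apply: (hnear_point (P := fun w => psi x w = E (w *m M)) hw).
apply: (agreement eta1 psi_sheet psi_orig X_hausdorff (convex_balls orig orig e0 e0) (a := a)).
- move=> p [hp]; rewrite lor_orig => pe _.
  by have [] := sheet_extends hS eta1 psi_sheet psi_orig x => h _; exact: h.
- move=> p [hp _ _]; have hpM := isom_hyp iM hp.
  have [K [iK pK nK]] := E_iso hpM; exists (M *m K); split; [exact: isomM|by rewrite mulmxA|].
  by apply: hnear_sub (liftM _ _ hp nK) => v hv ->; rewrite mulmxA.
- by split; rewrite ?lor_orig.
- by split; rewrite ?lor_orig.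
- rewrite -aM in nN; apply: hnear_sub (hnear_and nM1 (liftM _ _ ha nN)) => v hv [-> ->].
  by rewrite aM /M mulmxA mulmxKV//; exact: isom_unit.
Qed.

Lemma point_lift p : hyp p -> exists M, [/\ isom M, orig *m M = p &
  forall w, hyp w -> w 0 i2 < eta -> E (w *m M) = psi (E p) w].
Proof. by move=> hp; apply: sheet_lift => //; exact: hyp_orig. Qed.

Lemma E_inj p v w : hyp p -> hyp v -> hyp w -> lor p v < eta -> lor p w < eta ->
  E v = E w -> v = w.
Proof.
move=> hp hv hw pv pw e; have [M [iM oM hM]] := point_lift hp.
have Mu := isom_unit iM; have iV := isomV iM.
have key u : hyp u -> lor p u < eta -> [/\ hyp (u *m invmx M), (u *m invmx M) 0 i2 < eta &
    psi (E p) (u *m invmx M) = E u].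
  move=> hu pu; have hu' := isom_hyp iV hu.
  have ue : (u *m invmx M) 0 i2 < eta by rewrite -lor_orig lorC lor_invmx// oM lorC.
  by split=> //; rewrite -hM// mulmxKV.
have [v1 v2 v3] := key v hv pv; have [w1 w2 w3] := key w hw pw.
have := sheet_inj (psi_sheet (E p)) v1 w1 v2 w2; rewrite v3 w3 e => /(_ erefl).
by move=> /(congr1 (mulmx^~ M)); rewrite !mulmxKV.
Qed.

Lemma E_near p (V : set X) : hyp p -> nbhs (E p) V -> hnear p (fun w => V (E w)).
Proof.
by move=> hp; apply: (local_iso_near eta1 psi_sheet psi_orig hp); exact: E_iso.
Qed.

Lemma E_open p (P : space -> Prop) : hyp p -> hnear p P ->
  nbhs (E p) [set z | exists2 v, hyp v /\ P v & E v = z].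
Proof.
move=> hp [d d1 hd]; have [M [iM oM hM]] := point_lift hp.
have n : hnear orig (fun w => P (w *m M)).
  exists d => // w hw wd; apply: hd; first exact: isom_hyp iM hw.
  by rewrite -oM isom_lor.
have := sheet_open hS (psi_sheet (E p)) hyp_orig orig_eta n; rewrite psi_orig.
apply: filterS => z [v [hv ve Pv <-]]; exists (v *m M); last exact: hM.
by split=> //; exact: isom_hyp iM hv.
Qed.

(** The image is open, and closed because sheets are evenly covered. *)
Lemma E_surj : connected [set: X] -> forall x, exists2 w, hyp w & E w = x.
Proof.
move=> cX x; pose I := [set z | exists2 w, hyp w & E w = z].
suff : I = [set: X] by move=> h; have : [set: X] x by []; rewrite -h.
apply: cX.
- by exists (E orig); exists orig => //; exact: hyp_orig.
- exists I; last by rewrite setTI.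
  apply: near_open => z [w hw <-].
  have n : hnear w (fun=> True) by exists eta.
  by apply: filterS (E_open hw n) => y [v [hv _] <-]; exists v.
- exists I; last by rewrite setTI.
  rewrite -openC; apply: near_open => z nz.
  have n : hnear orig (fun=> True) by exists eta.
  have := sheet_open hS (psi_sheet z) hyp_orig orig_eta n; rewrite psi_orig.
  apply: filterS => y [v [hv ve _ <-]] [w hw e]; apply: nz.
  have [M [iM vM hM]] := sheet_lift hv ve hw (esym e).
  by exists (orig *m M); [exact: isom_hyp iM hyp_orig|rewrite hM ?psi_orig//; exact: hyp_orig].
Qed.

Definition deck (M : 'M[R]_3) : Prop := isom M /\ forall v, hyp v -> E (v *m M) = E v.

Lemma deck1 : deck 1%:M.
Proof. by split=> [|v _]; [exact: isom1|rewrite mulmx1]. Qed.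

Lemma deckM M N : deck M -> deck N -> deck (M *m N).
Proof.
move=> [iM hM] [iN hN]; split=> [|v hv]; first exact: isomM.
by rewrite mulmxA hN ?hM//; exact: isom_hyp iM hv.
Qed.

Lemma deckV M : deck M -> deck (invmx M).
Proof.
move=> [iM hM]; split=> [|v hv]; first exact: isomV.
by rewrite -hM ?mulmxKV//; [exact: isom_unit|apply: isom_hyp hv; exact: isomV].
Qed.

(** An isometry that matches two sheets at [u] and [v] preserves [E] near [u],
    hence everywhere. *)
Lemma deck_trans u v : hyp u -> hyp v -> E u = E v -> exists2 M, deck M & u *m M = v.
Proof.
move=> hu hv e; have [M [iM oM hM]] := point_lift hu; have [N [iN oN hN]] := point_lift hv.
have iV := isomV iM; have Mu := isom_unit iM; pose K := invmx M *m N.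
have iK : isom K by exact: isomM.
have uK : u *m K = v by rewrite /K mulmxA -oM mulmxK.
exists K => //; split=> // w hw; apply/esym.
apply: (hnear_point (P := fun w => E w = E (w *m K)) hw).
apply: (agreement eta1 psi_sheet psi_orig X_hausdorff convex_hyp (a := u)).
- exact: E_iso.
- move=> p hp; have [L [iL pL [d d1 hL]]] := E_iso (isom_hyp iK hp).
  exists (K *m L); split; [exact: isomM|by rewrite (mulmxA p K L)|].
  exists d => // z hz zd; rewrite (mulmxA z K L); apply: hL; first exact: isom_hyp iK hz.
  by rewrite isom_lor.
- exact: hu.
- exact: hw.
- exists eta => // z hz uz; have hzM := isom_hyp iV hz.
  have ze : (z *m invmx M) 0 i2 < eta by rewrite -lor_orig lorC lor_invmx// oM lorC.
  by rewrite /K mulmxA hN// -e -hM// mulmxKV.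
Qed.

Lemma deck_free M v : deck M -> hyp v -> lor v (v *m M) < eta -> M = 1%:M.
Proof.
move=> [iM hM] hv vM; have hvM := isom_hyp iM hv.
have vv : v *m M = v.
  apply/esym; apply: (E_inj hv hv hvM) => //; last by rewrite hM.
  by case: (hv) => ->.
apply: (rigidity hv eta1) => w hw vw; rewrite mulmx1; apply/esym.
have hwM := isom_hyp iM hw.
by apply: (E_inj hv hw hwM) => //; [rewrite -{1}vv isom_lor|rewrite hM].
Qed.

(** This is what makes curves liftable chart by chart. *)
Lemma E_frame p k : hyp p -> A k -> cdom k (E p) -> exists U Y,
  [/\ frame_field (g k) U Y, U `<=` cimg k, U (cmap k (E p)),
      row i2 (Y (cmap k (E p))) = p &
      forall v, U v -> E (row i2 (Y v)) = cinv k v /\ lor p (row i2 (Y v)) < eta].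
Proof.
move=> hp Ak kp; have [M [iM pM [d d1 hM]]] := E_iso hp; set x := E p in kp hM *.
have [phi [U0 [oU0 UP h c]]] := psi_sheet x.
have iV := isomV iM; have Mu := isom_unit iM.
have [Ux] := h _ hyp_orig orig_eta; rewrite psi_orig => phx; rewrite psi_orig in Ux.
have [dx _ _] := UP _ Ux.
have dx' := dev_at_mulr iV dx.
have [U [Y [fY Uk Uz UF _]]] := dx' k Ak kp.
have [oU CY _ _ _] := fY.
have Yp : row i2 (Y (cmap k x)) = p by rewrite UF// cmapK// phx -pM mulmxK.
pose U' := [set v | [/\ U v, U0 (cinv k v), lor p (row i2 (Y v)) < d & lor p (row i2 (Y v)) < eta]].
have rc v : U v -> {for v, continuous (fun v => row i2 (Y v))}.
  move=> Uv; have FF : Filter (nbhs (v : plane)) by exact: nbhs_filter.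
  apply: cvg_mx => i j; rewrite mxE; under eq_fun do rewrite mxE.
  exact: Ck_cts (CY i2 j) Uv.
have oU' : open U'.
  apply: near_open => v [Uv U0v vd ve].
  have FF : Filter (nbhs (v : plane)) by exact: nbhs_filter.
  have n1 : nbhs v U by exact: open_nbhs_nbhs.
  have n2 : nbhs (cinv k v) U0 by exact: open_nbhs_nbhs.
  have c1 : row i2 (Y w) @[w --> v] --> row i2 (Y v) by exact: rc.
  have n3 : nbhs (row i2 (Y v)) [set w | lor p w < Num.min d eta].
    by apply: open_nbhs_nbhs; split; [exact: lor_ball_open|rewrite /= lt_min vd].
  apply: filterS3 n1 (cinv_near (Uk _ Uv) n2) (c1 _ n3) => w ? ? /=.
  by rewrite lt_min => /andP[? ?].
exists U', Y; split=> //.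
- by apply: (frame_restrict fY) => // v [].
- by move=> v [/Uk].
- by split=> //; rewrite ?cmapK// Yp; case: hp => ->.
- move=> v [Uv U0v vd ve]; split=> //; have hv := frame_hyp fY Uv.
  rewrite hM// UF// mulmxKV//.
  by have [_ _ ->] := UP _ U0v.
Qed.

Lemma E_bounded : compact [set: X] -> connected [set: X] ->
  exists C, forall x, exists w, [/\ hyp w, w 0 i2 < C & E w = x].
Proof.
move=> /compact_near_coveringP cX conX.
pose P (C : R) x := exists w, [/\ hyp w, w 0 i2 < C & E w = x].
have H : \forall C \near +oo, [set: X] `<=` P C.
  apply: cX => x _; have [w hw <-] := E_surj conX x.
  have n : hnear w (fun v => lor orig v < w 0 i2 + 1).
    by apply: hnear_ball; rewrite ?lor_orig//; lra.
  exists ([set z | exists2 v, hyp v /\ lor orig v < w 0 i2 + 1 & E v = z],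
     [set C | w 0 i2 + 1 < C]).
    split=> /=; first exact: E_open hw n.
    by apply: nbhs_pinfty_gt; exact: num_real.
  move=> [z C] /= [[v [hv vw] <-] wC]; exists v; split=> //.
  by rewrite -lor_orig; exact: lt_trans wC.
near (pinfty_nbhs R) => C; exists C => x.
have : [set: X] `<=` P C by near: C.
exact.
Unshelve. all: by end_near. Qed.

End Deck.

(** * Lengths of curves *)

Section Curves.
Context {R : realType}.
Local Notation plane := 'rV[R]_2.
Local Notation space := 'rV[R]_3.
Local Notation mink_mx := (@mink_mx R).
Local Notation hyp := (@hyp R).
Local Notation orig := (@orig R).

Definition sinh (x : R) : R := (expR x - expR (- x)) / 2.

Lemma cosh_sinh (x : R) : cosh x ^+ 2 - sinh x ^+ 2 = 1.
Proof.
have h : expR x * expR (- x) = 1 by rewrite -expRD subrr expR0.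
rewrite /cosh /sinh; by rewrite -[RHS]h; move: (expR x) (expR (- x)) => a b; field.
Qed.

Lemma coshD (x y : R) : cosh (x + y) = cosh x * cosh y + sinh x * sinh y.
Proof. by rewrite /cosh /sinh opprD !expRD; field. Qed.

Lemma cosh0 : cosh (0 : R) = 1.
Proof. by rewrite /cosh oppr0 expR0 -[X in X / _]mulr2n -mulr_natl mulr1 divff. Qed.

Lemma sinh0 : sinh (0 : R) = 0.
Proof. by rewrite /sinh oppr0 subrr mul0r. Qed.

Lemma sinh_ge0 (x : R) : 0 <= x -> 0 <= sinh x.
Proof. by move=> x0; rewrite /sinh divr_ge0// subr_ge0 ler_expR; lra. Qed.

Lemma cosh_ge1 (x : R) : 1 <= cosh x.
Proof.
have h : expR x * expR (- x) = 1 by rewrite -expRD subrr expR0.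
have := expR_gt0 x; have := expR_gt0 (- x); rewrite /cosh.
move: (expR x) (expR (- x)) h => a b h b0 a0; have := sqr_ge0 (a - b); rewrite expr2; nra.
Qed.

Lemma cosh_gt0 (x : R) : 0 < cosh x.
Proof. by have := cosh_ge1 x; lra. Qed.

Lemma inv_sum_le (a b : R) : 1 <= a -> a <= b -> a + a^-1 <= b + b^-1.
Proof.
move=> a1 ab; have a0 : 0 < a by lra. have b0 : 0 < b by lra.
rewrite -subr_ge0 (_ : _ - _ = (b - a) * (a * b - 1) / (a * b)); last first.
  by field; rewrite !gt_eqF.
by rewrite divr_ge0 ?mulr_ge0//; [lra|nra|lra|lra].
Qed.

Lemma cosh_le (x y : R) : 0 <= x -> x <= y -> cosh x <= cosh y.
Proof.
move=> x0 xy; rewrite /cosh ler_pM2r ?invr_gt0// !expRN; apply: inv_sum_le.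
  by rewrite -expR0 ler_expR.
by rewrite ler_expR.
Qed.

Lemma cosh_surj (L : R) : 1 <= L -> exists2 T, 0 <= T <= L & cosh T = L.
Proof.
move=> L1; have q : 0 <= L ^+ 2 - 1 by rewrite expr2; nra.
pose k := L + Num.sqrt (L ^+ 2 - 1).
have s0 := sqrtr_ge0 (L ^+ 2 - 1); have sE := sqr_sqrtr q.
have k0 : 0 < k by rewrite /k; lra.
have lk : expR (ln k) = k by rewrite lnK.
have T0 : 0 <= ln k by rewrite ln_ge0// /k; lra.
have E : cosh (ln k) = L.
  rewrite /cosh expRN lk; have kV : k^-1 = L - Num.sqrt (L ^+ 2 - 1).
    apply: (mulfI (lt0r_neq0 k0)); rewrite divff ?gt_eqF// /k; move: sE; rewrite !expr2.
    by move: (Num.sqrt _) => s; lra.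
  by rewrite kV /k; lra.
exists (ln k) => //; rewrite T0 /= -E /cosh.
have h1 := expR_ge1Dx (ln k); have h2 := expR_gt0 (- ln k); have h3 := expR_ge1Dx (ln k / 2).
have e : expR (ln k) = expR (ln k / 2) ^+ 2 by rewrite -expRM_natl mulrC divfK.
rewrite e; have : ln k <= expR (ln k / 2) ^+ 2 / 2; last by lra.
apply: (@le_trans _ _ ((1 + ln k / 2) ^+ 2 / 2)).
  by have := sqr_ge0 (ln k / 2 - 1); rewrite !expr2; lra.
by rewrite ler_pM2r ?invr_gt0// lerXn2r ?nnegrE ?expR_ge0//; lra.
Qed.

(** The triangle inequality. *)
Lemma lor_triangle (u v w : space) (x y : R) : hyp u -> hyp v -> hyp w -> 0 <= x -> 0 <= y ->
  lor u v <= cosh x -> lor v w <= cosh y -> lor u w <= cosh (x + y).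
Proof.
move=> hu hv hw x0 y0; have := gram_le hu hv hw; have := lor_ge1 hu hv; have := lor_ge1 hv hw.
rewrite coshD; have := cosh_sinh x; have := cosh_sinh y.
have := sinh_ge0 x0; have := sinh_ge0 y0; have := cosh_ge1 x; have := cosh_ge1 y.
move: (lor u v) (lor v w) (lor u w) (cosh x) (cosh y) (sinh x) (sinh y).
move=> a b c p q s r q1 p1 r0 s0 qr ps b1 a1 h ap bq.
rewrite leNgt; apply/negP => lt.
have ab : a * b <= p * q by apply: ler_pM => //; lra.
have h1 : s * r < c - a * b by lra.
have h2 : (a ^+ 2 - 1) * (b ^+ 2 - 1) <= (s * r) ^+ 2.
  rewrite exprMn; apply: ler_pM; rewrite ?expr2; rewrite !expr2 in ps qr; nra.
have : (s * r) ^+ 2 < (c - a * b) ^+ 2 by rewrite ltrXn2r ?nnegrE ?mulr_ge0//; nra.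
by move: h; rewrite -(sqrrN (a * b - c)) opprB; lra.
Qed.

Lemma is_derive_lor n (gm : R -> space) (t : R) dg : is_derive t 1 gm dg ->
  is_derive t 1 (fun x => lor n (gm x)) (lor n dg).
Proof.
move=> /is_derive_mx h; have c i := is_deriveZ (n 0 i) (h 0 i).
exact: (is_deriveB (is_deriveB (c i2) (c i0)) (c i1)).
Qed.

Lemma is_derive_lor_sq (gm : R -> space) (t : R) dg : is_derive t 1 gm dg ->
  is_derive t 1 (fun x => lor (gm x) (gm x)) (2 * lor (gm t) dg).
Proof.
move=> /is_derive_mx h; have c i := is_deriveM (h 0 i) (h 0 i).
have d := is_deriveB (is_deriveB (c i2) (c i0)) (c i1).
by apply: (is_derive_eq (f := fun x => lor (gm x) (gm x)) d); rewrite /lor /GRing.scale /=; ring.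
Qed.

(** The distance of the curve to the line through its origin perpendicular to
    the chord grows no faster than arc length. *)
Lemma lor_le_cosh (gm dg : R -> space) (S sg : R -> R) (s t : R) : s <= t ->
  (forall x : R, s <= x <= t -> is_derive x 1 gm (dg x)) ->
  (forall x : R, s <= x <= t -> hyp (gm x)) ->
  (forall x : R, s <= x <= t -> is_derive x 1 S (sg x)) ->
  (forall x : R, s <= x <= t -> 0 <= sg x /\ - lor (dg x) (dg x) <= sg x ^+ 2) ->
  S s <= S t /\ lor (gm s) (gm t) <= cosh (S t - S s).
Proof.
move=> st hg hh hS sp.
have oc (x : R) : s < x < t -> s <= x <= t by move=> /andP[/ltW -> /ltW ->].
have sin : s <= s <= t by rewrite lexx.
have tin : s <= t <= t by rewrite st lexx.
have wS : {within `[s, t], continuous S}.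
  apply: derivable_within_continuous => x; rewrite in_itv /= => /hS; by case.
split.
  have := @ler0_derive1_nincr R (fun x => - S x) s t _ _ _ s t (lexx _) st (lexx _).
  rewrite lerN2; apply.
  - by move=> x; rewrite in_itv /= => /oc /hS [d _]; exact: derivableN.
  - move=> x; rewrite in_itv /= => /oc xI; have [d e] := hS x xI.
    by rewrite derive1E (deriveN d) e oppr_le0; have [] := sp x xI.
  - by move=> x; apply: continuousN; exact: wS.
have hs := hh s sin; have ht := hh t tin.
have L1 := lor_ge1 hs ht; set L := lor (gm s) (gm t) in L1 *.
have [Lle|Lgt] := leP L 1; first by apply: le_trans Lle (cosh_ge1 _).
have q0 : 0 < L ^+ 2 - 1 by rewrite expr2; nra.
pose r := Num.sqrt (L ^+ 2 - 1); have r0 : 0 < r by rewrite sqrtr_gt0.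
have rE : r ^+ 2 = L ^+ 2 - 1 by rewrite sqr_sqrtr// ltW.
pose n := r^-1 *: (gm t + (- L) *: gm s).
have nn : lor n n = -1.
  rewrite /n lorZl lorZr !lorDl !lorDr !lorZl !lorZr (lorC (gm t) (gm s)) -/L.
  case: (hs) => -> _; case: (ht) => -> _.
  have -> : 1 + - L * L + (- L * L + - L * (- L * 1)) = - r ^+ 2 by rewrite rE; ring.
  by field; exact: lt0r_neq0.
have ns : lor n (gm s) = 0.
  rewrite /n !(lorZl, lorDl) (lorC (gm t) (gm s)) -/L; case: (hs) => -> _; ring.
have nt : - lor n (gm t) = r.
  rewrite /n !(lorZl, lorDl) -/L; case: (ht) => -> _; apply: (mulfI (lt0r_neq0 r0)).
  by rewrite mulrN mulVKf ?gt_eqF// -expr2 rE; ring.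
pose h (x : R) := - lor n (gm x).
have dh (x : R) : s <= x <= t -> is_derive x 1 h (- lor n (dg x)).
  by move=> xI; exact: (is_deriveN (is_derive_lor n (hg x xI))).
pose q (x : R) := Num.sqrt (1 + h x ^+ 2).
have q1 (x : R) : 0 < 1 + h x ^+ 2 by rewrite ltr_pwDl// sqr_ge0.
have qp (x : R) : 0 < q x by rewrite sqrtr_gt0.
have qE (x : R) : q x ^+ 2 = 1 + h x ^+ 2 by rewrite sqr_sqrtr// ltW.
have dq (x : R) : s <= x <= t -> is_derive x 1 q (h x * (- lor n (dg x)) / q x).
  move=> xI; have d1 := is_deriveM (dh x xI) (dh x xI).
  have d2 := is_deriveD (is_derive_cst (1 : R) x 1) d1.
  have d2' : is_derive x 1 (fun y => 1 + h y ^+ 2) (2 * h x * (- lor n (dg x))).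
    have -> : (fun y => 1 + h y ^+ 2) = (cst 1 + h * h) by apply/funext => y; rewrite expr2.
    by apply: is_derive_eq; rewrite /GRing.scale /=; ring.
  have := is_derive1_comp (g := fun y => 1 + h y ^+ 2) (is_derive1_sqrt (q1 x)) d2'.
  move=> d3; apply: (is_derive_eq (f := q) d3); rewrite -/(q x); field; exact: lt0r_neq0.
pose K (x : R) := (h x + q x) * expR (- S x).
have kpos (x : R) : 0 < h x + q x.
  have := qE x; have := qp x; move: (h x) (q x) => a b b0 ba; nra.
have dK (x : R) : s <= x <= t -> is_derive x 1 K
    ((h x + q x) * (- sg x * expR (- S x)) +
     expR (- S x) * (- lor n (dg x) + h x * (- lor n (dg x)) / q x)).
  move=> xI; have d1 := is_deriveD (dh x xI) (dq x xI).
  have d2 := is_deriveN (hS x xI).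
  have d3 := is_derive1_comp (g := - S) (is_derive_expR (- S x)) d2.
  have d4 := is_deriveM d1 d3; apply: (is_derive_eq (f := K) d4).
  rewrite /GRing.scale /= !fctE /=. by rewrite (mulrC (expR _) (- sg x)).
have Kle : K t <= K s.
  apply: (@ler0_derive1_nincr R K s t _ _ _ s t (lexx _) st (lexx _)).
  - by move=> x; rewrite in_itv /= => /oc /dK [].
  - move=> x; rewrite in_itv /= => xo; have xI := oc x xo; have [d e] := dK x xI.
    rewrite derive1E e.
    have [sg0 sgl] := sp x xI.
    have tang : lor (gm x) (dg x) = 0.
      have d1 := is_derive_lor_sq (hg x xI).
      have nfg : \near x, (fun=> 1 : R) x = lor (gm x) (gm x).
        have nI : \forall y \near x, s < y < t.
          have := @near_in_itvoo R s t x; rewrite !in_itv /= => /(_ xo).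
          by apply: filterS => y; rewrite in_itv.
        by apply: filterS nI => y /oc /hh [-> _].
      have [_ e0] := near_eq_is_derive nfg (is_derive_cst (1 : R) x 1).
      by case: d1 => _; rewrite e0 => ?; lra.
    have cs : (lor n (dg x)) ^+ 2 <= (q x * sg x) ^+ 2.
      have := gram_det n (gm x) (dg x); set d2 := (X in _ = X ^+ 2); have := sqr_ge0 d2.
      move: (d2 ^+ 2) => D D0; rewrite nn tang; case: (hh x xI) => -> _ ed.
      rewrite exprMn qE /h sqrrN.
      have : (1 + lor n (gm x) ^+ 2) * (- lor (dg x) (dg x)) <= (1 + lor n (gm x) ^+ 2) * sg x ^+ 2.
        by rewrite ler_wpM2l// addr_ge0// sqr_ge0.
      lra.
    have cs' : - lor n (dg x) <= q x * sg x.
      have h0 : 0 <= q x * sg x by rewrite mulr_ge0// ltW.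
      by move: cs h0; rewrite !expr2; move: (lor n (dg x)) (_ * sg x) => a b; nra.
    have -> : (h x + q x) * (- sg x * expR (- S x)) +
        expR (- S x) * (- lor n (dg x) + h x * (- lor n (dg x)) / q x) =
        - (expR (- S x) * (h x + q x) / q x * (q x * sg x - (- lor n (dg x)))).
      by field; exact: lt0r_neq0.
    by rewrite oppr_le0 !mulr_ge0 ?invr_ge0 ?expR_ge0 ?subr_ge0 ?(ltW (qp x)) ?(ltW (kpos x)).
  - by apply: derivable_within_continuous => x; rewrite in_itv /= => /dK [].
have hs0 : h s = 0 by rewrite /h ns oppr0.
have ht0 : h t = r by [].
have qt : q t = L.
  apply/eqP; rewrite -(@eqrXn2 _ 2) ?ltW//; last by lra.
  by rewrite qE ht0 rE; apply/eqP; ring.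
have qs : q s = 1 by rewrite /q hs0 expr0n addr0 sqrtr1.
have kt : r + L <= expR (S t - S s).
  move: Kle; rewrite /K hs0 qs ht0 qt add0r mul1r expRD => Kle.
  have e0 := expR_gt0 (S t); rewrite expRN ler_pdivrMr// in Kle.
  by rewrite mulrC.
have rL1 : 1 <= r + L by lra.
have rLV : (r + L)^-1 = L - r.
  have rL0 : r + L != 0 by rewrite gt_eqF//; lra.
  apply: (mulfI rL0); rewrite divff//; move: rE; rewrite !expr2; lra.
have := inv_sum_le rL1 kt; rewrite rLV -expRN /cosh; lra.
Unshelve. all: by end_near. Qed.

End Curves.

Section Primitives.
Context {R : realType}.
Local Notation plane := 'rV[R]_2.
Local Notation space := 'rV[R]_3.

Lemma primitive_line m n (f : R -> 'M[R]_(m, n)) : continuous f ->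
  exists F : R -> 'M[R]_(m, n), forall x : R, is_derive x 1 F (f x).
Proof.
move=> cf; have [F1 [_ _ d1]] := primitive_mx (-1) cf.
have cf' : continuous (fun x => f (- x)).
  by move=> x; apply: (@continuous_comp _ _ _ (@GRing.opp R) f); [exact: opp_continuous|exact: cf].
have [F2 [_ _ d2]] := primitive_mx (-1) cf'.
pose G (x : R) := - F2 (- x).
have dG (x : R) : x < 1 -> is_derive x 1 G (f x).
  move=> x1; have x1' : -1 < - x by lra.
  apply/is_derive_mx => i j; have /is_derive_mx /(_ i j) h := d2 _ x1'; rewrite opprK in h.
  have o : is_derive x 1 (fun y : R => - y) (- 1) by exact: (is_deriveN (is_derive_id x 1)).
  have h2 := is_derive1_comp (g := fun y : R => - y) h o.
  have h3 := is_deriveN h2.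
  suff : is_derive x 1 (fun t => G t i j) (- (f x i j * -1)) by rewrite mulrN1 opprK.
  have -> : (fun t => G t i j) = - ((fun t => F2 t i j) \o (fun y : R => - y)).
    by apply/funext => y; rewrite /G mxE.
  exact: h3.
pose c := F1 0 - G 0.
pose F (x : R) := if 0 <= x then F1 x else G x + c.
have dD (x : R) : -1 < x < 1 -> is_derive x 1 (fun y => F1 y - G y) (0 : 'M[R]_(m, n)).
  move=> /andP[x0 x1]; have := is_deriveB (d1 x x0) (dG x x1); by rewrite subrr.
have FF1 (u : R) : -1 < u -> F u = F1 u.
  move=> u1; rewrite /F; case: leP => // u0.
  have : `|(F1 0 - G 0) - (F1 u - G u)| <= 0 * (0 - u).
    apply: (mvt_ineq (f := fun y => F1 y - G y) (df := fun=> 0)) => //; first exact: ltW.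
    - by move=> x /andP[x0 x1]; apply: dD; apply/andP; split; lra.
    - by apply: (derive_within (df := fun=> 0)) => x /andP[x0 x1]; apply: dD; apply/andP; split; lra.
    - by move=> x _; rewrite normr0.
  rewrite mul0r normr_le0 subr_eq0 => /eqP e; rewrite /c e.
  by rewrite addrC subrK.
exists F => x; have [x1|x1] := ltP (-1) x.
  have nE : \near x, F1 x = F x.
    have := @near_in_itvoo R (-1) (x + 1) x; rewrite !in_itv /= x1 /= => /(_ _).
    by move=> h; apply: filterS (h _) => [y|]; [rewrite in_itv /= => /andP[y1 _]; rewrite FF1|lra].
  exact: near_eq_is_derive nE (d1 x x1).
have nE : \near x, (fun y => G y + c) x = F x.
  have := @near_in_itvoo R (x - 1) 0 x; rewrite !in_itv /= => h.
  apply: filterS (h _) => [y|]; last by apply/andP; split; lra.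
  by rewrite in_itv /= => /andP[_ y0]; rewrite /F leNgt y0.
apply: near_eq_is_derive nE _.
have := is_deriveD (dG x (le_lt_trans x1 _)) (is_derive_cst c x 1); rewrite addr0; apply; lra.
Unshelve. all: by end_near. Qed.

Lemma is_derive_continuous m n (f : R -> 'M[R]_(m, n)) (t : R) d : is_derive t 1 f d ->
  {for t, continuous f}.
Proof. by move=> [h _]; apply: differentiable_continuous; exact/derivable1_diffP. Qed.

Definition speed (G : plane -> 'M[R]_2) (u : R -> plane) (t : R) : R :=
  Num.sqrt (qform (G (u t)) (derive1 u t)).

Lemma speed_continuous V (G : plane -> 'M[R]_2) u (t : R) : hyperbolic_metric V G -> V (u t) ->
  (forall t, derivable u t 1) -> continuous (derive1 u) -> {for t, continuous (speed G u)}.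
Proof.
move=> hG Vu du cu.
have FF : Filter (nbhs (t : R)) by exact: nbhs_filter.
have uc : {for t, continuous u} by apply: differentiable_continuous; exact/derivable1_diffP.
have Gc i j : {for t, continuous (fun s => G (u s) i j)}.
  have h : {for u t, continuous (fun v => G v i j)}.
    by case: hG => _ /(_ i j 0%N) h _ _ _; exact: Ck_cts h Vu.
  exact: (@continuous_comp _ _ _ u (fun v => G v i j) t uc h).
have dc j : {for t, continuous (fun s => derive1 u s 0 j)}.
  exact: (@cvg_entry _ _ _ FF _ _ _ _ 0 j (cu t)).
have -> : speed G u = (fun s => Num.sqrt (
    derive1 u s 0 0 * derive1 u s 0 0 * G (u s) 0 0 +
    derive1 u s 0 0 * derive1 u s 0 1 * (G (u s) 0 1 + G (u s) 1 0) +
    derive1 u s 0 1 * derive1 u s 0 1 * G (u s) 1 1)).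
  by apply/funext => s; rewrite /speed qformE.
apply: (@continuous_comp _ _ _ _ (@Num.sqrt R) t _ (@sqrt_continuous R _)).
exact: cvgD (cvgD (cvgM (cvgM (dc 0) (dc 0)) (Gc 0 0))
  (cvgM (cvgM (dc 0) (dc 1)) (cvgD (Gc 0 1) (Gc 1 0)))) (cvgM (cvgM (dc 1) (dc 1)) (Gc 1 1)).
Qed.

Lemma arc_primitive V (G : plane -> 'M[R]_2) u (a b : R) : hyperbolic_metric V G -> a < b ->
  (forall t, a <= t <= b -> V (u t)) ->
  (forall t, derivable u t 1) -> continuous (derive1 u) -> exists S : R -> R,
  (forall t : R, a <= t <= b -> is_derive t 1 S (speed G u t)) /\ arc_length G u a b = S b - S a.
Proof.
move=> hG ab Vu du cu; have ab' := ltW ab.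
pose f t := speed G u (clamp a b t).
have cf : continuous f.
  move=> t; apply: (@continuous_comp _ _ _ (clamp a b) (speed G u) t (@clamp_continuous R a b t)).
  by apply: (speed_continuous hG) => //; apply: Vu; exact: clamp_in.
have [S [Sc _ dS]] := primitive_exists (a - 1) cf.
have dS' (t : R) : a <= t <= b -> is_derive t 1 S (speed G u t).
  move=> tI; have := dS t; rewrite /f clamp_id//; apply.
  by case/andP: tI => ta _; lra.
exists S; split=> //.
rewrite /arc_length /Rintegral.
have -> : (\int[lebesgue_measure]_(x in `[a, b]) (speed G u x)%:E =
    \int[lebesgue_measure]_(x in `[a, b]) (f x)%:E)%E.
  apply: eq_integral => x; rewrite inE /= in_itv /= => xI.
  by rewrite /f clamp_id.
rewrite (@continuous_FTC2 R f S a b ab) //.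
- by apply: continuous_subspaceT => x; exact: cf.
- split.
  + by move=> x; rewrite in_itv /= => /andP[xa xb]; have [] := dS' x; rewrite ?(ltW xa) ?(ltW xb).
  + by apply: cvg_at_right_filter; exact: Sc.
  + by apply: cvg_at_left_filter; exact: Sc.
- move=> x; rewrite in_itv /= => /andP[xa xb].
  have xa' : a - 1 < x by lra.
  by rewrite derive1E; have [_ ->] := dS x xa'.
Qed.

Lemma arc_length_cst V (G : plane -> 'M[R]_2) u (a b T : R) : hyperbolic_metric V G -> a < b ->
  (forall t, a <= t <= b -> V (u t)) ->
  (forall t, derivable u t 1) -> continuous (derive1 u) ->
  (forall t, a <= t <= b -> speed G u t = T) -> arc_length G u a b = T * (b - a).
Proof.
move=> hG ab Vu du cu sT; rewrite /arc_length.
rewrite (@eq_Rintegral _ _ R lebesgue_measure _ (fun=> T)).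
  rewrite Rintegral_cst//; congr (_ * _).
  have := lebesgue_measure_itv (Interval (BLeft a) (BRight b)) => /= ->.
  by rewrite lte_fin ab.
by move=> x; rewrite inE /= in_itv /= => /sT.
Qed.

(** The lift of a curve through a frame field has the same speed. *)
Lemma frame_curve G U (Y : plane -> 'M[R]_3) (u : R -> plane) (t : R) du :
  frame_field G U Y -> U (u t) -> is_derive t 1 u du ->
  exists dg, is_derive t 1 (fun s => row i2 (Y (u s))) dg /\
    [/\ - lor dg dg = qform (G (u t)) du,
        dg = du 0 0 *: row i0 (Y (u t)) + du 0 1 *: row i1 (Y (u t)) &
        lor (row i2 (Y (u t))) dg = 0].
Proof.
move=> [oU CY jY gY pY] Ut d.
pose dg := du 0 0 *: row i0 (Y (u t)) + du 0 1 *: row i1 (Y (u t)).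
have rE i j : (row i (Y (u t))) 0 j = Y (u t) i j by rewrite mxE.
have dgE j : dg 0 j = du 0 0 * Y (u t) i0 j + du 0 1 * Y (u t) i1 j by rewrite /dg !vecE !rE.
have P i m : Y (u t) i i0 * Y (u t) m i0 + Y (u t) i i1 * Y (u t) m i1 -
    Y (u t) i i2 * Y (u t) m i2 = gram (G) (u t) i m by rewrite -prod_entry gY.
exists dg; split.
  apply/is_derive_mx => a m; rewrite (ord1 a) dgE.
  have h := chain_curve oU (CY i2 m) Ut d.
  have jE i : partial i (fun w => Y w i2 m) (u t) = Y (u t) (if i == 0 then i0 else i1) m.
    have /matrixP /(_ i2 m) := jY i _ Ut; rewrite mxE mulmx33 !gauss_formE => ->.
    have [-> | ->] : i = 0 \/ i = 1 by case: (i) => [[|[|//]] p]; [left|right]; exact/val_inj.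
      by rewrite /=; ring.
    by rewrite /=; ring.
  rewrite !jE /= in h.
  have -> : (fun s => row i2 (Y (u s)) 0 m) = (fun w => Y w i2 m) \o u.
    by apply/funext => s; rewrite mxE.
  exact: h.
have p00 := P i0 i0; have p01 := P i0 i1; have p11 := P i1 i1; have p10 := P i1 i0.
have p20 := P i2 i0; have p21 := P i2 i1.
rewrite !gramE in p00 p01 p11 p10 p20 p21.
split=> //.
- rewrite /lor !dgE qformE -p00 -p01 -p11 -p10; ring.
- rewrite /lor !dgE !rE; move: p20 p21; move: (Y (u t)) => M p20 p21.
  transitivity (- (du 0 0 * (M i2 i0 * M i0 i0 + M i2 i1 * M i0 i1 - M i2 i2 * M i0 i2) +
    du 0 1 * (M i2 i0 * M i1 i0 + M i2 i1 * M i1 i1 - M i2 i2 * M i1 i2))); first by ring.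
  by rewrite p20 p21; ring.
Qed.

End Primitives.

Section Covering.
Context {R : realType}.
Local Notation plane := 'rV[R]_2.
Local Notation space := 'rV[R]_3.
Local Notation hyp := (@hyp R).
Local Notation orig := (@orig R).
Context {X : topologicalType}.
Variables (A B : set (chart R X)) (g : chart R X -> plane -> 'M[R]_2).
Hypothesis hS : oriented_hyperbolic A B g.

(** What is used of the universal covering: it is a local isometry, injective on
    balls of radius [eta] (measured by [lor]), whose fibres are the orbits of the
    deck group. *)
Record covering (eta : R) (E : space -> X) : Prop := Covering {
  cov_eta : 1 < eta;
  cov_inj : forall p v w, hyp p -> hyp v -> hyp w -> lor p v < eta -> lor p w < eta ->
    E v = E w -> v = w;
  cov_near : forall p (V : set X), hyp p -> nbhs (E p) V -> hnear p (fun w => V (E w));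
  cov_open : forall p (P : space -> Prop), hyp p -> hnear p P ->
    nbhs (E p) [set z | exists2 v, hyp v /\ P v & E v = z];
  cov_surj : forall x, exists2 w, hyp w & E w = x;
  cov_trans : forall u v, hyp u -> hyp v -> E u = E v -> exists2 M, deck E M & u *m M = v;
  cov_free : forall M v, deck E M -> hyp v -> lor v (v *m M) < eta -> M = 1%:M;
  cov_frame : forall p k, hyp p -> A k -> cdom k (E p) -> exists U Y,
    [/\ frame_field (g k) U Y, U `<=` cimg k, U (cmap k (E p)),
        row i2 (Y (cmap k (E p))) = p &
        forall v, U v -> E (row i2 (Y v)) = cinv k v /\ lor p (row i2 (Y v)) < eta];
  cov_bounded : exists C, forall x, exists w, [/\ hyp w, w 0 i2 < C & E w = x] }.

Lemma covering_exists (x0 : X) : hausdorff_space X -> compact [set: X] -> connected [set: X] ->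
  exists eta E, covering eta E.
Proof.
move=> hX cX conX; have [eta e1 hpsi] := uniform_sheets hS cX.
have /choice[psi hp] : forall x, exists psi, sheet A B g psi eta /\ psi orig = x.
  by move=> x; have [psi h1 h2] := hpsi x; exists psi.
have psi_sheet x : sheet A B g (psi x) eta by have [] := hp x.
have psi_orig x : psi x orig = x by have [] := hp x.
have [E hE _] := developing_map hS e1 psi_sheet psi_orig hX x0.
exists eta, E; split=> //.
- exact: (E_inj hS e1 psi_sheet psi_orig hX hE).
- exact: (E_near e1 psi_sheet psi_orig hE).
- exact: (E_open hS e1 psi_sheet psi_orig hX hE).
- exact: (E_surj hS e1 psi_sheet psi_orig hX hE conX).
- exact: (deck_trans hS e1 psi_sheet psi_orig hX hE).
- exact: (deck_free hS e1 psi_sheet psi_orig hX hE).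
- exact: (E_frame e1 psi_sheet psi_orig hE).
- exact: (E_bounded hS e1 psi_sheet psi_orig hX hE cX conX).
Qed.

Variables (eta : R) (E : space -> X).
Hypothesis cE : covering eta E.

(** Short pieces of the curve are lifted through the frame fields and joined by
    deck transformations. *)
Lemma arc_lift (c : R -> X) (a b : R) k u : A k -> a < b -> C1_arc c a b k u ->
  0 <= arc_length (g k) u a b /\ forall p, hyp p -> E p = c a ->
    exists q, [/\ hyp q, E q = c b & lor p q <= cosh (arc_length (g k) u a b)].
Proof.
move=> Ak ab [du cu huc]; have hG := chart_metric hS Ak.
have Vu (t : R) : a <= t <= b -> cimg k (u t).
  by move=> /huc[kc <-]; exact: cimg_mem.
have [S [dS ->]] := arc_primitive hG ab Vu du cu.
pose Rel (s t : R) := S s <= S t /\ forall p, hyp p -> E p = c s ->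
  exists q, [/\ hyp q, E q = c t & lor p q <= cosh (S t - S s)].
suff [h1 h2] : Rel a b by split; rewrite ?subr_ge0.
apply: interval_chain; first exact: ltW.
  move=> s t w [st h1] [tw h2]; split; first exact: le_trans st tw.
  move=> p hp ep; have [q [hq eq pq]] := h1 p hp ep; have [r [hr er qr]] := h2 q hq eq.
  exists r; split=> //; rewrite (_ : S w - S s = (S t - S s) + (S w - S t)); last by ring.
  by apply: (lor_triangle hp hq hr) => //; rewrite subr_ge0.
move=> t0 t0I; have [kt0 ut0] := huc _ t0I.
have [p0 hp0 ep0] := cov_surj cE (c t0).
have kp0 : cdom k (E p0) by rewrite ep0.
have [U [Y [fY Uk Uz _ hU]]] := cov_frame cE hp0 Ak kp0; rewrite ep0 ut0 in Uz.
have [oU _ _ _ _] := fY.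
have uc : {for t0, continuous u} by apply: differentiable_continuous; exact/derivable1_diffP.
have [r r0 hr] : exists2 r : R, 0 < r & forall s, `|s - t0| < r -> U (u s).
  by apply: near_ball_R; apply: uc; exact: open_nbhs_nbhs.
exists r => // s t as_ st tb sr tr.
have sI (x : R) : s <= x <= t -> a <= x <= b.
  by move=> /andP[sx xt]; rewrite (le_trans as_ sx) (le_trans xt tb).
have Ux (x : R) : s <= x <= t -> U (u x).
  move=> /andP[sx xt]; apply: hr; move: sr tr; rewrite !ltr_norml => /andP[? ?] /andP[? ?].
  by apply/andP; split; lra.
pose gm x := row i2 (Y (u x)).
have Egm (x : R) : s <= x <= t -> E (gm x) = c x.
  move=> xI; have [-> _] := hU _ (Ux x xI); have [kx <-] := huc _ (sI x xI).
  by rewrite cmapK.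
have /choice[dg hdg] : forall x : R, exists dg, s <= x <= t -> is_derive x 1 gm dg /\
    - lor dg dg = qform (g k (u x)) (derive1 u x).
  move=> x; have [xI|xI] := boolP (s <= x <= t); last by exists 0.
  have dux : is_derive x 1 u (derive1 u x) by rewrite derive1E; exact: derivableP.
  have [dg [h1 [h2 _ _]]] := frame_curve fY (Ux x xI) dux.
  by exists dg.
have hgm (x : R) : s <= x <= t -> hyp (gm x) by move=> /Ux; exact: frame_hyp fY.
have hsp (x : R) : s <= x <= t -> 0 <= speed (g k) u x /\ - lor (dg x) (dg x) <= speed (g k) u x ^+ 2.
  move=> xI; split; first exact: sqrtr_ge0.
  rewrite (hdg x xI).2 /speed sqr_sqrtr//.
  have [->|n0] := eqVneq (derive1 u x) 0.
    by rewrite qformE !mxE !mul0r !addr0.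
  by case: hG => _ _ _ pos _; apply: ltW; apply: pos => //; exact: Uk (Ux x xI).
have [h1 h2] := lor_le_cosh st (fun x xI => (hdg x xI).1) hgm (fun x xI => dS x (sI x xI)) hsp.
split=> // p hp ep.
have sin : s <= s <= t by rewrite lexx. have tin : s <= t <= t by rewrite st lexx.
have [M [iM hM] gM] := cov_trans cE (hgm s sin) hp (etrans (Egm s sin) (esym ep)).
exists (gm t *m M); split; first exact: isom_hyp iM (hgm t tin).
  by rewrite hM ?Egm//; exact: hgm.
by rewrite -gM isom_lor.
Qed.

Lemma curve_lift (c : R -> X) L : has_length A g c L -> 0 <= L /\ forall p, hyp p -> E p = c 0 ->
  exists q, [/\ hyp q, E q = c 1 & lor p q <= cosh L].
Proof.
move=> [n [t [k [u [t0 t1 hi ->]]]]].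
have key m : (m <= n)%N -> 0 <= \sum_(i < m) arc_length (g (k i)) (u i) (t i) (t i.+1) /\
    forall p, hyp p -> E p = c (t 0%N) -> exists q, [/\ hyp q, E q = c (t m) &
      lor p q <= cosh (\sum_(i < m) arc_length (g (k i)) (u i) (t i) (t i.+1))].
  elim: m => [_|m IH mn].
    by rewrite big_ord0; split=> // p hp ep; exists p; split=> //; rewrite cosh0; case: hp => ->.
  have [s0 h] := IH (ltnW mn); have [ti Ak arc] := hi m mn.
  have [l0 h'] := arc_lift Ak ti arc.
  rewrite big_ord_recr /=; split=> [|p hp ep]; first exact: addr_ge0.
  have [q [hq eq pq]] := h p hp ep; have [r [hr er qr]] := h' q hq eq.
  by exists r; split=> //; exact: lor_triangle hp hq hr s0 l0 pq qr.
have := key n (leqnn n); by rewrite t0 t1.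
Qed.

(** ** Projections of geodesics *)

(** As in [has_length], on an arbitrary interval, which allows concatenation. *)
Definition pieces (c : R -> X) (s t L : R) : Prop :=
  exists (n : nat) (tt : nat -> R) (k : nat -> chart R X) (u : nat -> R -> plane),
    [/\ tt 0%N = s, tt n = t,
        forall i, (i < n)%N ->
          [/\ tt i < tt i.+1, A (k i) & C1_arc c (tt i) (tt i.+1) (k i) (u i)] &
        L = \sum_(i < n) arc_length (g (k i)) (u i) (tt i) (tt i.+1)].

Lemma pieces_cat c s t w L L' : pieces c s t L -> pieces c t w L' -> pieces c s w (L + L').
Proof.
move=> [n [f [k [u [f0 fn hf ->]]]]] [m [f' [k' [u' [f0' fm hf' ->]]]]].
pose ff i := if (i <= n)%N then f i else f' (i - n)%N.
pose kk i := if (i < n)%N then k i else k' (i - n)%N.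
pose uu i := if (i < n)%N then u i else u' (i - n)%N.
have ffr i : ff (n + i)%N = f' i.
  rewrite /ff; case: i => [|i]; first by rewrite addn0 leqnn fn f0'.
  by rewrite addnS leqNgt ltnS leq_addr /= -addnS addKn.
have kkr i : kk (n + i)%N = k' i by rewrite /kk ltnNge leq_addr /= addKn.
have uur i : uu (n + i)%N = u' i by rewrite /uu ltnNge leq_addr /= addKn.
have ffl i : (i < n)%N -> [/\ ff i = f i, ff i.+1 = f i.+1, kk i = k i & uu i = u i].
  by move=> ni; rewrite /ff /kk /uu ni (ltnW ni).
exists (n + m)%N, ff, kk, uu; split.
- by rewrite /ff leq0n.
- by rewrite ffr.
- move=> i nm; have [ni|ni] := ltnP i n; first by have [-> -> -> ->] := ffl i ni; exact: hf.
  rewrite -(subnKC ni) -addnS !ffr kkr uur; apply: hf'.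
  by rewrite ltn_subLR.
- pose a (i : nat) := arc_length (g (kk i)) (uu i) (ff i) (ff i.+1).
  transitivity (\sum_(i < n) a i + \sum_(i < m) a (n + i)%N); last first.
    by rewrite -[RHS]/(\sum_(i < n + m) a i) big_split_ord.
  apply: f_equal2; apply: eq_bigr => i _; rewrite /a.
    by have [-> -> -> ->] := ffl i (ltn_ord i).
  by rewrite -addnS !ffr kkr uur.
Qed.

Lemma pieces_nil c s : pieces c s s 0.
Proof.
have [_ h _ _ _] := hS; have [k0 _ _] := h (c s).
by exists 0%N, (fun=> s), (fun=> k0), (fun=> cst 0); split; rewrite ?big_ord0.
Qed.

Lemma hyp_of_lor p v : hyp p -> lor v v = 1 -> 0 < lor p v -> hyp v.
Proof.
move=> hp vv pv; split=> //; rewrite ltNge; apply/negP => v2.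
have [n0|n0] : v 0 i2 = 0 \/ v 0 i2 < 0.
    by move: v2; rewrite le_eqVlt => /orP[/eqP|]; [left|right].
  move: vv; rewrite /lor n0.
  by have := sqr_ge0 (v 0 i0); have := sqr_ge0 (v 0 i1); rewrite !expr2; lra.
have hn : hyp (- v).
  split; last by rewrite vecE; lra.
  by rewrite lorNl lorC lorNl opprK.
by have := lor_ge1 hn hp; rewrite lorNl lorC; lra.
Qed.

Lemma is_derive_cosh (T t : R) : is_derive t 1 (fun x => cosh (T * x)) (T * sinh (T * t)).
Proof.
have d1 : is_derive t 1 (fun x : R => T * x) T.
  by have := is_deriveZ T (is_derive_id t 1); rewrite /GRing.scale /= mulr1.
have e1 := is_derive1_comp (g := fun x : R => T * x) (is_derive_expR (T * t)) d1.
have d2 := is_deriveN d1.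
have e2 := is_derive1_comp (g := - (fun x : R => T * x)) (is_derive_expR (- (T * t))) d2.
have d := is_deriveZ 2^-1 (is_deriveD e1 e2).
have -> : (fun x => cosh (T * x)) = 2^-1 \*: ((expR \o (fun x => T * x)) +
    (expR \o (- (fun x : R => T * x)))).
  apply/funext => x; rewrite /cosh [LHS]mulrC. by [].
by apply: (is_derive_eq d); rewrite /GRing.scale /= /sinh; field.
Qed.

Lemma is_derive_sinh (T t : R) : is_derive t 1 (fun x => sinh (T * x)) (T * cosh (T * t)).
Proof.
have d1 : is_derive t 1 (fun x : R => T * x) T.
  by have := is_deriveZ T (is_derive_id t 1); rewrite /GRing.scale /= mulr1.
have e1 := is_derive1_comp (g := fun x : R => T * x) (is_derive_expR (T * t)) d1.
have d2 := is_deriveN d1.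
have e2 := is_derive1_comp (g := - (fun x : R => T * x)) (is_derive_expR (- (T * t))) d2.
have d := is_deriveZ 2^-1 (is_deriveB e1 e2).
have -> : (fun x => sinh (T * x)) = 2^-1 \*: ((expR \o (fun x => T * x)) -
    (expR \o (- (fun x : R => T * x)))).
  apply/funext => x; rewrite /sinh [LHS]mulrC. by [].
by apply: (is_derive_eq d); rewrite /GRing.scale /= /cosh; field.
Qed.

(** The geodesic from [p] in the unit direction [n], at speed [T]. *)
Definition geodesic (p n : space) (T t : R) : space := cosh (T * t) *: p + sinh (T * t) *: n.

Definition geodesic_velocity (p n : space) (T t : R) : space :=
  (T * sinh (T * t)) *: p + (T * cosh (T * t)) *: n.

Lemma geodesicP p n T (t : R) : hyp p -> lor p n = 0 -> lor n n = -1 ->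
  [/\ hyp (geodesic p n T t), lor p (geodesic p n T t) = cosh (T * t),
      is_derive t 1 (geodesic p n T) (geodesic_velocity p n T t) &
      - lor (geodesic_velocity p n T t) (geodesic_velocity p n T t) = T ^+ 2].
Proof.
move=> hp pn nn; have cs := cosh_sinh (T * t).
have pp : lor p p = 1 by case: hp.
have pg : lor p (geodesic p n T t) = cosh (T * t).
  by rewrite /geodesic !(lorDr, lorZr) pp pn; ring.
split=> //.
- apply: (hyp_of_lor hp); last by rewrite pg cosh_gt0.
  by rewrite /geodesic !lorDl !lorDr !lorZl !lorZr (lorC n p) pp pn nn -[RHS]cs; ring.
- apply/is_derive_mx => i j; rewrite (ord1 i).
  have d1 := is_deriveM (is_derive_cosh T t) (is_derive_cst (p 0 j) t 1).
  have d2 := is_deriveM (is_derive_sinh T t) (is_derive_cst (n 0 j) t 1).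
  have d := is_deriveD d1 d2.
  have -> : (fun x => geodesic p n T x 0 j) = (fun x => cosh (T * x)) * cst (p 0 j) +
      (fun x => sinh (T * x)) * cst (n 0 j).
    by apply/funext => x; rewrite /geodesic !mxE.
  by apply: (is_derive_eq d); rewrite /geodesic_velocity !mxE /GRing.scale /=; ring.
- rewrite /geodesic_velocity !lorDl !lorDr !lorZl !lorZr (lorC n p) pp pn nn.
  transitivity (T ^+ 2 * (cosh (T * t) ^+ 2 - sinh (T * t) ^+ 2)); first by ring.
  by rewrite cs mulr1.
Qed.

Lemma geodesic_velocity_continuous p n T : continuous (geodesic_velocity p n T).
Proof.
move=> t; have d1 := is_derive_cosh T t; have d2 := is_derive_sinh T t.
have c1 : {for t, continuous (fun x => cosh (T * x))}.
  by apply: differentiable_continuous; apply/derivable1_diffP; case: d1.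
have c2 : {for t, continuous (fun x => sinh (T * x))}.
  by apply: differentiable_continuous; apply/derivable1_diffP; case: d2.
have FF : Filter (nbhs (t : R)) by exact: nbhs_filter.
apply: cvg_mx => i j; rewrite /geodesic_velocity.
under eq_fun do rewrite !mxE.
rewrite !mxE; apply: cvgD; apply: cvgM; try exact: cvg_cst.
  by apply: cvgM; [exact: cvg_cst|exact: c2].
by apply: cvgM; [exact: cvg_cst|exact: c1].
Qed.

Lemma geodesic_exists p q : hyp p -> hyp q -> exists T n,
  [/\ 0 <= T <= lor p q, cosh T = lor p q, lor p n = 0, lor n n = -1 & geodesic p n T 1 = q].
Proof.
move=> hp hq; have L1 := lor_ge1 hp hq; have [T Tb cT] := cosh_surj L1.
exists T; have [Lle|Lgt] := leP (lor p q) 1.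
  have e := lor_eq1 hp hq Lle; have [M iM oM] := hyp_transitive hp.
  exists (row3 1 0 0 *m M); split=> //.
  - by rewrite -oM isom_lor// lor_orig row3E.
  - by rewrite isom_lor// /lor !row3E; ring.
  have s0 : sinh T ^+ 2 = 0.
    have := cosh_sinh T; rewrite cT (_ : lor p q = 1); last by apply/le_anti; rewrite Lle.
    by move=> h; lra.
  move: s0 => /eqP; rewrite sqrf_eq0 => /eqP s0.
  rewrite /geodesic mulr1 s0 scale0r addr0 cT (_ : lor p q = 1); last by apply/le_anti; rewrite Lle.
  by rewrite scale1r.
have s2 : sinh T ^+ 2 = lor p q ^+ 2 - 1 by rewrite -cT; have := cosh_sinh T; lra.
have sn : sinh T != 0.
  by rewrite -sqrf_eq0 s2 gt_eqF// expr2; nra.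
pose n := (sinh T)^-1 *: (q + (- lor p q) *: p).
have pp : lor p p = 1 by case: hp.
have qq : lor q q = 1 by case: hq.
exists n; split=> //.
- by rewrite /n lorZr lorDr lorZr pp; ring.
- rewrite /n lorZl lorZr !lorDl !lorDr !lorZl !lorZr (lorC q p) pp qq.
  have -> : 1 + - lor p q * lor p q + (- lor p q * lor p q + - lor p q * (- lor p q * 1)) =
    - sinh T ^+ 2 by rewrite s2; ring.
  by field.
- rewrite /geodesic mulr1 cT /n scalerA divff// scale1r addrCA scaleNr subrr addr0 //.
Qed.

End Covering.

Section Geodesics.
Context {R : realType}.
Local Notation plane := 'rV[R]_2.
Local Notation space := 'rV[R]_3.
Local Notation hyp := (@hyp R).
Local Notation orig := (@orig R).
Context {X : topologicalType}.
Variables (A B : set (chart R X)) (g : chart R X -> plane -> 'M[R]_2).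
Hypothesis hS : oriented_hyperbolic A B g.
Variables (eta : R) (E : space -> X).
Hypothesis cE : covering A g eta E.

(** The coordinates of the projection of a C^1 curve are C^1: they solve the
    equation given by the immersion of the chart, by the inverse function
    theorem. *)
Lemma projected_curve (gm dg : R -> space) (t0 : R) k : A k -> cdom k (E (gm t0)) ->
  (forall t : R, is_derive t 1 gm (dg t)) -> continuous dg -> (forall t, hyp (gm t)) ->
  exists2 r : R, 0 < r & exists dv : R -> plane, forall t : R, `|t - t0| < r ->
    [/\ cdom k (E (gm t)), is_derive t 1 (fun s => cmap k (E (gm s))) (dv t),
        {for t, continuous dv} &
        qform (g k (cmap k (E (gm t)))) (dv t) = - lor (dg t) (dg t)].
Proof.
move=> Ak kp hg cdg hh; set p := gm t0 in kp *.
have [U [Y [fY Uk Uz Yp hU]]] := cov_frame cE (hh t0) Ak kp; rewrite -/p in Uz Yp hU.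
have [oU CY jY gY pY] := fY; have hG := chart_metric hS Ak.
pose v0 := cmap k (E p); rewrite -/v0 in Uz Yp.
pose f (v : plane) : plane := shadow (row i2 (Y v)).
have fE v : (f v 0 0 = Y v i2 i0) * (f v 0 1 = Y v i2 i1) by rewrite /f /shadow pt0 pt1 !mxE.
have ord2 (m : 'I_2) : m = 0 \/ m = 1.
  by case: m => [[|[|//]] q]; [left|right]; exact/val_inj.
have Cf m : Ck 1 U (fun v => f v 0 m).
  have [-> | ->] := ord2 m; first by under eq_fun do rewrite (fE _).1; exact: CY.
  by under eq_fun do rewrite (fE _).2; exact: CY.
have dY i c v : U v -> partial i (fun v => Y v i2 c) v = Y v (if i == 0 then i0 else i1) c.
  move=> Uv; have /matrixP /(_ i2 c) := jY i v Uv; rewrite mxE mulmx33 !gauss_formE => ->.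
  by have [-> | ->] := ord2 i; rewrite /=; ring.
have T0 i v : partial i (fun v => f v 0 0) v = partial i (fun v => Y v i2 i0) v.
  by congr (partial i _ v); apply/funext => w; rewrite (fE w).1.
have T1 i v : partial i (fun v => f v 0 1) v = partial i (fun v => Y v i2 i1) v.
  by congr (partial i _ v); apply/funext => w; rewrite (fE w).2.
have tE v : U v -> ((tjac f v 0 0 = Y v i0 i0) * (tjac f v 0 1 = Y v i0 i1) *
    (tjac f v 1 0 = Y v i1 i0) * (tjac f v 1 1 = Y v i1 i1))%type.
  by move=> Uv; do !split; rewrite mxE ?T0 ?T1 dY.
(* the tangent plane is spacelike, hence projects injectively *)
have Ju v : U v -> \det (tjac f v) != 0.
  move=> Uv; have := frame_unit hG fY Uv (Uk _ Uv); rewrite unitmxE unitfE det33 => dn.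
  have P i m : Y v i i0 * Y v m i0 + Y v i i1 * Y v m i1 - Y v i i2 * Y v m i2 = gram (g k) v i m.
    by rewrite -prod_entry gY.
  have p0 := P i2 i0; have p1 := P i2 i1; have p2 := P i2 i2; rewrite !gramE in p0 p1 p2.
  rewrite det2 !tE//; apply: contra_neq dn => dz.
  have pp := pY v Uv; apply: (mulfI (lt0r_neq0 pp)); rewrite mulr0.
  move: p0 p1 p2 dz; move: (Y v i0 i0) (Y v i0 i1) (Y v i0 i2) (Y v i1 i0) (Y v i1 i1) (Y v i1 i2)
    (Y v i2 i0) (Y v i2 i1) (Y v i2 i2) => a b c d e l x y z p0 p1 p2 dz.
  have zc : z * c = x * a + y * b by lra.
  have zl : z * l = x * d + y * e by lra.
  transitivity (a * z * (e * z) - b * z * (d * z) - a * y * (z * l) + b * x * (z * l)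
    + (z * c) * (d * y - e * x)); first by ring.
  rewrite zl zc; transitivity ((a * e - b * d) * (z * z - x * x - y * y)); first by ring.
  by rewrite dz mul0r.
have [r [d [L [h [/andP[r0 _] d0 L0 inv]]]]] : exists r d L h, [/\ 0 < r <= (1 : R), 0 < d, 0 <= L &
    invertible_near f v0 r d L h].
  by apply: (local_inverse oU Cf Uz); rewrite ?unitmxE ?unitfE ?Ju.
have [hv0 hf hK lip] := inv.
pose y (t : R) := shadow (gm t).
have fv0 : f v0 = y t0 by rewrite /f Yp.
pose v t := cmap k (E (gm t)).
have gc t : {for t, continuous gm} by exact: is_derive_continuous (hg t).
have [s s0 hs] : exists2 s : R, 0 < s & forall t, `|t - t0| < s ->
    [/\ cdom k (E (gm t)), U (v t), `|v t - v0| < r, `|y t - f v0| < d & lor p (gm t) < eta].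
  apply: near_ball_R.
  have FF : Filter (nbhs (t0 : R)) by exact: nbhs_filter.
  have n1 : nbhs v0 (U `&` [set w | `|w - v0| < r]).
    apply: filterI; first exact: open_nbhs_nbhs.
    by apply: open_nbhs_nbhs; split; [exact: ball_plane_open|rewrite /= subrr normr0].
  have n2 : nbhs (E p) [set z | cdom k z /\ (U `&` [set w | `|w - v0| < r]) (cmap k z)].
    by apply: filterI; [exact: cdom_nbhs|exact: (cmap_near kp n1)].
  have [dl dl1 n3] := cov_near cE (hh t0) n2.
  have n4 : nbhs p [set w | lor p w < Num.min dl eta].
    apply: open_nbhs_nbhs; split; first exact: lor_ball_open.
    by rewrite /= lt_min; case: (hh t0) => -> _; rewrite dl1 (cov_eta cE).
  have n5 : nbhs p [set w | `|shadow w - f v0| < d].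
    apply: (@shadow_continuous R p [set w | `|w - f v0| < d]); apply: open_nbhs_nbhs.
    by split; [exact: ball_plane_open|rewrite /= fv0 /y subrr normr0].
  have g4 : \forall t \near t0, lor p (gm t) < Num.min dl eta by exact: (gc t0 _ n4).
  have g5 : \forall t \near t0, `|y t - f v0| < d by exact: (gc t0 _ n5).
  have key (t : R) : lor p (gm t) < Num.min dl eta -> `|y t - f v0| < d ->
      [/\ cdom k (E (gm t)), U (v t), `|v t - v0| < r, `|y t - f v0| < d & lor p (gm t) < eta].
    by rewrite lt_min => /andP[t1 t2] t3; have [? [? ?]] := n3 _ (hh t) t1.
  exact: (@filterS2 _ _ FF _ _ _ key g4 g5).
have Fv t : `|t - t0| < s -> row i2 (Y (v t)) = gm t.
  move=> ts; have [kt Ut _ _ pe] := hs t ts; have [e1 e2] := hU _ Ut.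
  apply: (cov_inj cE (hh t0) (frame_hyp fY Ut) (hh t)) => //.
  by rewrite e1 cmapK.
have vE t : `|t - t0| < s -> h (y t) = v t.
  by move=> ts; have [_ _ vr _ _] := hs t ts; rewrite -(hK _ vr) /f Fv.
pose dy (t : R) : plane := shadow (dg t).
have dyP (t : R) : is_derive t 1 y (dy t).
  have /is_derive_mx hgt := hg t.
  apply/is_derive_mx => i j; rewrite (ord1 i).
  have [-> | ->] := ord2 j.
    by rewrite /dy /y /shadow pt0; under eq_fun do rewrite pt0; exact: hgt.
  by rewrite /dy /y /shadow pt1; under eq_fun do rewrite pt1; exact: hgt.
pose dv t := dy t *m invmx (tjac f (v t)).
exists s => //; exists dv => t ts; have [kt Ut vr yd pe] := hs t ts.
have near_s : \forall x \near t, `|x - t0| < s.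
  have := @near_in_itvoo R (t0 - s) (t0 + s) t; rewrite !in_itv /= => hh0.
  apply: filterS (hh0 _) => [x|]; last by move: ts; rewrite ltr_norml => /andP[? ?]; apply/andP; split; lra.
  by rewrite in_itv /= ltr_norml => /andP[? ?]; apply/andP; split; lra.
have dvt : is_derive t 1 v (dv t).
  have vt := vE t ts.
  have : is_derive t 1 (fun x => h (y x)) (dy t *m invmx (tjac f (h (y t)))).
    have U' : U (h (y t)) by rewrite vt.
    have J' : tjac f (h (y t)) \in unitmx by rewrite unitmxE unitfE Ju.
    exact: (inverse_curve oU Cf inv L0 yd U' J' (dyP t)).
  rewrite vt; apply: near_eq_is_derive.
  by apply: filterS near_s => x; exact: vE.
split; [exact: kt|exact: dvt| |].
- have vc : {for t, continuous v} by exact: is_derive_continuous dvt.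
  have ci a b : {for t, continuous (fun x => invmx (tjac f (v x)) a b)}.
    have Ca i m : Ck 0 U (fun w => tjac f w i m).
      apply: (Ck_ext (f := partial i (fun w => f w 0 m)) oU); last exact: Ck_partial (Cf m).
      by move=> w _; rewrite mxE.
    have Cd : Ck 0 U (fun w => \det (tjac f w)).
      apply: (Ck_ext (f := fun w => tjac f w 0 0 * tjac f w 1 1 + - (tjac f w 0 1 * tjac f w 1 0)) oU).
        by move=> w _; rewrite det2.
      by apply: Ck_add => //; [|apply: Ck_opp => //]; apply: Ck_mul => //; exact: Ca.
    have Cdi := Ck_inv oU Ju Cd.
    have Ci : Ck 0 U (fun w => invmx (tjac f w) a b).
      have E2 w : U w -> [/\ invmx (tjac f w) 0 0 = tjac f w 1 1 * (\det (tjac f w))^-1,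
          invmx (tjac f w) 0 1 = - tjac f w 0 1 * (\det (tjac f w))^-1,
          invmx (tjac f w) 1 0 = - tjac f w 1 0 * (\det (tjac f w))^-1 &
          invmx (tjac f w) 1 1 = tjac f w 0 0 * (\det (tjac f w))^-1].
        by move=> /Ju; rewrite det2; exact: inv2.
      have [-> | ->] := ord2 a; have [-> | ->] := ord2 b.
      - by apply: (Ck_ext oU (fun w Uw => esym (let: And4 e _ _ _ := E2 w Uw in e))); exact: Ck_mul.
      - apply: (Ck_ext oU (fun w Uw => esym (let: And4 _ e _ _ := E2 w Uw in e))).
        by apply: Ck_mul => //; exact: Ck_opp.
      - apply: (Ck_ext oU (fun w Uw => esym (let: And4 _ _ e _ := E2 w Uw in e))).
        by apply: Ck_mul => //; exact: Ck_opp.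
      - by apply: (Ck_ext oU (fun w Uw => esym (let: And4 _ _ _ e := E2 w Uw in e))); exact: Ck_mul.
    exact: (@continuous_comp _ _ _ v (fun w => invmx (tjac f w) a b) t vc (Ck_cts Ci Ut)).
  have FF : Filter (nbhs (t : R)) by exact: nbhs_filter.
  apply: cvg_mulmx; last by apply: cvg_mx => a b; exact: ci.
  exact: (@continuous_comp _ _ _ dg shadow t (cdg t) (@shadow_continuous R (dg t))).
- have [dg' [h1 [h2 _ _]]] := frame_curve fY Ut dvt.
  have nE : \near t, gm t = row i2 (Y (v t)).
    by apply: filterS near_s => x /Fv ->.
  have [_ e1] := near_eq_is_derive nE (hg t); case: h1 => _; rewrite e1 => e2.
  by rewrite -h2 -e2.
Qed.

Lemma geodesic_pieces p n (T : R) : hyp p -> lor p n = 0 -> lor n n = -1 -> 0 <= T ->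
  has_length A g (fun t => E (geodesic p n T t)) T.
Proof.
move=> hp pn nn T0.
pose c t := E (geodesic p n T t).
suff : pieces A g c 0 1 (T * (1 - 0)) by rewrite subr0 mulr1.
pose Rel (s t : R) := pieces A g c s t (T * (t - s)).
apply: (@interval_chain R 0 1 Rel) => //.
  move=> s t u h1 h2; have := pieces_cat h1 h2; rewrite /Rel -mulrDr.
  by rewrite (_ : t - s + (u - t) = u - s)//; ring.
move=> t0 _; have [k Ak kt] : exists2 k, A k & cdom k (c t0) by case: hS => _ h _ _ _; exact: h.
have gP t := geodesicP T t hp pn nn.
have hg t : hyp (geodesic p n T t) by have [] := gP t.
have dg (t : R) : is_derive t 1 (geodesic p n T) (geodesic_velocity p n T t) by have [] := gP t.
have [r r0 [dv hv]] := projected_curve Ak kt dg (@geodesic_velocity_continuous R p n T) hg.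
exists r => // s t s0 st t1 sr tr; rewrite /Rel.
have [->|ne] := eqVneq s t; first by rewrite subrr mulr0; exact: (pieces_nil hS).
have lt : s < t by rewrite lt_neqAle ne.
have inI x : `|clamp s t x - t0| < r.
  have /andP[h1 h2] := clamp_in x st; move: sr tr; rewrite !ltr_norml => /andP[? ?] /andP[? ?].
  by apply/andP; split; lra.
pose w x := dv (clamp s t x).
have cw : continuous w.
  move=> x; apply: (@continuous_comp _ _ _ (clamp s t) dv x (@clamp_continuous R s t x)).
  by have [] := hv _ (inI x).
have [F dF] := primitive_line cw.
pose v x := cmap k (c x).
pose u x := F x + (v s - F s).
have du (x : R) : is_derive x 1 u (w x).
  by have := is_deriveD (dF x) (is_derive_cst (v s - F s) x 1); rewrite addr0.
have du1 : derive1 u = w by apply/funext => x; rewrite derive1E; case: (du x).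
have rI (x : R) : s <= x <= t -> `|x - t0| < r by move=> xI; rewrite -(clamp_id xI).
have uv (x : R) : s <= x <= t -> u x = v x.
  move=> /andP[sx xt].
  have dz (z : R) : s <= z <= x -> is_derive z 1 (fun y => u y - v y) (0 : plane).
    move=> /andP[sz zx]; have zI : s <= z <= t by rewrite sz (le_trans zx xt).
    have [_ d _ _] := hv z (rI z zI).
    have := is_deriveB (du z) d; by rewrite /w clamp_id// subrr.
  have : `|(u x - v x) - (u s - v s)| <= 0 * (x - s).
    apply: (mvt_ineq (f := fun y => u y - v y) (df := fun=> 0)).
    - exact: sx.
    - by [].
    - by move=> z /andP[/ltW sz /ltW zx]; apply: dz; rewrite sz.
    - exact: (derive_within (df := fun=> 0)).
    - by move=> z _; rewrite normr0.
  have us : u s = v s by rewrite /u addrC subrK.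
  by rewrite mul0r us subrr subr0 normr_le0 subr_eq0 => /eqP.
have [du_ cu] : (forall x, derivable u x 1) /\ continuous (derive1 u).
  by split; [move=> x; case: (du x)|rewrite du1].
have arc : C1_arc c s t k u.
  split=> // x xI; have [kx _ _ _] := hv x (rI x xI).
  by split=> //; rewrite uv.
exists 1%N, (fun i => if i is 0%N then s else t), (fun=> k), (fun=> u); split=> //.
  by case.
rewrite big_ord1 /=; apply/esym; apply: (arc_length_cst (chart_metric hS Ak)) => //.
  by move=> x xI; have [_ _ h] := arc; have [kx <-] := h x xI; exact: cimg_mem.
move=> x xI; rewrite /speed du1 /w clamp_id// uv//.
have [_ _ _ ->] := hv x (rI x xI); have [_ _ _ ->] := gP x.
by rewrite sqrtr_sqr ger0_norm.
Qed.

End Geodesics.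

(** * Lifting homotopies *)

Section Homotopy.
Context {R : realType}.
Local Notation plane := 'rV[R]_2.
Local Notation space := 'rV[R]_3.
Local Notation hyp := (@hyp R).
Local Notation orig := (@orig R).
Context {X : topologicalType}.
Variables (A B : set (chart R X)) (g : chart R X -> plane -> 'M[R]_2).
Hypothesis hS : oriented_hyperbolic A B g.
Variables (eta : R) (E : space -> X).
Hypothesis cE : covering A g eta E.

Definition I01 (t : R) : Prop := 0 <= t <= 1.

(** [c] has a continuous lift to the hyperboloid that does not close up. *)
Definition open_lift (c : R -> X) : Prop := exists l : R -> space,
  [/\ forall t, I01 t -> hyp (l t) /\ E (l t) = c t,
      forall t d, I01 t -> 1 < d -> exists2 r : R, 0 < r & forall t', I01 t' -> `|t' - t| < r ->
        lor (l t) (l t') < d &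
      l 0 <> l 1].

Let i0I : I01 0. Proof. by rewrite /I01 lexx ler01. Qed.
Let i1I : I01 1. Proof. by rewrite /I01 lexx ler01. Qed.

Lemma constant_no_lift p c : (forall t, I01 t -> c t = p) -> ~ open_lift c.
Proof.
move=> cp [l [hl lc ne]]; apply: ne.
apply: (@interval_chain R 0 1 (fun s t => l s = l t)) => //; first by move=> s t u -> ->.
move=> t0 t0I; have [r r0 hr] := lc t0 eta t0I (cov_eta cE).
exists r => // s t s0 st t1 sr tr.
have sI : I01 s by rewrite /I01 s0 (le_trans st t1).
have tI : I01 t by rewrite /I01 t1 (le_trans s0 st).
have [h1 e1] := hl _ sI; have [h2 e2] := hl _ tI; have [h3 _] := hl _ t0I.
by apply: (cov_inj cE h3 h1 h2); [exact: hr|exact: hr|rewrite e1 e2 !cp].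
Qed.

Definition close (kp : R) (x y : X) : Prop :=
  exists p q, [/\ hyp p, hyp q, E p = x, E q = y & lor p q < kp].

Lemma close_sym kp x y : close kp x y -> close kp y x.
Proof. by move=> [p [q [hp hq ep eq pq]]]; exists q, p; split=> //; rewrite lorC. Qed.

(** The lift of [c'] is chosen pointwise at distance [kp] from that of [c]; it is
    continuous because [E] is injective at that scale, and it closes up only if
    the given lift does. *)
Lemma transfer_lift (kp : R) (c c' : R -> X) : 1 < kp -> 2 * kp ^+ 2 - 1 < eta ->
  c 0 = c 1 -> c' 0 = c' 1 -> (forall t, I01 t -> close kp (c t) (c' t)) ->
  (forall t (V : set X), I01 t -> nbhs (c' t) V -> exists2 r : R, 0 < r & forall t', I01 t' ->
     `|t' - t| < r -> V (c' t')) ->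
  open_lift c -> open_lift c'.
Proof.
move=> k1 ke c01 c01' near cc' [l [hl lc ne]].
have ke' : kp < eta by have : kp <= kp ^+ 2 by [rewrite expr2; nra]; nra.
have /choice[l' hl'] : forall t, exists q, I01 t -> [/\ hyp q, E q = c' t & lor (l t) q < kp].
  move=> t; have [tI|n] := pselect (I01 t); last by exists 0.
  have [p [q [hp hq ep eq pq]]] := near t tI; have [h1 e1] := hl t tI.
  have [M [iM hM] pM] := cov_trans cE hp h1 (etrans ep (esym e1)).
  exists (q *m M) => _; split; [exact: isom_hyp iM hq|by rewrite hM|].
  by rewrite -pM isom_lor.
exists l'; split.
- by move=> t /hl' [].
- move=> t d tI d1; have [h0 e0 q0] := hl' t tI; have [h1 e1] := hl t tI.
  have nP : hnear (l' t) (fun w => lor (l' t) w < d /\ lor (l t) w < kp).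
    apply: hnear_and; last exact: hnear_ball.
    by apply: hnear_ball => //; case: h0 => ->.
  have := cov_open cE h0 nP; rewrite e0 => /(cc' t _ tI) [r r0 hr].
  have [s s0 hs] := lc t kp tI k1.
  exists (Num.min r s) => [|t' tI']; first by rewrite lt_min r0.
  rewrite lt_min => /andP[t'r t's].
  have [w [hw [wd wk]] ew] := hr t' tI' t'r.
  have [h2 e2 q2] := hl' t' tI'; have [h3 e3] := hl t' tI'.
  suff -> : l' t' = w by [].
  apply: (cov_inj cE h1 h2 hw); last by rewrite e2 ew.
    apply: le_lt_trans ke; apply: (lor_double h1 h3 h2); apply: ltW => //.
    exact: hs.
  by lra.
- have [h0 e0] := hl 0 i0I; have [h1 e1] := hl 1 i1I.
  have [h0' e0' q0] := hl' 0 i0I; have [h1' e1' q1] := hl' 1 i1I.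
  have ee : E (l 0) = E (l 1) by rewrite e0 e1.
  have [M dM gM] := cov_trans cE h0 h1 ee; have [iM hM] := dM.
  have E1 : l' 0 *m M = l' 1.
    apply: (cov_inj cE h1 (isom_hyp iM h0') h1'); rewrite ?hM//.
    - by rewrite -gM isom_lor//; lra.
    - by lra.
    - by rewrite e0' e1'.
  move=> e; apply: ne; rewrite -gM.
  have -> : M = 1%:M.
    apply: (cov_free cE dM h0'); rewrite E1 -e; case: (h0') => -> _; exact: cov_eta cE.
  by rewrite mulmx1.
Qed.

Lemma square_continuous (H : R * R -> X) :
  {within `[0, 1]%classic `*` `[0, 1]%classic, continuous H} ->
  continuous (fun z : R * R => H (clamp 0 1 z.1, clamp 0 1 z.2)).
Proof.
move=> cH z; pose phi (z : R * R) := (clamp 0 1 z.1, clamp 0 1 z.2).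
have inS w : (`[0, 1]%classic `*` `[0, 1]%classic) (phi w).
  by split; rewrite /= in_itv /=; exact: clamp_in.
have cphi : phi w @[w --> z] --> phi z.
  have f1 V : nbhs z.1 V -> nbhs z [set w : R * R | V w.1].
    by move=> nV; exists (V, setT) => [|w []//]; split; [exact: nV|apply: open_nbhs_nbhs; split => //; exact: openT].
  have f2 V : nbhs z.2 V -> nbhs z [set w : R * R | V w.2].
    by move=> nV; exists (setT, V) => [|w []//]; split; [apply: open_nbhs_nbhs; split => //; exact: openT|exact: nV].
  have a : clamp 0 1 w.1 @[w --> z] --> clamp 0 1 z.1.
    by move=> V nV; exact: (f1 _ (@clamp_continuous R 0 1 z.1 _ nV)).
  have b : clamp 0 1 w.2 @[w --> z] --> clamp 0 1 z.2.
    by move=> V nV; exact: (f2 _ (@clamp_continuous R 0 1 z.2 _ nV)).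
  exact: (cvg_pair a b).
move/subspace_continuousP : cH => /(_ _ (inS z)) cH V nV.
have hV := cphi _ (cH V nV).
exact: (@filterS _ _ (@nbhs_filter _ z) _ _ (fun w hw => hw (inS w)) hV).
Qed.

(** Stages of the homotopy at close times are uniformly close, so that lifts that
    do not close up pass from the first stage to the last one, which is
    constant. *)
Lemma not_contractible (gm : R -> space) M : continuous gm -> (forall t, hyp (gm t)) ->
  deck E M -> M <> 1%:M -> gm 0 *m M = gm 1 -> ~ contractible (fun t => E (gm t)).
Proof.
move=> cg hg dM M1 gM [H [p [cH hH]]].
have e1 := cov_eta cE.
pose kp := Num.sqrt ((eta + 3) / 4).
have k1 : 1 < kp by rewrite -sqrtr1 ltr_sqrt; lra.
have ke : 2 * kp ^+ 2 - 1 < eta by rewrite sqr_sqrtr; lra.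
pose mu := Num.sqrt ((kp + 3) / 4).
have m1 : 1 < mu by rewrite -sqrtr1 ltr_sqrt; lra.
have mk : 2 * mu ^+ 2 - 1 < kp by rewrite sqr_sqrtr; lra.
pose H' (z : R * R) := H (clamp 0 1 z.1, clamp 0 1 z.2).
have cH' : continuous H' by exact: square_continuous.
have HE s t : I01 s -> I01 t -> H' (s, t) = H (s, t) by move=> sI tI; rewrite /H' !clamp_id.
pose c s t := H' (s, t).
suff : open_lift (c 1).
  apply: (@constant_no_lift p) => t tI; rewrite /c HE//.
  by have [_ ->] := hH t tI.
have l0 : open_lift (c 0).
  exists gm; split.
  - by move=> t tI; split=> //; rewrite /c HE//; have [-> _] := hH t tI.
  - move=> t d tI d1.
    have n : nbhs (gm t) [set w | lor (gm t) w < d].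
      by apply: open_nbhs_nbhs; split; [exact: lor_ball_open|case: (hg t) => /= ->].
    have [r r0 hr] := near_ball_R (cg t _ n); exists r => // t' _; exact: hr.
  - move=> e; apply: M1; apply: (cov_free cE dM (hg 0)).
    by rewrite gM -e; case: (hg 0) => ->.
move: l0; apply: (@interval_chain R 0 1 (fun s t => open_lift (c s) -> open_lift (c t))) => //.
  by move=> s t u h1 h2 /h1 /h2.
move=> s0 s0I.
have closed s : I01 s -> c s 0 = c s 1.
  by move=> sI; rewrite /c !HE//; have [_ _] := hH s sI.
have ccont s t (V : set X) : I01 t -> nbhs (c s t) V -> exists2 r : R, 0 < r &
    forall t', I01 t' -> `|t' - t| < r -> V (c s t').
  move=> tI nV; have := cH' (s, t) _ nV => -[[V1 V2] [/= n1 n2] h].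
  have [r r0 hr] := near_ball_R n2; exists r => // t' _ t'r.
  by apply: (h (s, t')); split => //=; [exact: nbhs_singleton n1|exact: hr].
have [r r0 hr] : exists2 r : R, 0 < r & forall s, `|s - s0| < r ->
    `[0, 1]%classic `<=` [set t | close kp (c s0 t) (c s t)].
  apply: near_ball_R.
  have /compact_near_coveringP cI := @segment_compact R 0 1.
  apply: (cI R (nbhs s0) (fun s t => close kp (c s0 t) (c s t))) => t tI.
  have [w hw ew] := cov_surj cE (c s0 t).
  have nw : hnear w (fun v => lor w v < mu) by exists mu.
  have nV := cov_open cE hw nw; rewrite ew in nV.
  have := cH' (s0, t) _ nV => -[[V1 V2] [/= n1 n2] h].
  exists (V2, V1) => // -[t' s] /= [v2 v1].
  have [a [ha wa] ea] := h (s0, t') (conj (nbhs_singleton n1) v2).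
  have [b [hb wb] eb] := h (s, t') (conj v1 v2).
  exists a, b; split=> //.
  apply: le_lt_trans mk; apply: (lor_double ha hw hb); last exact: ltW.
  by rewrite lorC ltW.
have s0I' : I01 s0 by [].
have cl s t : `|s - s0| < r -> I01 t -> close kp (c s0 t) (c s t).
  by move=> sr tI; apply: (hr s sr); rewrite /= in_itv.
exists r => // s t s0' st t1 sr tr.
have sI : I01 s by rewrite /I01 s0' (le_trans st t1).
have tI : I01 t by rewrite /I01 t1 (le_trans s0' st).
move=> ls; apply: (@transfer_lift kp (c s0)) => //; [exact: closed|exact: closed| |exact: ccont|].
  by move=> x; exact: cl.
apply: (@transfer_lift kp (c s)) => //; [exact: closed|exact: closed| |exact: ccont].
by move=> x xI; apply: close_sym; exact: cl.
Qed.

(** * Diameter and systole in terms of the deck group *)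

Lemma length_ge0 c L : has_length A g c L -> 0 <= L.
Proof. by move=> /(curve_lift hS cE) []. Qed.

Lemma geodesic0 p n (T : R) : geodesic p n T 0 = p.
Proof. by rewrite /geodesic mulr0 cosh0 sinh0 scale1r scale0r addr0. Qed.

Lemma distance_le u v : hyp u -> hyp v ->
  0 <= riemannian_distance A g (E u) (E v) <= lor u v.
Proof.
move=> hu hv; have [T [n [/andP[T0 Tl] cT un nn e]]] := geodesic_exists hu hv.
rewrite /riemannian_distance; set S := mkset _.
have ST : S T.
  exists (fun t => E (geodesic u n T t)); split; [by rewrite geodesic0|by rewrite e|].
  exact: (geodesic_pieces hS cE hu un nn T0).
have lb : lbound S 0 by move=> L [c [_ _ /length_ge0]].
apply/andP; split; first by apply: lb_le_inf => //; exists T.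
by apply: le_trans Tl; apply: ge_inf => //; exists 0.
Qed.

Lemma distance_lift u y (e : R) : hyp u -> 0 < e -> exists v, [/\ hyp v, E v = y &
  lor u v <= cosh (riemannian_distance A g (E u) y + e)].
Proof.
move=> hu e0; have [v hv ev] := cov_surj cE y.
have [T [n [/andP[T0 Tl] cT un nn eg]]] := geodesic_exists hu hv.
rewrite /riemannian_distance; set S := mkset _.
have ST : S T.
  exists (fun t => E (geodesic u n T t)); split; [by rewrite geodesic0|by rewrite eg ev|].
  exact: (geodesic_pieces hS cE hu un nn T0).
have lb : lbound S 0 by move=> L [c [_ _ /length_ge0]].
have hi : has_inf S by split; [exists T|exists 0].
have [L [c [c0 c1 hL]] Lt] := inf_adherent e0 hi.
have [L0 lift] := curve_lift hS cE hL.
have [w [hw ew lw]] := lift u hu (esym c0).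
exists w; split; rewrite ?ew//; apply: le_trans lw _.
by apply: cosh_le => //; exact: ltW.
Qed.

(** Distances are bounded because a ball of the hyperboloid covers [X]. *)
Lemma distance_le_diameter x y : riemannian_distance A g x y <= diameter A g.
Proof.
have [C hC] := cov_bounded cE.
apply: ub_le_sup; last by exists x, y.
exists (2 * C ^+ 2 - 1) => d [x' [y' ->]].
have [u [hu uC <-]] := hC x'; have [v [hv vC <-]] := hC y'.
have [_ h] := andP (distance_le hu hv); apply: le_trans h _.
apply: (lor_double hu hyp_orig hv); first by rewrite lorC lor_orig; exact: ltW.
by rewrite lor_orig; exact: ltW.
Qed.

Lemma diameter_ge0 : 0 <= diameter A g.
Proof.
apply: le_trans (distance_le_diameter (E orig) (E orig)).
by have /andP[] := distance_le hyp_orig hyp_orig.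
Qed.

(** A curve from [E u] to [E v] of length less than the diameter plus [e] lifts to
    a curve that starts at [u] and ends over [E v]. *)
Lemma orbit_dense u v (e : R) : hyp u -> hyp v -> 0 < e ->
  exists2 M, deck E M & lor u (v *m M) <= cosh (diameter A g + e).
Proof.
move=> hu hv e0; have [w [hw ew uw]] := distance_lift (E v) hu e0.
have [M dM vM] := cov_trans cE hv hw (esym ew); exists M => //; rewrite vM.
apply: le_trans uw _; have := distance_le_diameter (E u) (E v).
have /andP[d0 _] := distance_le hu hv => dd.
by apply: cosh_le; lra.
Qed.

(** The projection of the geodesic from [v] to its image is not contractible. *)
Lemma systole_le M v : deck E M -> M <> 1%:M -> hyp v ->
  0 <= systole A g /\ cosh (systole A g) <= lor v (v *m M).
Proof.
move=> dM M1 hv; have [iM hM] := dM; have hvM := isom_hyp iM hv.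
have [T [n [/andP[T0 Tl] cT vn nn e]]] := geodesic_exists hv hvM.
rewrite /systole; set S := mkset _.
have gP t := geodesicP T t hv vn nn.
have ST : S T.
  exists (fun t => E (geodesic v n T t)); split; first by rewrite geodesic0 e hM.
    apply: (@not_contractible (geodesic v n T) M) => //.
    - by move=> t; have [_ _ d _] := gP t; exact: is_derive_continuous d.
    - by move=> t; have [] := gP t.
    - by rewrite geodesic0 e.
  exact: (geodesic_pieces hS cE hv vn nn T0).
have lb : lbound S 0 by move=> L [c [_ _ /length_ge0]].
have s0 : 0 <= inf S by apply: lb_le_inf => //; exists T.
split=> //; rewrite -cT; apply: cosh_le => //.
by apply: ge_inf => //; exists 0.
Qed.

End Homotopy.

(** * The action of SL2 on the hyperboloid *)

Section SpecialLinear.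
Context {R : realType}.
Local Notation space := 'rV[R]_3.
Local Notation mat := 'M[R]_2.
Local Notation hyp := (@hyp R).
Local Notation orig := (@orig R).
Local Notation mink_mx := (@mink_mx R).

Definition mat2 (a b c d : R) : mat :=
  \matrix_(i, j) if i == 0 then if j == 0 then a else b else if j == 0 then c else d.

Lemma mat2E a b c d : ((mat2 a b c d 0 0 = a) * (mat2 a b c d 0 1 = b) *
  (mat2 a b c d 1 0 = c) * (mat2 a b c d 1 1 = d))%type.
Proof. by do !split; rewrite mxE. Qed.

Lemma mat2P (A B : mat) : A 0 0 = B 0 0 -> A 0 1 = B 0 1 -> A 1 0 = B 1 0 -> A 1 1 = B 1 1 ->
  A = B.
Proof.
have ord2 (m : 'I_2) : m = 0 \/ m = 1.
  by case: m => [[|[|//]] p]; [left|right]; exact/val_inj.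
move=> h00 h01 h10 h11; apply/matrixP => i j.
by have [-> | ->] := ord2 i; have [-> | ->] := ord2 j.
Qed.

(** A point [(x, y, t)] is the symmetric matrix with entries [t + x, y, y, t - x],
    on which [A] acts by [S |-> A^T S A]. *)
Definition Ad (A : mat) : 'M[R]_3 := \matrix_(i, j)
  let a := A 0 0 in let b := A 0 1 in let c := A 1 0 in let d := A 1 1 in
  if i == i0 then row3 ((a * a - c * c - b * b + d * d) / 2) (a * b - c * d)
    ((a * a - c * c + b * b - d * d) / 2) 0 j
  else if i == i1 then row3 (a * c - b * d) (a * d + b * c) (a * c + b * d) 0 j
  else row3 ((a * a + c * c - b * b - d * d) / 2) (a * b + c * d)
    ((a * a + c * c + b * b + d * d) / 2) 0 j.

Lemma AdE (A : mat) : let a := A 0 0 in let b := A 0 1 in let c := A 1 0 in let d := A 1 1 in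
  ((Ad A i0 i0 = ((a * a - c * c - b * b + d * d) / 2)%R) *
   (Ad A i0 i1 = (a * b - c * d)%R) *
   (Ad A i0 i2 = ((a * a - c * c + b * b - d * d) / 2)%R) *
   (Ad A i1 i0 = (a * c - b * d)%R) * (Ad A i1 i1 = (a * d + b * c)%R) *
   (Ad A i1 i2 = (a * c + b * d)%R) *
   (Ad A i2 i0 = ((a * a + c * c - b * b - d * d) / 2)%R) *
   (Ad A i2 i1 = (a * b + c * d)%R) *
   (Ad A i2 i2 = ((a * a + c * c + b * b + d * d) / 2)%R))%type.
Proof. by do !split; rewrite mxE /= row3E. Qed.

Lemma AdM (A B : mat) : Ad (A *m B) = Ad A *m Ad B.
Proof.
apply/matrixP => i j; rewrite mulmx33; move: i j.
elim/ord3P; elim/ord3P; rewrite !AdE !mulmx22;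
  move: (A 0 0) (A 0 1) (A 1 0) (A 1 1) (B 0 0) (B 0 1) (B 1 0) (B 1 1) => a b c d a' b' c' d'; by field.
Qed.

Lemma Ad_isom (A : mat) : \det A = 1 -> isom (Ad A).
Proof.
rewrite det2 => h.
have tr p q : (Ad A)^T p q = Ad A q p by rewrite mxE.
move: h; set a := A 0 0; set b := A 0 1; set c := A 1 0; set d := A 1 1 => h; split.
- have key i j : (Ad A *m mink_mx *m (Ad A)^T) i j = (a * d - b * c) ^+ 2 * mink_mx i j.
    rewrite !mulmx33 !tr; move: i j.
    by elim/ord3P; elim/ord3P; rewrite !mink_mxE !AdE -/a -/b -/c -/d; clearbody a b c d; field.
  by apply/matrixP => i j; rewrite key h expr1n mul1r.
- rewrite det33 !AdE -/a -/b -/c -/d; clearbody a b c d.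
  by rewrite (_ : _ + _ = (a * d - b * c) ^+ 3); [rewrite h expr1n|field].
- rewrite AdE -/a -/b -/c -/d divr_gt0// -!expr2.
  have [a0|a0] := eqVneq a 0; last by have := sqr_ge0 b; have := sqr_ge0 c; have := sqr_ge0 d;
    have : 0 < a ^+ 2 by [rewrite exprn_even_gt0]; lra.
  have c0 : c != 0 by apply/eqP => c0; move: h; rewrite a0 c0 mul0r mulr0 subrr => /eqP; rewrite eq_sym oner_eq0.
  by have := sqr_ge0 b; have := sqr_ge0 a; have := sqr_ge0 d;
    have : 0 < c ^+ 2 by [rewrite exprn_even_gt0]; lra.
Qed.

Lemma Ad_trivial (A : mat) : \det A = 1 -> Ad A = 1%:M -> A = 1%:M \/ A = - 1%:M.
Proof.
rewrite det2 => h /matrixP e.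
have e01 := e i1 i0; have e11 := e i1 i1; have e12 := e i1 i2; have e20 := e i2 i0; have e22 := e i2 i2.
move: h e01 e11 e12 e20 e22; rewrite !AdE !mxE /=.
have fin (s : R) : A 0 0 = s -> A 0 1 = 0 -> A 1 0 = 0 -> A 1 1 = s -> A = s%:M.
  by move=> ? ? ? ?; apply: mat2P; rewrite mxE /=.
move: fin; move: (A 0 0) (A 0 1) (A 1 0) (A 1 1) => a b c d fin h e01 e11 e12 e20 e22.
have ad : a * d = 1 by lra.
have a0 : a != 0 by apply/eqP => a0; move: ad; rewrite a0 mul0r => /eqP; rewrite eq_sym oner_eq0.
have d0 : d != 0 by apply/eqP => d0; move: ad; rewrite d0 mulr0 => /eqP; rewrite eq_sym oner_eq0.
have c0 : c = 0 by apply: (mulfI a0); rewrite mulr0; lra.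
have b0 : b = 0 by apply: (mulIf d0); rewrite mul0r; lra.
have : a * a = 1 by move: e20 e22; rewrite b0 c0; lra.
rewrite -expr2 => /eqP; rewrite sqrf_eq1 => /orP[]/eqP a1.
  by left; apply: fin => //; move: ad; rewrite a1 mul1r.
right; rewrite (fin (-1)) ?scalemxN1 //; last by move: ad; rewrite a1; lra.
by rewrite -[LHS]scalemx1 scaleN1r.
Qed.

Lemma orig_mulE (M : 'M[R]_3) j : (orig *m M) 0 j = M i2 j.
Proof. by rewrite mulmx33 !row3E; ring. Qed.

Lemma Ad_surj M : isom M -> exists2 A, \det A = 1 & Ad A = M.
Proof.
move=> iM; have hp := isom_hyp iM hyp_orig; set p := orig *m M in hp.
have sp := hyp_sq hp; have [_ p0] := hp.
have tx : 0 < p 0 i2 + p 0 i0.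
  have : p 0 i0 ^+ 2 < p 0 i2 ^+ 2 by rewrite sp; have := sqr_ge0 (p 0 i1); lra.
  by rewrite !expr2; move: (p 0 i0) (p 0 i2) p0 => x t t0; nra.
pose al := Num.sqrt (p 0 i2 + p 0 i0); have al0 : 0 < al by rewrite sqrtr_gt0.
have al2 : al * al = p 0 i2 + p 0 i0 by rewrite -expr2 sqr_sqrtr// ltW.
pose B := mat2 al (p 0 i1 / al) 0 al^-1.
have dB : \det B = 1 by rewrite det2 !mat2E mulr0 subr0 divff// gt_eqF.
have iB := Ad_isom dB.
have oB : orig *m Ad B = p.
  have q : (p 0 i1 / al) * (p 0 i1 / al) + al^-1 * al^-1 = p 0 i2 - p 0 i0.
    apply: (mulfI (lt0r_neq0 (mulr_gt0 al0 al0))).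
    transitivity (p 0 i1 * p 0 i1 + 1); first by field; exact: lt0r_neq0.
    by rewrite al2; move: sp; rewrite !expr2; lra.
  have r : al * (p 0 i1 / al) = p 0 i1 by field; exact: lt0r_neq0.
  apply: row3P; rewrite orig_mul mxE AdE !mat2E.
  - by move: al2 q; rewrite !mul0r; lra.
  - by rewrite r mul0r addr0.
  - by move: al2 q; rewrite !mul0r; lra.
pose K := M *m invmx (Ad B).
have iK : isom K by apply: isomM => //; exact: isomV.
have Ko : orig *m K = orig by rewrite /K mulmxA -/p -oB mulmxK//; exact: isom_unit.
have K2 j : K i2 j = orig 0 j by rewrite -orig_mulE Ko.
have K20 := K2 i0; have K21 := K2 i1; have K22 := K2 i2; rewrite !row3E in K20 K21 K22.
have [KK dK _] := iK.
have P i m : K i i0 * K m i0 + K i i1 * K m i1 - K i i2 * K m i2 = mink_mx i m.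
  by rewrite -prod_entry KK.
have e02 : K i0 i2 = 0 by have := P i0 i2; rewrite K20 K21 K22 mink_mxE; lra.
have e12 : K i1 i2 = 0 by have := P i1 i2; rewrite K20 K21 K22 mink_mxE; lra.
have q00 := P i0 i0; have q01 := P i0 i1; have q11 := P i1 i1.
rewrite !mink_mxE e02 in q00; rewrite !mink_mxE e02 in q01; rewrite !mink_mxE e12 in q11.
move: dK; rewrite det33 K20 K21 K22 e02 e12 => dK.
pose c := K i0 i0; pose s := K i0 i1.
have [e10 e11] : K i1 i0 = - s /\ K i1 i1 = c.
  rewrite -/c -/s in q00 q01 dK.
  have d1 : (c * K i1 i1 - s * K i1 i0) ^+ 2 = 1.
    transitivity ((c * c + s * s) * (K i1 i0 * K i1 i0 + K i1 i1 * K i1 i1)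
      - (c * K i1 i0 + s * K i1 i1) ^+ 2); first by ring.
    have z1 : c * K i1 i0 + s * K i1 i1 = 0 by lra.
    have z2 : c * c + s * s = 1 by lra.
    have z3 : K i1 i0 * K i1 i0 + K i1 i1 * K i1 i1 = 1 by move: q11; lra.
    by rewrite z1 z2 z3 expr2; ring.
  have d2 : c * K i1 i1 - s * K i1 i0 = 1.
    move/eqP: d1; rewrite sqrf_eq1 => /orP[/eqP//|/eqP d1]; move: dK; lra.
  have z : (K i1 i0 + s) ^+ 2 + (K i1 i1 - c) ^+ 2 = 0.
    by rewrite !expr2; move: q00 q01 q11 d2; lra.
  move/eqP: z; rewrite paddr_eq0 ?sqr_ge0// !sqrf_eq0 subr_eq0 addr_eq0 => /andP[/eqP-> /eqP->].
  by [].
have cs : c * c + s * s = 1 by move: q00; rewrite -/c -/s; lra.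
have c1 : -1 <= c <= 1 by apply/andP; split; nra.
pose u := Num.sqrt ((1 + c) / 2); pose v0 := Num.sqrt ((1 - c) / 2).
have u2 : u * u = (1 + c) / 2 by rewrite -expr2 sqr_sqrtr//; lra.
have v2 : v0 * v0 = (1 - c) / 2 by rewrite -expr2 sqr_sqrtr//; lra.
have uv2 : (2 * u * v0) ^+ 2 = s ^+ 2.
  rewrite (_ : _ ^+ 2 = 4 * (u * u) * (v0 * v0)); last by ring.
  by rewrite u2 v2 (_ : s ^+ 2 = 1 - c * c); [field|rewrite expr2; lra].
have [v [v2' uv]] : exists v, v * v = (1 - c) / 2 /\ 2 * u * v = s.
  move/eqP: uv2; rewrite eqf_sqr => /orP[/eqP h|/eqP h]; first by exists v0.
  by exists (- v0); rewrite mulrNN; split=> //; rewrite mulrN h opprK.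
pose Q := mat2 u v (- v) u.
have dQ : \det Q = 1 by rewrite det2 !mat2E mulrN opprK u2 v2'; field.
have AQ : Ad Q = K.
  clear KK dK q00 q01 q11 cs c1 v2 uv2 dQ.
  apply/matrixP; elim/ord3P; elim/ord3P; rewrite AdE !mat2E ?K20 ?K21 ?K22 ?e02 ?e12 ?e10 ?e11
    -?/c -?/s; move: u2 v2' uv; lra.
exists (Q *m B); first by rewrite det_mulmx dQ dB mul1r.
by rewrite AdM AQ /K mulmxKV//; exact: isom_unit.
Qed.

Lemma AdN A : Ad (- A) = Ad A.
Proof.
apply/matrixP => i j; move: i j; elim/ord3P; elim/ord3P; rewrite !AdE ![(- A) _ _]mxE; ring.
Qed.

Lemma Ad_inj A B : \det A = 1 -> \det B = 1 -> Ad A = Ad B -> A = B \/ A = - B.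
Proof.
move=> dA dB e; have Bu : B \in unitmx by rewrite unitmxE dB unitr1.
have dC : \det (A *m invmx B) = 1 by rewrite det_mulmx det_inv dA dB invr1 mul1r.
have iB := Ad_isom dB.
have : Ad (A *m invmx B) = 1%:M.
  have h : Ad (A *m invmx B) *m Ad B = Ad B by rewrite -AdM mulmxKV.
  by rewrite -[LHS](mulmxK (isom_unit iB)) h mulmxV//; exact: isom_unit.
move=> /(Ad_trivial dC) [] /(congr1 (mulmx^~ B)); rewrite mulmxKV// ?mulNmx mul1mx; by [left|right].
Qed.

(** Trace and skew part of [A B^-1], for [B] of determinant 1. *)
Definition tr2 (A B : mat) : R :=
  A 0 0 * B 1 1 - A 0 1 * B 1 0 - A 1 0 * B 0 1 + A 1 1 * B 0 0.
Definition sk2 (A B : mat) : R :=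
  A 0 0 * B 0 1 - A 0 1 * B 0 0 + A 1 0 * B 1 1 - A 1 1 * B 1 0.

Lemma tr2C A B : tr2 A B = tr2 B A. Proof. by rewrite /tr2; ring. Qed.
Lemma sk2C A B : sk2 A B = - sk2 B A. Proof. by rewrite /sk2; ring. Qed.

Lemma tr2_mulr A B L : \det L = 1 -> tr2 (A *m L) (B *m L) = tr2 A B.
Proof.
move=> dL; transitivity (tr2 A B * \det L); last by rewrite dL mulr1.
by rewrite /tr2 det2 !mulmx22; ring.
Qed.

Lemma sk2_mulr A B L : \det L = 1 -> sk2 (A *m L) (B *m L) = sk2 A B.
Proof.
move=> dL; transitivity (sk2 A B * \det L); last by rewrite dL mulr1.
by rewrite /sk2 det2 !mulmx22; ring.
Qed.

Lemma tr2Nl A B : tr2 (- A) B = - tr2 A B.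
Proof. by rewrite /tr2 ![(- A) _ _]mxE; ring. Qed.
Lemma sk2Nl A B : sk2 (- A) B = - sk2 A B.
Proof. by rewrite /sk2 ![(- A) _ _]mxE; ring. Qed.

Lemma tr2E A B : \det B = 1 -> tr2 A B = \tr (A *m invmx B).
Proof.
rewrite det2 => dB; have d0 : B 0 0 * B 1 1 - B 0 1 * B 1 0 != 0 by rewrite dB oner_neq0.
have [e00 e01 e10 e11] := inv2 d0.
by rewrite /mxtrace sum2 !mulmx22 e00 e01 e10 e11 dB invr1 /tr2; ring.
Qed.

(** Once [q] is moved to the origin, each [A_j] amounts to complex numbers
    [a_j, b_j] with [|a_j|^2 = |b_j|^2 + 1 <= (C + 1) / 2], and
    [tr2 A_j A_k] is twice the real part of [a_j conj(a_k) - b_j conj(b_k)]. The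
    quadratic form [2 Re(x_1 conj(x_2) + x_2 conj(x_3) - x_3 conj(x_1))] has
    eigenvalues 1, 1 and -2, which gives [3 (C + 1) / 2 + 2 * 3 (C - 1) / 2]. *)
Lemma trace_bound (A1 A2 A3 : mat) q C : \det A1 = 1 -> \det A2 = 1 -> \det A3 = 1 -> hyp q ->
  lor q (orig *m Ad A1) <= C -> lor q (orig *m Ad A2) <= C -> lor q (orig *m Ad A3) <= C ->
  tr2 A1 A2 + tr2 A2 A3 - tr2 A3 A1 <= 3 * ((3 * C - 1) / 2).
Proof.
move=> d1 d2 d3 hq.
have [M iM oM] := hyp_transitive hq; have [L dL AL] := Ad_surj (isomV iM).
have mv A : lor q (orig *m Ad A) = lor orig (orig *m Ad (A *m L)).
  by rewrite AdM AL mulmxA -{1}oM -(isom_lor _ _ (isomV iM)) mulmxK//; exact: isom_unit.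
rewrite !mv -(tr2_mulr A1 A2 dL) -(tr2_mulr A2 A3 dL) -(tr2_mulr A3 A1 dL).
have dm A : \det A = 1 -> \det (A *m L) = 1 by move=> dA; rewrite det_mulmx dA dL mulr1.
move: (dm _ d1) (dm _ d2) (dm _ d3); rewrite !det2 !lor_orig !orig_mulE !AdE /tr2.
move: (A1 *m L) (A2 *m L) (A3 *m L) => B1 B2 B3.
move: (B1 0 0) (B1 0 1) (B1 1 0) (B1 1 1) (B2 0 0) (B2 0 1) (B2 1 0) (B2 1 1)
  (B3 0 0) (B3 0 1) (B3 1 0) (B3 1 1) => a b c d a' b' c' d' a'' b'' c'' d'' h1 h2 h3 k1 k2 k3.
have := sqr_ge0 ((a + d) - (a' + d') + (a'' + d'')).
have := sqr_ge0 ((b - c) - (b' - c') + (b'' - c'')).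
have := sqr_ge0 ((a - d) + (a' - d')); have := sqr_ge0 ((a' - d') + (a'' - d'')).
have := sqr_ge0 ((a - d) - (a'' - d'')); have := sqr_ge0 ((b + c) - (b'' + c'')).
have := sqr_ge0 ((b + c) + (b' + c')); have := sqr_ge0 ((b' + c') + (b'' + c'')).
rewrite !expr2; lra.
Qed.

(** ** The sign of a triangle *)

Definition det3 (u v w : space) : R :=
  u 0 i0 * (v 0 i1 * w 0 i2 - v 0 i2 * w 0 i1)
  - u 0 i1 * (v 0 i0 * w 0 i2 - v 0 i2 * w 0 i0)
  + u 0 i2 * (v 0 i0 * w 0 i1 - v 0 i1 * w 0 i0).

(** Half of the rotation angle of the matrix [A B^-1]; it does not depend on the
    signs of [A] and [B]. *)
Definition angle (A B : mat) : R := atan (sk2 A B / tr2 A B).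

Lemma angleC A B : angle A B = - angle B A.
Proof. by rewrite /angle sk2C tr2C mulNr atanN. Qed.

Lemma angle_self A : angle A A = 0.
Proof. by have := angleC A A; lra. Qed.

Lemma angleNl A B : angle (- A) B = angle A B.
Proof. by rewrite /angle tr2Nl sk2Nl invrN mulrNN. Qed.

Lemma angleNr A B : angle A (- B) = angle A B.
Proof. by rewrite angleC angleNl -angleC. Qed.

Lemma angle_mulr A B L : \det L = 1 -> angle (A *m L) (B *m L) = angle A B.
Proof. by move=> dL; rewrite /angle tr2_mulr// sk2_mulr. Qed.

Lemma atan_sum_pos (x y z : R) : 0 < 1 - x * y - y * z - z * x -> 0 < x + y + z - x * y * z ->
  0 < atan x + atan y + atan z.
Proof.
move=> hre him.
have cp (t : R) : 0 < cos (atan t).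
  by apply: cos_gt0_pihalf; rewrite atan_gtNpi2 atan_ltpi2.
have sE (t : R) : sin (atan t) = t * cos (atan t).
  by rewrite -{2}(atanK t) /tan divfK// gt_eqF.
have cS : cos (atan x + atan y + atan z) = (1 - x * y - y * z - z * x) *
    (cos (atan x) * cos (atan y) * cos (atan z)).
  by rewrite !(sinD, cosD) !sE; ring.
have sS : sin (atan x + atan y + atan z) = (x + y + z - x * y * z) *
    (cos (atan x) * cos (atan y) * cos (atan z)).
  by rewrite !(sinD, cosD) !sE; ring.
have ccc : 0 < cos (atan x) * cos (atan y) * cos (atan z) by rewrite !mulr_gt0.
have c0 : 0 < cos (atan x + atan y + atan z) by rewrite cS mulr_gt0.
have s0 : 0 < sin (atan x + atan y + atan z) by rewrite sS mulr_gt0.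
have b1 := @atan_gtNpi2 R x; have b2 := @atan_gtNpi2 R y; have b3 := @atan_gtNpi2 R z.
move: c0 s0; set S := _ + _ + _ => c0 s0; have Sb : - (pi + pi / 2) < S by rewrite /S; lra.
have p0 := pi_gt0 R.
rewrite ltNge; apply/negP => S0.
have [h|h] := leP (- pi) S.
  have : 0 <= sin (- S) by apply: sin_ge0_pi; apply/andP; split; lra.
  by rewrite sinN; lra.
have : 0 < cos (S + pi).
  by apply: cos_gt0_pihalf; apply/andP; split; lra.
by rewrite cosDpi; lra.
Qed.

(** The products [a_j conj(a_k) - b_j conj(b_k)] attached to three elements form a
    Gram matrix of signature (1,1), which is singular; and the imaginary part of
    their cyclic product is the orientation of the three points. *)
Lemma triangle_sign (A1 A2 A3 : mat) : \det A1 = 1 -> \det A2 = 1 -> \det A3 = 1 ->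
  0 < tr2 A1 A2 * tr2 A2 A3 * tr2 A3 A1 ->
  0 < det3 (orig *m Ad A1) (orig *m Ad A2) (orig *m Ad A3) ->
  0 < angle A1 A2 + angle A2 A3 + angle A3 A1.
Proof.
move=> d1 d2 d3 tp dp.
have mod A B : \det A = 1 -> \det B = 1 -> 4 <= tr2 A B ^+ 2 + sk2 A B ^+ 2.
  move=> dA dB.
  have e : tr2 A B ^+ 2 + sk2 A B ^+ 2 = 4 * (\det A * \det B) +
      (A 0 0 * B 1 1 - A 0 1 * B 1 0 + A 1 0 * B 0 1 - A 1 1 * B 0 0) ^+ 2 +
      (- A 0 0 * B 0 1 + A 0 1 * B 0 0 + A 1 0 * B 1 1 - A 1 1 * B 1 0) ^+ 2.
    by rewrite /tr2 /sk2 !det2; ring.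
  rewrite e dA dB; have := sqr_ge0 (A 0 0 * B 1 1 - A 0 1 * B 1 0 + A 1 0 * B 0 1 - A 1 1 * B 0 0).
  have := sqr_ge0 (- A 0 0 * B 0 1 + A 0 1 * B 0 0 + A 1 0 * B 1 1 - A 1 1 * B 1 0); lra.
have m12 := mod _ _ d1 d2; have m23 := mod _ _ d2 d3; have m31 := mod _ _ d3 d1.
have gram : 2 * (tr2 A1 A2 * tr2 A2 A3 * tr2 A3 A1 - tr2 A1 A2 * sk2 A2 A3 * sk2 A3 A1
     - sk2 A1 A2 * tr2 A2 A3 * sk2 A3 A1 - sk2 A1 A2 * sk2 A2 A3 * tr2 A3 A1) =
   2 * (\det A3 * (tr2 A1 A2 ^+ 2 + sk2 A1 A2 ^+ 2) + \det A1 * (tr2 A2 A3 ^+ 2 + sk2 A2 A3 ^+ 2)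
     + \det A2 * (tr2 A3 A1 ^+ 2 + sk2 A3 A1 ^+ 2)) - 8 * (\det A1 * \det A2 * \det A3).
  rewrite /tr2 /sk2 !det2; move: (A1 0 0) (A1 0 1) (A1 1 0) (A1 1 1) (A2 0 0) (A2 0 1) (A2 1 0) (A2 1 1)
    (A3 0 0) (A3 0 1) (A3 1 0) (A3 1 1) => *; ring.
have im : sk2 A1 A2 * tr2 A2 A3 * tr2 A3 A1 + tr2 A1 A2 * sk2 A2 A3 * tr2 A3 A1 +
    tr2 A1 A2 * tr2 A2 A3 * sk2 A3 A1 - sk2 A1 A2 * sk2 A2 A3 * sk2 A3 A1 =
    2 * det3 (orig *m Ad A1) (orig *m Ad A2) (orig *m Ad A3).
  rewrite /tr2 /sk2 /det3 !orig_mulE !AdE.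
  move: (A1 0 0) (A1 0 1) (A1 1 0) (A1 1 1) (A2 0 0) (A2 0 1) (A2 1 0) (A2 1 1)
    (A3 0 0) (A3 0 1) (A3 1 0) (A3 1 1) => a b c d a' b' c' d' a'' b'' c'' d''; by field.
rewrite d1 d2 d3 in gram.
have : tr2 A1 A2 != 0 /\ tr2 A2 A3 != 0 /\ tr2 A3 A1 != 0.
  by have := lt0r_neq0 tp; rewrite !mulf_eq0 !negb_or -andbA => /and3P[].
move: tp m12 m23 m31 gram im dp; rewrite /angle; move: (det3 _ _ _) => D.
move: (tr2 A1 A2) (tr2 A2 A3) (tr2 A3 A1) (sk2 A1 A2) (sk2 A2 A3) (sk2 A3 A1).
move=> t u v s r q tp m12 m23 m31 gram im dp [t0 [u0 v0]].
apply: atan_sum_pos.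
- rewrite (_ : _ - _ = (t * u * v - t * r * q - s * u * q - s * r * v) / (t * u * v)); last first.
    by field; rewrite t0 u0 v0.
  by rewrite divr_gt0//; lra.
- rewrite (_ : _ - _ = (s * u * v + t * r * v + t * u * q - s * r * q) / (t * u * v)); last first.
    by field; rewrite t0 u0 v0.
  by rewrite divr_gt0//; lra.
Qed.

(** The error [e] is there for parabolic elements, whose displacement has infimum
    0 without reaching it. *)
Lemma displacement (A : mat) (e : R) : \det A = 1 -> 0 < e -> exists2 v, hyp v &
  lor v (v *m Ad A) <= 1 + Num.max 0 ((\tr A ^+ 2 - 4) / 2) + e.
Proof.
move=> dA e0; set m := Num.max _ _.
have m0 : 0 <= m by rewrite le_max lexx.
have mt : (\tr A ^+ 2 - 4) / 2 <= m by rewrite le_max lexx orbT.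
suff [B dB hB] : exists2 B, \det B = 1 & (B *m A *m invmx B) 0 0 ^+ 2 + (B *m A *m invmx B) 0 1 ^+ 2 +
    (B *m A *m invmx B) 1 0 ^+ 2 + (B *m A *m invmx B) 1 1 ^+ 2 <= 2 * (1 + m + e).
  have iB := Ad_isom dB; have Bu : B \in unitmx by rewrite unitmxE dB unitr1.
  exists (orig *m Ad B); first exact: isom_hyp iB hyp_orig.
  have -> : orig *m Ad B *m Ad A = orig *m Ad (B *m A *m invmx B) *m Ad B.
    by rewrite -(mulmxA orig (Ad (B *m A *m invmx B))) -AdM mulmxKV// AdM mulmxA.
  rewrite isom_lor// lor_orig orig_mulE AdE -!expr2; lra.
clearbody m; move: dA mt; rewrite det2 /mxtrace sum2.
set a := A 0 0; set b := A 0 1; set c := A 1 0; set d := A 1 1 => dA mt.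
(* conjugation by [mat2 l x 0 l^-1] *)
have conj (l x : R) : 0 < l -> let B := mat2 l x 0 l^-1 in [/\ \det B = 1,
    (B *m A *m invmx B) 0 0 = a + x * c / l, (B *m A *m invmx B) 1 0 = c / (l * l),
    (B *m A *m invmx B) 1 1 = d - x * c / l &
    (B *m A *m invmx B) 0 1 = l * l * b + l * x * (d - a) - x * x * c].
  move=> l0 B; have ln := lt0r_neq0 l0.
  have dB : \det B = 1 by rewrite det2 !mat2E mulr0 subr0 divff.
  have d0 : B 0 0 * B 1 1 - B 0 1 * B 1 0 != 0 by rewrite -det2 dB oner_neq0.
  have [e00 e01 e10 e11] := inv2 d0; rewrite -det2 dB invr1 !mulr1 in e00 e01 e10 e11.
  by split=> //; rewrite !mulmx22 ?e00 ?e01 ?e10 ?e11 !mat2E -/a -/b -/c -/d; field.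
have small (z f : R) : 0 < f -> exists2 l : R, 0 < l & (z * (l * l)) ^+ 2 <= f.
  move=> f0; exists (Num.min 1 (f / (z ^+ 2 + 1))).
    by rewrite lt_min ltr01 divr_gt0// ltr_wpDl// sqr_ge0.
  set l := Num.min _ _.
  have z2 := sqr_ge0 z.
  have l0 : 0 < l by rewrite lt_min ltr01 divr_gt0// ltr_wpDl.
  have l1 : l <= 1 by rewrite ge_min lexx.
  have lf : l * (z ^+ 2 + 1) <= f by rewrite -ler_pdivlMr ?ltr_wpDl// ge_min lexx orbT.
  have l2 : l * l <= l by rewrite ler_piMl// ltW.
  have ll : (l * l) ^+ 2 <= l.
    have ll1 : l * l <= 1 by apply: le_trans l2 l1.
    have ll0 : 0 <= l * l by apply: mulr_ge0; exact: ltW.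
    by apply: le_trans l2; rewrite expr2 ler_piMl.
  rewrite exprMn; apply: le_trans lf; rewrite mulrC.
  by apply: ler_pM; rewrite ?sqr_ge0//; lra.
have [c0|c0] := eqVneq c 0.
  have [l l0 hl] := small b e e0; exists (mat2 l 0 0 l^-1); have [dB e1 e2 e3 e4] := conj l 0 l0 => //.
  rewrite e1 e2 e3 e4 c0 [leLHS](_ : _ = a ^+ 2 + (b * (l * l)) ^+ 2 + d ^+ 2); last by ring.
  by move: dA mt hl; rewrite c0 !expr2; lra.
pose x l := l * (d - a) / (2 * c).
have conj2 l : 0 < l -> exists B, [/\ \det B = 1, (B *m A *m invmx B) 0 0 = (a + d) / 2,
    (B *m A *m invmx B) 1 0 = c / (l * l), (B *m A *m invmx B) 1 1 = (a + d) / 2 &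
    (B *m A *m invmx B) 0 1 = ((a + d) ^+ 2 - 4) / (4 * c) * (l * l)].
  move=> l0; have ln := lt0r_neq0 l0; exists (mat2 l (x l) 0 l^-1).
  have [dB e1 e2 e3 e4] := conj l (x l) l0; split=> //.
  - by rewrite e1 /x; field; rewrite ln c0.
  - by rewrite e3 /x; field; rewrite ln c0.
  - transitivity (((a + d) ^+ 2 - 4 * (a * d - b * c)) / (4 * c) * (l * l)); last by rewrite dA mulr1.
    by rewrite e4 /x; field; rewrite c0.
have [t4|t4] := eqVneq ((a + d) ^+ 2 - 4) 0.
  have [l l0 hl] := small c e e0; have li : 0 < l^-1 by rewrite invr_gt0.
  have [B [dB e1 e2 e3 e4]] := conj2 _ li; exists B => //.
  rewrite e1 e2 e3 e4 t4 -invfM invrK.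
  by move: t4 hl; rewrite !expr2; lra.
(* the two off-diagonal entries are made equal in absolute value *)
pose D := `|(a + d) ^+ 2 - 4|; have D0 : 0 < D by rewrite normr_gt0.
pose w := Num.sqrt D; have w0 : 0 < w by rewrite sqrtr_gt0.
have w2 : w * w = D by rewrite -expr2 sqr_sqrtr// ltW.
pose k := 2 * `|c| / w; have k0 : 0 < k by rewrite divr_gt0// mulr_gt0// normr_gt0.
pose l := Num.sqrt k; have l0 : 0 < l by rewrite sqrtr_gt0.
have l2 : l * l = k by rewrite -expr2 sqr_sqrtr// ltW.
have [B [dB e1 e2 e3 e4]] := conj2 _ l0; exists B => //.
rewrite e1 e2 e3 e4 l2.
have c2 : `|c| * `|c| = c * c by rewrite -normrM ger0_norm// -expr2 sqr_ge0.
have cn : `|c| != 0 by rewrite normr_eq0.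
have wn := lt0r_neq0 w0.
have f1 : (c / k) ^+ 2 = D / 4.
  rewrite /k expr_div_n (_ : (2 * `|c| / w) ^+ 2 = 4 * (`|c| * `|c|) / (w * w)); last first.
    by field; rewrite wn.
  by rewrite c2 w2 expr2; field; rewrite c0 lt0r_neq0.
have f2 : (((a + d) ^+ 2 - 4) / (4 * c) * k) ^+ 2 = D / 4.
  rewrite /k; have DD : ((a + d) ^+ 2 - 4) ^+ 2 = D * D by rewrite -expr2 real_normK ?num_real.
  rewrite (_ : _ ^+ 2 = ((a + d) ^+ 2 - 4) ^+ 2 * (`|c| * `|c|) / (4 * (c * c) * (w * w))); last first.
    by field; rewrite wn c0.
  by rewrite DD c2 w2; field; rewrite c0 lt0r_neq0.
rewrite f1 f2.
suff : D / 2 <= 2 * (1 + m) - (a + d) ^+ 2 / 2 by rewrite !expr2; lra.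
by rewrite /D; case: (ger0P ((a + d) ^+ 2 - 4)) => h; lra.
Qed.

End SpecialLinear.

(** * Discrete groups with large traces *)

Section Orbit.
Context {R : realType}.
Local Notation space := 'rV[R]_3.
Local Notation mat := 'M[R]_2.
Local Notation hyp := (@hyp R).
Local Notation orig := (@orig R).

(** ** Points on a circle *)

Lemma det3_isom (M : 'M[R]_3) (u v w : space) : det3 (u *m M) (v *m M) (w *m M) = det3 u v w * \det M.
Proof.
rewrite /det3 det33 !mulmx33.
move: (u 0 i0) (u 0 i1) (u 0 i2) (v 0 i0) (v 0 i1) (v 0 i2) (w 0 i0) (w 0 i1) (w 0 i2)
  (M i0 i0) (M i0 i1) (M i0 i2) (M i1 i0) (M i1 i1) (M i1 i2) (M i2 i0) (M i2 i1) (M i2 i2).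
by move=> *; ring.
Qed.

Lemma det3_swap (u v w : space) : det3 u w v = - det3 u v w.
Proof. by rewrite /det3; ring. Qed.

Lemma collinear_on_circle (x y a b c d : R) : a * d = b * c ->
  2 * (x * a + y * b) = - (a * a + b * b) -> 2 * (x * c + y * d) = - (c * c + d * d) ->
  [\/ a = 0 /\ b = 0, c = 0 /\ d = 0 | a = c /\ b = d].
Proof.
move=> cr h1 h2.
have [n1|n1] := eqVneq (a * a + b * b) 0.
  by apply: Or31; move/eqP: n1; rewrite paddr_eq0 -?expr2 ?sqr_ge0// !sqrf_eq0 => /andP[/eqP-> /eqP->].
have [n2|n2] := eqVneq (c * c + d * d) 0.
  by apply: Or32; move/eqP: n2; rewrite paddr_eq0 -?expr2 ?sqr_ge0// !sqrf_eq0 => /andP[/eqP-> /eqP->].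
apply: Or33.
have e1 : c * c + d * d = a * c + b * d.
  apply: (mulfI n1); transitivity ((a * a + b * b) * - (2 * (x * c + y * d))); first by rewrite h2 opprK.
  transitivity ((a * c + b * d) * - (2 * (x * a + y * b)) -
     2 * (a * d - b * c) * (y * a - x * b)); first by ring.
  by rewrite cr h1; ring.
have e2 : a * a + b * b = a * c + b * d.
  apply: (mulfI n2); transitivity ((c * c + d * d) * - (2 * (x * a + y * b))); first by rewrite h1 opprK.
  transitivity ((a * c + b * d) * - (2 * (x * c + y * d)) -
     2 * (b * c - a * d) * (y * c - x * d)); first by ring.
  by rewrite cr h2; ring.
have : (a - c) ^+ 2 + (b - d) ^+ 2 = 0 by rewrite !expr2; lra.
move/eqP; rewrite paddr_eq0 ?sqr_ge0// !sqrf_eq0 !subr_eq0 => /andP[/eqP-> /eqP->]; by [].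
Qed.

(** A line meets a circle in at most two points. *)
Lemma det_circle q p1 p2 p3 : hyp q -> hyp p1 -> hyp p2 -> hyp p3 ->
  lor q p1 = lor q p2 -> lor q p1 = lor q p3 -> p1 <> p2 -> p1 <> p3 -> p2 <> p3 ->
  det3 p1 p2 p3 != 0.
Proof.
move=> hq h1 h2 h3 e2 e3 n12 n13 n23.
have [M iM oM] := hyp_transitive hq; have iV := isomV iM.
have Mu := isom_unit iM.
have [_ dV _] := iV.
apply/eqP => dz.
have := det3_isom (invmx M) p1 p2 p3; rewrite dz mul0r.
have key p : lor q p = (p *m invmx M) 0 i2.
  by rewrite -lor_orig [RHS]lorC lor_invmx// oM lorC.
have inj (p p' : space) : p *m invmx M = p' *m invmx M -> p = p'.
  by move=> /(congr1 (mulmx^~ M)); rewrite !mulmxKV.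
rewrite !key in e2 e3.
have s1 := hyp_sq (isom_hyp iV h1); have s2 := hyp_sq (isom_hyp iV h2).
have s3 := hyp_sq (isom_hyp iV h3); have [_ z0] := isom_hyp iV h1.
have i12 := @inj p1 p2; have i13 := @inj p1 p3; have i23 := @inj p2 p3.
move: e2 e3 s1 s2 s3 z0 i12 i13 i23; move: (p1 *m _) (p2 *m _) (p3 *m _) => u v w.
rewrite /det3 => e2 e3 s1 s2 s3 z0 i12 i13 i23 d.
have cr : (v 0 i0 - u 0 i0) * (w 0 i1 - u 0 i1) = (v 0 i1 - u 0 i1) * (w 0 i0 - u 0 i0).
  apply: (mulfI (lt0r_neq0 z0)); move: d; rewrite -e2 -e3; lra.
rewrite -e2 in s2; rewrite -e3 in s3.
have c1 : 2 * (u 0 i0 * (v 0 i0 - u 0 i0) + u 0 i1 * (v 0 i1 - u 0 i1)) =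
   - ((v 0 i0 - u 0 i0) * (v 0 i0 - u 0 i0) + (v 0 i1 - u 0 i1) * (v 0 i1 - u 0 i1)).
  by move: s1 s2; rewrite !expr2; lra.
have c2 : 2 * (u 0 i0 * (w 0 i0 - u 0 i0) + u 0 i1 * (w 0 i1 - u 0 i1)) =
   - ((w 0 i0 - u 0 i0) * (w 0 i0 - u 0 i0) + (w 0 i1 - u 0 i1) * (w 0 i1 - u 0 i1)).
  by move: s1 s3; rewrite !expr2; lra.
have [[a b]|[a b]|[a b]] := collinear_on_circle cr c1 c2.
- by apply: n12; apply: i12; apply: row3P => //; lra.
- by apply: n13; apply: i13; apply: row3P => //; lra.
- by apply: n23; apply: i23; apply: row3P => //; [lra|lra|rewrite -e2 -e3].
Qed.

(** Seen from a point [v] of a circle, the other points of the circle are linearly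
    ordered by orientation. *)
Lemma det3_trans q v a b c (s : R) : hyp q -> hyp v -> hyp a -> hyp b -> hyp c ->
  lor q v = lor q a -> lor q v = lor q b -> lor q v = lor q c -> v <> a -> v <> b -> v <> c ->
  0 < s * det3 v a b -> 0 < s * det3 v b c -> 0 < s * det3 v a c.
Proof.
move=> hq hv ha hb hc ea eb ec na nb nc ab bc.
pose m := v + (- (lor q v)^-1) *: q.
have r0 : lor q v != 0 by have := lor_ge1 hq hv; move=> h; rewrite gt_eqF//; lra.
have mE x : lor m x = lor v x - lor q x / lor q v.
  by rewrite /m lorDl lorZl mulNr mulrC.
have mv : lor m v = 0 by rewrite mE divff//; case: hv => -> _; rewrite subrr.
have pos x : hyp x -> lor q v = lor q x -> v <> x -> 0 < lor m x.
  move=> hx e nx; rewrite mE -e divff// subr_gt0 lt_neqAle lor_ge1// andbT.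
  by apply/eqP => e1; apply: nx; apply: lor_eq1; rewrite // -e1.
have pa := pos a ha ea na; have pb := pos b hb eb nb; have pc := pos c hc ec nc.
have id : lor m a * det3 v b c - lor m b * det3 v a c + lor m c * det3 v a b =
    lor m v * det3 a b c.
  by rewrite /det3 /lor; ring.
rewrite mv mul0r in id.
have : 0 < lor m b * (s * det3 v a c).
  rewrite (_ : _ * _ = lor m a * (s * det3 v b c) + lor m c * (s * det3 v a b)).
    by rewrite addr_gt0// mulr_gt0.
  by apply: subr0_eq; rewrite -[RHS](mulr0 (- s)) -id; ring.
by rewrite pmulr_rgt0.
Qed.

(** ** The orbit of the origin *)

Variables (D : 'M[R]_3 -> Prop) (eta C : R).
Hypothesis eta1 : 1 < eta.
Hypothesis D_isom : forall M, D M -> isom M.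
Hypothesis D1 : D 1%:M.
Hypothesis DM : forall M N, D M -> D N -> D (M *m N).
Hypothesis DV : forall M, D M -> D (invmx M).
Hypothesis D_free : forall M v, D M -> hyp v -> lor v (v *m M) < eta -> M = 1%:M.
Hypothesis D_dense : forall q, hyp q -> exists2 M, D M & lor q (orig *m M) <= C.
Hypothesis D_trace : forall A : mat, \det A = 1 -> D (Ad A) -> Ad A <> 1%:M ->
  (3 * C - 1) / 2 < `|\tr A|.

Definition orbit (p : space) : Prop := exists2 M, D M & orig *m M = p.

Lemma orbit_hyp p : orbit p -> hyp p.
Proof. by move=> [M dM <-]; exact: isom_hyp (D_isom dM) hyp_orig. Qed.

Lemma orbit_orig : orbit orig.
Proof. by exists 1%:M; rewrite ?mulmx1. Qed.

Lemma orbit_mul p M : D M -> orbit p -> orbit (p *m M).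
Proof. by move=> dM [N dN <-]; exists (N *m M); [exact: DM|rewrite mulmxA]. Qed.

Lemma D_eq M N : D M -> D N -> orig *m M = orig *m N -> M = N.
Proof.
move=> dM dN e; have Nu := isom_unit (D_isom dN).
suff h : M *m invmx N = 1%:M by rewrite -[M](mulmxKV Nu) h mul1mx.
apply: (@D_free _ orig); [exact: DM dM (DV dN)|exact: hyp_orig|].
by rewrite mulmxA e mulmxK// lor_orig row3E.
Qed.

Lemma orbit_sep p p' : orbit p -> orbit p' -> lor p p' < eta -> p = p'.
Proof.
move=> [M dM <-] [N dN <-] h; have iM := D_isom dM.
suff -> : M = N by [].
have Mu := isom_unit iM.
have e1 : N *m invmx M = 1%:M.
  apply: (@D_free _ orig); [exact: DM dN (DV dM)|exact: hyp_orig|].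
  by rewrite mulmxA lorC lor_invmx// lorC.
by rewrite -[N](mulmxKV Mu) e1 mul1mx.
Qed.

Lemma C_ge1 : 1 <= C.
Proof.
have [M dM h] := D_dense hyp_orig.
by apply: le_trans h; apply: lor_ge1 hyp_orig _; exact: isom_hyp (D_isom dM) hyp_orig.
Qed.

Lemma gof_ex : exists gof : space -> 'M[R]_3, forall p, orbit p -> D (gof p) /\ orig *m gof p = p.
Proof.
have /choice[f hf] : forall p, exists M, orbit p -> D M /\ orig *m M = p.
  by move=> p; have [[M dM e]|n] := pselect (orbit p); [exists M|exists 0].
by exists f.
Qed.

(** The element of the group that takes the origin to the given orbit point. *)
Definition gof := projT1 (cid gof_ex).
Lemma gofP p : orbit p -> D (gof p) /\ orig *m gof p = p.
Proof. exact: (projT2 (cid gof_ex)). Qed.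

Lemma gof_mul p M : orbit p -> D M -> gof (p *m M) = gof p *m M.
Proof.
move=> op dM; have [d1 e1] := gofP (orbit_mul dM op); have [d2 e2] := gofP op.
by apply: D_eq => //; [exact: DM|rewrite e1 mulmxA e2].
Qed.

Lemma lift_ex : exists lft : 'M[R]_3 -> mat, forall M, D M -> \det (lft M) = 1 /\ Ad (lft M) = M.
Proof.
have /choice[f hf] : forall M, exists A : mat, D M -> \det A = 1 /\ Ad A = M.
  move=> M; have [dM|n] := pselect (D M); last by exists 0.
  by have [A dA e] := Ad_surj (D_isom dM); exists A.
by exists f.
Qed.

(** Lifts to SL2, with arbitrary signs. *)
Definition lft := projT1 (cid lift_ex).
Lemma lftP M : D M -> \det (lft M) = 1 /\ Ad (lft M) = M.
Proof. exact: (projT2 (cid lift_ex)). Qed.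

Definition elt (p : space) : mat := lft (gof p).
Lemma eltP p : orbit p -> \det (elt p) = 1 /\ orig *m Ad (elt p) = p.
Proof. by move=> op; have [d e] := gofP op; have [h1 h2] := lftP d; rewrite /elt h2. Qed.

Definition ang (p p' : space) : R := angle (elt p) (elt p').

Lemma ang_mul p p' M : orbit p -> orbit p' -> D M -> ang (p *m M) (p' *m M) = ang p p'.
Proof.
move=> op op' dM; have [dL eL] := lftP dM.
have key x : orbit x -> elt (x *m M) = elt x *m lft M \/ elt (x *m M) = - (elt x *m lft M).
  move=> ox; have [d1 e1] := gofP ox; have [d2 e2] := lftP d1.
  have [d3 e3] := lftP (gofP (orbit_mul dM ox)).1.
  apply: Ad_inj => //; first by rewrite det_mulmx dL d2 mulr1.
  by rewrite AdM eL e2 e3 gof_mul.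
rewrite /ang; have [-> | ->] := key p op; have [-> | ->] := key p' op';
  by rewrite ?angleNl ?angleNr angle_mulr.
Qed.

Lemma tr_big p p' : orbit p -> orbit p' -> p <> p' -> (3 * C - 1) / 2 < `|tr2 (elt p) (elt p')|.
Proof.
move=> op op' ne; have [d1 e1] := gofP op; have [d2 e2] := lftP d1.
have [d1' e1'] := gofP op'; have [d2' e2'] := lftP d1'.
have Bu : elt p' \in unitmx by rewrite unitmxE d2' unitr1.
rewrite tr2E//; have dA : \det (elt p *m invmx (elt p')) = 1.
  by rewrite det_mulmx det_inv d2 d2' invr1 mulr1.
have AE : Ad (elt p *m invmx (elt p')) *m gof p' = gof p.
  by rewrite -{1}e2' -/(elt p') -AdM mulmxKV// e2.
have gu := isom_unit (D_isom d1').
have AE' : Ad (elt p *m invmx (elt p')) = gof p *m invmx (gof p') by rewrite -AE mulmxK.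
apply: D_trace => //; first by rewrite AE'; exact: DM d1 (DV d1').
by move=> h; apply: ne; rewrite -e1 -e1' -AE h mul1mx.
Qed.

(** If the product were negative, one could change the signs of the lifts so that
    the first two traces are positive and the third is negative; the three bounds
    [tr_big] would then add up to more than [trace_bound] allows. *)
Lemma triple_trace q p1 p2 p3 : hyp q -> orbit p1 -> orbit p2 -> orbit p3 ->
  lor q p1 <= C -> lor q p2 <= C -> lor q p3 <= C -> p1 <> p2 -> p2 <> p3 -> p3 <> p1 ->
  0 < tr2 (elt p1) (elt p2) * tr2 (elt p2) (elt p3) * tr2 (elt p3) (elt p1).
Proof.
move=> hq o1 o2 o3 q1 q2 q3 n12 n23 n31.
have t12 := tr_big o1 o2 n12; have t23 := tr_big o2 o3 n23; have t31 := tr_big o3 o1 n31.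
have [d1 e1] := eltP o1; have [d2 e2] := eltP o2; have [d3 e3] := eltP o3.
have C1 := C_ge1.
have q1' : lor q (orig *m Ad (elt p1)) <= C by rewrite e1.
have q2' : lor q (orig *m Ad (elt p2)) <= C by rewrite e2.
have q3' : lor q (orig *m Ad (elt p3)) <= C by rewrite e3.
have b1 := trace_bound d1 d2 d3 hq q1' q2' q3'.
have b2 := trace_bound d2 d3 d1 hq q2' q3' q1'.
have b3 := trace_bound d3 d1 d2 hq q3' q1' q2'.
have d2n : \det (- elt p2) = 1 by rewrite -d2 !det2 ![(- _ : mat) _ _]mxE; ring.
have q2n : lor q (orig *m Ad (- elt p2)) <= C by rewrite AdN.
have b4 := trace_bound d1 d2n d3 hq q1' q2n q3'.
rewrite tr2Nl (tr2C (elt p1)) tr2Nl (tr2C (elt p2) (elt p1)) in b4.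
clear q1 q2 q3 q1' q2' q3' q2n d1 d2 d3 d2n.
move: t12 t23 t31 b1 b2 b3 b4.
move: (tr2 (elt p1) _) (tr2 (elt p2) _) (tr2 (elt p3) _) => x y z.
case: (ger0P x) => x0; case: (ger0P y) => y0; case: (ger0P z) => z0 hx hy hz b1 b2 b3 b4; try lra.
- by rewrite !mulr_gt0//; lra.
- by rewrite -mulrA mulr_gt0 ?nmulr_rgt0//; lra.
- by rewrite mulrAC mulr_gt0 ?nmulr_rgt0//; lra.
- by rewrite mulr_gt0 ?nmulr_rgt0//; lra.
Qed.

Lemma angC p p' : ang p p' = - ang p' p.
Proof. exact: angleC. Qed.

Lemma ang_self p : ang p p = 0.
Proof. exact: angle_self. Qed.

Lemma triple_angle (s : R) q p1 p2 p3 : s = 1 \/ s = -1 -> hyp q ->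
  orbit p1 -> orbit p2 -> orbit p3 ->
  lor q p1 <= C -> lor q p2 <= C -> lor q p3 <= C -> p1 <> p2 -> p2 <> p3 -> p3 <> p1 ->
  0 < s * det3 p1 p2 p3 -> 0 < s * (ang p1 p2 + ang p2 p3 + ang p3 p1).
Proof.
have pos x1 x2 x3 : hyp q -> orbit x1 -> orbit x2 -> orbit x3 -> lor q x1 <= C -> lor q x2 <= C ->
    lor q x3 <= C -> x1 <> x2 -> x2 <> x3 -> x3 <> x1 -> 0 < det3 x1 x2 x3 ->
    0 < ang x1 x2 + ang x2 x3 + ang x3 x1.
  move=> hq o1 o2 o3 q1 q2 q3 n12 n23 n31 d.
  have [d1 e1] := eltP o1; have [d2 e2] := eltP o2; have [d3 e3] := eltP o3.
  apply: triangle_sign => //; last by rewrite e1 e2 e3.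
  exact: (triple_trace hq).
move=> [-> | ->] hq o1 o2 o3 q1 q2 q3 n12 n23 n31; first by rewrite !mul1r; exact: pos.
rewrite !mulN1r -det3_swap => d.
have := pos p1 p3 p2 hq o1 o3 o2 q1 q3 q2 (nesym n31) (nesym n23) (nesym n12) d.
by rewrite (angC p1 p3) (angC p3 p2) (angC p2 p1); lra.
Qed.

(** ** Nearest orbit points *)

(** Two orbit points with the same first coordinates up to [dl] coincide, so a
    ball contains at most one orbit point per cell of a grid. *)
Lemma orbit_finite K : exists s : seq space, forall p, p \in s <-> (orbit p /\ lor orig p <= K).
Proof.
have e1 := eta1; pose dl := Num.sqrt ((eta - 1) / 2).
have dl0 : 0 < dl by rewrite sqrtr_gt0; lra.
have dl2 : dl ^+ 2 = (eta - 1) / 2 by rewrite sqr_sqrtr//; lra.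
pose S p := orbit p /\ lor orig p <= K.
pose L := `|K| + 1.
have Sb p i : S p -> i = i0 \/ i = i1 -> 0 <= (p 0 i + L) / dl < (2 * L) / dl + 1.
  move=> [op pK] ii; have hp := orbit_hyp op; rewrite lor_orig in pK.
  have sp := hyp_sq hp; have [_ p2] := hp.
  have b : p 0 i ^+ 2 < L ^+ 2.
    have : p 0 i2 ^+ 2 <= `|K| ^+ 2.
      by rewrite lerXn2r ?nnegrE//; [lra|apply: le_trans pK (ler_norm _)].
    rewrite sp /L; have := sqr_ge0 (p 0 i0); have := sqr_ge0 (p 0 i1); have := normr_ge0 K.
    by case: ii => ->; rewrite !expr2; nra.
  have L0 : 0 < L by rewrite /L ltr_wpDl.
  have /andP[b1 b2] : - L < p 0 i < L.
    by rewrite -ltr_norml -(@ltr_pXn2r _ 2) ?nnegrE// ?real_normK ?num_real// ltW.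
  rewrite divr_ge0 ?(ltW dl0)//=; last by lra.
  by rewrite ltr_wpDr// ltr_pM2r ?invr_gt0//; lra.
pose n := (Num.truncn ((2 * L) / dl + 1)).+1.
pose cell (p : space) : nat * nat := (Num.truncn ((p 0 i0 + L) / dl), Num.truncn ((p 0 i1 + L) / dl)).
have cell_eq p p' : S p -> S p' -> cell p = cell p' -> p = p'.
  move=> Sp Sp' [c0 c1]; have [op _] := Sp; have [op' _] := Sp'.
  apply: orbit_sep => //.
  have near i : i = i0 \/ i = i1 -> Num.truncn ((p 0 i + L) / dl) = Num.truncn ((p' 0 i + L) / dl) ->
      (p 0 i - p' 0 i) ^+ 2 <= dl ^+ 2.
    move=> ii e; have /andP[b0 _] := Sb p i Sp ii; have /andP[b0' _] := Sb p' i Sp' ii.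
    have /andP[h1 h2] := truncn_itv b0; have /andP[h1' h2'] := truncn_itv b0'.
    rewrite -e in h1' h2'; move: h1 h2 h1' h2'; rewrite -!natr1 !ler_pdivlMr// !ltr_pdivrMr//.
    move: (_%:R) => m h1 h2 h1' h2'.
    rewrite -(real_normK (num_real (_ - _))) lerXn2r ?nnegrE// ?ltW//.
    by rewrite ltr_norml; apply/andP; split; lra.
  have d0 := near i0 (or_introl erefl) c0; have d1 := near i1 (or_intror erefl) c1.
  have [h _] := orbit_hyp op; have [h' _] := orbit_hyp op'.
  have := sqr_ge0 (p 0 i2 - p' 0 i2).
  by move: h h' d0 d1; rewrite dl2 /lor !expr2; lra.
have /choice[f hf] : forall c : nat * nat, exists p, (exists2 p', S p' & cell p' = c) ->
    S p /\ cell p = c.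
  by move=> c; have [[p Sp e]|nn] := pselect (exists2 p', S p' & cell p' = c); [exists p|exists 0].
pose s := [seq f (i, j) | i <- iota 0 n, j <- iota 0 n].
exists [seq p <- s | `[< S p >]] => p; rewrite mem_filter; split=> [/andP[/asboolP//]|Sp].
apply/andP; split; first exact/asboolP.
have [Sf cf] := hf (cell p) (ex_intro2 _ _ p Sp erefl).
have -> : p = f (cell p) by apply: cell_eq.
have lt i : i = i0 \/ i = i1 -> Num.truncn ((p 0 i + L) / dl) \in iota 0 n.
  move=> ii; have /andP[b0 b1] := Sb p i Sp ii; rewrite mem_iota /= add0n ltnS.
  by apply: le_truncn; exact: ltW.
by apply/allpairsP; exists (cell p); split; [apply: lt; left|apply: lt; right|rewrite -surjective_pairing].
Qed.

Definition nearest (q p : space) : Prop := orbit p /\ forall p', orbit p' -> lor q p <= lor q p'.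

Lemma nearest_le q p : hyp q -> nearest q p -> lor q p <= C.
Proof.
by move=> hq [op h]; have [M dM le] := D_dense hq; apply: le_trans le; apply: h; exists M.
Qed.

Lemma nearest_eq q p p' : nearest q p -> nearest q p' -> lor q p = lor q p'.
Proof. by move=> [op h] [op' h']; apply/le_anti; rewrite h ?h'. Qed.

Lemma nearest_mul q p M : D M -> nearest q p -> nearest (q *m M) (p *m M).
Proof.
move=> dM [op h]; split; first exact: orbit_mul.
move=> p' op'; have iM := D_isom dM; rewrite isom_lor// -(mulmxKV (isom_unit iM) p') isom_lor//.
by apply: h; exact: orbit_mul (DV dM) op'.
Qed.

Lemma nearest_list q : hyp q -> exists s : seq space, uniq s /\ forall p, p \in s <-> nearest q p.
Proof.
move=> hq; pose k := Num.max (lor orig q) C.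
have [s hs] := orbit_finite (2 * k ^+ 2 - 1).
exists (undup [seq p <- s | `[< nearest q p >]]); split; first exact: undup_uniq.
move=> p; rewrite mem_undup mem_filter; split=> [/andP[/asboolP//]|np].
apply/andP; split; first exact/asboolP.
have [op _] := np; apply/hs; split=> //.
apply: (lor_double hyp_orig hq (orbit_hyp op)); first by rewrite le_max lexx.
by rewrite le_max (nearest_le hq np) orbT.
Qed.

(** ** Successors on the circle of nearest points *)

(** The nearest orbit points of [q] lie on a circle about [q]; [w] follows [v] on
    it, in the direction given by the sign [s]. *)
Definition succ (s : R) (q v w : space) : Prop :=
  [/\ nearest q w, w <> v & forall k, nearest q k -> k <> v -> k <> w -> 0 < s * det3 v w k].

(** The linear order [det3_trans] on a finite set has a least element. *)
Lemma succ_exists s q v : s = 1 \/ s = -1 -> hyp q -> nearest q v ->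
  (exists2 w, nearest q w & w <> v) -> exists w, succ s q v w.
Proof.
move=> s1 hq nv [w0 nw0 ne0].
have [l [_ hl]] := nearest_list hq.
pose l' := [seq p <- l | p != v].
have hl' p : p \in l' <-> nearest q p /\ p <> v.
  rewrite mem_filter; split=> [/andP[/eqP ? /hl//]|[/hl ? /eqP ?]]; exact/andP.
have s0 : s != 0 by case: s1 => ->; rewrite ?oppr_eq0 oner_neq0.
have hp p : nearest q p -> hyp p by move=> [/orbit_hyp].
have key (m : seq space) : m != [::] -> (forall p, p \in m -> nearest q p /\ p <> v) ->
    exists w, w \in m /\ forall k, k \in m -> k <> w -> 0 < s * det3 v w k.
  elim: m => // a m IH _ hm; have [na av] := hm a (mem_head _ _).
  have [m0|m0] := eqVneq m [::].
    by exists a; rewrite mem_head; split=> // k; rewrite m0 inE => /eqP.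
  have [|w [wm hw]] := IH m0; first by move=> p pm; apply: hm; rewrite inE pm orbT.
  have [nw wv] : nearest q w /\ w <> v by apply: hm; rewrite inE wm orbT.
  have [aw|/eqP aw] := eqVneq a w.
    exists w; rewrite inE wm orbT; split=> // k; rewrite inE => /orP[/eqP->|km] kw; last exact: hw.
    by case: kw.
  have dn : s * det3 v w a != 0.
    by rewrite mulf_neq0// (det_circle hq (hp _ nv) (hp _ nw) (hp _ na))//;
      [exact: nearest_eq|exact: nearest_eq|exact: nesym|exact: nesym|exact: nesym].
  have [pos|neg] := ltP 0 (s * det3 v w a).
    exists w; rewrite inE wm orbT; split=> // k; rewrite inE => /orP[/eqP-> //|km] kw; exact: hw.
  have {}neg : 0 < s * det3 v a w.
    by rewrite det3_swap mulrN oppr_gt0 lt_neqAle dn.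
  exists a; rewrite mem_head; split=> // k; rewrite inE => /orP[/eqP-> //|km] ka.
  have [->//|/eqP kw] := eqVneq k w.
  have [nk kv] : nearest q k /\ k <> v by apply: hm; rewrite inE km orbT.
  by apply: (det3_trans hq (hp _ nv) (hp _ na) (hp _ nw) (hp _ nk)) neg (hw _ km kw);
    (exact: nearest_eq || exact: nesym).
have [|p|w [wl hw]] := key l'.
- by apply/eqP => e; have : w0 \in l' by [apply/hl']; rewrite e.
- by move/hl'.
- exists w; have [nw wv] := (hl' w).1 wl; split=> // k nk kv kw; apply: hw => //; exact/hl'.
Qed.

Lemma succ_unique s q v w w' : succ s q v w -> succ s q v w' -> w = w'.
Proof.
move=> [nw wv h] [nw' wv' h']; have [//|/eqP ne] := eqVneq w w'.
exfalso; have := h w' nw' wv' (nesym ne); have := h' w nw wv ne.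
by rewrite det3_swap; lra.
Qed.

Lemma succ_mul s q v w M : D M -> succ s q v w -> succ s (q *m M) (v *m M) (w *m M).
Proof.
move=> dM [nw wv h]; have iM := D_isom dM; have Mu := isom_unit iM; have [_ dt _] := iM.
have inj (x y : space) : x *m M = y *m M -> x = y.
  by move=> /(congr1 (mulmx^~ (invmx M))); rewrite !mulmxK.
split; [exact: nearest_mul|by move=> /inj|].
move=> k nk kv kw; have nk' := nearest_mul (DV dM) nk; rewrite mulmxK// in nk'.
have hh := h _ nk'.
have -> : det3 (v *m M) (w *m M) k = det3 v w (k *m invmx M) * \det M.
  by rewrite -det3_isom mulmxKV.
rewrite mulrA mulr_gt0//; apply: hh => e; [apply: kv|apply: kw]; by rewrite -e mulmxKV.
Qed.

(** ** Edges of the Voronoi tessellation *)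

Definition edge_normal (w : space) : space := row3 (w 0 i1) (- w 0 i0) 0.

Lemma lor_edge_normal w x : lor (edge_normal w) x = det3 orig w x.
Proof. by rewrite /lor /det3 !row3E; ring. Qed.

Lemma seq_min (T : eqType) (f : T -> R) (l : seq T) : l != [::] ->
  exists2 p, p \in l & forall p', p' \in l -> f p <= f p'.
Proof.
elim: l => // a l IH _; have [->|l0] := eqVneq l [::].
  by exists a; [exact: mem_head|move=> p'; rewrite inE => /eqP->].
have [p pl hp] := IH l0; have [ap|pa] := leP (f a) (f p).
  exists a; first exact: mem_head.
  by move=> p'; rewrite inE => /orP[/eqP->//|/hp]; exact: le_trans.
exists p; first by rewrite inE pl orbT.
by move=> p'; rewrite inE => /orP[/eqP->|/hp//]; exact: ltW.
Qed.

(** The points equidistant from the origin and [w] form the line [q + t n]. Moving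
    along it away from the other nearest points of [q], one reaches the first
    point that has a new nearest orbit point; such a point exists because the
    orbit is dense at scale [C]. *)
Lemma edge q w : hyp q -> nearest q orig -> nearest q w -> w <> orig ->
  (forall k, nearest q k -> k <> orig -> k <> w -> 0 < det3 orig w k) ->
  exists q', [/\ hyp q', nearest q' orig, succ (-1) q' orig w,
    (exists k, [/\ nearest q' k, k <> orig & k <> w]) &
    exists a t, [/\ 0 < a, 0 < t & q' = a *: (q + t *: edge_normal w)]].
Proof.
move=> hq no nw wo side; set n := edge_normal w.
have hw : hyp w by case: nw => /orbit_hyp.
have C1 := C_ge1; have sw := hyp_sq hw.
have nn : lor n n = - (w 0 i0 ^+ 2 + w 0 i1 ^+ 2) by rewrite /lor !row3E !expr2; ring.
have a0 : 0 < - lor n n.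
  rewrite nn opprK; have : 1 < w 0 i2.
    rewrite lt_neqAle hyp_pos// andbT; apply/eqP => e; apply: wo.
    by apply: lor_eq1 => //; [exact: hyp_orig|rewrite lorC lor_orig -e].
  by move: sw; rewrite !expr2; nra.
have lno : lor n orig = 0 by rewrite lorC lor_orig row3E.
have lnw : lor n w = 0 by rewrite lor_edge_normal /det3; ring.
set z := q 0 i2; have z1 : 1 <= z by exact: hyp_pos.
have qo : lor q orig = z by rewrite lorC lor_orig.
pose x (t : R) := q + t *: n.
have xo t : lor (x t) orig = z by rewrite /x lorDl lorZl lno mulr0 addr0.
have xw t : lor (x t) w = z by rewrite /x lorDl lorZl lnw mulr0 addr0 (nearest_eq nw no).
have xk t k : lor (x t) k = lor q k + t * lor n k by rewrite /x lorDl lorZl.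
have x2 t : (x t) 0 i2 = z by rewrite /x !vecE row3E mulr0 addr0.
pose a := - lor n n; pose b := lor q n.
have xx t : lor (x t) (x t) = 1 + 2 * b * t - a * t ^+ 2.
  rewrite /x !lorDl !lorDr !lorZl !lorZr (lorC n q) -/b /a; case: (hq) => -> _; ring.
pose eps := (2 * C ^+ 2)^-1.
have C2 : 1 <= C ^+ 2 by rewrite expr2; nra.
have ep0 : 0 < eps by rewrite invr_gt0; lra.
have ep1 : eps < 1 by rewrite invf_lt1; lra.
have epC : eps * C ^+ 2 < 1.
  by rewrite /eps invfM -mulrA mulVf ?gt_eqF//; lra.
pose t1 := (b + Num.sqrt (b ^+ 2 + a * (1 - eps))) / a.
have sq : b ^+ 2 < b ^+ 2 + a * (1 - eps) by rewrite ltrDl mulr_gt0// subr_gt0.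
have sb : `|b| < Num.sqrt (b ^+ 2 + a * (1 - eps)).
  by rewrite -sqrtr_sqr ltr_sqrt// (le_lt_trans (sqr_ge0 b)).
have t10 : 0 < t1.
  by rewrite divr_gt0//; have := ler_norm (- b); rewrite normrN; lra.
have t1E : 1 + 2 * b * t1 - a * t1 ^+ 2 = eps.
  have sE := sqr_sqrtr (ltW (le_lt_trans (sqr_ge0 b) sq)).
  have an : a != 0 by rewrite gt_eqF.
  rewrite /t1; move: (Num.sqrt _) sE => r sE.
  have -> : 1 + 2 * b * ((b + r) / a) - a * ((b + r) / a) ^+ 2 = 1 + (b ^+ 2 - r ^+ 2) / a by field.
  by rewrite sE; field.
have conc t : 0 <= t <= t1 -> eps <= lor (x t) (x t).
  move=> /andP[h0 h1]; rewrite xx -subr_ge0.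
  have -> : 1 + 2 * b * t - a * t ^+ 2 - eps = (t1 - t) * ((1 - eps) / t1 + a * t).
    have t1n : t1 != 0 by rewrite gt_eqF.
    have -> : (1 - eps) / t1 = a * t1 - 2 * b.
      by apply: (mulIf t1n); rewrite divfK//; move: t1E; rewrite !expr2; lra.
    have -> : eps = 1 + 2 * b * t1 - a * t1 ^+ 2 by [].
    ring.
  have f1 : 0 <= (1 - eps) / t1 by apply: divr_ge0; lra.
  have f2 : 0 <= a * t by apply: mulr_ge0 => //; exact: ltW.
  by apply: mulr_ge0; [lra|exact: addr_ge0].
pose N t := Num.sqrt (lor (x t) (x t)).
have Np t : 0 <= t <= t1 -> 0 < N t.
  by move=> /conc h; rewrite sqrtr_gt0; lra.
have hx t : 0 <= t <= t1 -> hyp ((N t)^-1 *: x t).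
  by move=> tI; apply: hyp_scale; [have := conc _ tI; lra|rewrite x2; lra].
(* some orbit point is closer to the end of the segment than the origin is *)
have t1I : 0 <= t1 <= t1 by rewrite lexx ltW.
have [p0 op0 [np0 rp0]] : exists2 p0, orbit p0 & lor n p0 < 0 /\ lor q p0 - z < t1 * - lor n p0.
  have [M dM h] := D_dense (hx _ t1I); exists (orig *m M); first by exists M.
  move: h; rewrite lorZl ler_pdivrMl ?Np// => h.
  have NC : N t1 * C < z.
    apply: lt_le_trans z1; rewrite -(@ltr_pXn2r _ 2) ?nnegrE ?mulr_ge0 ?sqrtr_ge0//; last by lra.
    by rewrite exprMn sqr_sqrtr ?xx ?t1E ?expr1n// ltW.
  rewrite xk in h; have oo : orbit (orig *m M) by exists M.
  have := no.2 _ oo; rewrite qo => le.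
  by split; [nra|nra].
clear sq sb epC t1E C2 ep1.
pose K := z / Num.sqrt eps; pose r (p : space) := (lor q p - z) / - lor n p.
have [s0 hs0] := orbit_finite (2 * K ^+ 2 - 1).
pose l := [seq p <- s0 | (lor n p < 0) && (r p <= t1)].
have rge p : orbit p -> lor n p < 0 -> 0 <= r p.
  move=> op np; rewrite divr_ge0//; last by lra.
  by rewrite subr_ge0 -qo; exact: no.2.
have lP p : orbit p -> lor n p < 0 -> r p <= t1 -> p \in l.
  move=> op np rp; rewrite mem_filter np rp /=; apply/hs0; split=> //.
  have rI : 0 <= r p <= t1 by rewrite rge.
  have hp := orbit_hyp op.
  have xp : lor (x (r p)) p = z.
    by rewrite xk /r -[lor n p in X in _ + X]opprK mulrN mulrC; field; rewrite lt_eqF.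
  have bound v : lor (x (r p)) v = z -> lor ((N (r p))^-1 *: x (r p)) v <= K.
    move=> e; rewrite lorZl e mulrC /K ler_pM2l; last by lra.
    by rewrite lef_pV2 ?posrE ?sqrtr_gt0 ?ler_sqrt//; have := conc _ rI; lra.
  apply: (lor_double hyp_orig (hx _ rI) hp); last exact: bound.
  by rewrite lorC; apply: bound; exact: xo.
have l0 : l != [::].
  have p0l : p0 \in l by apply: lP => //; rewrite /r ler_pdivrMr//; lra.
  by apply/eqP => l0; rewrite l0 in p0l.
have [p pl pmin] := seq_min r l0.
move: (pl); rewrite mem_filter => /andP[/andP[np rp] /hs0[op _]].
have po : p <> orig by move=> e; move: np; rewrite e lno ltxx.
have pw : p <> w by move=> e; move: np; rewrite e lnw ltxx.
set t := r p in rp pmin.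
have t0 : 0 < t.
  rewrite lt_neqAle rge// andbT; apply/eqP => e.
  have e' : lor q p = z.
    move/esym/eqP: e; rewrite /t /r mulf_eq0 invr_eq0 oppr_eq0 (lt_eqF np) orbF subr_eq0.
    by move/eqP.
  have npq : nearest q p by split=> // p' op'; rewrite e' -qo; exact: no.2.
  by have := side p npq po pw; rewrite -lor_edge_normal -/n; lra.
have tI : 0 <= t <= t1 by rewrite ltW.
have xmin k : orbit k -> z <= lor (x t) k.
  move=> ok; rewrite xk; have := no.2 k ok; rewrite qo => le.
  have [nk|nk] := leP 0 (lor n k); first by have : 0 <= t * lor n k by [rewrite mulr_ge0// ltW]; lra.
  have tr : t <= r k.
    have [rk|rk] := leP (r k) t1; first exact/pmin/lP.
    exact: le_trans rp (ltW rk).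
  by move: tr; rewrite /r ler_pdivlMr; lra.
pose q' := (N t)^-1 *: x t.
have hq' : hyp q' by exact: hx.
have Ni : 0 < (N t)^-1 by rewrite invr_gt0 Np.
have near k : orbit k -> lor (x t) k = z -> nearest q' k.
  by move=> ok e; split=> // k' ok'; rewrite !lorZl e ler_pM2l// xmin.
have near_inv k : nearest q' k -> lor (x t) k = z.
  move=> [ok h]; have := h _ orbit_orig; rewrite !lorZl ler_pM2l// xo => le.
  by apply/le_anti; rewrite le xmin.
have no' : nearest q' orig by apply: near; [exact: orbit_orig|exact: xo].
have nw' : nearest q' w by apply: near; [by case: nw|exact: xw].
exists q'; split=> //.
- split=> // k nk ko kw; have ok : orbit k by case: nk.
  have := near_inv k nk; rewrite xk => e; have := no.2 k ok; rewrite qo => le.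
  have d0 : det3 orig w k != 0.
    apply: (det_circle hq' hyp_orig hw (orbit_hyp ok)); try exact: nearest_eq.
    - exact: nesym.
    - exact: nesym.
    - exact: nesym.
  rewrite mulN1r oppr_gt0 lt_neqAle d0 -lor_edge_normal -/n /=.
  have : t * lor n k <= 0 by lra.
  by rewrite pmulr_rle0.
- exists p; split=> //; apply: near => //; rewrite xk /t /r.
  by field; rewrite lt_eqF.
- by exists (N t)^-1, t.
Qed.

(** ** Summing angles over the vertices *)

Definition three (q : space) : Prop := exists a b c,
  [/\ nearest q a, nearest q b, nearest q c & [/\ a <> b, b <> c & c <> a]].

(** The corners of the Voronoi cell of the origin. *)
Definition vertex (q : space) : Prop := [/\ hyp q, nearest q orig & three q].

Lemma three_mul q M : D M -> three q -> three (q *m M).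
Proof.
move=> dM [a [b [c [na nb nc [ab bc ca]]]]]; have Mu := isom_unit (D_isom dM).
have inj (x y : space) : x *m M = y *m M -> x = y.
  by move=> /(congr1 (mulmx^~ (invmx M))); rewrite !mulmxK.
exists (a *m M), (b *m M), (c *m M); split; [exact: nearest_mul|exact: nearest_mul|exact: nearest_mul|].
by split=> /inj.
Qed.

Lemma three_others q v : three q -> exists x y,
  [/\ nearest q x, nearest q y & [/\ x <> v, y <> v & x <> y]].
Proof.
move=> [a [b [c [na nb nc [ab bc ca]]]]].
have [av|/eqP av] := eqVneq a v; first by exists b, c; rewrite -av; split=> //; split=> //; exact: nesym.
have [bv|/eqP bv] := eqVneq b v; first by exists a, c; rewrite -bv; split=> //; split=> //; exact: nesym.
by exists a, b.
Qed.

Lemma circumcenter_unique q q' v w : hyp q -> hyp q' -> lor q orig = lor q v -> lor q orig = lor q w ->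
  lor q' orig = lor q' v -> lor q' orig = lor q' w -> det3 orig v w != 0 -> q = q'.
Proof.
move=> hq hq' ev ew ev' ew' dn; have z1 := hyp_pos hq; have z1' := hyp_pos hq'.
pose r := q 0 i2 / q' 0 i2; have r0 : 0 < r by rewrite divr_gt0//; lra.
pose u := q + (- r) *: q'.
have u2 : u 0 i2 = 0 by rewrite /u /r !vecE; field; rewrite gt_eqF//; lra.
have uo : lor u orig = 0 by rewrite lorC lor_orig.
have uv : lor u v = 0 by rewrite -uo /u !lorDl !lorZl ev ev'.
have uw : lor u w = 0 by rewrite -uo /u !lorDl !lorZl ew ew'.
have dd : v 0 i0 * w 0 i1 - v 0 i1 * w 0 i0 != 0.
  by move: dn; rewrite /det3 !row3E !mul0r subr0 add0r mul1r.
rewrite /lor u2 !mul0r in uv uw.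
have u0 : u 0 i0 = 0.
  apply: (mulfI dd); rewrite mulr0.
  transitivity (w 0 i1 * (u 0 i0 * v 0 i0 + u 0 i1 * v 0 i1) - v 0 i1 * (u 0 i0 * w 0 i0 + u 0 i1 * w 0 i1)).
    by ring.
  by rewrite (_ : u 0 i0 * v 0 i0 + u 0 i1 * v 0 i1 = 0) 1?(_ : u 0 i0 * w 0 i0 + u 0 i1 * w 0 i1 = 0);
    [ring|lra|lra].
have u1 : u 0 i1 = 0.
  apply: (mulfI dd); rewrite mulr0.
  transitivity (v 0 i0 * (u 0 i0 * w 0 i0 + u 0 i1 * w 0 i1) - w 0 i0 * (u 0 i0 * v 0 i0 + u 0 i1 * v 0 i1)).
    by ring.
  by rewrite (_ : u 0 i0 * v 0 i0 + u 0 i1 * v 0 i1 = 0) 1?(_ : u 0 i0 * w 0 i0 + u 0 i1 * w 0 i1 = 0);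
    [ring|lra|lra].
have e : q = r *: q'.
  apply: subr0_eq; rewrite -scaleNr -/u; apply: row3P; rewrite ?u0 ?u1 ?u2 mxE //.
have rr : r ^+ 2 = 1.
  have := hq.1; rewrite e lorZl lorZr; case: (hq') => -> _; rewrite mulr1 -expr2 //.
have r1 : r = 1.
  by move/eqP: rr; rewrite sqrf_eq1 => /orP[/eqP//|/eqP r1]; move: r0; rewrite r1; lra.
by rewrite e r1 scale1r.
Qed.

Lemma vertex_list : exists s : seq space, uniq s /\ forall q, q \in s <-> vertex q.
Proof.
have [L hL] := orbit_finite (2 * C ^+ 2 - 1).
pose P q (vw : space * space) := [/\ vertex q, nearest q vw.1, nearest q vw.2 &
  [/\ vw.1 <> orig, vw.2 <> orig & vw.1 <> vw.2]].
have /choice[f hf] : forall vw, exists q, (exists q', P q' vw) -> P q vw.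
  by move=> vw; have [[q h]|nn] := pselect (exists q', P q' vw); [exists q|exists 0].
exists (undup [seq q <- [seq f (v, w) | v <- L, w <- L] | `[< vertex q >]]).
split; first exact: undup_uniq.
move=> q; rewrite mem_undup mem_filter; split=> [/andP[/asboolP//]|vq].
apply/andP; split; first exact/asboolP.
have [hq no t3] := vq; have [v [w [nv nw [vo wo vw]]]] := three_others orig t3.
have Pq : P q (v, w) by [].
have [[hq' no' _] nv' nw' _] := hf (v, w) (ex_intro _ q Pq).
have inL p : nearest q p -> p \in L.
  move=> np; have [op _] := np; apply/hL; split=> //.
  apply: (lor_double hyp_orig hq (orbit_hyp op)); last exact: nearest_le.
  by rewrite lorC; exact: nearest_le.
have hv : hyp v by case: nv => /orbit_hyp. have hw : hyp w by case: nw => /orbit_hyp.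
have -> : q = f (v, w).
  apply: (circumcenter_unique (v := v) (w := w) hq hq'); try exact: nearest_eq.
  apply: (det_circle hq hyp_orig hv hw) => //; try exact: nearest_eq.
  - exact: nesym.
  - exact: nesym.
by apply/allpairsP; exists (v, w); split=> //; exact: inL.
Qed.

Lemma perm_injection (T : eqType) (f : T -> T) (l : seq T) : uniq l ->
  (forall x, x \in l -> f x \in l) -> {in l &, injective f} -> perm_eq (map f l) l.
Proof.
move=> ul fl inj; have um : uniq (map f l) by rewrite map_inj_in_uniq.
have sub : {subset map f l <= l} by move=> y /mapP[x xl ->]; exact: fl.
apply: uniq_perm => //.
by have [_ h] := uniq_min_size um sub (eq_leq (esym (size_map f l))); exact: h.
Qed.

Lemma sum_injection (T : eqType) (f : T -> T) (F : T -> R) (l : seq T) : uniq l ->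
  (forall x, x \in l -> f x \in l) -> {in l &, injective f} ->
  \sum_(x <- l) F (f x) = \sum_(x <- l) F x.
Proof.
by move=> ul fl inj; rewrite -[RHS](perm_big _ (perm_injection ul fl inj)) big_map.
Qed.

Lemma nearest_list_ex : exists nl : space -> seq space, forall q, hyp q ->
  uniq (nl q) /\ forall p, p \in nl q <-> nearest q p.
Proof.
have /choice[f hf] : forall q, exists l : seq space, hyp q -> uniq l /\ forall p, p \in l <-> nearest q p.
  move=> q; have [hq|nn] := pselect (hyp q); last by exists [::].
  by have [l hl] := nearest_list hq; exists l.
by exists f.
Qed.
(** The list of the nearest orbit points of a point of the hyperboloid. *)
Definition nl := projT1 (cid nearest_list_ex).
Lemma nl_uniq q : hyp q -> uniq (nl q).
Proof. by move=> /(projT2 (cid nearest_list_ex)) []. Qed.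
Lemma nlP q p : hyp q -> p \in nl q <-> nearest q p.
Proof. by move=> /(projT2 (cid nearest_list_ex)) []. Qed.

Lemma succ_ex s : exists sc : space -> space -> space, forall q v, (exists w, succ s q v w) ->
  succ s q v (sc q v).
Proof.
have /choice[f hf] : forall qv, exists w, (exists w', succ s qv.1 qv.2 w') -> succ s qv.1 qv.2 w.
  by move=> qv; have [[w h]|nn] := pselect (exists w', succ s qv.1 qv.2 w'); [exists w|exists 0].
by exists (fun q v => f (q, v)) => q v h; exact: (hf (q, v)).
Qed.
Definition sc s := projT1 (cid (succ_ex s)).

Lemma scP s q v : s = 1 \/ s = -1 -> hyp q -> three q -> nearest q v -> succ s q v (sc s q v).
Proof.
move=> s1 hq t3 nv; apply: (projT2 (cid (succ_ex s))); apply: succ_exists => //.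
by have [x [_ [nx _ [xv _ _]]]] := three_others v t3; exists x.
Qed.

(** The angles around a polygon of nearest points add up to those of the
    triangles from one of its corners. *)
Lemma polygon_angle s q : s = 1 \/ s = -1 -> vertex q ->
  0 < s * \sum_(v <- nl q) ang v (sc s q v).
Proof.
move=> s1 [hq no t3]; set l := nl q; have ul : uniq l := nl_uniq hq.
have lP p : p \in l <-> nearest q p := nlP p hq.
have sP v : v \in l -> succ s q v (sc s q v) by move=> /lP; exact: scP.
have scl v : v \in l -> sc s q v \in l by move=> /sP[nw _ _]; exact/lP.
have inj : {in l &, injective (sc s q)}.
  move=> v v' vl vl' e; have [nw wv h] := sP v vl; have [nw' wv' h'] := sP v' vl'.
  have [//|/eqP ne] := eqVneq v v'; exfalso.
  rewrite -e in wv' h'.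
  have a1 := h v' ((lP _).1 vl') (nesym ne) (nesym wv').
  have a2 := h' v ((lP _).1 vl) ne (nesym wv).
  have e3 : det3 v' (sc s q v) v = - det3 v (sc s q v) v' by rewrite /det3; ring.
  by move: a2; rewrite e3; lra.
have -> : \sum_(v <- l) ang v (sc s q v) =
    \sum_(v <- l) (ang v (sc s q v) + ang (sc s q v) orig + ang orig v).
  rewrite !big_split /= (sum_injection (fun x => ang x orig) ul scl inj) -addrA -big_split /=.
  by rewrite [X in _ + X]big1 ?addr0// => v _; rewrite angC addNr.
rewrite mulr_sumr.
have term v : v \in l -> 0 <= s * (ang v (sc s q v) + ang (sc s q v) orig + ang orig v) /\
    (v <> orig -> sc s q v <> orig -> 0 < s * (ang v (sc s q v) + ang (sc s q v) orig + ang orig v)).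
  move=> vl; have [nw wv h] := sP v vl; have nv := (lP v).1 vl.
  have pos : v <> orig -> sc s q v <> orig ->
      0 < s * (ang v (sc s q v) + ang (sc s q v) orig + ang orig v).
    move=> vo wo; apply: (triple_angle s1 hq); try exact: nearest_le.
    - by case: nv.
    - by case: nw.
    - exact: orbit_orig.
    - exact: nesym.
    - exact: wo.
    - exact: nesym.
    - by apply: h => //; exact: nesym.
  split=> //; have [vo|/eqP vo] := eqVneq v orig.
    by rewrite vo ang_self addr0 (angC orig) addNr mulr0.
  have [wo|/eqP wo] := eqVneq (sc s q v) orig; last exact: ltW (pos vo wo).
  by rewrite wo ang_self addr0 (angC orig) subrr mulr0.
have [v vl [vo wo]] : exists2 v, v \in l & v <> orig /\ sc s q v <> orig.
  have [x [y [nx ny [xo yo xy]]]] := three_others orig t3.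
  have xl : x \in l by apply/lP. have yl : y \in l by apply/lP.
  have [e|/eqP ne] := eqVneq (sc s q x) orig; last by exists x.
  exists y => //; split=> // e'; apply: xy; apply: inj => //; by rewrite e e'.
rewrite (bigD1_seq v) //=; apply: ltr_pwDl; first by have [_ p] := term v vl; exact: p.
by rewrite big_seq_cond; apply: sumr_ge0 => x /andP[xl _]; have [] := term x xl.
Qed.

Lemma vertex_mul q v : vertex q -> nearest q v -> vertex (q *m invmx (gof v)).
Proof.
move=> [hq no t3] nv; have ov := nv.1; have [dg eg] := gofP ov; have dV := DV dg.
split; [exact: isom_hyp (D_isom dV) hq| |exact: three_mul].
have := nearest_mul dV nv; rewrite -{2}eg mulmxK//; exact: isom_unit (D_isom dg).
Qed.

Lemma size_nl_mul q M : hyp q -> D M -> size (nl (q *m M)) = size (nl q).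
Proof.
move=> hq dM; have iM := D_isom dM; have Mu := isom_unit iM; have hqM := isom_hyp iM hq.
have inj : injective (fun v : space => v *m M).
  by move=> x y /(congr1 (mulmx^~ (invmx M))); rewrite !mulmxK.
have : perm_eq (map (fun v : space => v *m M) (nl q)) (nl (q *m M)).
  apply: uniq_perm; [by rewrite map_inj_uniq//; exact: nl_uniq|exact: nl_uniq|].
  move=> p; apply/idP/idP => [/mapP[v vq ->]|/(nlP _ hqM) np].
    by apply/(nlP _ hqM); apply: nearest_mul => //; exact/(nlP _ hq).
  apply/mapP; exists (p *m invmx M); last by rewrite mulmxKV.
  by apply/(nlP _ hq); have := nearest_mul (DV dM) np; rewrite mulmxK.
by move=> /perm_size; rewrite size_map.
Qed.

(** Summing over the vertices adjacent to the origin amounts to summing over all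
    corners of the polygons: exchange the roles of the origin and of the corner by
    moving the corner to the origin. *)
Lemma mass_transport s (VL : seq space) : s = 1 \/ s = -1 -> uniq VL ->
  (forall q, q \in VL <-> vertex q) ->
  \sum_(q <- VL) ang orig (sc s q orig) =
  \sum_(q <- VL) (size (nl q))%:R^-1 * \sum_(v <- nl q) ang v (sc s q v).
Proof.
move=> s1 uV hV.
pose W : seq (space * space) := [seq (q, v) | q <- VL, v <- nl q].
have hW x : x \in W <-> vertex x.1 /\ nearest x.1 x.2.
  case: x => q v; split=> [/allpairsPdep[q' [v' [q'V v'n [-> ->]]]]|[vq nv]].
    have vq := (hV q').1 q'V; split=> //=; apply/nlP => //; by case: vq.
  apply/allpairsPdep; exists q, v; split=> //; first exact/hV.
  by apply/nlP => //; case: vq.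
have uW : uniq W.
  apply: allpairs_uniq_dep => //; first by move=> q /hV[hq _ _]; exact: nl_uniq.
  by move=> [? ?] [? ?] _ _ /= [-> ->].
pose ph (x : space * space) := (x.1 *m invmx (gof x.2), orig *m invmx (gof x.2)).
have phW x : x \in W -> ph x \in W.
  move=> /hW[vq nv]; apply/hW; split; first exact: vertex_mul.
  by apply: nearest_mul; [exact: DV (gofP nv.1).1|case: vq].
have go : gof orig = 1%:M.
  by have [d e] := gofP orbit_orig; apply: D_eq => //; rewrite e mulmx1.
have phK x : x \in W -> ph (ph x) = x.
  move=> /hW[vq nv]; have [dg eg] := gofP nv.1; have gu := isom_unit (D_isom dg).
  have e : gof (orig *m invmx (gof x.2)) = invmx (gof x.2).
    by rewrite gof_mul ?go ?mul1mx//; [exact: orbit_orig|exact: DV].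
  by rewrite /ph /= e invmxK mulmxKV// eg -surjective_pairing.
have inj : {in W &, injective ph} by move=> x y xW yW e; rewrite -(phK x xW) -(phK y yW) e.
pose G (x : space * space) := (size (nl x.1))%:R^-1 * ang orig (sc s x.1 orig).
have e1 : \sum_(q <- VL) ang orig (sc s q orig) = \sum_(x <- W) G x.
  rewrite big_allpairs_dep; apply: eq_big_seq => q /hV[hq no _].
  rewrite /G /= big_const_seq count_predT iter_addr_0 -mulrnAl -[_^-1 *+ _]mulr_natr mulVf ?mul1r//.
  rewrite pnatr_eq0 size_eq0; apply/eqP => e.
  by have : orig \in nl q by [apply/nlP]; rewrite e.
rewrite e1 -(sum_injection G uW phW inj) big_allpairs_dep.
apply: eq_big_seq => q /hV vq; rewrite mulr_sumr; apply: eq_big_seq => v.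
have [hq no t3] := vq; move=> /(nlP _ hq) nv; have [dg eg] := gofP nv.1; have dV := DV dg.
have gu := isom_unit (D_isom dg); have [hq' no' t3'] := vertex_mul vq nv.
rewrite /G /= size_nl_mul//; congr (_ * _).
have sv := scP s1 hq t3 nv; have ow : orbit (sc s q v) by have [[]] := sv.
have vo : v *m invmx (gof v) = orig by rewrite -{1}eg mulmxK.
have := succ_mul dV sv; rewrite vo => h; have := scP s1 hq' t3' no' => h'.
by rewrite (succ_unique h' h) -{1}vo ang_mul//; exact: nv.1.
Qed.

Lemma three_succ q v w : nearest q v -> succ (-1) q v w ->
  (exists k, [/\ nearest q k, k <> v & k <> w]) -> three q.
Proof.
move=> nv [nw wv _] [k [nk kv kw]]; exists v, w, k; split=> //.
by split=> //; exact: nesym.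
Qed.

(** Each edge at the origin has two endpoints, at which the same orbit point is
    the successor of the origin for opposite orientations. *)
Lemma edge_sum (VL : seq space) : uniq VL -> (forall q, q \in VL <-> vertex q) ->
  \sum_(q <- VL) ang orig (sc 1 q orig) = \sum_(q <- VL) ang orig (sc (-1) q orig).
Proof.
move=> uV hV; have p1 : (1 : R) = 1 \/ (1 : R) = -1 by left.
have m1 : (-1 : R) = 1 \/ (-1 : R) = -1 by right.
have /choice[tau htau] : forall q, exists q', vertex q -> [/\ hyp q', nearest q' orig,
    succ (-1) q' orig (sc 1 q orig),
    (exists k, [/\ nearest q' k, k <> orig & k <> sc 1 q orig]) &
    exists a t, [/\ 0 < a, 0 < t & q' = a *: (q + t *: edge_normal (sc 1 q orig))]].
  move=> q; have [[hq no t3]|nn] := pselect (vertex q); last by exists 0.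
  have [nw wo h] := scP p1 hq t3 no.
  have [|q' hq'] := edge hq no nw wo _; last by exists q'.
  by move=> k nk ko kw; have := h k nk ko kw; rewrite mul1r.
have vtau q : vertex q -> vertex (tau q).
  by move=> /htau[h1 h2 h3 h4 _]; split=> //; exact: three_succ h2 h3 h4.
have stau q : vertex q -> sc (-1) (tau q) orig = sc 1 q orig.
  move=> vq; have [h1 h2 h3 _ _] := htau q vq; have [_ _ t3] := vtau q vq.
  exact: succ_unique (scP m1 h1 t3 h2) h3.
have tl q : q \in VL -> tau q \in VL by move=> /hV /vtau h; exact/hV.
have key q1 q2 w (lam mu : R) : vertex q1 -> vertex q2 -> succ 1 q2 orig w -> 0 < lam ->
    q2 = lam *: q1 + mu *: edge_normal w -> mu <= 0.
  move=> [h1 no1 _] [h2 no2 t2] [nw wo hs] l0 e; rewrite leNgt; apply/negP => m0.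
  have [x [y [nx ny [xo yo xy]]]] := three_others orig t2.
  have [k [nk ko kw]] : exists k, [/\ nearest q2 k, k <> orig & k <> w].
    have [xw|/eqP xw] := eqVneq x w; last by exists x.
    by exists y; split=> //; rewrite -xw; exact: nesym.
  have := nearest_eq nk no2; rewrite e !lorDl !lorZl !lor_edge_normal.
  have -> : det3 orig w orig = 0 by rewrite /det3; ring.
  have := hs k nk ko kw; rewrite mul1r => d0; have := no1.2 k nk.1 => le.
  have : 0 < mu * det3 orig w k by rewrite mulr_gt0.
  have : lam * lor q1 orig <= lam * lor q1 k by rewrite ler_pM2l.
  by lra.
have inj : {in VL &, injective tau}.
  move=> q1 q2 /hV v1 /hV v2 e; have ew : sc 1 q1 orig = sc 1 q2 orig by rewrite -!stau// e.
  have [_ _ _ _ [a1 [t1 [a10 t10 e1]]]] := htau q1 v1.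
  have [_ _ _ _ [a2 [t2 [a20 t20 e2]]]] := htau q2 v2.
  have [hq1 no1 t31] := v1; have [hq2 no2 t32] := v2.
  have s1 := scP p1 hq1 t31 no1; have s2 := scP p1 hq2 t32 no2.
  rewrite -ew in e2 s2; set w := sc 1 q1 orig in e1 e2 s1 s2.
  have e3 : a1 *: (q1 + t1 *: edge_normal w) = a2 *: (q2 + t2 *: edge_normal w) by rewrite -e1 -e2 e.
  have n1 := lt0r_neq0 a10; have n2 := lt0r_neq0 a20.
  have solve (x y n : space) (a b t u : R) : b != 0 ->
      a *: (x + t *: n) = b *: (y + u *: n) -> y = (a / b) *: x + (a / b * t - u) *: n.
    move=> b0 h; apply/rowP => j; have := congr1 (fun v : space => v 0 j) h; rewrite !mxE => hj.
    by apply: (mulfI b0); rewrite -[LHS](addrK (b * (u * n 0 j))) -mulrDr -hj; field.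
  have f2 : q2 = (a1 / a2) *: q1 + (a1 / a2 * t1 - t2) *: edge_normal w.
    exact: solve n2 e3.
  have f1 : q1 = (a2 / a1) *: q2 + (a2 / a1 * t2 - t1) *: edge_normal w.
    exact: solve n1 (esym e3).
  have k1 := key _ _ _ _ _ v1 v2 s2 (divr_gt0 a10 a20) f2.
  have k2 := key _ _ _ _ _ v2 v1 s1 (divr_gt0 a20 a10) f1.
  have z : a1 / a2 * t1 - t2 = 0.
    have : 0 <= a1 / a2 * t1 - t2.
      have -> : a1 / a2 * t1 - t2 = - (a1 / a2 * (a2 / a1 * t2 - t1)) by field; rewrite n1 n2.
      by rewrite oppr_ge0 pmulr_rle0// divr_gt0.
    by lra.
  rewrite z scale0r addr0 in f2; set r := a1 / a2 in f2.
  have r0 : 0 < r by rewrite divr_gt0.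
  have : r ^+ 2 = 1.
    by have := hq2.1; rewrite f2 lorZl lorZr; case: hq1 => -> _; rewrite mulr1 -expr2.
  move/eqP; rewrite sqrf_eq1 => /orP[/eqP r1|/eqP r1]; first by rewrite f2 r1 scale1r.
  by exfalso; move: r0; rewrite r1; lra.
rewrite -(sum_injection (fun q => ang orig (sc (-1) q orig)) uV tl inj).
by apply: eq_big_seq => q /hV vq; rewrite stau.
Qed.

(** The midpoint between the origin and a closest orbit point is on an edge. *)
Lemma vertex_exists : exists q, vertex q.
Proof.
have C1 := C_ge1; have e1 := eta1.
have [p op po] : exists2 p, orbit p & p <> orig.
  pose b := Num.sqrt ((C + 1) ^+ 2 - 1).
  have h : hyp (row3 b 0 (C + 1)).
    by split; rewrite /lor !row3E; [rewrite mulr0 subr0 -!expr2 sqr_sqrtr ?expr2; nra|lra].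
  have [M dM le] := D_dense h; exists (orig *m M); first by exists M.
  by move=> e; move: le; rewrite e lorC lor_orig row3E; lra.
have [s hs] := orbit_finite (lor orig p).
pose l := [seq x <- s | x != orig].
have l0 : l != [::].
  have pl : p \in l by rewrite mem_filter; apply/andP; split; [exact/eqP|exact/hs].
  by apply/eqP => l0; rewrite l0 in pl.
have [w wl wmin] := seq_min (lor orig) l0.
move: wl; rewrite mem_filter => /andP[/eqP wo /hs[ow wp]].
have hw := orbit_hyp ow.
have wclose x : orbit x -> x <> orig -> lor orig w <= lor orig x.
  move=> ox xo; have [xp|xp] := leP (lor orig x) (lor orig p); last exact: le_trans wp (ltW xp).
  by apply: wmin; rewrite mem_filter; apply/andP; split; [exact/eqP|exact/hs].
pose y := orig + w; have L1 := lor_ge1 (@hyp_orig R) hw.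
have yy : 0 < lor y y.
  rewrite /y !lorDl !lorDr (lorC w orig); case: hw => -> _; case: (@hyp_orig R) => -> _; lra.
have y2 : 0 < y 0 i2 by rewrite /y vecE row3E; case: hw => _ ?; lra.
have hm := hyp_scale yy y2; set m := _ *: y in hm.
have Ni : 0 < (Num.sqrt (lor y y))^-1 by rewrite invr_gt0 sqrtr_gt0.
have yk x : orbit x -> lor y orig <= lor y x.
  move=> ox; rewrite /y !lorDl (lorC w orig); have [->|/eqP xo] := eqVneq x orig; first by rewrite (lorC w orig).
  have := wclose x ox xo; have := lor_ge1 hw (orbit_hyp ox); case: (@hyp_orig R) => -> _; lra.
have near x : orbit x -> lor y x = lor y orig -> nearest m x.
  by move=> ox e; split=> // x' ox'; rewrite !lorZl ler_pM2l// e yk.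
have no : nearest m orig by apply: near => //; exact: orbit_orig.
have nw : nearest m w.
  apply: near => //; rewrite /y !lorDl (lorC w orig); case: hw => -> _; case: (@hyp_orig R) => -> _.
  by rewrite addrC.
have [[k [nk ko kw]]|nn] := pselect (exists k, [/\ nearest m k, k <> orig & k <> w]).
  exists m; split=> //; exists orig, w, k; split=> //.
  by split=> //; exact: nesym.
have [|q' [h1 h2 h3 h4 _]] := edge hm no nw wo _.
  by move=> k nk ko kw; case: nn; exists k.
by exists q'; split=> //; exact: three_succ h2 h3 h4.
Qed.

(** By [mass_transport] and [polygon_angle] the sum of the angles at the corners of
    the cell of the origin has the sign of [s], but by [edge_sum] it does not
    depend on [s]. *)
Lemma large_traces_absurd : False.
Proof.
have [VL [uV hV]] := vertex_list; have [q0 vq0] := vertex_exists.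
have pos s : s = 1 \/ s = -1 -> 0 < s * \sum_(q <- VL) ang orig (sc s q orig).
  move=> s1; rewrite (mass_transport s1 uV hV) mulr_sumr.
  have term q : q \in VL -> 0 < s * ((size (nl q))%:R^-1 * \sum_(v <- nl q) ang v (sc s q v)).
    move=> /hV vq; have [hq no _] := vq; rewrite mulrCA mulr_gt0 ?polygon_angle//.
    rewrite invr_gt0 ltr0n; case e : (nl q) => //.
    by have : orig \in nl q by [apply/nlP]; rewrite e.
  have q0V : q0 \in VL by apply/hV.
  rewrite (bigD1_seq q0) //=; apply: ltr_pwDl; first exact: term.
  by rewrite big_seq_cond; apply: sumr_ge0 => q /andP[qV _]; exact: ltW (term q qV).
have := pos 1 (or_introl erefl); have := pos (-1) (or_intror erefl).
by rewrite (edge_sum uV hV); lra.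
Qed.

End Orbit.

Section SystoleDiameter.
Context {R : realType}.
Local Notation plane := 'rV[R]_2.

Lemma cosh_half (x : R) : cosh x = 2 * cosh (x / 2) ^+ 2 - 1.
Proof.
have := cosh_sinh (x / 2); have := coshD (x / 2) (x / 2); rewrite -splitr -!expr2 => ->; lra.
Qed.

(** A nontrivial deck transformation translates every point by a definite amount,
    hence its trace exceeds 2, and its translation length bounds the systole. *)
Lemma systole_trace (X : topologicalType) (P Q : set (chart R X))
    (g : chart R X -> plane -> 'M[R]_2) eta E (A : 'M[R]_2) :
  oriented_hyperbolic P Q g -> covering P g eta E ->
  \det A = 1 -> deck E (Ad A) -> Ad A <> 1%:M -> 2 * cosh (systole P g / 2) <= `|\tr A|.
Proof.
move=> hS cE dA kA A1; set m := (\tr A ^+ 2 - 4) / 2; have e1 := cov_eta cE.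
have small e : 0 < e -> exists2 v, hyp v & lor v (v *m Ad A) <= 1 + Num.max 0 m + e.
  by move=> e0; exact: displacement dA e0.
have m0 : 0 < m.
  rewrite ltNge; apply/negP => m0; have [|v hv le] := small ((eta - 1) / 2); first by lra.
  apply: A1; apply: (cov_free cE kA hv); apply: le_lt_trans le _.
  by rewrite (max_idPl m0); lra.
have le : cosh (systole P g) <= 1 + m.
  apply/ler_addgt0Pr => e e0; have [v hv le] := small e e0.
  have [_ sv] := systole_le hS cE kA A1 hv; apply: le_trans sv _.
  by rewrite (max_idPr (ltW m0)) in le.
rewrite cosh_half in le; have := cosh_gt0 (systole P g / 2) => c0.
rewrite -(@ler_pXn2r _ 2) ?nnegrE//; last by lra.
by rewrite real_normK ?num_real// exprMn; move: le; rewrite /m; lra.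
Qed.

Lemma small_trace (X : topologicalType) (P Q : set (chart R X))
    (g : chart R X -> plane -> 'M[R]_2) eta E (e : R) :
  oriented_hyperbolic P Q g -> covering P g eta E -> 0 < e ->
  exists A : 'M[R]_2, [/\ \det A = 1, deck E (Ad A), Ad A <> 1%:M &
    `|\tr A| <= (3 * cosh (diameter P g + e) - 1) / 2].
Proof.
move=> hS cE e0; apply: contrapT => nA.
apply: (@large_traces_absurd _ (deck E) eta (cosh (diameter P g + e)) (cov_eta cE)).
- by move=> M [].
- exact: deck1.
- by move=> M N; exact: deckM.
- by move=> M; exact: deckV.
- exact: cov_free cE.
- by move=> q hq; exact: (orbit_dense hS cE hq (@hyp_orig R) e0).
- by move=> A dA kA A1; rewrite ltNge; apply/negP => le; apply: nA; exists A.
Qed.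

End SystoleDiameter.

Theorem theorem1p1 (R : realType) (X : topologicalType) (A : set (chart R X))
    (g : chart R X -> 'rV[R]_2 -> 'M[R]_2)
    (hX : closed_orientable_hyperbolic_surface A g) :
  4 * cosh (systole A g / 2) <= 3 * cosh (diameter A g) - 1.
Proof.
have [[hausX compX connX] atA [B [orB atAB]] [c _] [metric curv]] := hX.
have hS : oriented_hyperbolic A B g by split=> //; case: atA.
have [eta [E cE]] := covering_exists hS (c ord0 0) hausX compX connX.
have d0 := diameter_ge0 hS cE; rewrite leNgt; apply/negP => lt.
(* a radius larger than the diameter for which the inequality still fails *)
have [T /andP[T0 _] cT] : exists2 T, 0 <= T <= (cosh (diameter A g) + (4 * cosh (systole A g / 2) + 1) / 3) / 2
    & cosh T = (cosh (diameter A g) + (4 * cosh (systole A g / 2) + 1) / 3) / 2.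
  by apply: cosh_surj; have := cosh_ge1 (diameter A g); lra.
have dT : diameter A g < T.
  by rewrite ltNge; apply/negP => /(cosh_le T0); rewrite cT; lra.
have [|M [dM kM M1 trM]] := small_trace (e := T - diameter A g) hS cE; first by rewrite subr_gt0.
have := le_trans (systole_trace hS cE dM kM M1) trM; rewrite subrKC cT; lra.
Qed.
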